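(* Let $\mathcal{D}=\bigcap_{s=1}^p\ker\lambda^s$ be a distribution of rank $n$ and corank $p$ on $\mathbb{R}^N$, $N=n+p$. Fix an integer $q\ge0$ satisfying $nq\ge p-n$. Then the following hold. 1. The sheaf $\Phi^{\mathcal{W}}$ of $\mathcal{W}$-regular $\mathcal{D}$-horizontal curves is microflexible. 2. For any $\alpha\ge\max\{3q+1,\;2q+2\}$, the jet map $j^{\alpha+1}:\Phi^{\mathcal{W}}\to\Psi^{\mathcal{W}}_\alpha$ is a local weak homotopy equivalence.
   Context: Here $\lambda^s=\sum_\mu\lambda^s_\mu\,dy^\mu$ ($1\le s\le p$) are pointwise linearly independent $1$-forms on $\mathbb{R}^N$ with coordinates $y^1,\dots,y^N$, and $t$ is the coordinate on $\mathbb{R}$. For $u:\mathbb{R}\to\mathbb{R}^N$ set $\mathfrak{D}(u)=\big(u^*\lambda^s(\partial_t)\big)_{s=1}^p\in C^\infty(\mathbb{R},\mathbb{R}^p)$; $u$ is $\mathcal{D}$-horizontal iff $\mathfrak{D}(u)=0$. Let $R_u$ and $\Lambda$ be the $p\times N$ matrices with $(s,\mu)$ entries $d\lambda^s(u_*\partial_t,\partial_\mu)$ and $\lambda^s_\mu\circ u$ respectively. Let $A=A(j^{q+1}_u(x))$ be the $p(q+2)\times N(q+1)$ block matrix whose $p\times N$ block in row-block $i\in\{0,\dots,q+1\}$ and column-block $j\in\{0,\dots,q\}$ is $\binom{j}{i}\partial_t^{\,j-i}R_u+\binom{j}{i-1}\partial_t^{\,j-i+1}\Lambda$ evaluated at $x$,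 where $\binom{j}{k}=0$ (and the term is omitted) if $k<0$ or $k>j$. Define $$\mathcal{W}=\{j^{q+1}_u(x)\mid du_x\text{ is injective and }A(j^{q+1}_u(x))\text{ has full row rank}\}\subset J^{q+1}(\mathbb{R},\mathbb{R}^N);$$ a smooth map $u$ with $j^{q+1}_u$ valued in $\mathcal{W}$ is called $\mathcal{W}$-regular. For $\alpha\ge0$ let $\mathcal{R}^\alpha_{\mathrm{tang}}=\{j^{\alpha+1}_u(x)\mid j^\alpha_{\mathfrak{D}(u)}(x)=0\}\subset J^{\alpha+1}(\mathbb{R},\mathbb{R}^N)$, and for $\alpha\ge2q$ let $\mathcal{W}_\alpha=(p^{\alpha+1}_{q+1})^{-1}(\mathcal{W})\cap\mathcal{R}^\alpha_{\mathrm{tang}}$, with $p^{\alpha+1}_{q+1}:J^{\alpha+1}\to J^{q+1}$ the jet projection. $\Phi^{\mathcal{W}}$ is the sheaf on $\mathbb{R}$ of smooth solutions of $\mathcal{W}_\alpha$ (independent of $\alpha\ge2q$: these are the $\mathcal{W}$-regular $\mathcal{D}$-horizontal maps), and $\Psi^{\mathcal{W}}_\alpha=\Gamma\mathcal{W}_\alpha$ is the sheaf of sections of $J^{\alpha+1}(\mathbb{R},\mathbb{R}^N)\to\mathbb{R}$ with values in $\mathcal{W}_\alpha$. These are sheaves of (quasi-)topological spaces in Gromov's sense. Such a sheaf $\Phi$ is microflexible if for all compact $C'\subset C$ the restriction $\Phi(C)\to\Phi(C')$ ($\Phi(C)$ being germs along $C$) is a microfibration: for every compact polyhedron $P$, every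 continuous $h:P\times[0,1]\to\Phi(C')$ and every lift of $h|_{P\times0}$ to $\Phi(C)$, there are $\epsilon>0$ and a continuous lift of $h|_{P\times[0,\epsilon]}$ to $\Phi(C)$ extending the given one. A sheaf map $\Phi\to\Psi$ is a local weak homotopy equivalence if it induces a weak homotopy equivalence on stalks $\Phi(x)\to\Psi(x)$ at every point $x$. *)

(* Defs.v *)
From HB Require Import structures.
From mathcomp Require Import all_boot all_order all_algebra.
From mathcomp Require Import all_classical all_reals all_analysis.
Set Implicit Arguments.
Unset Strict Implicit.
Unset Printing Implicit Defensive.
Import Order.TTheory GRing.Theory Num.Theory.
Import numFieldNormedType.Exports.
Local Open Scope classical_set_scope.
Local Open Scope ring_scope.

(* A quasi-topology is specified by the maps P -> X that it declares
   continuous, for all test spaces P. *)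
Record qspace := QSpace {
  qcar :> Type;
  qcont : forall P : topologicalType, (P -> qcar) -> Prop }.

Arguments qcont X {P} _ : rename.

Definition unitI (R : realType) : set R := `[0, 1].
Arguments unitI R : clear implicits.

Definition conv_hull (R : realType) (m : nat) (s : seq 'rV[R]_m) :
    set 'rV[R]_m :=
  [set y | exists a : 'I_(size s) -> R,
    [/\ forall i, 0 <= a i, \sum_i a i = 1 & y = \sum_i a i *: s`_i]].

Definition compact_polyhedron (R : realType) (m : nat) (P : set 'rV[R]_m) :=
  exists S : seq (seq 'rV[R]_m), P = \bigcup_(s in [set` S]) conv_hull s.

Definition microfibration (R : realType) (X Y : qspace) (r : X -> Y) : Prop :=
  forall (m : nat) (P : set 'rV[R]_m)
    (h : set_type P * set_type (unitI R) -> Y) (h0 : set_type P -> X),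
  compact_polyhedron P ->
  qcont Y h -> qcont X h0 ->
  (forall z t, set_val t = 0 -> r (h0 z) = h (z, t)) ->
  exists (e : R) (H : set_type P * set_type (`[0, e] : set R) -> X),
    [/\ 0 < e <= 1, qcont X H,
        forall z t, set_val t = 0 -> H (z, t) = h0 z
      & forall z t t', set_val t = set_val t' -> r (H (z, t)) = h (z, t')].

Definition path_joined (R : realType) (X : qspace) (x y : X) : Prop :=
  exists g : set_type (unitI R) -> X,
    [/\ qcont X g, forall t, set_val t = 0 -> g t = x
      & forall t, set_val t = 1 -> g t = y].
Arguments path_joined R {X} x y.

Definition homotopic_rel (R : realType) (X : qspace) (P : topologicalType)
    (A : set P) (f g : P -> X) : Prop :=
  exists H : P * set_type (unitI R) -> X,
    [/\ qcont X H, forall z t, set_val t = 0 -> H (z, t) = f z,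
        forall z t, set_val t = 1 -> H (z, t) = g z
      & forall z t, A z -> H (z, t) = f z].
Arguments homotopic_rel R {X P} A f g.

Definition cube (R : realType) (k : nat) : set 'rV[R]_k :=
  [set y | forall i, 0 <= y 0 i <= 1].
Arguments cube R k : clear implicits.

Definition cube_boundary (R : realType) (k : nat) : set (set_type (cube R k)) :=
  [set y | let v : 'rV[R]_k := set_val y in exists i, v 0 i = 0 \/ v 0 i = 1].
Arguments cube_boundary R k : clear implicits.

(* The maps (I^k, bd I^k) -> (X, x); modulo homotopy relative to the boundary
   they are the elements of pi_k (X, x). *)
Definition spheroid (R : realType) (X : qspace) (k : nat) (x : X)
    (a : set_type (cube R k) -> X) : Prop :=
  qcont X a /\ forall y, cube_boundary R k y -> a y = x.

(* bijective on pi_0 and on pi_k, k >= 1, at every base point *)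
Definition weak_homotopy_equivalence (R : realType) (X Y : qspace)
    (f : X -> Y) : Prop :=
  [/\ forall y, exists x, path_joined R (f x) y,
      forall x x', path_joined R (f x) (f x') -> path_joined R x x'
    & forall (k : nat) (x : X), (0 < k)%N ->
      (forall b : set_type (cube R k) -> Y, spheroid (f x) b ->
         exists2 a : set_type (cube R k) -> X, spheroid x a
           & homotopic_rel R (cube_boundary R k) (f \o a) b) /\
      (forall a a' : set_type (cube R k) -> X, spheroid x a -> spheroid x a' ->
         homotopic_rel R (cube_boundary R k) (f \o a) (f \o a') ->
         homotopic_rel R (cube_boundary R k) a a')].

(* [sec F U f] means that f restricts to a section over the open set U (the
   values of f off U are irrelevant), and [fam F U f] that the family of
   sections f over U is continuous in the parameter. *)
Record line_sheaf (R : realType) (T : Type) := LineSheaf {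
  sec : set R -> (R -> T) -> Prop;
  fam : forall (U : set R) (P : topologicalType), (P -> R -> T) -> Prop }.

Section Germs.
Context {R : realType} {T : Type}.
Implicit Types (F : line_sheaf R T) (C : set R) (f g : R -> T).

Definition near_sec F C f : Prop :=
  exists U : set R, [/\ open U, C `<=` U & sec F U f].

(* the functions agreeing with f on a neighbourhood of C *)
Definition germ_class C f : set (R -> T) :=
  [set g | set_nbhs C [set x | f x = g x]].

Definition germ F C : Type :=
  {G : set (R -> T) | exists2 f, near_sec F C f & G = germ_class C f}.

(* F(C), the direct limit of the F(U) over the open U containing C: a map to it
   is continuous if it comes from a continuous map to some F(U). *)
Definition germ_space F C : qspace :=
  @QSpace (germ F C) (fun P h =>
    exists (U : set R) (f : P -> R -> T),
      [/\ open U, C `<=` U, forall z, sec F U (f z), fam F U f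
        & forall z, sval (h z) = germ_class C (f z)]).

Definition germ_of F C f (hf : near_sec F C f) : germ F C :=
  exist _ (germ_class C f) (ex_intro2 _ _ f hf erefl).

Definition germ_repr F C (G : germ F C) : R -> T := sval (cid2 (svalP G)).

Lemma germ_repr_sec F C (G : germ F C) : near_sec F C (germ_repr G).
Proof. by rewrite /germ_repr; case: cid2. Qed.

Lemma germ_reprE F C (G : germ F C) : sval G = germ_class C (germ_repr G).
Proof. by rewrite /germ_repr; case: cid2. Qed.

Lemma near_sec_sub F C C' f : C' `<=` C -> near_sec F C f -> near_sec F C' f.
Proof.
by move=> sC [U [oU CU fU]]; exists U; split => //; exact: subset_trans CU.
Qed.

Definition germ_restr F C C' (sC : C' `<=` C) (G : germ F C) : germ F C' :=
  germ_of (near_sec_sub sC (germ_repr_sec G)).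

Lemma germ_classP C f g :
  germ_class C f = germ_class C g <-> set_nbhs C [set x | f x = g x].
Proof.
split=> [e|fg].
  suff: germ_class C f g by [].
  by rewrite e => x Cx; apply: filterS filterT.
apply/seteqP; split => h /= hh.
  by move=> x Cx; apply: filterS2 (fg x Cx) (hh x Cx) => y /= <-.
by move=> x Cx; apply: filterS2 (fg x Cx) (hh x Cx) => y /= ->.
Qed.

Lemma germ_restrE F C C' (sC : C' `<=` C) (G : germ F C) f :
  sval G = germ_class C f -> sval (germ_restr sC G) = germ_class C' f.
Proof.
rewrite germ_reprE => /germ_classP h; apply/germ_classP => x C'x.
by apply: (h x); exact: sC.
Qed.

Definition microflexible F : Prop :=
  forall (C C' : set R) (sC : C' `<=` C), compact C -> compact C' ->
    @microfibration R (germ_space F C) (germ_space F C') (germ_restr sC).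

End Germs.

Record sheaf_map (R : realType) (T T' : Type) (F : line_sheaf R T)
    (F' : line_sheaf R T') := SheafMap {
  smap :> (R -> T) -> R -> T';
  smap_sec : forall U f, open U -> sec F U f -> sec F' U (smap f);
  smap_local : forall U f g, open U -> (forall x, U x -> f x = g x) ->
    forall x, U x -> smap f x = smap g x }.

Section GermMap.
Context {R : realType} {T T' : Type} {F : line_sheaf R T}
  {F' : line_sheaf R T'}.
Implicit Types (phi : sheaf_map F F') (C : set R).

Lemma near_sec_map phi C f : near_sec F C f -> near_sec F' C (phi f).
Proof. by case=> U [oU CU fU]; exists U; split => //; exact: smap_sec. Qed.

Definition germ_map phi C (G : germ F C) : germ F' C :=
  germ_of (near_sec_map phi (germ_repr_sec G)).

Lemma germ_mapE phi C (G : germ F C) f :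
  sval G = germ_class C f -> sval (germ_map phi G) = germ_class C (phi f).
Proof.
rewrite germ_reprE => /germ_classP /set_nbhsP [U [oU CU Uf]].
apply/germ_classP/set_nbhsP; exists U; split => // x Ux /=.
exact: (smap_local phi oU Uf).
Qed.

Definition local_weak_homotopy_equivalence phi : Prop :=
  forall x : R, @weak_homotopy_equivalence R
    (germ_space F [set x]) (germ_space F' [set x]) (germ_map phi (C := [set x])).

End GermMap.

Definition smooth_on (R : realType) (V : normedModType R) (U : set R)
    (u : R -> V) : Prop :=
  forall (k : nat) (x : R), U x -> derivable (derive1n k u) x 1.

Definition partial (R : realType) (N : nat) (mu : 'I_N) (f : 'rV[R]_N -> R) :
    'rV[R]_N -> R := fun y => 'D_(delta_mx 0 mu) f y.

Definition smooth_fun (R : realType) (N : nat) (f : 'rV[R]_N -> R) : Prop :=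
  forall s : seq 'I_N, let g := foldr (@partial R N) f s in
    continuous g /\ forall mu y, derivable g y (delta_mx 0 mu).

(* J^k(R, R^N): row i of the matrix is the i-th derivative *)
Definition jet_space (R : realType) (N k : nat) : Type :=
  (R * 'M[R]_(k.+1, N))%type.

Definition jet (R : realType) (N k : nat) (u : R -> 'rV[R]_N) (x : R) :
    jet_space R N k :=
  (x, \matrix_(i < k.+1, mu < N) derive1n i u x 0 mu).

(* the projection J^l -> J^k; only meaningful for k <= l, because of [inord] *)
Definition jet_proj (R : realType) (N l k : nat) (j : jet_space R N l) :
    jet_space R N k :=
  (j.1, \matrix_(i < k.+1, mu < N) j.2 (inord i) mu).

Unset Implicit Arguments.

Section Horizontal.
Context {R : realType} {N p : nat}.
(* row s of [lam y] is the s-th form at y, in the basis dy^1, ..., dy^N *)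
Implicit Types (lam : 'rV[R]_N -> 'M[R]_(p, N)) (u : R -> 'rV[R]_N).

Definition smooth_forms lam : Prop :=
  forall s mu, smooth_fun (fun y => lam y s mu).

Definition horiz lam u : R -> 'rV[R]_p :=
  fun t => \row_s \sum_mu lam (u t) s mu * derive1 u t 0 mu.

(* d(lambda^s)_y (v, w) for lambda^s = \sum_mu lambda^s_mu dy^mu, with the
   convention (dy^nu /\ dy^mu)(v, w) = v^nu w^mu - v^mu w^nu *)
Definition dform lam (s : 'I_p) (y v w : 'rV[R]_N) : R :=
  \sum_nu \sum_mu
    partial nu (fun z => lam z s mu) y * (v 0 nu * w 0 mu - v 0 mu * w 0 nu).

Definition Rmx lam u : R -> 'M[R]_(p, N) :=
  fun t => \matrix_(s, mu) dform lam s (u t) (derive1 u t) (delta_mx 0 mu).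

Definition Lmx lam u : R -> 'M[R]_(p, N) := fun t => lam (u t).

(* Only the blocks with j >= i - 1 are nonzero, so the truncated differences are
   the actual orders of derivation: j - i.-1 = j - i + 1 when 0 < i <= j + 1. *)
Definition Amx lam (q : nat) u (x : R) :
    'M[R]_(\sum_(i < q.+2) p, \sum_(j < q.+1) N) :=
  \mxblock_(i < q.+2, j < q.+1)
    ('C(j, i)%:R *: derive1n (j - i) (Rmx lam u) x +
     (if (0 < i)%N then 'C(j, i.-1)%:R *: derive1n (j - i.-1) (Lmx lam u) x else 0)).

(* Here and in [Rtang], as usual for jets, u need only be smooth near x. *)
Definition Wset lam (q : nat) : set (jet_space R N q.+1) :=
  [set j | exists u x, [/\ exists U, [/\ open U, U x & smooth_on U u],
     j = jet q.+1 u x,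
     injective ('d (u : R^o -> 'rV[R]_N) x : R^o -> 'rV[R]_N)
   & row_free (Amx lam q u x)]].

Definition Rtang lam (a : nat) : set (jet_space R N a.+1) :=
  [set j | exists u x, [/\ exists U, [/\ open U, U x & smooth_on U u],
     j = jet a.+1 u x & (jet a (horiz lam u) x).2 = 0]].

(* only meaningful for a >= q, because of [jet_proj] *)
Definition Wa lam (q a : nat) : set (jet_space R N a.+1) :=
  (fun j => jet_proj q.+1 j) @^-1` Wset lam q `&` Rtang lam a.

(* topologized by uniform convergence of all derivatives on compact subsets *)
Definition Phi lam (q : nat) : line_sheaf R 'rV[R]_N :=
  @LineSheaf R 'rV[R]_N
    (fun U u => [/\ smooth_on U u, forall x, U x -> Wset lam q (jet q.+1 u x)
       & forall x, U x -> horiz lam u x = 0])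
    (fun U P f => forall k : nat,
       continuous (fun z => derive1n k (f z) : {family compactly_in U, R -> 'rV[R]_N})).

(* continuous sections, with the compact-open topology *)
Definition Psi lam (q a : nat) : line_sheaf R (jet_space R N a.+1) :=
  @LineSheaf R (jet_space R N a.+1)
    (fun U sigma => [/\ forall x, U x -> {for x, continuous sigma},
       forall x, U x -> (sigma x).1 = x & forall x, U x -> Wa lam q a (sigma x)])
    (fun U P f => continuous
       (fun z => f z : {family compactly_in U, R -> jet_space R N a.+1})).

End Horizontal.

Section JetMap.
Context {R : realType} {N p : nat}.
Implicit Types (lam : 'rV[R]_N -> 'M[R]_(p, N)).

Lemma derive1n_local (V : normedModType R) (U : set R) (f g : R -> V) k :
  open U -> (forall x, U x -> f x = g x) ->
  forall x, U x -> derive1n k f x = derive1n k g x.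
Proof.
move=> oU fg; elim: k => [|k ih] x Ux; first by rewrite !derive1n0 fg.
rewrite !derive1nS !derive1E; apply: near_eq_derive.
by near=> y; apply: ih; near: y; exact: open_nbhs_nbhs.
Unshelve. all: by end_near. Qed.

Lemma jet_local k (U : set R) (f g : R -> 'rV[R]_N) :
  open U -> (forall x, U x -> f x = g x) ->
  forall x, U x -> jet k f x = jet k g x.
Proof.
move=> oU fg x Ux; congr (_, _); apply/matrixP => i mu.
by rewrite !mxE (@derive1n_local _ U f g i oU fg).
Qed.

Lemma jet_continuous k (U : set R) (u : R -> 'rV[R]_N) :
  smooth_on U u -> forall x, U x -> {for x, continuous (jet k u)}.
Proof.
move=> su x Ux.
have hM : (\matrix_(i < k.+1, mu < N) derive1n i u y 0 mu) @[y --> x] -->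
    (\matrix_(i < k.+1, mu < N) derive1n i u x 0 mu).
  apply/cvg_ballP => e e0.
  suff h : forall (i : nat) mu, \forall y \near x,
      ball (derive1n i u x 0 mu) e (derive1n i u y 0 mu).
    have : \forall y \near x, forall i : 'I_k.+1, forall mu : 'I_N,
        ball (derive1n i u x 0 mu) e (derive1n i u y 0 mu).
      have := @filter_forall R _ (fun (i : 'I_k.+1) y => forall mu : 'I_N,
        ball (derive1n i u x 0 mu) e (derive1n i u y 0 mu)) (nbhs x)
        (nbhs_filter x).
      apply => i.
      by have := filter_forall (nbhs_filter x) (h i); exact.
    by apply: filterS => y hy; split => // i mu; rewrite !mxE; exact: hy.
  move=> i mu.
  have ci : {for x, continuous (derive1n i u)}.
    by apply: differentiable_continuous; apply/derivable1_diffP; exact: su.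
  have cu : {for x, continuous (fun y => derive1n i u y 0 mu)}.
    exact: (continuous_comp ci (@coord_continuous R 1 N 0 mu _)).
  by move/cvg_ballP : cu; exact.
exact: (cvg_pair (@cvg_id _ (nbhs x)) hM).
Qed.

Lemma jet_projE k l (u : R -> 'rV[R]_N) x :
  (k <= l)%N -> jet_proj k (jet l u x) = jet k u x.
Proof.
move=> kl; congr (_, _); apply/matrixP => i mu.
by rewrite !mxE inordK // ltnS (leq_trans _ kl) // -ltnS.
Qed.

Lemma jet_sec lam (q a : nat) (ha : (2 * q <= a)%N) (U : set R) u :
  open U -> sec (Phi lam q) U u -> sec (Psi lam q a) U (jet a.+1 u).
Proof.
move=> oU [su Wu Du]; split => // x Ux; first exact: (@jet_continuous _ U).
split; rewrite /= ?jet_projE ?ltnS.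
- exact: Wu.
- by apply: leq_trans ha; rewrite leq_pmull.
exists u, x; split => //; first by exists U.
apply/matrixP => i s; rewrite mxE (@derive1n_local _ U _ (cst 0) i oU Du) //.
suff -> : derive1n i (cst 0 : R -> 'rV[R]_p) = cst 0 by rewrite !mxE.
elim: (nat_of_ord i) => [//|k ih].
by rewrite derive1nS ih; apply/funext => y; rewrite derive1_cst.
Qed.

Definition jet_map lam (q a : nat) (ha : (2 * q <= a)%N) :
    sheaf_map (Phi lam q) (Psi lam q a) :=
  SheafMap (@jet_sec lam q a ha) (@jet_local a.+1).

End JetMap.

(* Main.v *)
From HB Require Import structures.
Require Import Defs.
From mathcomp Require Import all_boot all_order all_algebra.
From mathcomp Require Import all_classical all_reals all_analysis.
From mathcomp Require Import ring lra.
Import Order.TTheory GRing.Theory Num.Theory.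
Import numFieldNormedType.Exports.
Local Open Scope classical_set_scope.
Local Open Scope ring_scope.
Set Implicit Arguments.
Unset Strict Implicit.
Unset Printing Implicit Defensive.

(** Let [proj y] be the orthogonal projection onto the common kernel of the forms at [y]. A curve is
    horizontal exactly when it solves a control equation [u' = v *m proj u]; its own derivative may
    serve as the control [v]. Local questions become questions about ordinary differential
    equations, and global ones become steering problems.

    Stalks. A jet in the tangency relation is realised by solving the control equation with a
    control that has the prescribed Taylor coefficients: the solution then has exactly that jet
    ([jet_sol], [builder]), and it stays regular near the base point because regularity is open.
    [phi_build] does this for compact families, with a uniqueness clause that makes the construction
    relative. Injectivity on homotopy groups follows by interpolating the controls of two families
    linearly while the jet at the base point follows the given homotopy ([homotopy_lift]). For
    surjectivity, the jets of a realising family are joined to the given sections by a straight line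
    of jets, pushed back into the tangency relation by the retraction that solves the equation with
    a jet as Taylor data ([surj_lift]).

    Microflexibility. Full row rank of [A] yields a differential operator that inverts the
    linearised horizontality equation on the right, up to the nonvanishing factor [det (A A^T)]
    ([Mop_inverse]). Because the operator is local, infinitesimally horizontal deformations can be
    cut off: on an interval [[a, b]] there is one that vanishes near [a], takes any prescribed value
    at [b], and whose control vanishes on the outer thirds ([kapf_lam], [cell_admissible]). A
    contraction turns this into exact steering between endpoints close to those of a regular
    horizontal curve, with a unique small parameter ([steer_exists], [key_injective]). The size of
    the control grows at most like a power of [1 / (b - a)] ([kap_bound]).

    Now let [f] be a homotopy of solutions near the smaller compact set, [g] its initial value and
    [f0] the given extension of [g]. The complement of that set, close to it, is a disjoint union of
    possibly infinitely many cells. In each cell the control [f0' + chi (f' - g')], plus a steering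
    correction, joins the required endpoint values. In a cell with both ends in the compact set the
    defect comes from [f0 - g], which is flat there, hence beats every power of the length
    ([flat_bound]). A cell with an end outside has length bounded below, and its defect is small as
    long as [f] is close to [g]. So steering applies in all cells at once ([extension]). The glued
    curve is [f] near the compact set, and it is [f0] away from it or when [f = g]. It depends
    continuously on the parameter because corrections are negligible in short cells and continuous
    in long ones ([FF_cont]). Applied over the product of the polyhedron with the interval, this
    gives the lift for a short time ([Phi_microflexible]).

    All smoothness, jet and continuity statements run through a single calculus of families, [cvb],
    which is stable under algebra, composition with smooth functions and solution of differential
    equations. *)

Section PointwiseDerivatives.
Context {R : realType}.
Implicit Types f g : R -> R.

Lemma derive1D_pt f g x : derivable f x 1 -> derivable g x 1 ->
  derive1 (fun y => f y + g y) x = derive1 f x + derive1 g x.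
Proof. by move=> df dg; rewrite !derive1E; exact: (deriveD df dg). Qed.

Lemma derive1M_pt f g x : derivable f x 1 -> derivable g x 1 ->
  derive1 (fun y => f y * g y) x = derive1 f x * g x + f x * derive1 g x.
Proof.
move=> df dg; rewrite !derive1E.
have -> : 'D_1 (fun y => f y * g y) x = f x *: 'D_1 g x + g x *: 'D_1 f x.
  exact: (deriveM df dg).
by rewrite /GRing.scale/= addrC [g x * _]mulrC.
Qed.

Lemma derive1V_pt f x : f x != 0 -> derivable f x 1 ->
  derive1 (fun y => (f y)^-1) x = - ((f x)^-1 * (f x)^-1 * derive1 f x).
Proof.
move=> f0 df; rewrite !derive1E.
have -> : 'D_1 (fun y => (f y)^-1) x = - (f x) ^- 2 *: 'D_1 f x.
  exact: (deriveV f0 df).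
by rewrite /GRing.scale/= mulNr -exprVn expr2.
Qed.

End PointwiseDerivatives.

(** * A calculus of families that agree to infinite order in a weight *)

Section Asymptotic.
Context {R : realType} {I : Type} (G : set_system I) {FG : Filter G}.
Variables (O D : I -> set R) (w : I -> R).
Hypothesis oO : forall i, open (O i).
Hypothesis DO : forall i, D i `<=` O i.
Hypothesis w1 : forall i, 1 <= w i.
Implicit Types f g : I -> R -> R.

(** Relative to the weight [w], [g] is moderate (bounded by a power of [w]) and [f - g] is
    negligible (smaller than every negative power of [w]). Differentiation takes place on the open
    [O i], estimates only on [D i]. Four regimes occur later: one index and empty [D] (plain
    smoothness); one index and [D] a point (equality of jets); a neighbourhood filter with constant
    weight (continuity in a parameter); the inverse length of an interval as weight (behaviour on
    shrinking intervals). *)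
Definition cv0 f g : Prop :=
  [/\ \forall i \near G, forall x, O i x -> derivable (f i) x 1,
      \forall i \near G, forall x, O i x -> derivable (g i) x 1,
      exists B m, \forall i \near G, forall x, D i x -> `|g i x| <= B * w i ^+ m
    & forall m e, 0 < e -> \forall i \near G, forall x, D i x ->
        `|f i x - g i x| * w i ^+ m <= e].

Fixpoint cvb k f g : Prop :=
  match k with
  | 0 => cv0 f g
  | k'.+1 => cv0 f g /\ cvb k' (fun i => derive1 (f i)) (fun i => derive1 (g i))
  end.

Lemma wX_ge1 i m : 1 <= w i ^+ m.
Proof. by rewrite exprn_ege1. Qed.

Lemma wX_gt0 i m : 0 < w i ^+ m.
Proof. exact: lt_le_trans (wX_ge1 i m). Qed.

Lemma wX_le i m n : (m <= n)%N -> w i ^+ m <= w i ^+ n.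
Proof. by move=> mn; rewrite ler_weXn2l. Qed.

Lemma cv0_eq f g f' g' : f = f' -> g = g' -> cv0 f g -> cv0 f' g'.
Proof. by move=> -> ->. Qed.

Lemma cvb_eq k f g f' g' : f = f' -> g = g' -> cvb k f g -> cvb k f' g'.
Proof. by move=> -> ->. Qed.

Lemma wX_bound i (B B' : R) m m' : B <= B' -> 0 <= B' -> (m <= m')%N ->
  B * w i ^+ m <= B' * w i ^+ m'.
Proof.
move=> BB B0 mm; apply: (@le_trans _ _ (B' * w i ^+ m)).
  by rewrite ler_pM2r// wX_gt0.
by rewrite ler_wpM2l// wX_le.
Qed.

Lemma cvb_cv0 k f g : cvb k f g -> cv0 f g.
Proof. by case: k => // k []. Qed.

Lemma cvbW k f g : cvb k.+1 f g -> cvb k f g.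
Proof.
elim: k f g => [|k ih] f g [] // h0 h1; split => //; exact: ih.
Qed.

Lemma cvb_leq j k f g : (j <= k)%N -> cvb k f g -> cvb j f g.
Proof.
move=> jk; rewrite -(subnK jk); elim: (k - j)%N => // d ih.
by rewrite addSn => /cvbW.
Qed.

Lemma cvbP k f g : cvb k f g <->
  forall j, (j <= k)%N ->
    cv0 (fun i => derive1n j (f i)) (fun i => derive1n j (g i)).
Proof.
elim: k f g => [|k ih] f g.
  by split => [h j|/(_ 0%N (leqnn _))//]; rewrite leqn0 => /eqP ->.
split=> [[h0 /ih h1] [//|j] jk|h].
  by apply: cv0_eq (h1 _ jk) => //; apply/funext => i; rewrite derive1Sn.
split; first exact: (h 0%N).
apply/ih => j jk.
by apply: cv0_eq (h j.+1 jk) => //; apply/funext => i; rewrite derive1Sn.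
Qed.

Lemma eq_derive1_on (U : set R) (f g : R -> R) : open U ->
  (forall x, U x -> f x = g x) -> forall x, U x -> derive1 f x = derive1 g x.
Proof.
move=> oU fg x Ux; rewrite !derive1E; apply: near_eq_derive.
by near=> y; apply: fg; near: y; exact: open_nbhs_nbhs.
Unshelve. all: by end_near. Qed.

Lemma eq_derivable_on (U : set R) (f g : R -> R) : open U ->
  (forall x, U x -> f x = g x) ->
  forall x, U x -> derivable f x 1 -> derivable g x 1.
Proof.
move=> oU fg x Ux; apply: near_eq_derivable.
by near=> y; apply: fg; near: y; exact: open_nbhs_nbhs.
Unshelve. all: by end_near. Qed.

Definition eq_fam f g : Prop := \forall i \near G, forall x, O i x -> f i x = g i x.

Lemma eq_famD f g : eq_fam f g ->
  eq_fam (fun i => derive1 (f i)) (fun i => derive1 (g i)).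
Proof. by apply: filterS => i fg x Ox; exact: (@eq_derive1_on _ _ _ (@oO i) fg x Ox). Qed.

(** Equality is required on [O i], not only on [D i]: derivatives agree only where the functions
    agree on an open set. *)
Lemma cvb_ext k f g f' g' :
  eq_fam f f' -> eq_fam g g' -> cvb k f g -> cvb k f' g'.
Proof.
have h0 a b a' b' : eq_fam a a' -> eq_fam b b' -> cv0 a b -> cv0 a' b'.
  move=> aa bb [da db [B [m hB]] hm]; split.
  - apply: filterS2 aa da => i ai di x Ox.
    exact: (@eq_derivable_on _ _ _ (@oO i) ai x Ox (di x Ox)).
  - apply: filterS2 bb db => i ai di x Ox.
    exact: (@eq_derivable_on _ _ _ (@oO i) ai x Ox (di x Ox)).
  - exists B, m; apply: filterS2 bb hB => i bi hi x Dx.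
    by rewrite -bi ?hi//; exact: DO.
  - move=> n e e0; apply: filterS3 aa bb (hm n e e0) => i ai bi hi x Dx.
    by rewrite -bi -?ai ?hi//; exact: DO.
elim: k f g f' g' => [|k ih] f g f' g' ff gg; first exact: h0.
move=> [c0 c1]; split; first exact: h0 ff gg c0.
by apply: ih c1; exact: eq_famD.
Qed.

Lemma cvb_congr k f g f' g' : (forall i x, O i x -> f i x = f' i x) ->
  (forall i x, O i x -> g i x = g' i x) -> cvb k f g -> cvb k f' g'.
Proof. by move=> h h'; apply: cvb_ext; apply: nearW. Qed.

(** The growth bound is imposed on [g] alone; [f] inherits it because it stays within 1 of [g] on
    [D i]. *)
Lemma cv0_sym f g : cv0 f g -> cv0 g f.
Proof.
move=> [df dg [B [m hB]] hm]; split => //; last first.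
  by move=> n e e0; apply: filterS (hm n e e0) => i hi x Dx; rewrite distrC hi.
exists (1 + B), m; apply: filterS2 hB (hm 0%N 1 ltr01) => i hB h1 x Dx.
rewrite mulrDl mul1r -(subrK (g i x) (f i x)).
apply: (le_trans (ler_normD _ _)); apply: lerD; last exact: hB.
by apply: le_trans (wX_ge1 i m); have := h1 x Dx; rewrite expr0 mulr1.
Qed.

Lemma cvb_sym k f g : cvb k f g -> cvb k g f.
Proof.
by elim: k f g => [|k ih] f g; [exact: cv0_sym|move=> [/cv0_sym ? /ih]].
Qed.

Lemma cv0_trans g f h : cv0 f g -> cv0 g h -> cv0 f h.
Proof.
move=> [df dg _ hm] [_ dh hB hm']; split => // m e e0.
have e2 : 0 < e / 2 by rewrite divr_gt0.
apply: filterS2 (hm m _ e2) (hm' m _ e2) => i h1 h2 x Dx.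
rewrite (splitr e); apply: le_trans (lerD (h1 x Dx) (h2 x Dx)).
rewrite -mulrDl ler_pM2r ?wX_gt0// -(subrK (g i x) (f i x)) -addrA.
by rewrite subrK; apply: le_trans (ler_normD _ _).
Qed.

Lemma cvb_trans k g f h : cvb k f g -> cvb k g h -> cvb k f h.
Proof.
elim: k f g h => [|k ih] f g h; first exact: cv0_trans.
by move=> [a b] [c d]; split; [exact: cv0_trans a c|exact: ih b d].
Qed.

Lemma cvb_refl k f g : cvb k f g -> cvb k f f.
Proof. by move=> h; apply: (cvb_trans h); exact: cvb_sym. Qed.

Lemma cv0_bound2 f g : cv0 f g -> exists B m, 0 <= B /\
  \forall i \near G, forall x, D i x ->
    `|f i x| <= B * w i ^+ m /\ `|g i x| <= B * w i ^+ m.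
Proof.
move=> h; have [_ _ [B [m hB]] _] := h.
have [_ _ [B' [m' hB']] _] := cv0_sym h.
exists (`|B| + `|B'|), (maxn m m'); split; first exact: addr_ge0.
apply: filterS2 hB hB' => i b b' x Dx; split.
  apply: (le_trans (b' x Dx)); apply: wX_bound; rewrite ?leq_maxr ?addr_ge0//.
  by apply: (le_trans (ler_norm _)); rewrite lerDr.
apply: (le_trans (b x Dx)); apply: wX_bound; rewrite ?leq_maxl ?addr_ge0//.
by apply: (le_trans (ler_norm _)); rewrite lerDl.
Qed.

Lemma cv0D f g f' g' : cv0 f g -> cv0 f' g' ->
  cv0 (fun i x => f i x + f' i x) (fun i x => g i x + g' i x).
Proof.
move=> h h'; have [df dg _ hm] := h; have [df' dg' _ hm'] := h'.
have [B [m [B0 hB]]] := cv0_bound2 h.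
have [B' [m' [B'0 hB']]] := cv0_bound2 h'; split.
- by apply: filterS2 df df' => i d d' x Ox; apply: derivableD; [exact: d|exact: d'].
- by apply: filterS2 dg dg' => i d d' x Ox; apply: derivableD; [exact: d|exact: d'].
- exists (B + B'), (maxn m m'); apply: filterS2 hB hB' => i b b' x Dx.
  apply: (le_trans (ler_normD _ _)); rewrite mulrDl; apply: lerD.
    by apply: (le_trans (b x Dx).2); rewrite ler_wpM2l// wX_le ?leq_maxl.
  by apply: (le_trans (b' x Dx).2); rewrite ler_wpM2l// wX_le ?leq_maxr.
- move=> n e e0; have e2 : 0 < e / 2 by rewrite divr_gt0.
  apply: filterS2 (hm n _ e2) (hm' n _ e2) => i h1 h2 x Dx.
  rewrite (splitr e); apply: le_trans (lerD (h1 x Dx) (h2 x Dx)).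
  rewrite -mulrDl ler_pM2r ?wX_gt0// opprD addrACA.
  exact: ler_normD.
Qed.

Lemma cvbD k f g f' g' : cvb k f g -> cvb k f' g' ->
  cvb k (fun i x => f i x + f' i x) (fun i x => g i x + g' i x).
Proof.
elim: k f g f' g' => [|k ih] f g f' g'; first exact: cv0D.
move=> [h0 h1] [h0' h1']; split; first exact: cv0D.
have [df dg _ _] := h0; have [df' dg' _ _] := h0'.
apply: cvb_ext (ih _ _ _ _ h1 h1').
  by apply: filterS2 df df' => i d d' x Ox; rewrite derive1D_pt; auto.
by apply: filterS2 dg dg' => i d d' x Ox; rewrite derive1D_pt; auto.
Qed.

(** Negligible times moderate is negligible: the exponent at which one difference is controlled is
    raised by the growth exponent of the other factor. *)
Lemma cv0M f g f' g' : cv0 f g -> cv0 f' g' ->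
  cv0 (fun i x => f i x * f' i x) (fun i x => g i x * g' i x).
Proof.
move=> h h'; have [df dg _ hm] := h; have [df' dg' _ hm'] := h'.
have [B [m [B0 hB]]] := cv0_bound2 h.
have [B' [m' [B'0 hB']]] := cv0_bound2 h'; split.
- by apply: filterS2 df df' => i d d' x Ox; apply: derivableM; [exact: d|exact: d'].
- by apply: filterS2 dg dg' => i d d' x Ox; apply: derivableM; [exact: d|exact: d'].
- exists (B * B'), (m + m')%N; apply: filterS2 hB hB' => i b b' x Dx.
  rewrite normrM exprD mulrACA.
  by apply: ler_pM => //; [exact: (b x Dx).2|exact: (b' x Dx).2].
- move=> n e e0.
  set c := B + B' + 1; have c0 : 0 < c by rewrite /c; lra.
  have e2 : 0 < e / c by rewrite divr_gt0.
  apply: filterS3 (filterI hB hB') (hm (n + m')%N _ e2) (hm' (n + m)%N _ e2) => i [b b'] h1 h2 x Dx.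
  have -> : f i x * f' i x - g i x * g' i x =
            (f i x - g i x) * f' i x + g i x * (f' i x - g' i x) by ring.
  apply: (@le_trans _ _ ((B' + B) * (e / c))); last first.
    rewrite mulrCA ger_pMr// ler_pdivrMr// mul1r /c; lra.
  apply: (@le_trans _ _ ((`|f i x - g i x| * `|f' i x| + `|g i x| * `|f' i x - g' i x|) * w i ^+ n)).
    rewrite ler_pM2r ?wX_gt0//; apply: (le_trans (ler_normD _ _)).
    by rewrite !normrM.
  rewrite !mulrDl; apply: lerD.
    apply: (@le_trans _ _ ((`|f i x - g i x| * (B' * w i ^+ m')) * w i ^+ n)).
      by rewrite ler_pM2r ?wX_gt0// ler_wpM2l// (b' x Dx).1.
    have -> : `|f i x - g i x| * (B' * w i ^+ m') * w i ^+ n =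
      B' * (`|f i x - g i x| * w i ^+ (n + m')) by rewrite exprD; ring.
    by rewrite ler_wpM2l// h1.
  apply: (@le_trans _ _ (((B * w i ^+ m) * `|f' i x - g' i x|) * w i ^+ n)).
    by rewrite ler_pM2r ?wX_gt0// ler_wpM2r// (b x Dx).2.
  have -> : (B * w i ^+ m) * `|f' i x - g' i x| * w i ^+ n =
    B * (`|f' i x - g' i x| * w i ^+ (n + m)) by rewrite exprD; ring.
  by rewrite ler_wpM2l// h2.
Qed.

Lemma cvbM k f g f' g' : cvb k f g -> cvb k f' g' ->
  cvb k (fun i x => f i x * f' i x) (fun i x => g i x * g' i x).
Proof.
elim: k f g f' g' => [|k ih] f g f' g'; first exact: cv0M.
move=> h h'; have [h0 h1] := h; have [h0' h1'] := h'.
split; first exact: cv0M.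
have [df dg _ _] := h0; have [df' dg' _ _] := h0'.
apply: cvb_ext (cvbD (ih _ _ _ _ h1 (cvbW h')) (ih _ _ _ _ (cvbW h) h1')).
  by apply: filterS2 df df' => i d d' x Ox; rewrite derive1M_pt; auto.
by apply: filterS2 dg dg' => i d d' x Ox; rewrite derive1M_pt; auto.
Qed.

Lemma cvb_cst_gen k (c d : I -> R) :
  (exists B m, \forall i \near G, `|d i| <= B * w i ^+ m) ->
  (forall m e, 0 < e -> \forall i \near G, `|c i - d i| * w i ^+ m <= e) ->
  cvb k (fun i _ => c i) (fun i _ => d i).
Proof.
elim: k c d => [|k ih] c d [B [m hB]] hm.
  split; try by apply: nearW => i x _; exact: derivable_cst.
  - by exists B, m; apply: filterS hB => i hi x _.
  - by move=> n e e0; apply: filterS (hm n e e0) => i hi x _.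
split.
  split; try by apply: nearW => i x _; exact: derivable_cst.
  - by exists B, m; apply: filterS hB => i hi x _.
  - by move=> n e e0; apply: filterS (hm n e e0) => i hi x _.
have h0 : cvb k (fun i _ => 0) (fun i _ => 0).
  apply: ih; first by exists 0, 0%N; apply: nearW => i; rewrite normr0 mul0r.
  by move=> n e e0; apply: nearW => i; rewrite subrr normr0 mul0r ltW.
by apply: cvb_congr h0 => i x _; rewrite derive1_cst.
Qed.

Lemma cvb_cst k (c : R) : cvb k (fun _ _ => c) (fun _ _ => c).
Proof.
apply: cvb_cst_gen; first by exists `|c|, 0%N; apply: nearW => i; rewrite expr0 mulr1.
by move=> n e e0; apply: nearW => i; rewrite subrr normr0 mul0r ltW.
Qed.

Lemma cvbN k f g : cvb k f g -> cvb k (fun i x => - f i x) (fun i x => - g i x).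
Proof.
move=> h; apply: cvb_congr (cvbM (cvb_cst k (-1)) h) => i x _; exact: mulN1r.
Qed.

Lemma cvbB k f g f' g' : cvb k f g -> cvb k f' g' ->
  cvb k (fun i x => f i x - f' i x) (fun i x => g i x - g' i x).
Proof. by move=> h h'; apply: cvbD => //; exact: cvbN. Qed.

Lemma cvb_sum k (J : Type) (r : seq J) (Q : pred J) (f g : J -> I -> R -> R) :
  (forall j, Q j -> cvb k (f j) (g j)) ->
  cvb k (fun i x => \sum_(j <- r | Q j) f j i x)
        (fun i x => \sum_(j <- r | Q j) g j i x).
Proof.
move=> h; elim: r => [|j r ih].
  by apply: cvb_congr (cvb_cst k 0) => i x _; rewrite big_nil.
have [Qj|Qj] := boolP (Q j).
  by apply: cvb_congr (cvbD (h j Qj) ih) => i x _; rewrite big_cons Qj.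
by apply: cvb_congr ih => i x _; rewrite big_cons (negbTE Qj).
Qed.

Lemma cvb_prod k (J : Type) (r : seq J) (f g : J -> I -> R -> R) :
  (forall j, cvb k (f j) (g j)) ->
  cvb k (fun i x => \prod_(j <- r) f j i x) (fun i x => \prod_(j <- r) g j i x).
Proof.
move=> h; elim: r => [|j r ih].
  by apply: cvb_congr (cvb_cst k 1) => i x _; rewrite big_nil.
by apply: cvb_congr (cvbM (h j) ih) => i x _; rewrite big_cons.
Qed.

Lemma cvb_derive k f g : cvb k.+1 f g ->
  cvb k (fun i => derive1 (f i)) (fun i => derive1 (g i)).
Proof. by case. Qed.

Lemma cvb_deriven k j f g : cvb (j + k) f g ->
  cvb k (fun i => derive1n j (f i)) (fun i => derive1n j (g i)).
Proof.
elim: j f g => [//|j ih] f g; rewrite addSn => /cvb_derive /ih.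
by apply: cvb_eq => //; apply/funext => i; rewrite derive1Sn.
Qed.

(** Nonvanishing on [O i] makes the inverses differentiable, while the estimates on [D i] need the
    uniform lower bound [c]. *)
Lemma cv0V (c : R) f g : 0 < c -> cv0 f g ->
  (\forall i \near G, forall x, O i x -> f i x != 0 /\ g i x != 0) ->
  (\forall i \near G, forall x, D i x -> c <= `|f i x| /\ c <= `|g i x|) ->
  cv0 (fun i x => (f i x)^-1) (fun i x => (g i x)^-1).
Proof.
move=> c0 [df dg _ hm] fg0 fgc; split.
- apply: filterS2 df fg0 => i d h x Ox.
  by apply: derivableV; [exact: (h x Ox).1|exact: d].
- apply: filterS2 dg fg0 => i d h x Ox.
  by apply: derivableV; [exact: (h x Ox).2|exact: d].
- exists c^-1, 0%N; apply: filterS fgc => i h x Dx.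
  rewrite expr0 mulr1 normfV lef_pV2 ?posrE//; first exact: (h x Dx).2.
  by apply: lt_le_trans (h x Dx).2.
- move=> n e e0; have e2 : 0 < e * (c * c) by rewrite !mulr_gt0.
  apply: filterS3 fgc fg0 (hm n _ e2) => i h h0 h1 x Dx.
  have [f0 g0] := h0 _ (DO Dx); have [cf cg] := h _ Dx.
  have -> : (f i x)^-1 - (g i x)^-1 = - ((f i x - g i x) / (f i x * g i x)).
    by field; rewrite f0 g0.
  rewrite normrN normrM mulrAC normfV ler_pdivrMr ?normr_gt0 ?mulf_neq0//.
  apply: (le_trans (h1 x Dx)); rewrite ler_pM2l// normrM.
  by apply: ler_pM; rewrite // ltW.
Qed.

Lemma cvbV k (c : R) f g : 0 < c -> cvb k f g ->
  (\forall i \near G, forall x, O i x -> f i x != 0 /\ g i x != 0) ->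
  (\forall i \near G, forall x, D i x -> c <= `|f i x| /\ c <= `|g i x|) ->
  cvb k (fun i x => (f i x)^-1) (fun i x => (g i x)^-1).
Proof.
move=> c0 h fg0 fgc; elim: k h => [|k ih] h; first exact: cv0V c0 _ _ _.
have [h0 h1] := h; split; first exact: cv0V c0 _ _ _.
have [df dg _ _] := h0; have {}ih := ih (cvbW h).
apply: cvb_ext (cvbN (cvbM (cvbM ih ih) h1)).
  by apply: filterS2 df fg0 => i d h' x Ox; have [f0 g0] := h' x Ox;
     rewrite derive1V_pt; auto.
by apply: filterS2 dg fg0 => i d h' x Ox; have [f0 g0] := h' x Ox;
   rewrite derive1V_pt; auto.
Qed.

End Asymptotic.

Section RowNorm.
Context {R : realType} {N : nat}.
Implicit Types y : 'rV[R]_N.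

Lemma coord_le_norm y mu : `|y 0 mu| <= `|y|.
Proof.
have := @mx_normrE R 1 N y; rewrite -[X in X = _]/(`|y|) => ->.
by apply: (le_bigmax_cond _ (fun ij : 'I_1 * 'I_N => `|y ij.1 ij.2|) (j := (0, mu))).
Qed.

Lemma row_norm_le y (e : R) : 0 <= e -> (forall mu, `|y 0 mu| <= e) -> `|y| <= e.
Proof.
move=> e0 h; have := @mx_normrE R 1 N y; rewrite -[X in X = _]/(`|y|) => ->.
by apply/bigmax_leP; split => // -[i mu] _ /=; rewrite (ord1 i).
Qed.

End RowNorm.

(** * Several-variable calculus: chain rule and stability of smooth functions *)

Section ChainRule.
Context {R : realType} {N : nat}.
Implicit Types (g : 'rV[R]_N -> R) (y z : 'rV[R]_N).

Definition C1_fun g : Prop := forall mu,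
  continuous (partial mu g) /\ forall y, derivable g y (delta_mx 0 mu).

Lemma is_derive_line g y mu (s : R) : (forall y, derivable g y (delta_mx 0 mu)) ->
  is_derive s 1 (fun s : R => g (y + s *: delta_mx 0 mu))
    (partial mu g (y + s *: delta_mx 0 mu)).
Proof.
move=> dg; have := dg (y + s *: delta_mx 0 mu).
set e := delta_mx 0 mu; move=> d.
have E : (fun h : R => h^-1 *: (((fun s => g (y + s *: e)) \o shift s) (h *: 1) - g (y + s *: e)))
   = (fun h : R => h^-1 *: ((g \o shift (y + s *: e)) (h *: e) - g (y + s *: e))).
  apply/funext => h /=; congr (_ *: (g _ - _)).
  by rewrite /GRing.scale /= mulr1 -/(GRing.scale _ _) scalerDl addrCA.
apply: DeriveDef; first by rewrite /derivable E.
by rewrite /derive E.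
Qed.

Lemma mvt_line g y mu (c : R) : C1_fun g -> exists2 s : R, 0 <= s <= 1 &
  g (y + c *: delta_mx 0 mu) - g y =
  partial mu g (y + (s * c) *: delta_mx 0 mu) * c.
Proof.
move=> /(_ mu) [_ dg].
pose f (s : R) := g (y + s *: delta_mx 0 mu).
have df (s : R) : is_derive s 1 (f \o (fun s => s * c))
    (partial mu g (y + (s * c) *: delta_mx 0 mu) * c).
  apply: is_derive1_comp; first exact: is_derive_line.
  apply: DeriveDef; first exact: derivableM.
  by rewrite -derive1E derive1M_pt ?derive1_id ?derive1_cst//= mulr0 addr0 mul1r.
have cf : {within `[0, 1], continuous (f \o (fun s => s * c))}.
  apply: continuous_subspaceT => x; apply: differentiable_continuous.
  by apply/derivable1_diffP; case: (df x).
have [s] := MVT_segment ler01 (fun x _ => df x) cf.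
rewrite in_itv/= => s01 h; exists s => //; move: h.
by rewrite /f/= mul1r mul0r scale0r addr0 subr0 mulr1.
Qed.

(* Moving from y to y' one coordinate at a time. *)
Lemma hadamard g y y' : C1_fun g -> exists xi : 'I_N -> 'rV[R]_N,
  [/\ forall mu, `|xi mu - y| <= `|y' - y|,
      forall mu, `|xi mu| <= Num.max `|y| `|y'|
    & g y' - g y = \sum_mu partial mu g (xi mu) * (y' 0 mu - y 0 mu)].
Proof.
move=> hg.
pose z (k : nat) := \row_(nu < N) (if (nu < k)%N then y' 0 nu else y 0 nu).
have zS (mu : 'I_N) : z mu.+1 = z mu + (y' 0 mu - y 0 mu) *: delta_mx 0 mu.
  apply/rowP => nu; rewrite !mxE ltnS leq_eqVlt eqxx /=.
  case: (eqVneq nu mu) => [->|nm]; first by rewrite eqxx ltnn mulr1 addrCA subrr addr0.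
  by rewrite (inj_eq val_inj) (negbTE nm) mulr0 addr0.
have /choice [xi hxi] : forall mu : 'I_N, exists x : 'rV[R]_N,
    [/\ `|x - y| <= `|y' - y|, `|x| <= Num.max `|y| `|y'|
      & g (z mu.+1) - g (z mu) = partial mu g x * (y' 0 mu - y 0 mu)].
  move=> mu; have [s /andP[s0 s1] hs] := mvt_line (z mu) mu (y' 0 mu - y 0 mu) hg.
  exists (z mu + (s * (y' 0 mu - y 0 mu)) *: delta_mx 0 mu); split.
  - apply: row_norm_le => // nu; rewrite !mxE eqxx /=.
    have h := coord_le_norm (y' - y) nu; rewrite !mxE in h.
    case: (eqVneq nu mu) => [e|nm].
      move: h; rewrite e ltnn mulr1 addrAC subrr add0r => h.
      by rewrite normrM ger0_norm// (le_trans _ h)// ler_piMl.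
    rewrite mulr0 addr0; case: ifP => // _; by rewrite subrr normr0.
  - apply: row_norm_le => [|nu]; first by rewrite le_max normr_ge0.
    rewrite !mxE eqxx /=.
    have h := coord_le_norm y nu; have h' := coord_le_norm y' nu.
    case: (eqVneq nu mu) => [e|nm].
      move: h h'; rewrite e ltnn mulr1 => h h'.
      have -> : y 0 mu + s * (y' 0 mu - y 0 mu) = (1 - s) * y 0 mu + s * y' 0 mu by ring.
      apply: (le_trans (ler_normD _ _)); rewrite !normrM.
      rewrite (ger0_norm s0) (@ger0_norm _ (1 - s)) ?subr_ge0//.
      have -> : Num.max `|y| `|y'| = (1 - s) * Num.max `|y| `|y'| + s * Num.max `|y| `|y'| by ring.
      by apply: lerD; rewrite ler_wpM2l ?subr_ge0// le_max ?h ?h' ?orbT.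
    by rewrite mulr0 addr0; case: ifP => _; rewrite le_max ?h ?h' ?orbT.
  - by rewrite -hs zS.
exists xi; split => [mu|mu|]; [by have [] := hxi mu|by have [] := hxi mu|].
have -> : \sum_mu partial mu g (xi mu) * (y' 0 mu - y 0 mu) =
    \sum_(mu < N) (g (z mu.+1) - g (z mu)).
  by apply: eq_bigr => mu _; have [_ _ ->] := hxi mu.
rewrite -(big_mkord xpredT (fun k => g (z k.+1) - g (z k))) telescope_sumr//.
congr (g _ - g _); apply/rowP => nu; rewrite !mxE; first by rewrite ltn_ord.
by rewrite ltn0.
Qed.

(** [hadamard] writes the increment of [g] as partial derivatives at intermediate points times
    coordinate increments of [u]. The intermediate points tend to [u t], so continuity of the
    partials suffices. *)
Lemma is_derive_chain g (u : R -> 'rV[R]_N) t : C1_fun g -> derivable u t 1 ->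
  is_derive t 1 (fun t => g (u t)) (\sum_mu partial mu g (u t) * derive1 u t 0 mu).
Proof.
move=> hg du.
have /choice [xi hxi] : forall h : R, exists xi : 'I_N -> 'rV[R]_N,
    (forall mu, `|xi mu - u t| <= `|u (h + t) - u t|) /\
    g (u (h + t)) - g (u t) = \sum_mu partial mu g (xi mu) * (u (h + t) 0 mu - u t 0 mu).
  by move=> h; have [xi [a _ b]] := hadamard (u t) (u (h + t)) hg; exists xi.
have cu : {for t, continuous u}.
  by apply: differentiable_continuous; apply/derivable1_diffP.
have lim : h^-1 *: (((fun t => g (u t)) \o shift t) (h *: 1) - g (u t)) @[h --> (0:R)^'] -->
   (\sum_mu partial mu g (u t) * derive1 u t 0 mu).
  have -> : (fun h => h^-1 *: (((fun t => g (u t)) \o shift t) (h *: 1) - g (u t)))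
      = fun h => \sum_mu partial mu g (xi h mu) *
      (h^-1 *: (((fun t => u t 0 mu) \o shift t) (h *: 1) - u t 0 mu)).
    apply/funext => h /=.
    rewrite /GRing.scale/= mulr1 (hxi h).2 mulr_sumr.
    by apply: eq_bigr => mu _; rewrite mulrCA.
  apply: (cvg_big add_continuous) => mu _; apply: cvgM; last first.
    rewrite derive1E derive_mx// mxE.
    have /derivable_mxP/(_ 0 mu) := du; exact.
  have [cg _] := hg mu.
  have cxi : xi h mu @[h --> (0:R)^'] --> u t.
    apply/cvgrPdist_le => e e0.
    have : \forall h \near (0:R), `|u t - u (h + t)| <= e.
      have c0 : u (h + t) @[h --> (0:R)] --> u t.
        have ch : (h + t) @[h --> (0:R)] --> 0 + t.
          by apply: cvgD; [exact: cvg_id|exact: cvg_cst].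
        by rewrite add0r in ch; exact: (cvg_comp _ _ ch cu).
      exact: (cvgr_dist_le _ _ c0 _ e0).
    move=> /(@nbhs_dnbhs _ _) h; apply: filterS h => h hh.
    by rewrite distrC; apply: le_trans ((hxi h).1 mu) _; rewrite distrC.
  exact: (cvg_comp _ _ cxi (cg (u t))).
apply: DeriveDef; first by apply/cvg_ex; eexists; exact: lim.
exact: cvg_lim lim.
Qed.

End ChainRule.

Section SmoothFun.
Context {R : realType} {N : nat}.
Implicit Types (g h : 'rV[R]_N -> R) (y z : 'rV[R]_N).

Lemma smooth_funD mu g : smooth_fun g -> smooth_fun (partial mu g).
Proof. by move=> hg s; have := hg (rcons s mu); rewrite foldr_rcons. Qed.

Lemma smooth_C1 g : smooth_fun g -> C1_fun g.
Proof.
move=> hg mu; split; first by case: (hg [:: mu]).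
by have [_] := hg [::]; apply.
Qed.

Lemma bounded_on_cube (g : 'rV[R]_N -> R) (B : R) : continuous g ->
  exists2 M, 0 <= M & forall y, `|y| <= B -> `|g y| <= M.
Proof.
move=> cg; pose K := [set y : 'rV[R]_N | forall i : 'I_N, `[- B, B]%classic (y ord0 i)].
have cK : compact K.
  by apply: (@rV_compact R N (fun=> `[- B, B]%classic)) => i; exact: segment_compact.
have : compact (g @` K).
  apply: (@continuous_compact _ _ g K _ cK).
  exact: continuous_subspaceT.
move=> /compact_bounded [M [Mr hM]].
exists (`|M| + 1); first by rewrite addr_ge0.
move=> y yB; apply: hM; first by apply: le_lt_trans (ler_norm M) _; rewrite ltrDl.
exists y => // i; rewrite /= in_itv/= -ler_norml.
exact: le_trans (coord_le_norm y i) yB.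
Qed.

Lemma smooth_lip g (B : R) : smooth_fun g ->
  exists2 M, 0 <= M & forall y z, `|y| <= B -> `|z| <= B ->
    `|g y - g z| <= M * \sum_mu `|y 0 mu - z 0 mu|.
Proof.
move=> hg.
have /choice [M hM] : forall mu, exists M, 0 <= M /\ forall y, `|y| <= B -> `|partial mu g y| <= M.
  move=> mu; have [cg _] := smooth_C1 hg mu.
  by have [M M0 h] := bounded_on_cube B cg; exists M.
exists (\sum_mu M mu); first by apply: sumr_ge0 => mu _; case: (hM mu).
move=> y z yB zB; have [xi [_ h ->]] := hadamard z y (smooth_C1 hg).
apply: (le_trans (ler_norm_sum _ _ _)); rewrite mulr_sumr.
apply: ler_sum => mu _; rewrite normrM; apply: ler_wpM2r => //.
apply: (@le_trans _ _ (M mu)).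
  apply: (hM mu).2; apply: (le_trans (h mu)); by rewrite ge_max zB yB.
rewrite (bigD1 mu)//= lerDl; apply: sumr_ge0 => nu _; by case: (hM nu).
Qed.

(** A class of expressions closed under partial derivatives ([smooth_alg1]): iterated partials of
    sums, products and inverses never have to be written out. *)
Inductive smooth_alg : ('rV[R]_N -> R) -> Prop :=
| SAbase g : smooth_fun g -> smooth_alg g
| SAcst c : smooth_alg (cst c)
| SAD g h : smooth_alg g -> smooth_alg h -> smooth_alg (fun y => g y + h y)
| SAM g h : smooth_alg g -> smooth_alg h -> smooth_alg (fun y => g y * h y)
| SAV g : (forall y, g y != 0) -> smooth_alg g -> smooth_alg (fun y => (g y)^-1).

Lemma smooth_alg1 g : smooth_alg g ->
  continuous g /\ forall mu, smooth_alg (partial mu g) /\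
    forall y, derivable g y (delta_mx 0 mu).
Proof.
elim=> {g} [g hg|c|g h _ [cg dg] _ [ch dh]|g h hg [cg dg] hh [ch dh]|g g0 hg [cg dg]].
- split; first by case: (hg [::]).
  move=> mu; split; first by apply: SAbase; exact: smooth_funD.
  by have [_] := hg [::]; apply.
- split; first exact: cst_continuous.
  move=> mu; split; last by move=> y; exact: derivable_cst.
  rewrite (_ : partial mu _ = cst 0); first exact: SAcst.
  by apply/funext => y; rewrite /partial derive_cst.
- split; first by move=> y; exact: (cvgD (cg y) (ch y)).
  move=> mu; split; last by move=> y; exact: (derivableD ((dg mu).2 y) ((dh mu).2 y)).
  rewrite (_ : partial mu _ = fun y => partial mu g y + partial mu h y).
    by apply: SAD; [exact: (dg mu).1|exact: (dh mu).1].
  apply/funext => y; exact: (deriveD ((dg mu).2 y) ((dh mu).2 y)).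
- split; first by move=> y; exact: (cvgM (cg y) (ch y)).
  move=> mu; split; last by move=> y; exact: (derivableM ((dg mu).2 y) ((dh mu).2 y)).
  rewrite (_ : partial mu _ = fun y => g y * partial mu h y + h y * partial mu g y).
    by apply: SAD; apply: SAM => //; [exact: (dh mu).1|exact: (dg mu).1].
  apply/funext => y; exact: (deriveM ((dg mu).2 y) ((dh mu).2 y)).
- split; first by move=> y; exact: (cvgV (g0 y) (cg y)).
  move=> mu; split; last by move=> y; exact: (derivableV (g0 y) ((dg mu).2 y)).
  rewrite (_ : partial mu _ = fun y => (-1) * ((g y)^-1 * (g y)^-1) * partial mu g y).
    apply: SAM; last exact: (dg mu).1.
    by apply: SAM; [exact: SAcst|apply: SAM; apply: SAV].
  apply/funext => y; rewrite [LHS](deriveV (g0 y) ((dg mu).2 y)).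
  by rewrite /GRing.scale/= mulN1r expr2 invfM.
Qed.

Lemma smooth_algP g : smooth_alg g -> smooth_fun g.
Proof.
move=> hg s; have {hg} : smooth_alg (foldr (@partial R N) g s).
  by elim: s => [//|mu s ih] /=; exact: ((smooth_alg1 ih).2 mu).1.
move=> /smooth_alg1 [c d]; split => // mu y; exact: (d mu).2.
Qed.

Lemma smooth_fun_cst c : smooth_fun (cst c : 'rV[R]_N -> R).
Proof. by apply: smooth_algP; exact: SAcst. Qed.

Lemma smooth_funA g h : smooth_fun g -> smooth_fun h -> smooth_fun (fun y => g y + h y).
Proof. by move=> hg hh; apply: smooth_algP; apply: SAD; exact: SAbase. Qed.

Lemma smooth_funM g h : smooth_fun g -> smooth_fun h -> smooth_fun (fun y => g y * h y).
Proof. by move=> hg hh; apply: smooth_algP; apply: SAM; exact: SAbase. Qed.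

Lemma smooth_funV g : (forall y, g y != 0) -> smooth_fun g ->
  smooth_fun (fun y => (g y)^-1).
Proof. by move=> g0 hg; apply: smooth_algP; apply: SAV => //; exact: SAbase. Qed.

Lemma smooth_fun_sum (J : Type) (r : seq J) (g : J -> 'rV[R]_N -> R) :
  (forall j, smooth_fun (g j)) -> smooth_fun (fun y => \sum_(j <- r) g j y).
Proof.
move=> hg; elim: r => [|j r ih].
  rewrite (_ : (fun y => _) = cst 0); first exact: smooth_fun_cst.
  by apply/funext => y; rewrite big_nil.
rewrite (_ : (fun y => _) = fun y => g j y + \sum_(j <- r) g j y); first exact: smooth_funA.
by apply/funext => y; rewrite big_cons.
Qed.

Lemma smooth_fun_prod (J : Type) (r : seq J) (g : J -> 'rV[R]_N -> R) :
  (forall j, smooth_fun (g j)) -> smooth_fun (fun y => \prod_(j <- r) g j y).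
Proof.
move=> hg; elim: r => [|j r ih].
  rewrite (_ : (fun y => _) = cst 1); first exact: smooth_fun_cst.
  by apply/funext => y; rewrite big_nil.
rewrite (_ : (fun y => _) = fun y => g j y * \prod_(j <- r) g j y); first exact: smooth_funM.
by apply/funext => y; rewrite big_cons.
Qed.

Lemma smooth_fun_det n (M : 'rV[R]_N -> 'M[R]_n) :
  (forall i j, smooth_fun (fun y => M y i j)) -> smooth_fun (fun y => \det (M y)).
Proof.
move=> hM; rewrite /determinant; apply: smooth_fun_sum => s.
apply: smooth_funM; first exact: smooth_fun_cst.
by apply: smooth_fun_prod => i.
Qed.

End SmoothFun.

Section AsymptoticComp.
Context {R : realType} {N : nat} {I : Type} (G : set_system I) {FG : Filter G}.
Variables (O D : I -> set R) (w : I -> R).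
Hypothesis oO : forall i, open (O i).
Hypothesis DO : forall i, D i `<=` O i.
Hypothesis w1 : forall i, 1 <= w i.
Local Notation cv0 := (cv0 G O D w).
Local Notation cvb := (cvb G O D w).

Lemma derivable_rowP (u : R -> 'rV[R]_N) x :
  (forall mu, derivable (fun x => u x 0 mu) x 1) -> derivable u x 1.
Proof. by move=> h; apply/derivable_mxP => i j; rewrite (ord1 i). Qed.

Lemma derive1_row (u : R -> 'rV[R]_N) x mu :
  derivable u x 1 -> derive1 u x 0 mu = derive1 (fun x => u x 0 mu) x.
Proof. by move=> du; rewrite !derive1E derive_mx// mxE. Qed.

Lemma cv0_near_forall (Q : 'I_N -> I -> Prop) :
  (forall mu, \forall i \near G, Q mu i) -> \forall i \near G, forall mu, Q mu i.
Proof. exact: filter_forall. Qed.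

Lemma cv0_comp (g : 'rV[R]_N -> R) (u v : I -> R -> 'rV[R]_N) (B : R) :
  smooth_fun g ->
  (forall mu, cv0 (fun i x => u i x 0 mu) (fun i x => v i x 0 mu)) ->
  (\forall i \near G, forall x, D i x -> `|v i x| <= B) ->
  cv0 (fun i x => g (u i x)) (fun i x => g (v i x)).
Proof.
move=> hg huv hB.
have hd (a : I -> R -> 'rV[R]_N) :
    (forall mu, \forall i \near G, forall x, O i x -> derivable (fun x => a i x 0 mu) x 1) ->
    \forall i \near G, forall x, O i x -> derivable (fun x => g (a i x)) x 1.
  move=> /cv0_near_forall; apply: filterS => i h x Ox.
  have da : derivable (a i) x 1 by apply: derivable_rowP => mu; exact: h.
  by case: (is_derive_chain (smooth_C1 hg) da).
have [M M0 hM] := smooth_lip (B + 1) hg.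
have [M' M'0 hM'] := bounded_on_cube B (hg [::]).1.
split.
- by apply: hd => mu; have [h _ _ _] := huv mu; exact: h.
- by apply: hd => mu; have [_ h _ _] := huv mu; exact: h.
- by exists M', 0%N; apply: filterS hB => i h x Dx; rewrite expr0 mulr1 hM' ?h.
- move=> m e e0.
  set c := M * N%:R + 1; have c0 : 0 < c by rewrite ltr_wpDl// mulr_ge0.
  have h1 : \forall i \near G, forall mu x, D i x -> `|u i x 0 mu - v i x 0 mu| * w i ^+ m <= e / c.
    by apply: cv0_near_forall => mu; have [_ _ _] := huv mu; apply; rewrite divr_gt0.
  have h2 : \forall i \near G, forall mu x, D i x -> `|u i x 0 mu - v i x 0 mu| * w i ^+ 0 <= 1.
    by apply: cv0_near_forall => mu; have [_ _ _] := huv mu; exact.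
  apply: filterS3 hB h1 h2 => i b h1 h2 x Dx.
  have vB : `|v i x| <= B + 1 by apply: (le_trans (b x Dx)); rewrite lerDl.
  have uB : `|u i x| <= B + 1.
    rewrite -(subrK (v i x) (u i x)) addrC; apply: (le_trans (ler_normD _ _)).
    apply: lerD; first exact: b.
    apply: row_norm_le => // mu; have := h2 mu x Dx; by rewrite expr0 mulr1 !mxE.
  apply: (@le_trans _ _ ((M * \sum_(mu < N) `|u i x 0 mu - v i x 0 mu|) * w i ^+ m)).
    by rewrite ler_pM2r ?hM// wX_gt0.
  rewrite -mulrA mulr_suml.
  apply: (@le_trans _ _ (M * \sum_(mu < N) (e / c))).
    by rewrite ler_wpM2l//; apply: ler_sum => mu _; exact: h1.
  rewrite sumr_const card_ord -[e / c *+ N]mulr_natl mulrA mulrCA ger_pMr//.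
  by rewrite ler_pdivrMr// mul1r /c lerDl.
Qed.

(** [g] is an arbitrary smooth function, so [v] must stay in a fixed ball on [D i], where [g] is
    bounded and Lipschitz. The chain rule passes from [k] to [k.+1], the partials of [g] being
    smooth again. *)
Lemma cvb_comp k (g : 'rV[R]_N -> R) (u v : I -> R -> 'rV[R]_N) (B : R) :
  smooth_fun g ->
  (forall mu, cvb k (fun i x => u i x 0 mu) (fun i x => v i x 0 mu)) ->
  (\forall i \near G, forall x, D i x -> `|v i x| <= B) ->
  cvb k (fun i x => g (u i x)) (fun i x => g (v i x)).
Proof.
elim: k g => [|k ih] g hg huv hB; first exact: cv0_comp huv hB.
split; first by apply: cv0_comp hB => // mu; exact: (huv mu).1.
have hd (a : I -> R -> 'rV[R]_N) :
    (forall mu, \forall i \near G, forall x, O i x -> derivable (fun x => a i x 0 mu) x 1) ->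
    eq_fam G O (fun i x => \sum_mu partial mu g (a i x) * derive1 (fun x => a i x 0 mu) x)
      (fun i => derive1 (fun x => g (a i x))).
  move=> /cv0_near_forall; apply: filterS => i h x Ox.
  have da : derivable (a i) x 1 by apply: derivable_rowP => mu; exact: h.
  rewrite derive1E; have [_ ->] := is_derive_chain (smooth_C1 hg) da.
  by apply: eq_bigr => mu _; rewrite derive1_row.
apply: (cvb_ext oO DO (hd u _) (hd v _)).
- by move=> mu; have [[h _ _ _] _] := huv mu; exact: h.
- by move=> mu; have [[_ h _ _] _] := huv mu; exact: h.
apply: (cvb_sum oO DO w1) => mu _.
apply: cvbM => //; last exact: (huv mu).2.
apply: ih => //; first exact: smooth_funD.
by move=> nu; exact: cvbW.
Qed.

End AsymptoticComp.

(** * Mean value estimates and ordinary differential equations *)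

Section CurveCalculus.
Context {R : realType} {n : nat}.
Implicit Types (u : R -> 'rV[R]_n).

Lemma is_derive_rowP u (t : R) (d : 'rV[R]_n) :
  is_derive t 1 u d <-> forall mu, is_derive t 1 (fun s => u s 0 mu) (d 0 mu).
Proof.
split=> [[du <-] mu|h].
  have du' := du; move/derivable_mxP/(_ 0 mu) : du => dmu.
  by apply: DeriveDef => //; rewrite derive_mx// mxE.
have du : derivable u t 1 by apply: derivable_rowP => mu; case: (h mu).
apply: DeriveDef => //; rewrite derive_mx//; apply/matrixP => i mu.
by rewrite (ord1 i) mxE; case: (h mu).
Qed.

Lemma is_derive_derive1 u (t : R) d : is_derive t 1 u d -> derive1 u t = d.
Proof. by case=> _ <-; rewrite derive1E. Qed.

Lemma is_derive_continuous u (t : R) d : is_derive t 1 u d -> {for t, continuous u}.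
Proof.
by case=> du _; apply: differentiable_continuous; apply/derivable1_diffP.
Qed.

Lemma antiderivative_real (f : R -> R) (a : R) : continuous f ->
  exists F : R -> R, forall t, a < t -> is_derive t 1 F (f t).
Proof.
move=> cf; exists (fun x => \int[lebesgue_measure]_(t in [set` `[a, x]]) f t).
move=> t at_.
have tt : t < t + 1 by rewrite ltrDl.
have [|||d e] := @continuous_FTC1 R f (BLeft a) t (t + 1) tt.
- apply: continuous_compact_integrable; first exact: segment_compact.
  exact: continuous_subspaceT.
- exact: at_.
- exact: cf.
- by apply: (DeriveDef d); rewrite -derive1E; exact: e.
Qed.

Lemma antiderivative (f : R -> 'rV[R]_n) (a : R) : continuous f ->
  exists F : R -> 'rV[R]_n, forall t, a < t -> is_derive t 1 F (f t).
Proof.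
move=> cf.
have /choice [F hF] : forall mu, exists F : R -> R,
    forall t, a < t -> is_derive t 1 F (f t 0 mu).
  move=> mu; apply: antiderivative_real => t.
  exact: (continuous_comp (cf t) (@coord_continuous R 1 n 0 mu _)).
exists (fun t => \row_mu F mu t) => t at_; apply/is_derive_rowP => mu.
rewrite (_ : (fun s => _) = F mu); first exact: hF.
by apply/funext => s; rewrite mxE.
Qed.

Lemma mvt_row_le u (du : R -> 'rV[R]_n) (a b B : R) : 0 <= B -> a <= b ->
  (forall s, a <= s <= b -> is_derive s 1 u (du s)) ->
  (forall s, a < s < b -> `|du s| <= B) -> `|u b - u a| <= B * (b - a).
Proof.
move=> B0; rewrite le_eqVlt => /orP[/eqP<- _ _|ab hd hB].
  by rewrite !subrr normr0 mulr0.
have ab' := ltW ab.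
apply: row_norm_le => [|mu]; first by rewrite mulr_ge0// subr_ge0.
have hmu s : a <= s <= b -> is_derive s 1 (fun s => u s 0 mu) (du s 0 mu).
  by move=> sab; have /is_derive_rowP := hd s sab; exact.
have cf : {within `[a, b], continuous (fun s => u s 0 mu)}.
  apply: derivable_within_continuous => s; rewrite in_itv/= => sab.
  by case: (hmu s sab).
have hmu' s : s \in `]a, b[ -> is_derive s 1 (fun s => u s 0 mu) (du s 0 mu).
  by rewrite in_itv/= => /andP[? ?]; apply: hmu; rewrite !ltW.
have [s sab e] := MVT ab hmu' cf.
rewrite !mxE e normrM (@ger0_norm _ (b - a)) ?subr_ge0// ler_wpM2r ?subr_ge0//.
apply: (le_trans (coord_le_norm _ _)); apply: hB; by rewrite in_itv/= in sab.
Qed.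

Lemma mvt_row u (du : R -> 'rV[R]_n) (a b B s t : R) : 0 <= B ->
  (forall s, a <= s <= b -> is_derive s 1 u (du s)) ->
  (forall s, a < s < b -> `|du s| <= B) ->
  a <= s <= b -> a <= t <= b -> `|u s - u t| <= B * `|s - t|.
Proof.
move=> B0 hd hB; wlog st : s t / s <= t.
  move=> h sab tab; have [st|/ltW ts] := leP s t; first exact: h.
  by rewrite distrC (distrC s); exact: h.
move=> /andP[as_ sb] /andP[at_ tb].
rewrite distrC (distrC s) (@ger0_norm _ (t - s)) ?subr_ge0//.
apply: (@mvt_row_le u du) => // x /andP[sx xt]; [apply: hd|apply: hB].
  by rewrite (le_trans as_ sx) (le_trans xt tb).
by rewrite (le_lt_trans as_ sx) (lt_le_trans xt tb).
Qed.

(* On an interval so short that the Lipschitz constant times its length is at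
   most 1/2 the integral inequality closes up without Gronwall's lemma. *)
Lemma ode_dependence (u1 u2 Y1 Y2 : R -> 'rV[R]_n) (a b c L e : R) :
  0 <= L -> 0 <= e -> L * (b - a) <= 2^-1 -> a <= c <= b ->
  (forall s, a <= s <= b -> is_derive s 1 u1 (Y1 s)) ->
  (forall s, a <= s <= b -> is_derive s 1 u2 (Y2 s)) ->
  (forall s, a < s < b -> `|Y1 s - Y2 s| <= L * `|u1 s - u2 s| + e) ->
  forall s, a <= s <= b ->
    `|u1 s - u2 s| <= 2 * (`|u1 c - u2 c| + (b - a) * e).
Proof.
move=> L0 e0 Lab cab d1 d2 hY.
have ab : a <= b by case/andP: cab => ac; exact: le_trans.
have dd s : a <= s <= b -> is_derive s 1 (fun s => u1 s - u2 s) (Y1 s - Y2 s).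
  by move=> sab; apply: is_deriveB; [exact: d1|exact: d2].
have cd : {within `[a, b], continuous (fun s => `|u1 s - u2 s|)}.
  apply: continuous_in_subspaceT => s; rewrite inE/= in_itv/= => sab.
  exact: (continuous_comp (is_derive_continuous (dd s sab)) (@norm_continuous _ _ _)).
have [m] := EVT_max ab cd; rewrite in_itv/= => mab hm.
set S := `|u1 m - u2 m| in hm.
have S0 : 0 <= S by exact: normr_ge0.
have hS s : a < s < b -> `|Y1 s - Y2 s| <= L * S + e.
  move=> sab; apply: (le_trans (hY s sab)); rewrite lerD2r ler_wpM2l//.
  by apply: hm; rewrite in_itv/=; case/andP: sab => ? ?; rewrite !ltW.
have hS0 : 0 <= L * S + e by rewrite addr_ge0// mulr_ge0.
have h := mvt_row hS0 dd hS mab cab.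
have mc : `|m - c| <= b - a.
  by case/andP: mab => ? ?; case/andP: cab => ? ?; rewrite ler_norml; apply/andP; split; lra.
have {}h : `|u1 m - u2 m - (u1 c - u2 c)| <= (L * S + e) * (b - a).
  by apply: (le_trans h); rewrite ler_wpM2l// addr_ge0// mulr_ge0.
have hS' : S <= `|u1 c - u2 c| + (L * S + e) * (b - a).
  rewrite /S -{1}(subrK (u1 c - u2 c) (u1 m - u2 m)) addrC.
  by apply: (le_trans (ler_normD _ _)); rewrite lerD2l.
move=> s sab; apply: (@le_trans _ _ S); first by apply: hm; rewrite in_itv.
have : L * (b - a) * S <= 2^-1 * S by rewrite ler_wpM2r.
move: hS'; set A := `|u1 c - u2 c|; move=> hS' h2.
have -> : 2 * (A + (b - a) * e) = 2 * A + 2 * ((b - a) * e) by ring.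
have e1 : (L * S + e) * (b - a) = L * (b - a) * S + (b - a) * e by ring.
rewrite e1 in hS'; lra.
Qed.

End CurveCalculus.

Lemma half_powers (R : realType) (M e : R) : 0 < e -> exists k, 2 * M / 2 ^+ k <= e.
Proof.
move=> e0; have [k hk] : exists k : nat, 2 * M / e <= k%:R.
  have [M0|M0] := leP (2 * M / e) 0; first by exists 0%N.
  by exists (Num.bound (2 * M / e)); apply/ltW/archi_boundP/ltW.
exists k; rewrite ler_pdivrMr ?exprn_gt0// -ler_pdivrMl// mulrC.
apply: (le_trans hk); rewrite -natrX ler_nat; exact/ltnW/ltn_expl.
Qed.

Section Picard.
Context {R : realType} {n : nat}.
Variables (Y : R -> 'rV[R]_n -> 'rV[R]_n) (c r L : R) (y0 : 'rV[R]_n).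
Hypothesis r0 : 0 < r.
Hypothesis L0 : 0 <= L.
Hypothesis Lr : L * r <= 2^-1.
Hypothesis cY : forall y, continuous (fun t => Y t y).
Hypothesis LY : forall t y z, `|Y t y - Y t z| <= L * `|y - z|.

Let clamp (t : R) : R := Num.max (c - r) (Num.min (c + r) t).

Let clamp_in t : c - r <= clamp t <= c + r.
by have r0' := r0; rewrite /clamp le_max lexx/= ge_max ge_min lexx /= andbT; lra. Qed.

Let clamp_id t : c - r <= t <= c + r -> clamp t = t.
Proof.
by move=> /andP[h1 h2]; rewrite /clamp (min_idPr h2) (max_idPr h1).
Qed.

Let clampK t : clamp (clamp t) = clamp t.
Proof. exact: clamp_id. Qed.

Let clamp_cont : continuous clamp.
Proof.
move=> t; apply: (@continuous_max _ _ (cst (c - r)) (fun t => Num.min (c + r) t) t).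
  exact: cvg_cst.
apply: (@continuous_min _ _ (cst (c + r)) id t); [exact: cvg_cst|exact: cvg_id].
Qed.

Let continuous_field (u : R -> 'rV[R]_n) : continuous u -> continuous (fun t => Y t (u t)).
Proof.
move=> cu t; have L0' := L0; apply/cvgrPdist_le => e e0.
have e2 : 0 < e / 2 by rewrite divr_gt0.
have eL : 0 < e / (2 * (L + 1)) by rewrite divr_gt0// mulr_gt0// ltr_wpDl.
near=> s.
rewrite (splitr e) -(subrK (Y s (u t)) (Y t (u t))) -addrA.
apply: (le_trans (ler_normD _ _)); apply: lerD.
  by near: s; exact: (cvgr_dist_le _ _ (cY (y := u t) (x := t)) _ e2).
apply: (le_trans (LY _ _ _)).
apply: (@le_trans _ _ (L * (e / (2 * (L + 1))))).
  by apply: ler_wpM2l => //; near: s; exact: (cvgr_dist_le _ _ (cu t) _ eL).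
rewrite invfM mulrCA [leLHS](_ : _ = e / 2 * (L / (L + 1))); last by field; lra.
by rewrite ger_pMr// ler_pdivrMr ?mul1r; lra.
Unshelve. all: by end_near. Qed.

Let picard_step (w : R -> 'rV[R]_n) : continuous w ->
  exists u : R -> 'rV[R]_n, u c = y0 /\
    forall t, c - r - 1 < t -> is_derive t 1 u (Y t (w t)).
Proof.
move=> /continuous_field /antiderivative - /(_ (c - r - 1)) [F hF].
exists (fun t => y0 - F c + F t); split; first by rewrite subrK.
move=> t ht; rewrite -[Y t (w t)]add0r; apply: is_deriveD; exact: hF.
Qed.

(** Since [L * r <= 1/2], integrating the field contracts the sup norm by 1/2. The iterates form a
    geometric Cauchy sequence and their limit is a fixed point. *)
Lemma picard : exists u : R -> 'rV[R]_n, u c = y0 /\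
  forall t, c - r <= t <= c + r -> is_derive t 1 u (Y t (u t)).
Proof.
have r0' := r0; have L0' := L0; have Lr' := Lr.
have /choice [T hT] : forall w : R -> 'rV[R]_n, exists u : R -> 'rV[R]_n,
    continuous w -> u c = y0 /\
    forall t, c - r - 1 < t -> is_derive t 1 u (Y t (w t)).
  move=> w; have [cw|ncw] := pselect (continuous w); last by exists w => /ncw.
  by have [u hu] := picard_step cw; exists u.
(* Composing with [clamp] freezes the iterates outside the interval, so bounds over all of [R]
   follow from bounds on a compact interval. *)
pose w := fix w k : R -> 'rV[R]_n :=
  if k is k'.+1 then T (w k') \o clamp else cst y0.
have cw k : continuous (w k).
  elim: k => [|k ih]; first exact: cst_continuous.
  move=> t; apply: continuous_comp; first exact: clamp_cont.
  have [_ h] := hT _ ih; apply: (is_derive_continuous (h _ _)).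
  by have /andP[] := clamp_in t; lra.
have wc k t : w k (clamp t) = w k t by case: k => [//|k] /=; rewrite clampK.
have hTd (v v' : R -> 'rV[R]_n) (e : R) : continuous v -> continuous v' ->
    (forall t, `|v t - v' t| <= e) ->
    forall t, c - r <= t <= c + r -> `|T v t - T v' t| <= e / 2.
  move=> cv cv' h t /andP[t1 t2].
  have [Tc dT] := hT _ cv; have [Tc' dT'] := hT _ cv'.
  have e0 : 0 <= e by exact: le_trans (normr_ge0 _) (h 0).
  have dd s : c - r <= s <= c + r -> is_derive s 1 (fun s => T v s - T v' s) (Y s (v s) - Y s (v' s)).
    by move=> /andP[? ?]; apply: is_deriveB; [apply: dT|apply: dT']; lra.
  have Le0 : 0 <= L * e by rewrite mulr_ge0.
  have hB s : c - r < s < c + r -> `|Y s (v s) - Y s (v' s)| <= L * e.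
    by move=> _; apply: (le_trans (LY _ _ _)); rewrite ler_wpM2l.
  have tin : c - r <= t <= c + r by rewrite t1.
  have cin : c - r <= c <= c + r by apply/andP; split; lra.
  have := mvt_row Le0 dd hB tin cin; rewrite Tc Tc' subrr subr0 => /le_trans; apply.
  apply: (@le_trans _ _ (L * e * r)).
    by rewrite ler_wpM2l ?mulr_ge0// ler_norml; apply/andP; split; lra.
  rewrite mulrAC mulrC ler_wpM2l//; lra.
have [M M0 hM] : exists2 M, 0 <= M & forall t, `|w 1%N t - w 0%N t| <= M.
  have cd : {within `[c - r, c + r], continuous (fun t => `|w 1%N t - w 0%N t|)}.
    apply: continuous_subspaceT => t.
    exact: (continuous_comp (cvgB (@cw 1%N t) (@cw 0%N t)) (@norm_continuous _ _ _)).
  have [|m _ hm] := EVT_max _ cd; first by lra.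
  exists `|w 1%N m - w 0%N m| => // t.
  have := hm (clamp t); rewrite (wc 1%N) (wc 0%N); apply; rewrite in_itv.
  exact: clamp_in.
have hw k t : `|w k.+1 t - w k t| <= M / 2 ^+ k.
  elim: k t => [|k ih] t; first by rewrite expr0 divr1.
  rewrite -[w k.+2 t]wc -[w k.+1 t]wc exprSr invfM mulrA.
  rewrite [w k.+2 _]/= [w k.+1 _]/= clampK.
  apply: (hTd (w k.+1) (w k) _ (cw k.+1) (cw k) ih); exact: clamp_in.
(* The subtracted term is the tail of the geometric series; keeping it makes the induction on [d]
   close. *)
have hwd k d t : `|w (d + k)%N t - w k t| <= 2 * M / 2 ^+ k - M / 2 ^+ (d + k) * 2.
  elim: d => [|d ih].
    by rewrite add0n subrr normr0; lra.
  rewrite -(subrK (w (d + k)%N t) (w (d.+1 + k)%N t)) -addrA.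
  apply: (le_trans (ler_normD _ _)); apply: (le_trans (lerD (hw _ t) ih)).
  rewrite addSn exprS invfM; set z := (2 ^+ (d + k))^-1; set z' := (2 ^+ k)^-1.
  have -> : M * (2^-1 * z) * 2 = M * z by field.
  lra.
have hwd' k m t : (k <= m)%N -> `|w m t - w k t| <= 2 * M / 2 ^+ k.
  move=> km; have := hwd k (m - k)%N t; rewrite subnK// => /le_trans; apply.
  by rewrite lerBlDr lerDl !mulr_ge0// invr_ge0 exprn_ge0.
have small := @half_powers R M.
have cvw t : cvgn (w ^~ t).
  apply/cauchy_cvgP/cauchy_exP => e e0.
  have e2 : 0 < e / 2 by rewrite divr_gt0.
  have [k hk] := small _ e2.
  exists (w k t); exists k => // m /= km.
  rewrite -ball_normE /= distrC; apply: (le_lt_trans (hwd' k m t km)).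
  by apply: (le_lt_trans hk); rewrite ltr_pdivrMr// ltr_pMr// ltr1n.
pose u t := limn (w ^~ t).
have hu k t : `|u t - w k t| <= 2 * M / 2 ^+ k.
  apply/ler_addgt0Pl => e e0.
  have [m km hm] : exists2 m, (k <= m)%N & `|u t - w m t| <= e.
    have h : \forall m \near \oo, `|u t - w m t| <= e := cvgr_dist_le _ _ (cvw t) _ e0.
    near \oo => m; exists m; near: m; [exact: nbhs_infty_ge|exact: h].
  rewrite -(subrK (w m t) (u t)) -addrA; apply: (le_trans (ler_normD _ _)).
  by apply: lerD => //; exact: hwd'.
have cu : continuous u.
  move=> t; apply/cvgrPdist_le => e e0.
  have e3 : 0 < e / 3 by rewrite divr_gt0.
  have [k hk] := small _ e3; near=> s.
  have -> : u t - u s = (u t - w k t) + (w k t - w k s) - (u s - w k s).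
    by rewrite opprB addrA addrA subrK addrAC -addrA addrAC addrA addrK.
  have -> : e = e / 3 + e / 3 + e / 3 by field.
  apply: (le_trans (ler_normB _ _)); apply: lerD; last exact: (le_trans (hu k s)).
  apply: (le_trans (ler_normD _ _)); apply: lerD; first exact: (le_trans (hu k t)).
  by near: s; exact: (cvgr_dist_le _ _ (@cw k t) _ e3).
have uT t : c - r <= t <= c + r -> T u t = u t.
  move=> ht; apply/eqP; rewrite -subr_eq0 -normr_le0; apply/ler_addgt0Pl => e e0.
  rewrite addr0; have e2 : 0 < e / 2 by rewrite divr_gt0.
  have [k hk] := small _ e2.
  have h1 : `|T u t - T (w k) t| <= e / 2 / 2.
    by apply: hTd => // s; exact: (le_trans (hu k s)).
  have h2 : `|u t - T (w k) t| <= e / 2.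
    have := hu k.+1 t; rewrite /= clamp_id// => /le_trans; apply.
    apply: (le_trans _ hk); rewrite exprS invfM.
    have : 0 <= 2 * M / 2 ^+ k by rewrite !mulr_ge0// invr_ge0 exprn_ge0.
    set z := (2 ^+ k)^-1; have -> : 2 * M * (2^-1 * z) = (2 * M * z) / 2 by ring.
    lra.
  rewrite -(subrK (T (w k) t) (T u t)) -addrA.
  apply: (le_trans (ler_normD _ _)); rewrite (distrC _ (u t)).
  by apply: (le_trans (lerD h1 h2)); lra.
have [Tc dT] := hT _ cu.
exists (T u); split => // t ht; rewrite (uT t ht); apply: dT.
by case/andP: ht => ? _; lra.
Unshelve. all: by end_near. Qed.

End Picard.

Section AsymptoticPull.
Context {R : realType}.

Lemma cvb_pull (I J : Type) (G : set_system I) (H : set_system J)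
    {FG : Filter G} {FH : Filter H} (s : J -> I)
    (O D : I -> set R) (O' D' : J -> set R) (w : I -> R) (w' : J -> R) (W : R) k f g :
  (forall i, 1 <= w i) -> (forall j, 1 <= w' j) ->
  (forall Q, G Q -> \forall j \near H, Q (s j)) ->
  (\forall j \near H, O' j `<=` O (s j)) -> (\forall j \near H, D' j `<=` D (s j)) ->
  (\forall j \near H, w' j <= W) -> (\forall j \near H, w (s j) <= w' j) ->
  cvb G O D w k f g -> cvb H O' D' w' k (fun j => f (s j)) (fun j => g (s j)).
Proof.
move=> w1 w'1 hs hO hD hW hw.
have h0 a b : cv0 G O D w a b -> cv0 H O' D' w' (fun j => a (s j)) (fun j => b (s j)).
  move=> [da db [B [m hB]] hm]; split.
  - by apply: filterS2 hO (hs _ da) => j h h' x /h; exact: h'.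
  - by apply: filterS2 hO (hs _ db) => j h h' x /h; exact: h'.
  - exists `|B|, m; apply: filterS3 hD (hs _ hB) hw => j h h' h'' x /h/h' /le_trans; apply.
    apply: (@le_trans _ _ (`|B| * w (s j) ^+ m)).
      by rewrite ler_wpM2r ?ler_norm// exprn_ge0// (le_trans ler01).
    by rewrite ler_wpM2l// lerXn2r// nnegrE (le_trans ler01).
  - move=> n e e0; have W0 : 0 < `|W| + 1 by rewrite ltr_wpDl.
    have e1 : 0 < e / (`|W| + 1) ^+ n by rewrite divr_gt0// exprn_gt0.
    apply: filterS3 hD (hs _ (hm 0%N _ e1)) hW => j h h' h'' x /h/h'.
    rewrite expr0 mulr1 ler_pdivlMr ?exprn_gt0// => /(le_trans _); apply.
    rewrite ler_wpM2l//; apply: lerXn2r; rewrite ?nnegrE.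
    + exact: le_trans ler01 (w'1 j).
    + exact: ltW.
    + by apply: (le_trans h''); rewrite (le_trans (ler_norm W))// lerDl.
elim: k f g => [|k ih] f g; first exact: h0.
by move=> [a b]; split; [exact: h0|exact: ih b].
Qed.

(** On the diagonal the negligible difference is zero, so only the growth bound has to be
    transported and the new weight may be unbounded. *)
Lemma cvb_pull_refl (I J : Type) (G : set_system I) (H : set_system J)
    {FG : Filter G} {FH : Filter H} (s : J -> I)
    (O D : I -> set R) (O' D' : J -> set R) (w : I -> R) (w' : J -> R) k f :
  (forall i, 1 <= w i) -> (forall j, 1 <= w' j) ->
  (forall Q, G Q -> \forall j \near H, Q (s j)) ->
  (\forall j \near H, O' j `<=` O (s j)) -> (\forall j \near H, D' j `<=` D (s j)) ->
  (\forall j \near H, w (s j) <= w' j) ->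
  cvb G O D w k f f -> cvb H O' D' w' k (fun j => f (s j)) (fun j => f (s j)).
Proof.
move=> w1 w'1 hs hO hD hw.
have h0 a : cv0 G O D w a a -> cv0 H O' D' w' (fun j => a (s j)) (fun j => a (s j)).
  move=> [da db [B [m hB]] hm]; split.
  - by apply: filterS2 hO (hs _ da) => j h h' x /h; exact: h'.
  - by apply: filterS2 hO (hs _ db) => j h h' x /h; exact: h'.
  - exists `|B|, m; apply: filterS3 hD (hs _ hB) hw => j h h' h'' x /h/h' /le_trans; apply.
    apply: (@le_trans _ _ (`|B| * w (s j) ^+ m)).
      by rewrite ler_wpM2r ?ler_norm// exprn_ge0// (le_trans ler01).
    by rewrite ler_wpM2l// lerXn2r// nnegrE (le_trans ler01).
  - by move=> n e e0; apply: nearW => j x _; rewrite subrr normr0 mul0r ltW.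
elim: k f => [|k ih] f; first exact: h0.
by move=> [a b]; split; [exact: h0|exact: ih b].
Qed.

End AsymptoticPull.

(** * Matrix-valued curves, Gram determinants and truncations *)

Section Coordinates.
Context {R : realType} {m n : nat}.
Implicit Types (u : R -> 'M[R]_(m, n)) (U : set R).

Lemma smooth_on_derive1 (V : normedModType R) U (u : R -> V) :
  smooth_on U u -> smooth_on U (derive1 u).
Proof. by move=> su k x Ux; rewrite -derive1Sn; exact: su. Qed.

Lemma eq_derivable_onV (V : normedModType R) U (f g : R -> V) : open U ->
  (forall x, U x -> f x = g x) ->
  forall x, U x -> derivable f x 1 -> derivable g x 1.
Proof.
move=> oU fg x Ux; apply: near_eq_derivable.
by near=> y; apply: fg; near: y; exact: open_nbhs_nbhs.
Unshelve. all: by end_near. Qed.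

Lemma smooth_on_ext (V : normedModType R) U (f g : R -> V) : open U ->
  (forall x, U x -> f x = g x) -> smooth_on U f -> smooth_on U g.
Proof.
move=> oU fg sf k x Ux.
apply: (eq_derivable_onV oU _ Ux (sf k x Ux)) => y Uy.
exact: (@derive1n_local _ _ U f g k oU fg y Uy).
Qed.

Lemma smooth_on_sub (V : normedModType R) U U' (f : R -> V) :
  U' `<=` U -> smooth_on U f -> smooth_on U' f.
Proof. by move=> UU sf k x /UU; exact: sf. Qed.

Lemma derive1n_entry U k u : open U ->
  (forall j x, (j < k)%N -> U x -> derivable (derive1n j u) x 1) ->
  forall i j x, U x -> derive1n k u x i j = derive1n k (fun x => u x i j) x.
Proof.
move=> oU; elim: k => [|k ih] su i j x Ux; first by rewrite !derive1n0.
rewrite !derive1nS derive1E derive_mx ?mxE -?derive1E; last exact: su.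
apply: (@eq_derive1_on _ U) => // y Uy.
by apply: ih => // l z lk; apply: su; exact: ltnW.
Qed.

(** Derivatives of a matrix can be read entrywise only once the lower-order ones are known to be
    differentiable, hence the strong induction on the order in the converse direction. *)
Lemma smooth_entryP U u : open U ->
  smooth_on U u <-> forall i j, smooth_on (V := R^o) U (fun x => u x i j).
Proof.
move=> oU; split=> [su i j k x Ux|su k].
  have /derivable_mxP/(_ i j) d := su k x Ux.
  apply: (@eq_derivable_on _ U _ _ oU _ x Ux d) => y Uy.
  by rewrite (@derive1n_entry U)// => l z _; exact: su.
have [l] := ubnP k; elim: l k => // l ih k kl x Ux.
apply/derivable_mxP => i j.
apply: (@eq_derivable_on _ U _ _ oU _ x Ux (su i j k x Ux)) => y Uy.
by rewrite (@derive1n_entry U)// => l' z lk Uz; apply: ih => //; exact: leq_trans lk _.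
Qed.

Lemma derive1n_entryE U k u i j x : open U -> smooth_on U u -> U x ->
  derive1n k u x i j = derive1n k (fun x => u x i j) x.
Proof. by move=> oU su Ux; apply: (@derive1n_entry U) => // l z _; exact: su. Qed.

End Coordinates.

Section GramMatrix.
Context {R : realType}.

Lemma row_dot_eq0 n (v : 'rV[R]_n) : v *m v^T = 0 -> v = 0.
Proof.
move=> /matrixP/(_ 0 0); rewrite !mxE => h; apply/rowP => i; rewrite mxE.
have h0 : \sum_(j < n) v 0 j * v 0 j = 0.
  by rewrite -[RHS]h; apply: eq_bigr => j _; rewrite mxE.
have hp j : true -> 0 <= v 0 j * v 0 j by move=> _; rewrite -expr2 sqr_ge0.
have := psumr_eq0P hp h0 (i := i) isT.
by move/eqP; rewrite mulf_eq0 orbb => /eqP.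
Qed.

(** If [v] kills [A *m A^T] then [v *m A] has zero square norm. The rank condition becomes the
    nonvanishing of one polynomial in the entries, to which the calculus applies. *)
Lemma row_free_gram m n (A : 'M[R]_(m, n)) :
  row_free A = (\det (A *m A^T) != 0).
Proof.
rewrite -unitfE -unitmxE; apply/idP/idP => [fA|uA].
  rewrite -row_free_unit; apply: inj_row_free => v hv.
  have : (v *m A) *m (v *m A)^T = 0 by rewrite trmx_mul mulmxA -(mulmxA v) hv mul0mx.
  by move/row_dot_eq0 => vA; apply: (row_free_inj fA); rewrite vA mul0mx.
by apply/row_freeP; exists (A^T *m invmx (A *m A^T)); rewrite mulmxA mulmxV.
Qed.

End GramMatrix.

Section MatrixBounds.
Context {R : realType}.

Lemma mulmx_row_le m n (v : 'rV[R]_m) (X : 'M[R]_(m, n)) (e : R) : 0 <= e ->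
  (forall i j, `|X i j| <= e) -> `|v *m X| <= m%:R * e * `|v|.
Proof.
move=> e0 hX; apply: row_norm_le => [|j]; first by rewrite !mulr_ge0.
rewrite mxE; apply: (le_trans (ler_norm_sum _ _ _)).
apply: (@le_trans _ _ (\sum_(i < m) (`|v| * e))).
  apply: ler_sum => i _; rewrite normrM.
  by apply: ler_pM => //; exact: coord_le_norm.
by rewrite sumr_const card_ord -[(_ * e) *+ m]mulr_natl (mulrC `|v|) mulrA.
Qed.

Definition clampr (B s : R) : R := Num.max (- B) (Num.min B s).

Lemma clampr_le B s : 0 <= B -> `|clampr B s| <= B.
Proof.
move=> B0; rewrite /clampr ler_norml le_max lexx/= ge_max ge_min lexx/= andbT; lra.
Qed.

Lemma clampr_id B s : `|s| <= B -> clampr B s = s.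
Proof.
by rewrite ler_norml => /andP[h1 h2]; rewrite /clampr (min_idPr h2) (max_idPr h1).
Qed.

Lemma clampr_lip B s t : 0 <= B -> `|clampr B s - clampr B t| <= `|s - t|.
Proof.
move=> B0; rewrite /clampr /Num.max /Num.min.
wlog st : s t / s <= t.
  move=> h; have [st|/ltW ts] := leP s t; first exact: h.
  by rewrite distrC (distrC s); exact: h.
rewrite distrC (distrC s) (@ger0_norm _ (t - s)) ?subr_ge0// ler_norml.
by case: (ltP B s) => h1; case: (ltP B t) => h2; case: ltP => h3; case: ltP => h4;
  apply/andP; split; lra.
Qed.

(** Truncation to a ball, without increasing distances: it makes a locally Lipschitz field globally
    Lipschitz, as [picard] demands. *)
Definition clamp_row n (B : R) (y : 'rV[R]_n) : 'rV[R]_n := map_mx (clampr B) y.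

Lemma clamp_row_le n B (y : 'rV[R]_n) : 0 <= B -> `|clamp_row B y| <= B.
Proof. by move=> B0; apply: row_norm_le => // mu; rewrite mxE clampr_le. Qed.

Lemma clamp_row_id n B (y : 'rV[R]_n) : `|y| <= B -> clamp_row B y = y.
Proof.
move=> yB; apply/rowP => mu; rewrite mxE clampr_id//.
exact: le_trans (coord_le_norm y mu) yB.
Qed.

Lemma clamp_row_lip n B (y z : 'rV[R]_n) : 0 <= B ->
  `|clamp_row B y - clamp_row B z| <= `|y - z|.
Proof.
move=> B0; apply: row_norm_le => // mu; rewrite !mxE.
apply: (le_trans (clampr_lip _ _ B0)).
by have := coord_le_norm (y - z) mu; rewrite !mxE.
Qed.

End MatrixBounds.

Section SmoothMatrix.
Context {R : realType} {N : nat}.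

Lemma smooth_fun_ext (f g : 'rV[R]_N -> R) : (forall y, f y = g y) ->
  smooth_fun f -> smooth_fun g.
Proof. by move=> /funext ->. Qed.

Lemma smooth_fun_mulmx m n r (A : 'rV[R]_N -> 'M[R]_(m, n)) (B : 'rV[R]_N -> 'M[R]_(n, r)) :
  (forall i j, smooth_fun (fun y => A y i j)) ->
  (forall i j, smooth_fun (fun y => B y i j)) ->
  forall i j, smooth_fun (fun y => (A y *m B y) i j).
Proof.
move=> hA hB i j.
rewrite (_ : (fun y => _) = fun y => \sum_k A y i k * B y k j).
  by apply: smooth_fun_sum => k; exact: smooth_funM.
by apply/funext => y; rewrite mxE.
Qed.

Lemma smooth_fun_invmx n (A : 'rV[R]_N -> 'M[R]_n) :
  (forall y, A y \in unitmx) ->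
  (forall i j, smooth_fun (fun y => A y i j)) ->
  forall i j, smooth_fun (fun y => invmx (A y) i j).
Proof.
move=> uA hA i j.
rewrite (_ : (fun y => _) = fun y => (\det (A y))^-1 *
   ((-1) ^+ (j + i) * \det (row' j (col' i (A y))))); last first.
  by apply/funext => y; rewrite /invmx uA !mxE.
apply: smooth_funM.
  apply: smooth_funV => [y|]; last exact: smooth_fun_det.
  by have := uA y; rewrite unitmxE unitfE.
apply: smooth_funM; first exact: smooth_fun_cst.
apply: smooth_fun_det => a b.
by apply: smooth_fun_ext (hA (lift j a) (lift i b)) => y; rewrite !mxE.
Qed.

End SmoothMatrix.

(** * Horizontal curves as solutions of a control system *)

Section Projection.
Context {R : realType} {N p : nat}.
Variable lam : 'rV[R]_N -> 'M[R]_(p, N).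
Hypothesis lam_smooth : smooth_forms lam.
Hypothesis lam_free : forall y, row_free (lam y).
Implicit Types (y z v : 'rV[R]_N).

Definition gram y := lam y *m (lam y)^T.

Lemma gram_unit y : gram y \in unitmx.
Proof. by rewrite unitmxE unitfE -row_free_gram. Qed.

(* v *m proj y is the orthogonal projection of v on the kernel of lam y *)
Definition proj y : 'M[R]_N := 1%:M - (lam y)^T *m invmx (gram y) *m lam y.

Lemma proj_lam y : proj y *m (lam y)^T = 0.
Proof.
by rewrite mulmxBl mul1mx -(mulmxA _ (lam y)) -/(gram y) mulmxKV ?gram_unit// subrr.
Qed.

Lemma proj_id y v : v *m (lam y)^T = 0 -> v *m proj y = v.
Proof. by move=> h; rewrite mulmxBr mulmx1 !mulmxA h !mul0mx subr0. Qed.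

Lemma proj_smooth i j : smooth_fun (fun y => proj y i j).
Proof.
have h : forall i j, smooth_fun (fun y => ((lam y)^T *m invmx (gram y) *m lam y) i j).
  have hT a b : smooth_fun (fun y => (lam y)^T a b).
    by apply: smooth_fun_ext (lam_smooth b a) => y; rewrite mxE.
  apply: smooth_fun_mulmx => //; apply: smooth_fun_mulmx => //.
  apply: smooth_fun_invmx; first exact: gram_unit.
  exact: smooth_fun_mulmx.
rewrite (_ : (fun y => _) = fun y => cst ((1%:M : 'M[R]_N) i j) y +
   cst (-1) y * ((lam y)^T *m invmx (gram y) *m lam y) i j).
  apply: smooth_funA; first exact: smooth_fun_cst.
  by apply: smooth_funM => //; exact: smooth_fun_cst.
by apply/funext => y; rewrite /proj [LHS]mxE [X in _ + X = _]mxE mulN1r.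
Qed.

Lemma horizE (u : R -> 'rV[R]_N) t : horiz lam u t = derive1 u t *m (lam (u t))^T.
Proof. by apply/rowP => s; rewrite !mxE; apply: eq_bigr => mu _; rewrite mxE mulrC. Qed.

Definition dproj y v : 'M[R]_N :=
  \matrix_(i, j) \sum_s v 0 s * partial s (fun y => proj y i j) y.

Lemma row_sum_le y : \sum_mu `|y 0 mu| <= N%:R * `|y|.
Proof.
apply: (@le_trans _ _ (\sum_(mu < N) `|y|)); first by apply: ler_sum => mu _; exact: coord_le_norm.
by rewrite sumr_const card_ord -[`|y| *+ N]mulr_natl.
Qed.

Lemma common_bound (Q : 'I_N -> 'I_N -> R -> Prop) :
  (forall i j, exists2 M, 0 <= M & Q i j M) ->
  (forall i j M M', M <= M' -> Q i j M -> Q i j M') ->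
  exists2 M, 0 <= M & forall i j, Q i j M.
Proof.
move=> h hQ.
have /choice [M hM] : forall ij : 'I_N * 'I_N, exists M, 0 <= M /\ Q ij.1 ij.2 M.
  by move=> [i j]; have [M M0 q] := h i j; exists M.
exists (\sum_ij M ij); first by apply: sumr_ge0 => ij _; exact: (hM ij).1.
move=> i j; apply: hQ (hM (i, j)).2; rewrite (bigD1 (i, j))//= lerDl.
by apply: sumr_ge0 => ij _; exact: (hM ij).1.
Qed.

Lemma proj_lip (B : R) : exists2 C, 1 <= C & forall y z v, `|y| <= B -> `|z| <= B ->
  `|v *m proj y| <= C * `|v| /\ `|v *m proj y - v *m proj z| <= C * `|v| * `|y - z|.
Proof.
have [M M0 hM] : exists2 M, 0 <= M & forall i j,
    forall y, `|y| <= B -> `|proj y i j| <= M.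
  apply: common_bound => [i j|i j M M' MM h y yB]; last exact: le_trans (h y yB) MM.
  exact: bounded_on_cube (proj_smooth i j [::]).1.
have [M' M'0 hM'] : exists2 M, 0 <= M & forall i j,
    forall y z, `|y| <= B -> `|z| <= B -> `|proj y i j - proj z i j| <= M * \sum_mu `|y 0 mu - z 0 mu|.
  apply: common_bound => [i j|i j M1 M2 MM h y z yB zB].
    exact: smooth_lip (proj_smooth i j).
  by apply: (le_trans (h y z yB zB)); rewrite ler_wpM2r// sumr_ge0.
exists (1 + N%:R * M + N%:R * (M' * N%:R)).
  by rewrite -addrA lerDl addr_ge0// !mulr_ge0.
move=> y z v yB zB; split.
  apply: (@le_trans _ _ (N%:R * M * `|v|)).
    by apply: mulmx_row_le => // i j; exact: hM.
  rewrite ler_wpM2r//.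
  have : 0 <= N%:R * (M' * N%:R) by rewrite !mulr_ge0.
  lra.
rewrite -mulmxBr; apply: (@le_trans _ _ (N%:R * (M' * (N%:R * `|y - z|)) * `|v|)).
  apply: mulmx_row_le => [|i j]; first by rewrite !mulr_ge0.
  rewrite !mxE; have := hM' i j y z yB zB; rewrite !mxE => /le_trans; apply.
  rewrite ler_wpM2l//; apply: le_trans (row_sum_le (y - z)).
  by apply: ler_sum => mu _; rewrite !mxE.
have -> : N%:R * (M' * (N%:R * `|y - z|)) * `|v| = N%:R * (M' * N%:R) * `|v| * `|y - z| by ring.
rewrite ler_wpM2r// ler_wpM2r//.
have : 0 <= N%:R * M by rewrite !mulr_ge0.
lra.
Qed.

Lemma proj_taylor (B : R) : exists2 C, 0 <= C & forall x y z v, `|x| <= B ->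
  (`|y| <= B -> `|z| <= B -> `|v *m proj y - v *m proj z - v *m dproj x (y - z)| <=
    C * `|v| * (`|y - x| + `|z - x|) * `|y - z|) /\
  `|v *m dproj x y| <= C * `|v| * `|y|.
Proof.
have [M M0 hM] : exists2 M, 0 <= M & forall i j, forall s y, `|y| <= B ->
    `|partial s (fun y => proj y i j) y| <= M.
  apply: common_bound => [i j|i j M M' MM h s y yB]; last exact: le_trans (h s y yB) MM.
  have /choice [M hM] : forall s, exists M, 0 <= M /\
      forall y, `|y| <= B -> `|partial s (fun y => proj y i j) y| <= M.
    move=> s; have [M M0 h] := bounded_on_cube B (smooth_funD s (proj_smooth i j) [::]).1.
    by exists M.
  exists (\sum_s M s); first by apply: sumr_ge0 => s _; exact: (hM s).1.
  move=> s y yB; apply: (le_trans ((hM s).2 y yB)); rewrite (bigD1 s)//= lerDl.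
  by apply: sumr_ge0 => s' _; exact: (hM s').1.
have [M' M'0 hM'] : exists2 M, 0 <= M & forall i j, forall s y z, `|y| <= B -> `|z| <= B ->
    `|partial s (fun y => proj y i j) y - partial s (fun y => proj y i j) z| <=
    M * \sum_mu `|y 0 mu - z 0 mu|.
  apply: common_bound => [i j|i j M1 M2 MM h s y z yB zB]; last first.
    by apply: (le_trans (h s y z yB zB)); rewrite ler_wpM2r// sumr_ge0.
  have /choice [M1 hM1] : forall s, exists M, 0 <= M /\ forall y z, `|y| <= B -> `|z| <= B ->
      `|partial s (fun y => proj y i j) y - partial s (fun y => proj y i j) z| <=
      M * \sum_mu `|y 0 mu - z 0 mu|.
    move=> s; have [M1 M10 h] := smooth_lip B (smooth_funD s (proj_smooth i j)).
    by exists M1.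
  exists (\sum_s M1 s); first by apply: sumr_ge0 => s _; exact: (hM1 s).1.
  move=> s y z yB zB; apply: (le_trans ((hM1 s).2 y z yB zB)).
  rewrite ler_wpM2r ?sumr_ge0// (bigD1 s)//= lerDl.
  by apply: sumr_ge0 => s' _; exact: (hM1 s').1.
exists (N%:R * (N%:R * M) + N%:R * (M' * (N%:R * 2) * N%:R)).
  by rewrite addr_ge0// !mulr_ge0.
move=> x y z v xB; split=> [yB zB|]; last first.
  apply: (@le_trans _ _ (N%:R * (N%:R * M * `|y|) * `|v|)).
    apply: mulmx_row_le => [|i j]; first by rewrite !mulr_ge0.
    rewrite mxE; apply: (le_trans (ler_norm_sum _ _ _)).
    apply: (@le_trans _ _ (\sum_s `|y 0 s| * M)).
      by apply: ler_sum => s _; rewrite normrM ler_wpM2l// hM.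
    rewrite -mulr_suml (mulrAC _ M) ler_wpM2r//; exact: row_sum_le.
  have -> : N%:R * (N%:R * M * `|y|) * `|v| = N%:R * (N%:R * M) * `|v| * `|y| by ring.
  rewrite ler_wpM2r// ler_wpM2r// lerDl !mulr_ge0//.
set d := `|y - x| + `|z - x|.
have d0 : 0 <= d by rewrite addr_ge0.
rewrite -!mulmxBr.
apply: (@le_trans _ _ (N%:R * (M' * (N%:R * (2 * d)) * (N%:R * `|y - z|)) * `|v|)).
  apply: mulmx_row_le => [|i j]; first by rewrite !mulr_ge0.
  have e3 (A1 A2 A3 : 'M[R]_N) : (A1 - A2 - A3) i j = A1 i j - A2 i j - A3 i j.
    by rewrite !mxE.
  rewrite e3 [dproj _ _ _ _]mxE.
  have [xi [hxi hxi' ->]] := hadamard z y (smooth_C1 (proj_smooth i j)).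
  rewrite -sumrB.
  apply: (le_trans (ler_norm_sum _ _ _)).
  apply: (@le_trans _ _ (\sum_s (M' * (N%:R * (2 * d)) * `|(y - z) 0 s|))); last first.
    rewrite -mulr_sumr ler_wpM2l ?mulr_ge0//; exact: row_sum_le.
  apply: ler_sum => s _; have h1 := hxi s; have h2 := hxi' s.
  have xiB : `|xi s| <= B by apply: (le_trans h2); rewrite ge_max zB yB.
  rewrite [X in _ * X - _](_ : _ = (y - z) 0 s); last by rewrite !mxE.
  rewrite mulrC -mulrBr normrM mulrC ler_wpM2r//.
  apply: (le_trans (hM' i j s _ _ xiB xB)); rewrite ler_wpM2l//.
  apply: (@le_trans _ _ (\sum_mu `|(xi s - x) 0 mu|)).
    by apply: ler_sum => mu _; rewrite !mxE.
  apply: (le_trans (row_sum_le _)); rewrite ler_wpM2l//.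
  have h3 : `|xi s - x| <= `|xi s - z| + `|z - x|.
    by rewrite -(subrK z (xi s)) -addrA subrK; exact: ler_normD.
  have h4 : `|y - z| <= `|y - x| + `|z - x|.
    by rewrite (distrC z) -{1}(subrK x y) -addrA; exact: ler_normD.
  have h5 : 0 <= `|y - x| by [].
  by rewrite /d; lra.
have -> : N%:R * (M' * (N%:R * (2 * d)) * (N%:R * `|y - z|)) * `|v| =
   N%:R * (M' * (N%:R * 2) * N%:R) * `|v| * d * `|y - z| by ring.
do 3!(rewrite ler_wpM2r//); rewrite lerDr !mulr_ge0//.
Qed.

End Projection.

Section ClampTime.
Context {R : realType}.
Variables (a b : R).
Definition clamp_time (t : R) : R := Num.max a (Num.min b t).

Lemma clamp_time_in t : a <= b -> a <= clamp_time t <= b.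
Proof. by move=> ab; rewrite /clamp_time le_max lexx/= ge_max ge_min lexx/= ab. Qed.

Lemma clamp_time_id t : a <= t <= b -> clamp_time t = t.
Proof.
by move=> /andP[h1 h2]; rewrite /clamp_time (min_idPr h2) (max_idPr h1).
Qed.

Lemma continuous_clamp_time (T : topologicalType) (f : R -> T) : a <= b ->
  (forall t, a <= t <= b -> {for t, continuous f}) -> continuous (f \o clamp_time).
Proof.
move=> ab cf t; apply: continuous_comp; last exact/cf/clamp_time_in.
apply: (@continuous_max _ _ (cst a) (fun t => Num.min b t) t); first exact: cvg_cst.
by apply: (@continuous_min _ _ (cst b) id t); [exact: cvg_cst|exact: cvg_id].
Qed.

End ClampTime.

Section Control.
Context {R : realType} {N p : nat}.
Variable lam : 'rV[R]_N -> 'M[R]_(p, N).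
Hypothesis lam_smooth : smooth_forms lam.
Hypothesis lam_free : forall y, row_free (lam y).
Local Notation proj := (proj lam).
Implicit Types (u v : R -> 'rV[R]_N) (a b c : R).

Definition proj_const (B C : R) : Prop := 1 <= C /\
  forall y z (v : 'rV[R]_N), `|y| <= B -> `|z| <= B ->
    `|v *m proj y| <= C * `|v| /\ `|v *m proj y - v *m proj z| <= C * `|v| * `|y - z|.

Lemma proj_constP B : exists C, proj_const B C.
Proof. by have [C C1 h] := proj_lip lam_smooth lam_free B; exists C. Qed.

(** [v] is a control: every solution is horizontal because [proj] kills the forms, and a horizontal
    curve is a solution with control its own derivative ([sol_horiz], [horiz_sol]). *)
Definition sol a b v u : Prop :=
  forall t, a <= t <= b -> is_derive t 1 u (v t *m proj (u t)).

Lemma mulmx_continuous m (f : R -> 'rV[R]_m) (X : 'M[R]_(m, N)) (t : R) :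
  {for t, continuous f} -> {for t, continuous (fun t => f t *m X)}.
Proof.
move=> cf; apply/cvgrPdist_le => e e0.
pose M := \sum_ij `|X ij.1 ij.2|.
have M0 : 0 <= M by apply: sumr_ge0.
have hX i j : `|X i j| <= M by rewrite /M (bigD1 (i, j))//= lerDl sumr_ge0.
have c0 : 0 < m%:R * M + 1 by rewrite ltr_wpDl// mulr_ge0.
near=> s; rewrite -mulmxBl; apply: (le_trans (mulmx_row_le _ M0 hX)).
apply: (@le_trans _ _ (m%:R * M * (e / (m%:R * M + 1)))).
  rewrite ler_wpM2l ?mulr_ge0//; near: s.
  by apply: (cvgr_dist_le _ _ cf); rewrite divr_gt0.
by rewrite mulrCA ger_pMr// ler_pdivrMr// mul1r lerDl.
Unshelve. all: by end_near. Qed.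

Lemma entry_le_norm m n (X : 'M[R]_(m, n)) i j : `|X i j| <= `|X|.
Proof.
have := @mx_normrE R m n X; rewrite -[X in X = _]/(`|X|) => ->.
by apply: (le_bigmax_cond _ (fun ij : 'I_m * 'I_n => `|X ij.1 ij.2|) (j := (i, j))).
Qed.

Lemma mulmx_continuous_r m (y : 'rV[R]_m) (H : R -> 'M[R]_(m, N)) (t : R) :
  {for t, continuous H} -> {for t, continuous (fun t => y *m H t)}.
Proof.
move=> cH; apply/cvgrPdist_le => e e0.
have c0 : 0 < m%:R * `|y| + 1 by rewrite ltr_wpDl// mulr_ge0.
near=> s; rewrite -mulmxBr.
apply: (le_trans (mulmx_row_le _ (normr_ge0 (H t - H s)) (@entry_le_norm _ _ _))).
apply: (@le_trans _ _ (m%:R * `|y| * (e / (m%:R * `|y| + 1)))).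
  rewrite mulrAC ler_wpM2l ?mulr_ge0//; near: s.
  by apply: (cvgr_dist_le _ _ cH); rewrite divr_gt0.
by rewrite mulrCA ger_pMr// ler_pdivrMr// mul1r lerDl.
Unshelve. all: by end_near. Qed.

Lemma sol_exists B C a b c v V y0 : 0 <= B -> proj_const (B + 1) C ->
  a < b -> a <= c <= b -> 0 <= V ->
  (forall t, a <= t <= b -> {for t, continuous v}) ->
  (forall t, a <= t <= b -> `|v t| <= V) ->
  `|y0| <= B -> C * V * (b - a) <= 2^-1 ->
  exists u, [/\ u c = y0, sol a b v u
    & forall t, a <= t <= b -> `|u t - y0| <= C * V * (b - a)].
Proof.
move=> B0 [C1 hC] ab cab V0 cv vV y0B CV.
have B1 : 0 <= B + 1 by lra.
have ab' : a <= b by exact: ltW.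
pose w := v \o clamp_time a b.
have cw : continuous w by exact: continuous_clamp_time.
have wV t : `|w t| <= V by apply: vV; exact: clamp_time_in.
have C0 : 0 <= C by lra.
pose Y t y := w t *m proj (clamp_row (B + 1) y).
have [|||y|t y z|u [uc du]] := @picard R N Y c (b - a) (C * V) y0.
- by rewrite subr_gt0.
- exact: mulr_ge0.
- exact: CV.
- by move=> t; exact: (@mulmx_continuous _ w _ t (cw t)).
- apply: (le_trans (hC _ _ _ (clamp_row_le _ B1) (clamp_row_le _ B1)).2).
  apply: ler_pM => //; first by rewrite mulr_ge0.
    by rewrite ler_wpM2l.
  exact: clamp_row_lip.
have sub t : a <= t <= b -> c - (b - a) <= t <= c + (b - a).
  by move=> /andP[? ?]; case/andP: cab => ? ?; apply/andP; split; lra.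
have CV0 : 0 <= C * V by rewrite mulr_ge0.
have hY t : a < t < b -> `|Y t (u t)| <= C * V.
  move=> _; apply: (le_trans (hC _ 0 _ (clamp_row_le _ B1) _).1); last by rewrite ler_wpM2l.
  by rewrite normr0.
have hu t : a <= t <= b -> `|u t - y0| <= C * V * (b - a).
  move=> tab; rewrite -uc.
  apply: (le_trans (mvt_row CV0 (fun s h => du s (sub s h)) hY tab cab)).
  rewrite ler_wpM2l ?mulr_ge0// ler_norml.
  by case/andP: tab => ? ?; case/andP: cab => ? ?; apply/andP; split; lra.
exists u; split => // t tab.
(* The curve moves by at most 1/2 from [y0], hence never reaches the region where the truncated
   field differs from the true one. *)
have e1 : clamp_row (B + 1) (u t) = u t.
  apply: clamp_row_id; rewrite -(subrK y0 (u t)).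
  apply: (le_trans (ler_normD _ _)); rewrite addrC; apply: lerD => //.
  apply: (le_trans (hu t tab)); lra.
have := du t (sub t tab).
by rewrite /Y e1 /w /= clamp_time_id.
Qed.

(** The difference of the fields is split at [v1 *m proj (u2 t)]: the Lipschitz constant involves
    only [v1], and the difference of the controls acts as a source term. *)
Lemma sol_dependence B C a b c v1 v2 V e u1 u2 : proj_const B C ->
  a <= c <= b -> 0 <= V -> 0 <= e -> C * V * (b - a) <= 2^-1 ->
  (forall t, a < t < b -> `|v1 t| <= V) ->
  (forall t, a < t < b -> `|v1 t - v2 t| <= e) ->
  sol a b v1 u1 -> sol a b v2 u2 ->
  (forall t, a <= t <= b -> `|u1 t| <= B) ->
  (forall t, a <= t <= b -> `|u2 t| <= B) ->
  forall t, a <= t <= b -> `|u1 t - u2 t| <= 2 * (`|u1 c - u2 c| + (b - a) * (C * e)).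
Proof.
move=> [C1 hC] cab V0 e0 CV v1V v12 s1 s2 u1B u2B.
apply: (ode_dependence (L := C * V) _ _ _ _ s1 s2) => //.
- by rewrite mulr_ge0//; lra.
- by rewrite mulr_ge0//; lra.
move=> t tab; have tab' : a <= t <= b by case/andP: tab => ? ?; rewrite !ltW.
have -> : v1 t *m proj (u1 t) - v2 t *m proj (u2 t) =
  (v1 t *m proj (u1 t) - v1 t *m proj (u2 t)) + (v1 t - v2 t) *m proj (u2 t).
  by rewrite mulmxBl addrA subrK.
apply: (le_trans (ler_normD _ _)); apply: lerD.
  apply: (le_trans (hC _ _ _ (u1B t tab') (u2B t tab')).2).
  by rewrite ler_wpM2r// ler_wpM2l ?v1V//; lra.
apply: (le_trans (hC _ _ _ (u2B t tab') (u2B t tab')).1).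
by rewrite ler_wpM2l ?v12//; lra.
Qed.

Lemma linear_ode_exists (H : R -> 'M[R]_N) a b c (L : R) (w0 : 'rV[R]_N) :
  a < b -> a <= c <= b -> 0 <= L -> L * (b - a) <= 2^-1 ->
  (forall t, a <= t <= b -> {for t, continuous H}) ->
  (forall t (w : 'rV[R]_N), a <= t <= b -> `|w *m H t| <= L * `|w|) ->
  exists W : R -> 'rV[R]_N, W c = w0 /\
    forall t, a <= t <= b -> is_derive t 1 W (W t *m H t).
Proof.
move=> ab cab L0 Lab cH hH.
have cH' := continuous_clamp_time (ltW ab) cH.
pose Y (t : R) (y : 'rV[R]_N) := y *m H (clamp_time a b t).
have [||||t y z|u [uc du]] := @picard R N Y c (b - a) L w0.
- by rewrite subr_gt0.
- exact: L0.
- exact: Lab.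
- by move=> y t; exact: (@mulmx_continuous_r _ y _ t (cH' t)).
- by rewrite /Y -mulmxBl; apply: hH; apply: clamp_time_in; exact: ltW.
exists u; split => // t tab.
have := du t; rewrite /Y clamp_time_id//; apply.
by case/andP: tab => ? ?; case/andP: cab => ? ?; apply/andP; split; lra.
Qed.

End Control.

(** * A smooth step function *)

Section SmoothStep.
Context {R : realType}.
Implicit Types (q : {poly R}) (x : R).

(** Allowing every polynomial [q] in front of the exponential makes the class stable under
    differentiation, with [q] replaced by [flat_next q]. *)
Definition flat q x : R := if 0 < x then q.[x^-1] * expR (- x^-1) else 0.

Lemma pow_expRN_le k (y : R) : 0 < y -> y ^+ k.+1 * expR (- y) <= (k.+1)`!%:R.
Proof.
move=> y0; rewrite expRN ler_pdivrMr ?expR_gt0// mulrC -ler_pdivrMr ?ltr0n ?fact_gt0//.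
by apply: le_trans (expR_ge1Dxn k (ltW y0)); rewrite lerDr.
Qed.

Lemma horner_expRN_le q : exists2 M, 0 <= M &
  forall y, 0 < y -> `|q.[y] * expR (- y)| * y ^+ 2 <= M.
Proof.
exists (\sum_(i < size q) `|q`_i| * (i.+2)`!%:R).
  by apply: sumr_ge0 => i _; rewrite mulr_ge0.
move=> y y0; rewrite normrM (ger0_norm (expR_ge0 _)) horner_coef.
apply: (@le_trans _ _ ((\sum_(i < size q) `|q`_i| * y ^+ i) * expR (- y) * y ^+ 2)).
  apply: ler_wpM2r; first by rewrite exprn_ge0// ltW.
  apply: ler_wpM2r; first exact: expR_ge0.
  apply: (le_trans (ler_norm_sum _ _ _)); apply: ler_sum => i _.
  by rewrite normrM (@ger0_norm _ (y ^+ i)) ?exprn_ge0// ltW.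
rewrite -mulrA mulr_suml; apply: ler_sum => i _.
rewrite -mulrA ler_wpM2l//.
have -> : y ^+ i * (expR (- y) * y ^+ 2) = y ^+ i.+2 * expR (- y).
  by rewrite mulrCA mulrC -exprD addn2.
exact: pow_expRN_le.
Qed.

Definition flat_next q : {poly R} := 'X^2 * (q - q^`()).

Lemma is_derive_flat q x : is_derive x 1 (flat q) (flat (flat_next q) x).
Proof.
have [x0|x0|<-] := ltgtP 0 x.
- have e1 : \forall y \near x, q.[y^-1] * expR (- y^-1) = flat q y.
    by near=> y; rewrite /flat (_ : 0 < y)//; near: y; exact: lt_nbhsr.
  have xn : x != 0 by rewrite gt_eqF.
  have d1 : is_derive x 1 (fun y : R => y^-1) (- x ^- 2 *: 1) := is_deriveV xn (is_derive_id x 1).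
  have d2 := is_derive1_comp (is_derive_poly q x^-1) d1.
  have d1N : is_derive x 1 (fun y : R => - y^-1) (- (- x ^- 2 *: 1)) := is_deriveN d1.
  have d3 := @is_derive1_comp R expR _ x _ _ (is_derive_expR (- x^-1)) d1N.
  apply: (near_eq_is_derive e1); apply: (is_derive_eq (is_deriveM d2 d3)).
  rewrite /flat x0 /flat_next hornerM hornerXn hornerD hornerN /GRing.scale/=.
  by rewrite exprVn; ring.
- have e1 : \forall y \near x, cst 0 y = flat q y.
    near=> y; rewrite /flat ltNge ltW//; near: y; exact: lt_nbhsl.
  rewrite [flat (flat_next q) x]/flat ltNge (ltW x0) /=.
  by apply: (near_eq_is_derive e1); exact: is_derive_cst.
(* At 0 the difference quotient is again a flat function, with [q] multiplied by the variable; it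
   tends to 0 since the exponential beats any polynomial. *)
- apply/is_derive1_caratheodory; exists (flat ('X * q)); split.
  + move=> z; rewrite /flat ltxx !subr0; case: ifP => [z0|]; last by rewrite mul0r.
    by rewrite hornerM hornerX [RHS]mulrC !mulrA divff ?gt_eqF// mul1r.
  + have [M M0 hM] := horner_expRN_le ('X * q).
    apply/cvgrPdist_le => e e0; rewrite [flat _ 0]/flat ltxx.
    have eM : 0 < Num.min 1 (e / (M + 1)) by rewrite lt_min ltr01 divr_gt0// ltr_wpDl.
    near=> z; rewrite sub0r normrN /flat; case: ifPn => [z0|]; last by rewrite normr0 ltW.
    have zV : 0 < z^-1 by rewrite invr_gt0.
    have := hM _ zV; rewrite exprVn ler_pdivrMr ?exprn_gt0// => /le_trans; apply.
    have : `|0 - z| < Num.min 1 (e / (M + 1)) by near: z; exact: (cvgr_dist_lt _ _ cvg_id).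
    rewrite sub0r normrN gtr0_norm// lt_min => /andP[z1 z2].
    rewrite ltr_pdivlMr ?ltr_wpDl// in z2.
    rewrite expr2 mulrA; apply: (@le_trans _ _ (M * z)).
      by apply: ler_piMr; [rewrite mulr_ge0// ltW|exact: ltW].
    apply: (le_trans _ (ltW z2)); rewrite mulrC ler_pM2l// lerDl ler01//.
  + by rewrite /flat ltxx.
Unshelve. all: by end_near. Qed.

Lemma flatZ (c : R) q x : flat (c *: q) x = c * flat q x.
Proof. by rewrite /flat; case: ifP => _; rewrite ?mulr0// hornerZ mulrA. Qed.

Lemma flat_affine_smooth (al be : R) q :
  smooth_fun (fun y : 'rV[R]_1 => flat q (al + be * y 0 0)).
Proof.
pose g q' (s : R) := flat q' (al + be * s).
have dg q' (s : R) : is_derive s 1 (g q') (g (be *: flat_next q') s).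
  rewrite /g flatZ mulrC.
  have d1 : is_derive s 1 (fun s : R => al + be * s) be.
    have := is_deriveD (is_derive_cst al s (1 : R)) (is_deriveZ be (is_derive_id s (1:R))).
    by move=> /is_derive_eq; apply; rewrite add0r /GRing.scale/= mulr1.
  exact: (is_derive1_comp (is_derive_flat q' _) d1).
have h q' (y : 'rV[R]_1) mu : is_derive y (delta_mx 0 mu)
    (fun y : 'rV[R]_1 => g q' (y 0 0)) (g (be *: flat_next q') (y 0 0)).
  rewrite (ord1 mu).
  have E : (fun h : R => h^-1 *: (((fun y : 'rV[R]_1 => g q' (y 0 0)) \o shift y) (h *: delta_mx 0 0) - g q' (y 0 0)))
    = (fun h : R => h^-1 *: ((g q' \o shift (y 0 0)) (h *: 1) - g q' (y 0 0))).
    by apply/funext => h /=; rewrite !mxE eqxx /GRing.scale/= !mulr1.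
  have [d1 d2] := dg q' (y 0 0).
  by apply: DeriveDef; [rewrite /derivable E|rewrite /derive E].
have hs s : exists q', foldr (@partial R 1) (fun y : 'rV[R]_1 => g q (y 0 0)) s =
    (fun y => g q' (y 0 0)).
  elim: s => [|mu s [q' ih]]; first by exists q.
  exists (be *: flat_next q') => /=; rewrite ih; apply/funext => y.
  by case: (h q' y mu).
move=> s; have [q' ->] := hs s; split => [y|mu y]; last by case: (h q' y mu).
apply: (@continuous_comp _ _ _ (fun y : 'rV[R]_1 => y 0 0) (g q')).
  exact: coord_continuous.
apply: differentiable_continuous; apply/derivable1_diffP.
by case: (dg q' (y 0 0)).
Qed.

Lemma flat_coord_smooth q : smooth_fun (fun y : 'rV[R]_1 => flat q (y 0 0)).
Proof.
by apply: smooth_fun_ext (flat_affine_smooth 0 1 q) => y; rewrite add0r mul1r.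
Qed.

Definition step (y : 'rV[R]_1) : R :=
  flat 1 (y 0 0) / (flat 1 (y 0 0) + flat 1 (1 - y 0 0)).

Lemma flat_ge0 x : 0 <= flat 1 x.
Proof. by rewrite /flat; case: ifP => // _; rewrite hornerC mul1r expR_ge0. Qed.

Lemma flat_gt0 x : 0 < x -> 0 < flat 1 x.
Proof. by move=> x0; rewrite /flat x0 hornerC mul1r expR_gt0. Qed.

Lemma step0 (y : 'rV[R]_1) : y 0 0 <= 0 -> step y = 0.
Proof. by move=> y0; rewrite /step /flat ltNge y0 mul0r. Qed.

Lemma step1 (y : 'rV[R]_1) : 1 <= y 0 0 -> step y = 1.
Proof.
move=> y1; rewrite /step [flat 1 (1 - _)]/flat subr_gt0 ltNge y1 addr0 divff// gt_eqF//.
by apply: flat_gt0; lra.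
Qed.

Lemma step_smooth : smooth_fun step.
Proof.
apply: smooth_funM; first exact: flat_coord_smooth.
apply: smooth_funV => [y|].
  rewrite gt_eqF//; have [y0|y0] := ltP 0 (y 0 0).
    by rewrite ltr_wpDr ?flat_ge0// flat_gt0.
  by rewrite ltr_wpDl ?flat_ge0// flat_gt0//; lra.
apply: smooth_funA; first exact: flat_coord_smooth.
by apply: smooth_fun_ext (flat_affine_smooth 1 (-1) 1) => y; rewrite mulN1r.
Qed.

End SmoothStep.

(** * Smoothness and equality of jets inside the calculus *)

Section SmoothAsAsymptotic.
Context {R : realType}.
Definition unit_filter : set_system unit := globally [set: unit].
Global Instance unit_filter_filter : Filter unit_filter := globally_filter _.

Lemma near_unit (Q : unit -> Prop) : (\forall i \near unit_filter, Q i) <-> Q tt.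
Proof. by split=> [|h]; [exact|case]. Qed.

(** One index and weight 1. With [D] empty all estimates are void and only differentiability on [U]
    remains; with [D] a point, negligible means zero, so the jets agree there. *)
Definition jcv (U D : set R) := @cvb R unit unit_filter (fun=> U) (fun=> D) (fun=> 1).

Lemma smooth_jcv (U D : set R) (f g : R -> R) k : open U -> D `<=` U ->
  smooth_on (V := R^o) U f -> smooth_on (V := R^o) U g ->
  (forall j, (j <= k)%N -> exists B, forall x, D x -> `|derive1n j g x| <= B) ->
  (forall j x, (j <= k)%N -> D x -> derive1n j f x = derive1n j g x) ->
  jcv U D k (fun=> f) (fun=> g).
Proof.
move=> oU DU sf sg hB he; apply/cvbP => j jk; split.
- by apply/near_unit => x Ux; exact: sf.
- by apply/near_unit => x Ux; exact: sg.
- have [B hB'] := hB j jk; exists B, 0%N; apply/near_unit => x Dx.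
  by rewrite expr0 mulr1; exact: hB'.
- move=> m e e0; apply/near_unit => x Dx.
  by rewrite he// subrr normr0 mul0r ltW.
Qed.

Lemma smooth_jcv0 (U : set R) (f : R -> R) k : open U ->
  smooth_on (V := R^o) U f -> jcv U set0 k (fun=> f) (fun=> f).
Proof. by move=> oU sf; apply: smooth_jcv => // j _; exists 0. Qed.

Lemma jcv_smooth (U D : set R) (f g : unit -> R -> R) :
  (forall k, jcv U D k f g) -> smooth_on (V := R^o) U (f tt).
Proof.
move=> h k x Ux; have /cvbP/(_ k (leqnn k)) [/near_unit d _ _ _] := h k.
exact: d.
Qed.

Lemma jcv_eq (U D : set R) k (f g : unit -> R -> R) : jcv U D k f g ->
  forall j x, (j <= k)%N -> D x -> derive1n j (f tt) x = derive1n j (g tt) x.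
Proof.
move=> h j x jk Dx; have /cvbP/(_ j jk) [_ _ _ hm] := h.
apply/eqP; rewrite -subr_eq0 -normr_le0; apply/ler_addgt0Pl => e e0.
have /near_unit/(_ x Dx) := hm 0%N e e0.
by rewrite expr0 mulr1 addr0.
Qed.

End SmoothAsAsymptotic.

Section Families.
Context {R : realType} {N p : nat}.
Variable lam : 'rV[R]_N -> 'M[R]_(p, N).
Hypothesis lam_smooth : smooth_forms lam.
Hypothesis lam_free : forall y, row_free (lam y).
Local Notation proj := (proj lam).
Context {I : Type} (G : set_system I) {FG : Filter G}.
Variables (O D : I -> set R) (w : I -> R).
Hypothesis oO : forall i, open (O i).
Hypothesis DO : forall i, D i `<=` O i.
Hypothesis w1 : forall i, 1 <= w i.
Local Notation cvb := (cvb G O D w).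
Local Notation cv0 := (cv0 G O D w).
Implicit Types u v F V : I -> R -> 'rV[R]_N.

Definition vcvb k u v : Prop :=
  forall mu, cvb k (fun i x => u i x 0 mu) (fun i x => v i x 0 mu).

Lemma vcvb_mulproj k F F' V V' (B : R) :
  (\forall i \near G, forall x, D i x -> `|F' i x| <= B) ->
  vcvb k F F' -> vcvb k V V' ->
  vcvb k (fun i x => V i x *m proj (F i x)) (fun i x => V' i x *m proj (F' i x)).
Proof.
move=> hB hF hV mu.
have h : cvb k (fun i x => \sum_nu V i x 0 nu * proj (F i x) nu mu)
    (fun i x => \sum_nu V' i x 0 nu * proj (F' i x) nu mu).
  apply: (cvb_sum oO DO w1) => nu _; apply: cvbM => //.
  exact: (cvb_comp oO DO w1 (proj_smooth lam_smooth lam_free nu mu) hF hB).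
by apply: (cvb_congr oO DO) h => i x _; rewrite mxE.
Qed.

Lemma vcvb_ode k F F' Y Y' :
  (\forall i \near G, forall x, O i x -> is_derive x 1 (F i) (Y i x)) ->
  (\forall i \near G, forall x, O i x -> is_derive x 1 (F' i) (Y' i x)) ->
  vcvb 0 F F' -> vcvb k Y Y' -> vcvb k.+1 F F'.
Proof.
move=> dF dF' h0 hY mu; split; first exact: h0.
apply: (cvb_ext oO DO _ _ (hY mu)).
  apply: filterS dF => i d x Ox; have d' := d x Ox.
  by rewrite -(is_derive_derive1 d') derive1_row//; case: d'.
apply: filterS dF' => i d x Ox; have d' := d x Ox.
by rewrite -(is_derive_derive1 d') derive1_row//; case: d'.
Qed.

Lemma vcvb0 F F' (B : R) :
  (\forall i \near G, forall x, O i x -> derivable (F i) x 1) ->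
  (\forall i \near G, forall x, O i x -> derivable (F' i) x 1) ->
  (\forall i \near G, forall x, D i x -> `|F' i x| <= B) ->
  (forall m e, 0 < e -> \forall i \near G, forall x, D i x ->
    `|F i x - F' i x| * w i ^+ m <= e) -> vcvb 0 F F'.
Proof.
move=> dF dF' hB hm mu; split.
- by apply: filterS dF => i d x Ox; have /derivable_mxP/(_ 0 mu) := d x Ox.
- by apply: filterS dF' => i d x Ox; have /derivable_mxP/(_ 0 mu) := d x Ox.
- exists B, 0%N; apply: filterS hB => i h x Dx; rewrite expr0 mulr1.
  exact: le_trans (coord_le_norm _ _) (h x Dx).
- move=> m e e0; apply: filterS (hm m e e0) => i h x Dx.
  apply: le_trans (h x Dx); rewrite ler_wpM2r ?exprn_ge0 ?(le_trans ler01)//.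
  by have := coord_le_norm (F i x - F' i x) mu; rewrite !mxE.
Qed.

(** Bootstrap: closeness of the solutions and of the controls to order [j] gives closeness of the
    right-hand sides to order [j], hence of the solutions to order [j + 1]. Only order zero has to
    be estimated by hand. *)
Lemma sol_cvb k F F' V V' (B : R) :
  (\forall i \near G, forall x, O i x ->
     is_derive x 1 (F i) (V i x *m proj (F i x))) ->
  (\forall i \near G, forall x, O i x ->
     is_derive x 1 (F' i) (V' i x *m proj (F' i x))) ->
  (\forall i \near G, forall x, D i x -> `|F' i x| <= B) ->
  (forall m e, 0 < e -> \forall i \near G, forall x, D i x ->
    `|F i x - F' i x| * w i ^+ m <= e) ->
  vcvb k V V' -> vcvb k.+1 F F'.
Proof.
move=> dF dF' hB hm.
have h0 : vcvb 0 F F'.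
  apply: (vcvb0 _ _ hB hm).
    by apply: filterS dF => i d x Ox; case: (d x Ox).
  by apply: filterS dF' => i d x Ox; case: (d x Ox).
elim: k => [|k ih] hV; apply: (vcvb_ode dF dF' h0).
  exact: vcvb_mulproj hB h0 hV.
exact: (vcvb_mulproj hB (ih (fun mu => cvbW (hV mu))) hV).
Qed.

Lemma vcvb_derive1 k u v :
  (\forall i \near G, smooth_on (O i) (u i)) -> (\forall i \near G, smooth_on (O i) (v i)) ->
  vcvb k.+1 u v -> vcvb k (fun i => derive1 (u i)) (fun i => derive1 (v i)).
Proof.
move=> su sv h mu; have [_ h1] := h mu.
apply: (cvb_ext oO DO _ _ h1).
  by apply: filterS su => i s x Ox; rewrite derive1_row//; exact: (s 0%N).
by apply: filterS sv => i s x Ox; rewrite derive1_row//; exact: (s 0%N).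
Qed.

Lemma Rmx_cvb k u v (B : R) s mu :
  (\forall i \near G, smooth_on (O i) (u i)) -> (\forall i \near G, smooth_on (O i) (v i)) ->
  (\forall i \near G, forall x, D i x -> `|v i x| <= B) -> vcvb k.+1 u v ->
  cvb k (fun i x => Rmx lam (u i) x s mu) (fun i x => Rmx lam (v i) x s mu).
Proof.
move=> su sv hB h.
have h1 := vcvb_derive1 su sv h.
have h0 : vcvb k u v by move=> nu; exact: (cvbW (h nu)).
pose f (u : I -> R -> 'rV[R]_N) i x := \sum_nu \sum_ta
  partial nu (fun z => lam z s ta) (u i x) *
   (derive1 (u i) x 0 nu * (delta_mx 0 mu : 'rV[R]_N) 0 ta - derive1 (u i) x 0 ta * (delta_mx 0 mu : 'rV[R]_N) 0 nu).
have hf : cvb k (f u) (f v).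
  apply: (cvb_sum oO DO w1) => nu _; apply: (cvb_sum oO DO w1) => ta _.
  apply: cvbM => //.
    exact: (cvb_comp oO DO w1 (smooth_funD nu (lam_smooth s ta)) h0 hB).
  apply: (cvbB oO DO w1); apply: cvbM => //; exact: cvb_cst.
by apply: (cvb_congr oO DO) hf => i x _; rewrite !mxE.
Qed.

Lemma Lmx_cvb k u v (B : R) s mu :
  (\forall i \near G, forall x, D i x -> `|v i x| <= B) -> vcvb k u v ->
  cvb k (fun i x => Lmx lam (u i) x s mu) (fun i x => Lmx lam (v i) x s mu).
Proof. by move=> hB h; exact: (cvb_comp oO DO w1 (lam_smooth s mu) h hB). Qed.

End Families.

Section SmoothRL.
Context {R : realType} {N p : nat}.
Variable lam : 'rV[R]_N -> 'M[R]_(p, N).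
Hypothesis lam_smooth : smooth_forms lam.
Implicit Types (u : R -> 'rV[R]_N).

Lemma smooth_vjcv (U : set R) u k : open U -> smooth_on U u ->
  vcvb unit_filter (fun=> U) (fun=> set0) (fun=> 1) k (fun=> u) (fun=> u).
Proof.
move=> oU su mu; apply: smooth_jcv0 => //.
by have /smooth_entryP := su; apply.
Qed.

Lemma smooth_Rmx (U : set R) u : open U -> smooth_on U u -> smooth_on U (Rmx lam u).
Proof.
move=> oU su; apply/smooth_entryP => // s mu.
apply: (@jcv_smooth _ U set0 (fun _ x => Rmx lam u x s mu) (fun _ x => Rmx lam u x s mu)) => k.
have su' : \forall i \near unit_filter, smooth_on U u by apply/near_unit.
apply: (Rmx_cvb lam_smooth (fun=> oU) (fun=> @sub0set _ _) (fun=> lexx 1) s mu su' su'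
  _ (smooth_vjcv _ oU su) (B := 0)).
by apply/near_unit.
Qed.

Lemma smooth_Lmx (U : set R) u : open U -> smooth_on U u -> smooth_on U (Lmx lam u).
Proof.
move=> oU su; apply/smooth_entryP => // s mu.
apply: (@jcv_smooth _ U set0 (fun _ x => Lmx lam u x s mu) (fun _ x => Lmx lam u x s mu)) => k.
apply: (Lmx_cvb lam_smooth (fun=> oU) (fun=> @sub0set _ _) (fun=> lexx 1) s mu
  _ (smooth_vjcv _ oU su) (B := 0)).
by apply/near_unit.
Qed.

End SmoothRL.

(** * The regular jets as the nonvanishing set of one function *)

Section Regularity.
Context {R : realType} {N p : nat}.
Variable lam : 'rV[R]_N -> 'M[R]_(p, N).
Hypothesis lam_smooth : smooth_forms lam.
Variable q : nat.

Definition detA (u : R -> 'rV[R]_N) x : R :=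
  \det (Amx lam q u x *m (Amx lam q u x)^T).

(** One scalar carries both conditions on a regular jet, immersion and full rank of [A]
    ([reg_neq0]). *)
Definition reg (u : R -> 'rV[R]_N) x : R :=
  (\sum_mu derive1 u x 0 mu * derive1 u x 0 mu) * detA u x.

Section Fam.
Context {I : Type} (G : set_system I) {FG : Filter G}.
Variables (O D : I -> set R) (w : I -> R).
Hypothesis oO : forall i, open (O i).
Hypothesis DO : forall i, D i `<=` O i.
Hypothesis w1 : forall i, 1 <= w i.
Variables (u v : I -> R -> 'rV[R]_N) (B : R).
Hypothesis su : \forall i \near G, smooth_on (O i) (u i).
Hypothesis sv : \forall i \near G, smooth_on (O i) (v i).
Hypothesis vB : \forall i \near G, forall x, D i x -> `|v i x| <= B.
Local Notation cvb := (cvb G O D w).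
Local Notation vcvb := (vcvb G O D w).

(** [A] contains up to [q] derivatives of [Rmx], which itself contains the derivative of the curve;
    hence the loss of [q.+1] orders. *)
Lemma Amx_cvb k a b : vcvb (k + q).+1 u v ->
  cvb k (fun i x => Amx lam q (u i) x a b) (fun i x => Amx lam q (v i) x a b).
Proof.
move=> h.
pose s1 := tagnat.sig1 a; pose s2 := tagnat.sig2 a.
pose t1 := tagnat.sig1 b; pose t2 := tagnat.sig2 b.
pose f (u : I -> R -> 'rV[R]_N) i x :=
  'C(t1, s1)%:R * derive1n (t1 - s1) (fun x => Rmx lam (u i) x s2 t2) x +
  (if (0 < s1)%N then
    'C(t1, s1.-1)%:R * derive1n (t1 - s1.-1) (fun x => Lmx lam (u i) x s2 t2) x else 0).
have fA (u' : I -> R -> 'rV[R]_N) : (\forall i \near G, smooth_on (O i) (u' i)) ->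
    eq_fam G O (f u') (fun i x => Amx lam q (u' i) x a b).
  apply: filterS => i si x Ox; rewrite /Amx /mxblock mxE -/s1 -/s2 -/t1 -/t2 /f.
  rewrite [RHS]mxE [X in _ = X + _]mxE.
  rewrite (derive1n_entryE _ _ _ (@oO i) (smooth_Rmx lam_smooth (@oO i) si) Ox).
  case: ifP => _; last by rewrite mxE.
  by rewrite mxE (derive1n_entryE _ _ _ (@oO i) (smooth_Lmx lam_smooth (@oO i) si) Ox).
apply: (cvb_ext oO DO (fA _ su) (fA _ sv)).
have hq (j : 'I_q.+1) d : (j - d + k <= k + q)%N.
  by rewrite addnC leq_add2l (leq_trans (leq_subr _ _))// -ltnS.
apply: (cvbD oO DO w1).
  apply: (cvbM oO DO w1); first exact: cvb_cst.
  apply: cvb_deriven; apply: (cvb_leq (hq t1 s1)).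
  exact: (Rmx_cvb lam_smooth oO DO w1 _ _ su sv vB h).
case: (0 < s1)%N; last exact: cvb_cst.
apply: (cvbM oO DO w1); first exact: cvb_cst.
apply: cvb_deriven; apply: (cvb_leq (hq t1 s1.-1)).
apply: (Lmx_cvb lam_smooth oO DO w1 _ _ vB) => mu.
exact: cvbW (h mu).
Qed.

Lemma det_cvb k n (X Y : I -> R -> 'M[R]_n) :
  (forall a b, cvb k (fun i x => X i x a b) (fun i x => Y i x a b)) ->
  cvb k (fun i x => \det (X i x)) (fun i x => \det (Y i x)).
Proof.
move=> h; rewrite /determinant; apply: (cvb_sum oO DO w1) => s _.
apply: (cvbM oO DO w1); first exact: cvb_cst.
by apply: (cvb_prod oO DO w1) => a.
Qed.

Lemma mulmx_cvb k m n r (X X' : I -> R -> 'M[R]_(m, n)) (Y Y' : I -> R -> 'M[R]_(n, r)) :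
  (forall a b, cvb k (fun i x => X i x a b) (fun i x => X' i x a b)) ->
  (forall a b, cvb k (fun i x => Y i x a b) (fun i x => Y' i x a b)) ->
  forall a b, cvb k (fun i x => (X i x *m Y i x) a b) (fun i x => (X' i x *m Y' i x) a b).
Proof.
move=> hX hY a b.
have h : cvb k (fun i x => \sum_c X i x a c * Y i x c b) (fun i x => \sum_c X' i x a c * Y' i x c b).
  by apply: (cvb_sum oO DO w1) => c _; apply: (cvbM oO DO w1).
by apply: (cvb_congr oO DO) h => i x _; rewrite mxE.
Qed.

Lemma AAT_cvb k a b : vcvb (k + q).+1 u v ->
  cvb k (fun i x => (Amx lam q (u i) x *m (Amx lam q (u i) x)^T) a b)
        (fun i x => (Amx lam q (v i) x *m (Amx lam q (v i) x)^T) a b).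
Proof.
move=> h; apply: mulmx_cvb => {a b} a b; first exact: Amx_cvb.
by apply: (cvb_congr oO DO) (Amx_cvb b a h) => i x _; rewrite [RHS]mxE.
Qed.

Lemma detA_cvb k : vcvb (k + q).+1 u v ->
  cvb k (fun i => detA (u i)) (fun i => detA (v i)).
Proof. by move=> h; apply: det_cvb => a b; exact: AAT_cvb. Qed.

Lemma reg_cvb k : vcvb (k + q).+1 u v -> cvb k (fun i => reg (u i)) (fun i => reg (v i)).
Proof.
move=> h; apply: (cvbM oO DO w1); last exact: detA_cvb.
have h1 : vcvb k (fun i => derive1 (u i)) (fun i => derive1 (v i)).
  apply: (vcvb_derive1 oO DO su sv) => mu.
  by apply: cvb_leq (h mu); rewrite ltnS leq_addr.
by apply: (cvb_sum oO DO w1) => mu _; apply: (cvbM oO DO w1).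
Qed.

End Fam.

Definition smooth_near (u : R -> 'rV[R]_N) x :=
  exists U, [/\ open U, U x & smooth_on U u].

Lemma smooth_near2 u v x : smooth_near u x -> smooth_near v x ->
  exists U, [/\ open U, U x, smooth_on U u & smooth_on U v].
Proof.
move=> [U [oU Ux su]] [V [oV Vx sv]]; exists (U `&` V); split.
- exact: openI.
- by split.
- by apply: smooth_on_sub su => y [].
- by apply: smooth_on_sub sv => y [].
Qed.

Lemma jet_derive1n k (u v : R -> 'rV[R]_N) x : jet k u x = jet k v x ->
  forall j mu, (j <= k)%N -> derive1n j u x 0 mu = derive1n j v x 0 mu.
Proof.
move=> [e] j mu jk; have jk' : (j < k.+1)%N by [].
by move/matrixP : e => /(_ (Ordinal jk') mu); rewrite !mxE.
Qed.

Lemma jet_vcvb k (U : set R) (u v : R -> 'rV[R]_N) x : open U -> U x ->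
  smooth_on U u -> smooth_on U v ->
  (forall j mu, (j <= k)%N -> derive1n j u x 0 mu = derive1n j v x 0 mu) ->
  vcvb unit_filter (fun=> U) (fun=> [set x]) (fun=> 1) k (fun=> u) (fun=> v).
Proof.
move=> oU Ux su sv e mu.
apply: smooth_jcv => //.
- by move=> y ->.
- by have /smooth_entryP := su; apply.
- by have /smooth_entryP := sv; apply.
- by move=> j _; eexists => y ->; exact: lexx.
- move=> j y jk ->; rewrite -(derive1n_entryE _ _ _ oU su Ux) -(derive1n_entryE _ _ _ oU sv Ux); exact: e.
Qed.

(** [Wset] only asserts the existence of some representative of the jet. Running the calculus with
    [D] the single point [x] shows that [reg] depends on the jet alone, so the choice is immaterial
    in [WsetP]. *)
Lemma jet_detA (u v : R -> 'rV[R]_N) x : smooth_near u x -> smooth_near v x ->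
  jet q.+1 u x = jet q.+1 v x -> reg u x = reg v x.
Proof.
move=> su sv e; have [U [oU Ux {}su {}sv]] := smooth_near2 su sv.
have h := jet_vcvb oU Ux su sv (jet_derive1n e).
have DU (i : unit) : [set x] `<=` U by move=> y ->.
have su' : \forall i \near unit_filter, smooth_on U u by apply/near_unit.
have sv' : \forall i \near unit_filter, smooth_on U v by apply/near_unit.
have hB : \forall i \near unit_filter, forall y, [set x] y -> `|v y| <= `|v x|.
  by apply/near_unit => y ->.
have h' : jcv U [set x] 0 (fun=> reg u) (fun=> reg v).
  exact: (@reg_cvb unit unit_filter _ (fun=> U) (fun=> [set x]) (fun=> 1) (fun=> oU) DU
    (fun=> lexx 1) (fun=> u) (fun=> v) _ su' sv' hB 0 h).
exact: (jcv_eq h' (leqnn 0)).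
Qed.

Lemma diff_injective (u : R -> 'rV[R]_N) x : derivable u x 1 ->
  injective ('d (u : R^o -> 'rV[R]_N) x : R^o -> 'rV[R]_N) <-> derive1 u x <> 0.
Proof.
move=> du; rewrite deriv1E//; split=> [inj u0|u0 a b].
  have := inj 0 1; rewrite u0 !scaler0 => /(_ erefl)/eqP.
  by rewrite eq_sym oner_eq0.
move=> /eqP; rewrite -subr_eq0 -scalerBl scaler_eq0 => /orP[|/eqP //].
by rewrite subr_eq0 => /eqP.
Qed.

Lemma reg_neq0 (u : R -> 'rV[R]_N) x :
  reg u x != 0 <-> derive1 u x <> 0 /\ row_free (Amx lam q u x).
Proof.
rewrite /reg mulf_eq0 negb_or row_free_gram; split.
  move=> /andP[h ->]; split => // u0; move: h; rewrite u0 big1 ?eqxx// => mu _.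
  by rewrite mxE mul0r.
move=> [u0 ->]; rewrite andbT; apply/eqP => h; apply: u0.
apply: row_dot_eq0; apply/matrixP => i j; rewrite (ord1 i) (ord1 j) !mxE -[RHS]h.
by apply: eq_bigr => mu _; rewrite mxE.
Qed.

Lemma WsetP (u : R -> 'rV[R]_N) x : smooth_near u x ->
  Wset lam q (jet q.+1 u x) <-> reg u x != 0.
Proof.
move=> su; split=> [[v [y [sv e inj rf]]]|/reg_neq0 [u0 rf]].
  have exy : x = y by case: e.
  move: sv inj rf e; rewrite -{}exy => sv inj rf e.
  rewrite (jet_detA su sv e); apply/reg_neq0; split => //.
  by apply/diff_injective => //; case: sv => V [_ Vx sv]; exact: (sv 0%N).
exists u, x; split => //; apply/diff_injective => //.
by case: su => V [_ Vx sv]; exact: (sv 0%N).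
Qed.

End Regularity.

(** * A differential right inverse of the linearised equation *)

Lemma pascal_sum (R : pzRingType) (V : lmodType R) (T : nat -> V) j :
  \sum_(i < j.+1) ((-1) ^+ (j - i) * 'C(j, i)%:R) *: T i.+1 -
  \sum_(i < j.+1) ((-1) ^+ (j - i) * 'C(j, i)%:R) *: T i =
  \sum_(i < j.+2) ((-1) ^+ (j.+1 - i) * 'C(j.+1, i)%:R) *: T i.
Proof.
have -> : \sum_(i < j.+1) ((-1) ^+ (j - i) * 'C(j, i)%:R) *: T i =
    \sum_(i < j.+2) ((-1) ^+ (j - i) * 'C(j, i)%:R) *: T i.
  by rewrite [RHS]big_ord_recr /= bin_small// mulr0 scale0r addr0.
rewrite [X in _ - X]big_ord_recl [RHS]big_ord_recl /= !subn0 !bin0 exprS mulN1r mulNr.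
rewrite opprD addrCA scaleNr; congr (_ + _).
rewrite -sumrB; apply: eq_bigr => i _; rewrite /bump /= add1n subSS binS natrD mulrDr scalerDl.
rewrite addrC; congr (_ + _); rewrite -scaleNr -mulNr; congr (_ *: _).
have [ij|ji] := ltnP i j; last by rewrite bin_small// !mulr0.
by rewrite -(subnSK ij) exprS mulN1r.
Qed.

Lemma jcv_ext (R : realType) (U D : set R) k (f g f' g' : unit -> R -> R) :
  open U -> D `<=` U -> (forall x, U x -> f tt x = f' tt x) ->
  (forall x, U x -> g tt x = g' tt x) -> jcv U D k f g -> jcv U D k f' g'.
Proof.
move=> oU DU hf hg; apply: cvb_ext; [by move=> _|by move=> _| |].
  by apply/near_unit.
by apply/near_unit.
Qed.

Section CalculusOn.
Context {R : realType}.
Variable U : set R.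
Hypothesis oU : open U.

Definition eqU (V : Type) (f g : R -> V) : Prop := forall x, U x -> f x = g x.

Lemma eqU_trans (V : Type) (g f h : R -> V) : eqU f g -> eqU g h -> eqU f h.
Proof. by move=> fg gh x Ux; rewrite fg// gh. Qed.

Section Matrices.
Context {m n : nat}.
Implicit Types (f g : R -> 'M[R]_(m, n)) (c : R).

Lemma eqU_derive1n k f g : eqU f g -> eqU (derive1n k f) (derive1n k g).
Proof. by move=> fg x Ux; exact: (@derive1n_local _ _ U). Qed.

Lemma eqU_derive1 f g : eqU f g -> eqU (derive1 f) (derive1 g).
Proof. by move=> fg x Ux; have := @eqU_derive1n 1%N f g fg x Ux; rewrite !derive1n1. Qed.

Lemma smooth_onD f g : smooth_on U f -> smooth_on U g ->
  smooth_on U (fun x => f x + g x) /\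
  forall k, eqU (derive1n k (fun x => f x + g x)) (fun x => derive1n k f x + derive1n k g x).
Proof.
move=> sf sg.
have h k : eqU (derive1n k (fun x => f x + g x)) (fun x => derive1n k f x + derive1n k g x).
  elim: k => [|k ih] x Ux; first by rewrite !derive1n0.
  rewrite derive1nS (eqU_derive1 ih Ux) !derive1nS !derive1E.
  exact: (deriveD (sf k x Ux) (sg k x Ux)).
split; last exact: h.
move=> k x Ux.
apply: (eq_derivable_onV oU _ Ux (derivableD (sf k x Ux) (sg k x Ux))) => y Uy.
by rewrite h.
Qed.

Lemma smooth_onZ c f : smooth_on U f ->
  smooth_on U (fun x => c *: f x) /\
  forall k, eqU (derive1n k (fun x => c *: f x)) (fun x => c *: derive1n k f x).
Proof.
move=> sf.
have h k : eqU (derive1n k (fun x => c *: f x)) (fun x => c *: derive1n k f x).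
  elim: k => [|k ih] x Ux; first by rewrite !derive1n0.
  rewrite derive1nS (eqU_derive1 ih Ux) !derive1nS !derive1E.
  exact: (deriveZ c (sf k x Ux)).
split; last exact: h.
move=> k x Ux.
apply: (@eq_derivable_onV _ _ U (c \*: derive1n k f) _ oU _ x Ux (@derivableZ _ _ _ _ c _ _ (sf k x Ux))) => y Uy.
by rewrite h.
Qed.

Lemma smooth_on0 : smooth_on U (fun _ : R => 0 : 'M[R]_(m, n)) /\
  forall k, eqU (derive1n k (fun _ : R => 0 : 'M[R]_(m, n))) (fun=> 0).
Proof.
have h k : derive1n k (fun _ : R => 0 : 'M[R]_(m, n)) = (fun=> 0).
  elim: k => [//|k ih]; rewrite derive1nS ih.
  by apply/funext => y; exact: derive1_cst.
split=> [k x Ux|k x Ux]; rewrite h//; exact: derivable_cst.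
Qed.

Lemma smooth_on_sum (J : Type) (r : seq J) (f : J -> R -> 'M[R]_(m, n)) :
  (forall j, smooth_on U (f j)) ->
  smooth_on U (fun x => \sum_(j <- r) f j x) /\
  forall k, eqU (derive1n k (fun x => \sum_(j <- r) f j x))
                (fun x => \sum_(j <- r) derive1n k (f j) x).
Proof.
move=> sf; elim: r => [|j r [ih1 ih2]].
  have [s0 h0] := smooth_on0.
  have e : (fun x => \sum_(j <- [::]) f j x) = (fun=> 0).
    by apply/funext => x; rewrite big_nil.
  split=> [|k x Ux]; first by rewrite e.
  by rewrite e h0// big_nil.
have e : (fun x => \sum_(j <- j :: r) f j x) = fun x => f j x + \sum_(j <- r) f j x.
  by apply/funext => x; rewrite big_cons.
have [s1 h1] := smooth_onD (sf j) ih1.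
split=> [|k x Ux]; first by rewrite e.
by rewrite e h1// ih2// big_cons.
Qed.

Lemma smooth_on_derive1n k f : smooth_on U f -> smooth_on U (derive1n k f).
Proof.
elim: k => [//|k ih] sf; rewrite derive1nS; exact/smooth_on_derive1/ih.
Qed.

Lemma smooth_onM (s : R -> R) f : smooth_on (V := R^o) U s -> smooth_on U f ->
  smooth_on U (fun x => s x *: f x).
Proof.
move=> ss sf; apply/smooth_entryP; first exact: oU.
move=> i j.
have sij : smooth_on (V := R^o) U (fun x => f x i j) by have /smooth_entryP := sf; apply.
apply: (@jcv_smooth _ U set0 (fun _ x => (s x *: f x) i j) (fun _ x => (s x *: f x) i j)) => k.
have h := @cvbM R unit unit_filter (@unit_filter_filter) (fun=> U) (fun=> set0) (fun=> 1) (fun=> oU)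
  (fun=> @sub0set _ _) (fun=> lexx 1) k _ _ _ _ (smooth_jcv0 k oU ss) (smooth_jcv0 k oU sij).
apply: (@jcv_ext R U set0 k _ _ _ _ oU (@sub0set _ _) _ _ h) => x _; by rewrite mxE.
Qed.

End Matrices.

Lemma smooth_on_mulmx m n r (X : R -> 'M[R]_(m, n)) (Y : R -> 'M[R]_(n, r)) :
  smooth_on U X -> smooth_on U Y -> smooth_on U (fun x => X x *m Y x).
Proof.
move=> sX sY; apply/smooth_entryP; first exact: oU.
move=> i j.
apply: (@jcv_smooth _ U set0 (fun _ x => (X x *m Y x) i j) (fun _ x => (X x *m Y x) i j)) => k.
apply: (mulmx_cvb (fun=> oU) (fun=> @sub0set _ _) (fun=> lexx 1)) => a b.
  by apply: smooth_jcv0 => //; have /smooth_entryP := sX; apply.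
by apply: smooth_jcv0 => //; have /smooth_entryP := sY; apply.
Qed.

Lemma derive1_mulmx m n r (X : R -> 'M[R]_(m, n)) (Y : R -> 'M[R]_(n, r)) x :
  derivable X x 1 -> derivable Y x 1 ->
  derive1 (fun x => X x *m Y x) x = derive1 X x *m Y x + X x *m derive1 Y x.
Proof.
move=> dX dY.
have dXe i j : derivable (fun x => X x i j) x 1 by have /derivable_mxP := dX; apply.
have dYe i j : derivable (fun x => Y x i j) x 1 by have /derivable_mxP := dY; apply.
have e i j : (fun x => (X x *m Y x) i j) = \sum_k (fun x => X x i k * Y x k j).
  by apply/funext => y; rewrite mxE fct_sumE.
have dXY : derivable (fun x => X x *m Y x) x 1.
  apply/derivable_mxP => i j; rewrite e; apply: derivable_sum => k.
  exact: (derivableM (dXe i k) (dYe k j)).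
rewrite derive1E (derive_mx dXY); apply/matrixP => i j.
rewrite 3!mxE e derive_sum => [|k]; last exact: (derivableM (dXe i k) (dYe k j)).
rewrite [X in _ = _ + X]mxE -big_split; apply: eq_bigr => k _ /=.
rewrite -derive1E derive1M_pt//; congr (_ * _ + _ * _).
  by rewrite !derive1E (derive_mx dX) mxE.
by rewrite !derive1E (derive_mx dY) mxE.
Qed.

(* Leibniz' rule solved for the term in which all derivatives fall on f. *)
Lemma reversed_leibniz m n r (X : R -> 'M[R]_(m, n)) (f : R -> 'M[R]_(n, r)) j :
  smooth_on U X -> smooth_on U f ->
  eqU (fun x => X x *m derive1n j f x)
      (fun x => \sum_(i < j.+1) ((-1) ^+ (j - i) * 'C(j, i)%:R) *:
         derive1n i (fun y => derive1n (j - i) X y *m f y) x).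
Proof.
elim: j X => [|j ih] X sX sf x Ux.
  by rewrite big_ord_recl big_ord0 addr0 subn0 expr0 bin0 mul1r scale1r !derive1n0.
pose T k i := derive1n i (fun y => derive1n k X y *m f y).
have sT k i : smooth_on U (T k i) :=
  smooth_on_derive1n (k := i) (smooth_on_mulmx (smooth_on_derive1n (k := k) sX) sf).
have sj := smooth_on_derive1n (k := j) sf.
have e0 : X x *m derive1n j.+1 f x =
    derive1 (fun y => X y *m derive1n j f y) x - derive1 X x *m derive1n j f x.
  by rewrite (derive1_mulmx (sX 0%N x Ux) (sj 0%N x Ux)) derive1nS addrAC subrr add0r.
rewrite e0 (eqU_derive1 (ih _ sX sf) Ux) (ih _ (smooth_on_derive1 sX) sf x Ux).
have sS i : smooth_on U (fun x => ((-1) ^+ (j - i) * 'C(j, i)%:R) *: T (j - i)%N i x).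
  exact: (smooth_onZ _ (sT _ _)).1.
have -> : derive1 (fun x => \sum_(i < j.+1) ((-1) ^+ (j - i) * 'C(j, i)%:R) *:
      derive1n i (fun y => derive1n (j - i) X y *m f y) x) x =
    \sum_(i < j.+1) ((-1) ^+ (j - i) * 'C(j, i)%:R) *: T (j - i)%N i.+1 x.
  have [_ /(_ 1%N x Ux)] := smooth_on_sum (index_enum 'I_j.+1) (fun i => sS i).
  rewrite derive1n1 => ->; apply: eq_bigr => i _.
  rewrite ((smooth_onZ _ (sT (j - i)%N i)).2 1%N x Ux) /T; congr (_ *: _).
have -> : \sum_(i < j.+1) ((-1) ^+ (j - i) * 'C(j, i)%:R) *:
      derive1n i (fun y => derive1n (j - i) (derive1 X) y *m f y) x =
    \sum_(i < j.+1) ((-1) ^+ (j - i) * 'C(j, i)%:R) *: T (j.+1 - i)%N i x.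
  apply: eq_bigr => i _; rewrite /T subSn ?(leq_ord i)//.
  by rewrite derive1Sn.
rewrite -(pascal_sum (fun i => T (j.+1 - i)%N i x)); congr (_ - _).
Qed.

End CalculusOn.

Section AdjointOperator.
Context {R : realType} {N p : nat}.
Variable lam : 'rV[R]_N -> 'M[R]_(p, N).
Hypothesis lam_smooth : smooth_forms lam.
Variable q : nat.
Implicit Types (u : R -> 'rV[R]_N) (x : R) (g : R -> 'cV[R]_p).

Definition firstblock : 'M[R]_(\sum_(i < q.+2) p, p) :=
  \mxcol_(i < q.+2) ((i == ord0)%:R *: (1%:M : 'M[R]_p)).

(** Solves [A b = det (A A^T) e_0], where [e_0] is the first block column. The adjugate replaces the
    inverse, so the coefficients are polynomial in the entries of [A] and smooth even where the
    determinant vanishes. *)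
Definition adjsol u x : 'M[R]_(\sum_(j < q.+1) N, p) :=
  (Amx lam q u x)^T *m \adj (Amx lam q u x *m (Amx lam q u x)^T) *m firstblock.

Definition bcoef u (j : 'I_q.+1) x : 'M[R]_(N, p) := submxcol (adjsol u x) j.

Definition Ablock u (i : 'I_q.+2) (j : 'I_q.+1) x : 'M[R]_(p, N) :=
  'C(j, i)%:R *: derive1n (j - i) (Rmx lam u) x +
   (if (0 < i)%N then 'C(j, i.-1)%:R *: derive1n (j - i.-1) (Lmx lam u) x else 0).

Lemma bcoefE u x i : \sum_j Ablock u i j x *m bcoef u j x =
  detA lam q u x *: ((i == ord0)%:R *: 1%:M).
Proof.
have h : Amx lam q u x *m adjsol u x = detA lam q u x *: firstblock.
  by rewrite /adjsol !mulmxA mul_mx_adj mul_scalar_mx.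
have : (\mxblock_(i, j) Ablock u i j x) *m (\mxcol_j bcoef u j x) = detA lam q u x *: firstblock.
  by rewrite submxcolK; exact: h.
rewrite mul_mxblock_mxrow => /(congr1 (fun M => submxcol M i)).
by rewrite mxcolK => ->; rewrite -mul_mx_scalar mxcol_mul mxcolK mul_mx_scalar.
Qed.

Definition Mop u g x : 'cV[R]_N :=
  \sum_(j < q.+1) (-1) ^+ j *: derive1n j (fun y => bcoef u j y *m g y) x.

Section Fam.
Context {I : Type} (G : set_system I) {FG : Filter G}.
Variables (O D : I -> set R) (w : I -> R).
Hypothesis oO : forall i, open (O i).
Hypothesis DO : forall i, D i `<=` O i.
Hypothesis w1 : forall i, 1 <= w i.
Variables (u v : I -> R -> 'rV[R]_N) (B : R).
Hypothesis su : \forall i \near G, smooth_on (O i) (u i).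
Hypothesis sv : \forall i \near G, smooth_on (O i) (v i).
Hypothesis vB : \forall i \near G, forall x, D i x -> `|v i x| <= B.
Local Notation cvb := (cvb G O D w).
Local Notation vcvb := (vcvb G O D w).

Lemma adj_cvb k n (X Y : I -> R -> 'M[R]_n) :
  (forall a b, cvb k (fun i x => X i x a b) (fun i x => Y i x a b)) ->
  forall a b, cvb k (fun i x => (\adj (X i x)) a b) (fun i x => (\adj (Y i x)) a b).
Proof.
move=> h a b.
have h1 : cvb k (fun i x => (-1) ^+ (b + a) * \det (row' b (col' a (X i x))))
   (fun i x => (-1) ^+ (b + a) * \det (row' b (col' a (Y i x)))).
  apply: (cvbM oO DO w1); first exact: cvb_cst.
  apply: (det_cvb oO DO w1) => c d.
  by apply: (cvb_congr oO DO) (h (lift b c) (lift a d)) => i x _; rewrite !mxE.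
by apply: (cvb_congr oO DO) h1 => i x _; rewrite !mxE.
Qed.

Lemma bcoef_cvb k j a b : vcvb (k + q).+1 u v ->
  cvb k (fun i x => bcoef (u i) j x a b) (fun i x => bcoef (v i) j x a b).
Proof.
move=> h.
have h1 c d : cvb k (fun i x => adjsol (u i) x c d) (fun i x => adjsol (v i) x c d).
  apply: (mulmx_cvb oO DO w1) => {c d} c d; last exact: cvb_cst.
  apply: (mulmx_cvb oO DO w1) => {c d} c d.
    apply: (cvb_congr oO DO) (Amx_cvb lam_smooth oO DO w1 su sv vB d c h) => i x _;
    by rewrite [RHS]mxE.
  apply: adj_cvb => {c d} c d; exact: (AAT_cvb lam_smooth oO DO w1 su sv vB).
by apply: (cvb_congr oO DO) (h1 (tagnat.Rank j a) b) => i x _; rewrite [RHS]mxE.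
Qed.

End Fam.

Variable U : set R.
Hypothesis oU : open U.
Variable u : R -> 'rV[R]_N.
Hypothesis su : smooth_on U u.

Lemma bcoef_smooth j : smooth_on U (bcoef u j).
Proof.
apply/smooth_entryP; first exact: oU.
move=> a b.
apply: (@jcv_smooth _ U set0 (fun _ x => bcoef u j x a b) (fun _ x => bcoef u j x a b)) => k.
have su' : \forall i \near unit_filter, smooth_on U u by apply/near_unit.
have hB : \forall i \near unit_filter, forall y, (set0 : set R) y -> `|u y| <= 0 by apply/near_unit.
apply: (@bcoef_cvb unit unit_filter _ (fun=> U) (fun=> set0) (fun=> 1) (fun=> oU)
  (fun=> @sub0set _ _) (fun=> lexx 1) (fun=> u) (fun=> u) _ su' su' hB).
exact: smooth_vjcv.
Qed.

Lemma Mop_smooth g : smooth_on U g -> smooth_on U (Mop u g).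
Proof.
move=> sg; apply: (smooth_on_sum oU _ _).1 => j; apply: (smooth_onZ oU _ _).1.
exact: (smooth_on_derive1n (k := j) (smooth_on_mulmx oU (@bcoef_smooth j) sg)).
Qed.

(** Up to sign the left-hand side applies the linearisation of [horiz] at [u]. Reversed Leibniz
    moves all derivatives outside and turns it into the sum over [i] of [(-1)^i] times the [i]-th
    derivative of [(sum_j A_ij b_j) g]: row block [i] of [A] collects exactly these coefficients. By
    [bcoefE] only [i = 0] survives. *)
Lemma Mop_inverse g : smooth_on U g ->
  eqU U (fun x => Rmx lam u x *m Mop u g x - derive1 (fun y => Lmx lam u y *m Mop u g y) x)
        (fun x => detA lam q u x *: g x).
Proof.
move=> sg.
have sR := smooth_Rmx lam_smooth oU su; have sL := smooth_Lmx lam_smooth oU su.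
have sB j := @bcoef_smooth j.
have sBg j : smooth_on U (fun y => bcoef u j y *m g y) by exact: (smooth_on_mulmx oU (sB j) sg).
pose T (X : R -> 'M[R]_(p, N)) k j i :=
  derive1n i (fun y => derive1n k X y *m (bcoef u j y *m g y)).
have sT X k j i : smooth_on U X -> smooth_on U (T X k j i).
  move=> sX; exact: (smooth_on_derive1n (k := i)
    (smooth_on_mulmx oU (smooth_on_derive1n (k := k) sX) (sBg j))).
have hsign (j i : nat) (z : 'cV[R]_p) : (-1) ^+ j *: (((-1) ^+ (j - i) * 'C(j, i)%:R) *: z) =
    ((-1) ^+ i * 'C(j, i)%:R) *: z.
  rewrite scalerA mulrA -exprD.
  have [ij|ji] := leqP i j; last by rewrite bin_small// !mulr0.
  congr ((_ * _) *: _).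
  by rewrite addnBA// -(signr_odd _ (j + j - i)) oddB ?(leq_trans ij) ?leq_addr// oddD addbb addFb signr_odd.
have expand X : smooth_on U X ->
    eqU U (fun x => X x *m Mop u g x)
     (fun x => \sum_(j < q.+1) \sum_(i < q.+1) ((-1) ^+ i * 'C(j, i)%:R) *: T X (j - i)%N j i x).
  move=> sX x Ux; rewrite /Mop mulmx_sumr; apply: eq_bigr => j _.
  rewrite -scalemxAr (reversed_leibniz oU j sX (sBg j) Ux) scaler_sumr.
  rewrite (big_ord_widen_cond q.+1 xpredT (fun i => (-1) ^+ j *: (((-1) ^+ (j - i) * 'C(j, i)%:R) *:
      derive1n i (fun y => derive1n (j - i) X y *m (bcoef u j y *m g y)) x))) ?ltn_ord//=.
  rewrite big_mkcond /=; apply: eq_bigr => i _; rewrite hsign.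
  case: ifP => // /negbT; rewrite -leqNgt => ji.
  by rewrite bin_small// mulr0 scale0r.
move=> x Ux; rewrite (expand _ sR x Ux).
have sin (i j : 'I_q.+1) : smooth_on U (fun x => ((-1) ^+ i * 'C(j, i)%:R) *: T (Lmx lam u) (j - i)%N j i x).
  by apply: (smooth_onZ oU _ _).1; exact: sT.
have sout (j : 'I_q.+1) := smooth_on_sum oU (index_enum 'I_q.+1) (fun i => sin i j).
have -> : derive1 (fun y => Lmx lam u y *m Mop u g y) x =
    \sum_(j < q.+1) \sum_(i < q.+1) ((-1) ^+ i * 'C(j, i)%:R) *: T (Lmx lam u) (j - i)%N j i.+1 x.
  rewrite (eqU_derive1 oU (expand _ sL) Ux).
  have [_ /(_ 1%N x Ux)] := smooth_on_sum oU (index_enum 'I_q.+1) (fun j => (sout j).1).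
  rewrite derive1n1 => ->; apply: eq_bigr => j _.
  rewrite ((sout j).2 1%N x Ux); apply: eq_bigr => i _.
  rewrite ((smooth_onZ oU _ (sT _ (j - i)%N j i sL)).2 1%N x Ux) /T; congr (_ *: _).
have sAblk i j : smooth_on U (Ablock u i j).
  apply: (smooth_onD oU _ _).1.
    exact: (smooth_onZ oU _ (smooth_on_derive1n (k := (j - i)%N) sR)).1.
  case: (0 < i)%N; last exact: (@smooth_on0 R U p N).1.
  exact: (smooth_onZ oU _ (smooth_on_derive1n (k := (j - i.-1)%N) sL)).1.
(* [S i] is the contribution of row block [i]. The outermost derivative of the [Lmx] part produces
   one extra order, so [i] runs up to [q.+1]. *)
pose S (i : nat) := \sum_(j < q.+1) ((-1) ^+ i) *:
  derive1n i (fun y => ('C(j, i)%:R *: derive1n (j - i) (Rmx lam u) y +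
   (if (0 < i)%N then 'C(j, i.-1)%:R *: derive1n (j - i.-1) (Lmx lam u) y else 0))
    *m (bcoef u j y *m g y)) x.
have S1 (i : 'I_q.+2) : S i = (-1) ^+ i *: derive1n i
    (fun y => (\sum_j Ablock u i j y *m bcoef u j y) *m g y) x.
  rewrite /S -scaler_sumr; congr (_ *: _).
  have sAb j : smooth_on U (fun y => Ablock u i j y *m (bcoef u j y *m g y)).
    exact: (smooth_on_mulmx oU (sAblk i j) (sBg j)).
  have [_ /(_ i x Ux) e] := smooth_on_sum oU (index_enum 'I_q.+1) sAb.
  rewrite -[LHS]e; congr (derive1n i _ x); apply/funext => y.
  by rewrite mulmx_suml; apply: eq_bigr => j _; rewrite mulmxA.
have S2 : \sum_(i < q.+2) S i = detA lam q u x *: g x.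
  rewrite big_ord_recl big1 => [|i _].
    rewrite addr0 S1 expr0 scale1r derive1n0 bcoefE eqxx scale1r.
    by rewrite -scalemxAl mul1mx.
  rewrite S1 (_ : (fun y => _) = fun=> 0).
    by rewrite ((@smooth_on0 R U p 1).2 _ x Ux) scaler0.
  by apply/funext => y; rewrite bcoefE /= scale0r scaler0 mul0mx.
have S3 (i : 'I_q.+2) : S i = \sum_(j < q.+1) (((-1) ^+ i * 'C(j, i)%:R) *: T (Rmx lam u) (j - i)%N j i x +
    (if (0 < i)%N then ((-1) ^+ i * 'C(j, i.-1)%:R) *: T (Lmx lam u) (j - i.-1)%N j i x else 0)).
  apply: eq_bigr => j _.
  have sX X k (c : R) : smooth_on U X ->
      smooth_on U (fun y => c *: (derive1n k X y *m (bcoef u j y *m g y))) /\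
      forall l, eqU U (derive1n l (fun y => c *: (derive1n k X y *m (bcoef u j y *m g y))))
         (fun x => c *: T X k j l x).
    move=> sX; have s1 : smooth_on U (fun y => derive1n k X y *m (bcoef u j y *m g y)).
      exact: (smooth_on_mulmx oU (smooth_on_derive1n (k := k) sX) (sBg j)).
    exact: (smooth_onZ oU c s1).
  case: ifP => [i0|_].
    have [s1 e1] := sX _ (j - i)%N ('C(j, i)%:R) sR.
    have [s2 e2] := sX _ (j - i.-1)%N ('C(j, i.-1)%:R) sL.
    have [_ /(_ i x Ux) e3] := smooth_onD oU s1 s2.
    rewrite -!scalerA -scalerDr; congr (_ *: _).
    rewrite -(e1 i x Ux) -(e2 i x Ux) -e3; congr (derive1n i _ x); apply/funext => y.
    by rewrite mulmxDl !scalemxAl.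
  have [s1 e1] := sX _ (j - i)%N ('C(j, i)%:R) sR.
  rewrite addr0 -scalerA; congr (_ *: _).
  rewrite -(e1 i x Ux); congr (derive1n i _ x); apply/funext => y.
  by rewrite addr0 scalemxAl.
rewrite -S2 (eq_bigr _ (fun i _ => S3 i)) [RHS]exchange_big /= -sumrB.
apply: eq_bigr => j _; rewrite big_split /=; congr (_ + _).
  (* The last row block has no [Rmx] part: its binomial coefficient is zero. *)
  by rewrite [RHS]big_ord_recr /= bin_small ?ltn_ord// mulr0 scale0r addr0.
(* In the [Lmx] part, row block [i.+1] carries the term of index [i]; the extra sign is the minus in
   front of the derivative. *)
rewrite [RHS]big_ord_recl /= add0r -sumrN; apply: eq_bigr => i _.
by rewrite /bump /= add1n /= exprS mulN1r mulNr scaleNr.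
Qed.

End AdjointOperator.

(** * Steering to prescribed endpoints by a contraction *)

HB.instance Definition _ (R : realType) (m n : nat) := Complete.on 'M[R]_(m, n).

Section BallFixpoint.
Context {R : realType} {n : nat}.

(** Composing with the truncation to the ball turns a contraction of the ball into a contraction of
    the whole space. *)
Lemma ball_fixpoint (T : 'rV[R]_n -> 'rV[R]_n) (r : R) : 0 <= r ->
  (forall x, `|x| <= r -> `|T x| <= r) ->
  (forall x y, `|x| <= r -> `|y| <= r -> `|T x - T y| <= 2^-1 * `|x - y|) ->
  exists2 x, `|x| <= r & T x = x.
Proof.
move=> r0 Tr Tl.
have hc x := @clamp_row_le R n r x r0.
pose T' : {fun [set: 'rV[R]_n] >-> [set: 'rV[R]_n]} :=
  [fun of totalfun (T \o clamp_row r)].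
have cT : is_contraction T'.
  exists (2^-1)%:nng; split => /=; first by rewrite invf_lt1 ?ltr1n.
  move=> [x y] _.
  have h : `|T (clamp_row r x) - T (clamp_row r y)| <= 2^-1 * `|x - y|.
    have h1 := Tl _ _ (hc x) (hc y); apply: (le_trans h1).
    by rewrite ler_wpM2l// clamp_row_lip.
  exact: h.
have [||x _ fx] := banach_fixed_point cT.
- exact: closedT.
- by exists 0.
have {}fx : x = T (clamp_row r x) by exact: fx.
have xr : `|x| <= r by rewrite fx; exact: Tr.
by exists x => //; rewrite [RHS]fx clamp_row_id.
Qed.

End BallFixpoint.

Lemma deviation_split (R : realType) n (a1 a2 a3 a4 a5 a6 a7 x1 x2 : 'rV[R]_n) :
  a1 - a2 - (x2 + (a6 - a7)) =
  a3 - a4 - x1 + (x1 - x2) + (a1 - a3 - (a5 - a4)) + (a5 - a2 - (a6 - a7)).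
Proof. by apply/rowP => j; rewrite !mxE; ring. Qed.

Section Steering.
Context {R : realType} {N p : nat}.
Variable lam : 'rV[R]_N -> 'M[R]_(p, N).
Hypothesis lam_smooth : smooth_forms lam.
Hypothesis lam_free : forall y, row_free (lam y).
Local Notation proj := (proj lam).
Local Notation dproj := (dproj lam).
Local Notation sol := (sol lam).
Local Notation proj_const := (proj_const lam).
Implicit Types (u v F : R -> 'rV[R]_N) (a b c : R).

Definition taylor_const (B C : R) : Prop := 0 <= C /\ forall x y z (v : 'rV[R]_N), `|x| <= B ->
  (`|y| <= B -> `|z| <= B -> `|v *m proj y - v *m proj z - v *m dproj x (y - z)| <=
    C * `|v| * (`|y - x| + `|z - x|) * `|y - z|) /\
  `|v *m dproj x y| <= C * `|v| * `|y|.

Lemma taylor_constP B : exists C, taylor_const B C.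
Proof. by have [C C0 h] := proj_taylor lam_smooth lam_free B; exists C. Qed.

Lemma dprojD x y z : dproj x (y + z) = dproj x y + dproj x z.
Proof.
apply/matrixP => i j; rewrite !mxE -big_split; apply: eq_bigr => s _ /=.
by rewrite mxE mulrDl.
Qed.

Lemma dprojZ x k y : dproj x (k *: y) = k *: dproj x y.
Proof.
apply/matrixP => i j; rewrite !mxE mulr_sumr; apply: eq_bigr => s _ /=.
by rewrite mxE mulrA.
Qed.

Lemma dprojN x y : dproj x (- y) = - dproj x y.
Proof. by rewrite -scaleN1r dprojZ scaleN1r. Qed.

(** A solved linear steering problem along the horizontal curve [u]: for each vector [th], the curve
    [th *m wmx] solves the linearised control equation with control [th *m kap], is 0 at [a] and
    [th] at [b]. [K] bounds [kap]; the bounds on products with [b - a] are the smallness conditions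
    of [ode_dependence]. *)
Record admissible (B C1 C2 V0 : R) (a b : R) u (kap wmx : R -> 'M[R]_N) (K : R) : Prop :=
 Admissible {
  adm_ab : a < b; adm_len : b - a <= 1; adm_K : 1 <= K;
  adm_C1 : C1 * (V0 + 2) * (b - a) <= 2^-1;
  adm_C2 : C2 * V0 * (b - a) <= 2^-1;
  adm_u : forall t, a <= t <= b -> `|u t| <= B;
  adm_u' : forall t, a <= t <= b -> `|derive1 u t| <= V0;
  adm_cu : forall t, a <= t <= b -> {for t, continuous (derive1 u)};
  adm_sol : sol a b (derive1 u) u;
  adm_kap : forall (th : 'rV[R]_N) t, a <= t <= b -> `|th *m kap t| <= K * `|th|;
  adm_ckap : forall (th : 'rV[R]_N) t, a <= t <= b -> {for t, continuous (fun t => th *m kap t)};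
  adm_kapP : forall t, a <= t <= b -> kap t *m proj (u t) = kap t;
  adm_wa : wmx a = 0; adm_wb : wmx b = 1%:M;
  adm_w : forall (th : 'rV[R]_N) t, a <= t <= b -> is_derive t 1 (fun t => th *m wmx t)
     (derive1 u t *m dproj (u t) (th *m wmx t) + th *m kap t) }.

Section Estimates.
Variables (B C1 C2 V0 : R).
Hypothesis B0 : 0 <= B.
Hypothesis V00 : 0 <= V0.
Hypothesis hC1 : proj_const (B + 2) C1.
Hypothesis hC2 : taylor_const (B + 2) C2.

(** The error constant of [ctl_key]: 16 comes from the Taylor remainder of [proj], and 6 = 2 + 4
    from the two terms where a projection is compared at two points. Below, [rho] bounds the
    steering parameter and [eps] the admissible defect of the data; both are of order [K^-2]. *)
Definition C5 : R := 16 * C1 ^+ 2 * (C2 * V0) + 6 * C1 ^+ 2.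
Definition rho (K : R) : R := (16 * C5 * K ^+ 2)^-1.
Definition eps (K : R) : R := (160 * C1 * C5 * K ^+ 2)^-1.

Lemma C1_ge1 : 1 <= C1. Proof. by case: hC1. Qed.
Lemma C2_ge0 : 0 <= C2. Proof. by case: hC2. Qed.

Lemma C5_ge1 : 1 <= C5.
Proof.
have h1 := C1_ge1; have h2 := C2_ge0; have h3 := V00.
have h4 : 0 <= C2 * V0 by rewrite mulr_ge0.
have h5 : 1 <= C1 ^+ 2 by rewrite exprn_ege1.
rewrite /C5; have : 0 <= 16 * C1 ^+ 2 * (C2 * V0) by rewrite !mulr_ge0//; lra.
lra.
Qed.

Lemma rho_gt0 K : 1 <= K -> 0 < rho K.
Proof.
move=> K1; have h := C5_ge1; rewrite invr_gt0 !mulr_gt0 ?exprn_gt0//; lra.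
Qed.

Lemma eps_gt0 K : 1 <= K -> 0 < eps K.
Proof.
move=> K1; have h := C5_ge1; have h' := C1_ge1.
rewrite invr_gt0 !mulr_gt0 ?exprn_gt0//; lra.
Qed.

(* |theta| <= rho and |v - u'| <= eps keep the total deviation delta small *)
Lemma delta_le K : 1 <= K -> [/\ eps K + K * rho K <= 1,
  2 * (2 * C5 * K * (eps K + K * rho K)) <= 2^-1 & 5 * C1 * eps K <= rho K / 2].
Proof.
move=> K1; have h := C5_ge1; have h' := C1_ge1.
have K0 : 0 < K by lra.
have e1 : K * rho K = (16 * C5 * K)^-1.
  by rewrite /rho; field; rewrite !gt_eqF//; lra.
have e2 : eps K = (16 * C5 * K)^-1 * (10 * C1 * K)^-1.
  by rewrite /eps; field; rewrite !gt_eqF//; lra.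
have z0 : 0 < (16 * C5 * K)^-1 by rewrite invr_gt0 !mulr_gt0//; lra.
have CK : 1 <= C1 * K by rewrite -(mulr1 1) ler_pM.
have CK5 : 1 <= C5 * K by rewrite -(mulr1 1) ler_pM.
have z1 : eps K <= (16 * C5 * K)^-1.
  have CK10 : 1 <= 10 * C1 * K by rewrite -mulrA; lra.
  rewrite e2; apply: ler_piMr; first exact: ltW.
  by rewrite invf_le1 ?(lt_le_trans ltr01 CK10).
have z2 : (16 * C5 * K)^-1 <= 16^-1.
  rewrite lef_pV2 ?posrE; lra.
split.
- rewrite e1; lra.
- rewrite e1; have : 2 * (2 * C5 * K * (eps K + (16 * C5 * K)^-1)) <=
    2 * (2 * C5 * K * ((16 * C5 * K)^-1 + (16 * C5 * K)^-1)).
    rewrite ler_wpM2l// ler_wpM2l ?mulr_ge0//; lra.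
  move/le_trans; apply; rewrite [leLHS](_ : _ = 2^-1) //.
  by field; rewrite !gt_eqF//; lra.
- rewrite [5 * C1 * eps K](_ : _ = rho K / 2) // /eps /rho.
  by field; rewrite !gt_eqF//; lra.
Qed.

Section OneCell.
Variables (a b : R) (u : R -> 'rV[R]_N) (kap wmx : R -> 'M[R]_N) (K : R).
Hypothesis adm : admissible B C1 C2 V0 a b u kap wmx K.
Variables (v : R -> 'rV[R]_N) (ya yb : 'rV[R]_N) (e : R).
Hypothesis cv : forall t, a <= t <= b -> {for t, continuous v}.
Hypothesis e_eps : e <= eps K.
Hypothesis hv : forall t, a <= t <= b -> `|v t - derive1 u t| <= e.
Hypothesis hya : `|ya - u a| <= e.
Hypothesis hyb : `|yb - u b| <= e.

Definition ctl (th : 'rV[R]_N) t := v t + th *m kap t.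

Let e0 : 0 <= e. Proof. exact: le_trans (normr_ge0 _) hya. Qed.

Lemma ctl_dist th t : a <= t <= b -> `|ctl th t - derive1 u t| <= e + K * `|th|.
Proof.
move=> tab; rewrite /ctl addrAC; apply: (le_trans (ler_normD _ _)).
by apply: lerD; [exact: hv|exact: (adm_kap adm)].
Qed.

Lemma ctl_le th t : a <= t <= b -> `|th| <= rho K -> `|ctl th t| <= V0 + 1.
Proof.
move=> tab thr; have [d1 _ _] := delta_le (adm_K adm).
rewrite -(subrK (derive1 u t) (ctl th t)) addrC; apply: (le_trans (ler_normD _ _)).
apply: lerD; first exact: (adm_u' adm).
apply: (le_trans (ctl_dist _ tab)); apply: (le_trans _ d1); apply: lerD => //.
by rewrite ler_wpM2l// (le_trans ler01 (adm_K adm)).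
Qed.

Lemma eps_le1 : e <= 1.
Proof.
have [d1 _ _] := delta_le (adm_K adm).
have := rho_gt0 (adm_K adm); have K1 := adm_K adm => r0.
have : 0 <= K * rho K by rewrite mulr_ge0//; lra.
have := e_eps; lra.
Qed.

Lemma ctl_sol th : `|th| <= rho K -> exists F, [/\ F a = ya, sol a b (ctl th) F
  & forall t, a <= t <= b -> `|F t| <= B + 2].
Proof.
move=> thr; have e1 := eps_le1; have B0' := B0; have V00' := V00.
have ab := adm_ab adm; have c1 := C1_ge1.
have yaB : `|ya| <= B + 1.
  rewrite -(subrK (u a) ya) addrC; apply: (le_trans (ler_normD _ _)).
  apply: lerD; last exact: le_trans hya e1.
  by apply: (adm_u adm); rewrite lexx ltW.
have CV : C1 * (V0 + 1) * (b - a) <= 2^-1.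
  apply: le_trans (adm_C1 adm); rewrite ler_wpM2r//; first by rewrite subr_ge0 ltW.
  rewrite ler_wpM2l//; lra.
have B1 : 0 <= B + 1 by lra.
have hC1' : proj_const (B + 1 + 1) C1 by rewrite -addrA; exact: hC1.
have aab : a <= a <= b by rewrite lexx ltW.
have V1 : 0 <= V0 + 1 by lra.
have cctl t : a <= t <= b -> {for t, continuous (ctl th)}.
  by move=> tab; apply: cvgD; [exact: cv|exact: (adm_ckap adm)].
have [F [Fa sF hF]] := sol_exists B1 hC1' ab aab V1 cctl
   (fun t h => ctl_le h thr) yaB CV.
exists F; split => // t tab; rewrite -(subrK ya (F t)).
apply: (le_trans (ler_normD _ _)); have := hF t tab; lra.
Qed.

Lemma ctl_near_u th F : `|th| <= rho K -> F a = ya -> sol a b (ctl th) F ->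
  (forall t, a <= t <= b -> `|F t| <= B + 2) ->
  forall t, a <= t <= b -> `|F t - u t| <= 4 * C1 * (e + K * `|th|).
Proof.
move=> thr Fa sF FB t tab; have c1 := C1_ge1; have K1 := adm_K adm; have V00' := V00.
have ab := adm_ab adm.
have d0 : 0 <= e + K * `|th| by rewrite addr_ge0// mulr_ge0//; lra.
have aab : a <= a <= b by rewrite lexx ltW.
have V2 : 0 <= V0 + 2 by lra.
have cl s : a < s < b -> `|ctl th s| <= V0 + 2.
  move=> /andP[? ?]; apply: le_trans (ctl_le _ thr) _; last by lra.
  by rewrite !ltW.
have cd s : a < s < b -> `|ctl th s - derive1 u s| <= e + K * `|th|.
  by move=> /andP[? ?]; apply: ctl_dist; rewrite !ltW.
have uB s : a <= s <= b -> `|u s| <= B + 2.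
  by move=> sab; apply: (le_trans ((adm_u adm) s sab)); lra.
have := sol_dependence hC1 aab V2 d0 (adm_C1 adm) cl cd sF (adm_sol adm) FB uB tab.
rewrite Fa => /le_trans; apply.
have h1 : `|ya - u a| <= C1 * (e + K * `|th|).
  apply: (le_trans hya); apply: (@le_trans _ _ (e + K * `|th|)).
    by rewrite lerDl mulr_ge0//; lra.
  by rewrite ler_peMl.
have h2 : (b - a) * (C1 * (e + K * `|th|)) <= C1 * (e + K * `|th|).
  by rewrite ler_piMl ?(adm_len adm)// mulr_ge0//; lra.
lra.
Qed.

(** The linearised endpoint map is the identity, because [wmx b] is. The true one differs from it by
    an error of order [C5 K de |th - th'|], where [de] bounds the deviation of the controls from the
    derivative of [u]; [delta_le] makes this at most half of [|th - th'|]. *)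
Lemma ctl_key th th' F F' : `|th| <= rho K -> `|th'| <= rho K ->
  F a = ya -> F' a = ya -> sol a b (ctl th) F -> sol a b (ctl th') F' ->
  (forall t, a <= t <= b -> `|F t| <= B + 2) ->
  (forall t, a <= t <= b -> `|F' t| <= B + 2) ->
  `|F b - F' b - (th - th')| <= 2^-1 * `|th - th'|.
Proof.
move=> thr thr' Fa Fa' sF sF' FB FB'.
have c1 := C1_ge1; have c2 := C2_ge0; have K1 := adm_K adm; have V00' := V00.
have ab := adm_ab adm; have K0 : 0 <= K by lra.
set D := `|th - th'|; have D0 : 0 <= D by exact: normr_ge0.
set de := eps K + K * rho K.
have [_ d2 _] := delta_le K1; rewrite -/de in d2.
have de0 : 0 <= de.
  by rewrite addr_ge0// ?mulr_ge0// ltW// ?rho_gt0// eps_gt0.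
have thde x : `|x| <= rho K -> e + K * `|x| <= de.
  by move=> h; apply: lerD => //; rewrite ler_wpM2l.
have aab : a <= a <= b by rewrite lexx ltW.
have V2 : 0 <= V0 + 2 by lra.
have KD : 0 <= K * D by rewrite mulr_ge0.
have uB s : a <= s <= b -> `|u s| <= B + 2.
  by move=> sab; apply: (le_trans ((adm_u adm) s sab)); lra.
have cl s : a < s < b -> `|ctl th s| <= V0 + 2.
  move=> /andP[? ?]; apply: le_trans (ctl_le _ thr) _; last by lra.
  by rewrite !ltW.
have cd s : a < s < b -> `|ctl th s - ctl th' s| <= K * D.
  move=> /andP[? ?]; rewrite /ctl opprD addrACA subrr add0r -mulmxBl.
  by apply: (adm_kap adm); rewrite !ltW.
have FF' t : a <= t <= b -> `|F t - F' t| <= 2 * C1 * K * D.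
  move=> tab.
  have := sol_dependence hC1 aab V2 KD (adm_C1 adm) cl cd sF sF' FB FB' tab.
  rewrite Fa Fa' subrr normr0 add0r => /le_trans; apply.
  rewrite -!mulrA ler_wpM2l//; rewrite ler_piMl ?(adm_len adm)// mulr_ge0//; lra.
have Fu t : a <= t <= b -> `|F t - u t| <= 4 * C1 * de.
  move=> tab; apply: (le_trans (ctl_near_u thr Fa sF FB tab)).
  by rewrite ler_wpM2l ?thde//; lra.
have Fu' t : a <= t <= b -> `|F' t - u t| <= 4 * C1 * de.
  move=> tab; apply: (le_trans (ctl_near_u thr' Fa' sF' FB' tab)).
  by rewrite ler_wpM2l ?thde//; lra.
(* The deviation from the linearised solution vanishes at [a] and is compared with the zero curve by
   [ode_dependence]. *)
pose d t := F t - F' t - (th - th') *m wmx t.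
pose Yd t := ctl th t *m proj (F t) - ctl th' t *m proj (F' t) -
  (derive1 u t *m dproj (u t) ((th - th') *m wmx t) + (th - th') *m kap t).
have dd t : a <= t <= b -> is_derive t 1 d (Yd t).
  move=> tab; apply: is_deriveB; last exact: (adm_w adm).
  by apply: is_deriveB; [exact: sF|exact: sF'].
have d0 t : a <= t <= b -> is_derive t 1 (fun _ : R => 0 : 'rV[R]_N) ((fun=> 0) t).
  by move=> _; exact: is_derive_cst.
have E0 : 0 <= C5 * K * de * D by rewrite !mulr_ge0// (le_trans ler01 C5_ge1).
have hY t : a < t < b -> `|Yd t - 0| <= C2 * V0 * `|d t - 0| + C5 * K * de * D.
  move=> /andP[at_ tb]; have tab : a <= t <= b by rewrite !ltW.
  rewrite !subr0.
  pose z := ctl th t - derive1 u t.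
  have zd : `|z| <= de by apply: le_trans (ctl_dist _ tab) _; exact: thde.
  (* Four terms: the Taylor remainder of [proj], the part linear in [d], the effect of the control
     differing from the derivative of [u], and [kap] projected at [F'] instead of at [u]. All but
     the second are of order [de * D]. *)
  have eY : Yd t = (derive1 u t *m proj (F t) - derive1 u t *m proj (F' t)
         - derive1 u t *m dproj (u t) (F t - F' t))
      + derive1 u t *m dproj (u t) (d t)
      + (z *m proj (F t) - z *m proj (F' t))
      + ((th - th') *m kap t *m proj (F' t) - (th - th') *m kap t *m proj (u t)).
    have -> : (th - th') *m kap t *m proj (u t) = (th - th') *m kap t.
      by rewrite -mulmxA (adm_kapP adm).
    have e1 : (th - th') *m kap t = ctl th t - ctl th' t.
      by rewrite /ctl opprD addrACA subrr add0r -mulmxBl.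
    have e2 : derive1 u t *m dproj (u t) (d t) = derive1 u t *m dproj (u t) (F t - F' t)
        - derive1 u t *m dproj (u t) ((th - th') *m wmx t).
      by rewrite /d dprojD dprojN mulmxDr mulmxN.
    rewrite e2 /Yd e1 /z !(mulmxBl (ctl th t)).
    exact: deviation_split.
  have T1 := (hC2.2 (u t) (F t) (F' t) (derive1 u t) (uB _ tab)).1 (FB _ tab) (FB' _ tab).
  have dB : `|derive1 u t| <= V0 by exact: (adm_u' adm).
  have T2 : `|derive1 u t *m dproj (u t) (d t)| <= C2 * V0 * `|d t|.
    apply: (le_trans (hC2.2 (u t) (d t) 0 (derive1 u t) (uB _ tab)).2).
    by rewrite ler_wpM2r// ler_wpM2l.
  have T3 := (hC1.2 _ _ z (FB _ tab) (FB' _ tab)).2.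
  have T4 := (hC1.2 _ _ ((th - th') *m kap t) (FB' _ tab) (uB _ tab)).2.
  rewrite eY; apply: (le_trans (ler_normD _ _)).
  have -> : C2 * V0 * `|d t| + C5 * K * de * D =
    (16 * C1 ^+ 2 * (C2 * V0) * K * de * D + C2 * V0 * `|d t| + 2 * C1 ^+ 2 * K * de * D)
    + 4 * C1 ^+ 2 * K * de * D by rewrite /C5; ring.
  have kD : `|(th - th') *m kap t| <= K * D by exact: (adm_kap adm).
  apply: lerD.
    apply: (le_trans (ler_normD _ _)); apply: lerD.
      apply: (le_trans (ler_normD _ _)); apply: lerD => //.
      apply: (le_trans T1).
      apply: (@le_trans _ _ (C2 * V0 * (4 * C1 * de + 4 * C1 * de) * (2 * C1 * K * D))).
        apply: ler_pM; rewrite ?mulr_ge0 ?addr_ge0 ?FF'//.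
        apply: ler_pM; rewrite ?mulr_ge0 ?addr_ge0// ?lerD ?Fu ?Fu'//.
        by rewrite ler_wpM2l.
      by rewrite [leLHS](_ : _ = 16 * C1 ^+ 2 * (C2 * V0) * K * de * D)//; ring.
    apply: (le_trans T3).
    apply: (@le_trans _ _ (C1 * de * (2 * C1 * K * D))).
      apply: ler_pM; rewrite ?mulr_ge0 ?FF'//; first lra.
      by rewrite ler_wpM2l//; lra.
    by rewrite [leLHS](_ : _ = 2 * C1 ^+ 2 * K * de * D)//; ring.
  apply: (le_trans T4).
  apply: (@le_trans _ _ (C1 * (K * D) * (4 * C1 * de))).
    apply: ler_pM; rewrite ?mulr_ge0 ?Fu'//; first lra.
    by rewrite ler_wpM2l//; lra.
  by rewrite [leLHS](_ : _ = 4 * C1 ^+ 2 * K * de * D)//; ring.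
have bab : a <= b <= b by rewrite lexx ltW.
have L0 : 0 <= C2 * V0 by rewrite mulr_ge0.
have := ode_dependence L0 E0 (adm_C2 adm) aab dd d0 hY bab.
rewrite /d Fa Fa' subrr (adm_wa adm) (adm_wb adm) mulmx0 mulmx1 !subr0 normr0 add0r => /le_trans; apply.
apply: (@le_trans _ _ (2 * (C5 * K * de * D))).
  by rewrite ler_wpM2l// ler_piMl ?(adm_len adm).
have -> : 2 * (C5 * K * de * D) = (2 * (2 * C5 * K * de)) / 2 * D by field.
by rewrite ler_wpM2r//; lra.
Qed.

(** A perturbation of the identity with ratio 1/2 shrinks distances by a factor 2 at most. *)
Lemma key_injective th th' F F' : `|th| <= rho K -> `|th'| <= rho K ->
  F a = ya -> F' a = ya -> sol a b (ctl th) F -> sol a b (ctl th') F' ->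
  (forall t, a <= t <= b -> `|F t| <= B + 2) ->
  (forall t, a <= t <= b -> `|F' t| <= B + 2) ->
  `|th - th'| <= 2 * `|F b - F' b|.
Proof.
move=> h1 h2 h3 h4 h5 h6 h7 h8.
have := ctl_key h1 h2 h3 h4 h5 h6 h7 h8.
have : `|th - th'| <= `|F b - F' b| + `|F b - F' b - (th - th')|.
  by rewrite -[X in `|X| <= _](subKr (F b - F' b)); exact: ler_normB.
lra.
Qed.

(** By [ctl_key] the map [th - (F th b - yb)] has ratio 1/2. Without correction the endpoint misses
    [yb] by at most [5 C1 e <= rho / 2], so the ball of radius [rho] is preserved, and twice the
    miss bounds the fixed point. *)
Lemma steer_exists : exists th F, [/\ `|th| <= rho K, `|th| <= 10 * C1 * e,
   F a = ya, F b = yb & sol a b (ctl th) F /\ forall t, a <= t <= b -> `|F t| <= B + 2].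
Proof.
have K1 := adm_K adm; have r0 := ltW (rho_gt0 K1); have c1 := C1_ge1.
have [_ _ d3] := delta_le K1; have ab := adm_ab adm.
have /choice [F hF] : forall th, exists F, `|th| <= rho K -> [/\ F a = ya, sol a b (ctl th) F
    & forall t, a <= t <= b -> `|F t| <= B + 2].
  move=> th; have [thr|nthr] := boolP (`|th| <= rho K); last by exists (cst 0).
  by have [F hF] := ctl_sol thr; exists F.
have bab : a <= b <= b by rewrite lexx ltW.
have z0 : `|0 : 'rV[R]_N| <= rho K by rewrite normr0.
have E0 : `|F 0 b - yb| <= 5 * C1 * e.
  have [h1 h2 h3] := hF 0 z0.
  have := ctl_near_u z0 h1 h2 h3 bab; rewrite normr0 mulr0 addr0 => h4.
  have : `|F 0 b - yb| <= `|F 0 b - u b| + `|yb - u b|.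
    by rewrite (distrC yb); exact: ler_distD.
  have := hyb; have : e <= C1 * e by rewrite ler_peMl.
  lra.
have E0r : `|F 0 b - yb| <= rho K / 2.
  apply: (le_trans E0); apply: le_trans d3; rewrite ler_wpM2l//; lra.
pose T th := th - (F th b - yb).
have Tl x y : `|x| <= rho K -> `|y| <= rho K -> `|T x - T y| <= 2^-1 * `|x - y|.
  move=> xr yr; have [h1 h2 h3] := hF x xr; have [h4 h5 h6] := hF y yr.
  have := ctl_key xr yr h1 h4 h2 h5 h3 h6.
  rewrite -normrN (_ : - (F x b - F y b - (x - y)) = T x - T y)//.
  by rewrite /T; apply/rowP => j; rewrite !mxE; ring.
have Tr x : `|x| <= rho K -> `|T x| <= rho K.
  move=> xr; have := Tl x 0 xr z0; rewrite subr0 => h.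
  rewrite -(subrK (T 0) (T x)); apply: (le_trans (ler_normD _ _)).
  have : `|T 0| <= rho K / 2 by rewrite /T sub0r normrN.
  lra.
have [th thr fx] := ball_fixpoint r0 Tr Tl.
have [h1 h2 h3] := hF th thr; have [g1 g2 g3] := hF 0 z0.
have Fb : F th b = yb.
  move/eqP: fx; rewrite /T -subr_eq0 addrAC subrr add0r oppr_eq0 subr_eq0.
  by move/eqP.
exists th, (F th); split => //.
have := key_injective thr z0 h1 g1 h2 g2 h3 g3; rewrite subr0 Fb distrC => /le_trans; apply.
lra.
Qed.

(** Stability: the first system is run with the second parameter [th']. Its endpoint is close to
    [yb'] by continuous dependence, hence to [yb], and [key_injective] converts closeness of
    endpoints into closeness of parameters. *)
Lemma steer_compare th F th' v' F' (ya' yb' : 'rV[R]_N) e' :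
  `|th| <= rho K -> F a = ya -> F b = yb -> sol a b (ctl th) F ->
  (forall t, a <= t <= b -> `|F t| <= B + 2) ->
  `|th'| <= rho K -> F' a = ya' -> F' b = yb' -> sol a b v' F' ->
  (forall t, a <= t <= b -> `|F' t| <= B + 2) ->
  `|ya - ya'| <= e' -> `|yb - yb'| <= e' ->
  (forall t, a < t < b -> `|ctl th' t - v' t| <= e') ->
  `|th - th'| <= (6 + 4 * C1) * e'.
Proof.
move=> thr Fa Fb sF FB thr' Fa' Fb' sF' FB' hya' hyb' hv'.
have [H [Ha sH HB]] := ctl_sol thr'.
have e'0 : 0 <= e' := le_trans (normr_ge0 _) hya'.
have c1 := C1_ge1; have V00' := V00; have ab := adm_ab adm.
have aab : a <= a <= b by rewrite lexx ltW.
have bab : a <= b <= b by rewrite lexx ltW.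
have V2 : 0 <= V0 + 2 by lra.
have cl s : a < s < b -> `|ctl th' s| <= V0 + 2.
  move=> /andP[? ?]; apply: le_trans (ctl_le _ thr') _; last by lra.
  by rewrite !ltW.
have := sol_dependence hC1 aab V2 e'0 (adm_C1 adm) cl hv' sH sF' HB FB' bab.
rewrite Ha Fa' Fb' => h1.
have h2 : (b - a) * (C1 * e') <= C1 * e'.
  by rewrite ler_piMl ?(adm_len adm)// mulr_ge0//; lra.
have := key_injective thr thr' Fa Ha sF sH FB HB; rewrite Fb => /le_trans; apply.
have : `|yb - H b| <= `|yb - yb'| + `|H b - yb'|.
  by rewrite (distrC (H b)); exact: ler_distD.
lra.
Qed.

End OneCell.
End Estimates.
End Steering.

(** * Linear steering with controls supported inside a cell *)

Section CellLinear.
Context {R : realType} {N p : nat}.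
Variable lam : 'rV[R]_N -> 'M[R]_(p, N).
Hypothesis lam_smooth : smooth_forms lam.
Hypothesis lam_free : forall y, row_free (lam y).
Variable q : nat.
Local Notation proj := (proj lam).
Local Notation dproj := (dproj lam).
Implicit Types (u : R -> 'rV[R]_N) (a b t : R) (i : 'I_N).

Definition Hmx u t : 'M[R]_N := \matrix_(s, mu)
  \sum_nu derive1 u t 0 nu * partial s (fun y => proj y nu mu) (u t).

Lemma Hmx_dproj u t (w : 'rV[R]_N) : w *m Hmx u t = derive1 u t *m dproj (u t) w.
Proof.
apply/rowP => mu; rewrite !mxE.
under eq_bigr => s _ do rewrite mxE mulr_sumr.
rewrite exchange_big /=; apply: eq_bigr => nu _; rewrite mxE mulr_sumr.
by apply: eq_bigr => s _; rewrite mulrCA.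
Qed.

Definition is_fund a b u i (W : R -> 'rV[R]_N) : Prop :=
  W b = delta_mx 0 i /\ forall t, a <= t <= b -> is_derive t 1 W (W t *m Hmx u t).

Definition fund a b u i : R -> 'rV[R]_N := xget (fun=> 0) (is_fund a b u i).

(** The argument goes from 0 to 1 on the middle third, so the value is 0 on the first third and 1 on
    the last. *)
Definition stepc a b t : R := step (\row_(_ < 1) (3 * (t - a) * (b - a)^-1 - 1)).

(** Cutting off [fund] violates the linearised equation by the derivative of [stepc] times the forms
    on [fund]. The division by the determinant anticipates the factor in [Mop_inverse]. *)
Definition gsrc a b u i t : 'cV[R]_p :=
  ((detA lam q u t)^-1 * derive1 (stepc a b) t) *: (lam (u t) *m (fund a b u i t)^T).

(** The cut-off of [fund], repaired by [Mop]. Since [Mop] is a differential operator, the repair is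
    supported where [stepc] varies: the curve is 0 near [a] and equals [fund] near [b]. *)
Definition wcurve a b u i t : 'rV[R]_N :=
  stepc a b t *: fund a b u i t + (Mop lam q u (gsrc a b u i) t)^T.

Definition kapf a b u i t : 'rV[R]_N :=
  derive1 (wcurve a b u i) t - wcurve a b u i t *m Hmx u t.

(** Nothing is known of [fund] off the closed cell. The extension by 0 is continuous on it because
    [kapf] vanishes on the outer thirds. *)
Definition kapr a b u i t : 'rV[R]_N := if a < t < b then kapf a b u i t else 0.

Definition kapm a b u t : 'M[R]_N := \matrix_i kapr a b u i t.
Definition wm a b u t : 'M[R]_N := \matrix_i wcurve a b u i t.

Lemma derive1_eq0 (V : normedModType R) (U : set R) (f : R -> V) : open U ->
  (forall x, U x -> f x = 0) -> forall k x, U x -> derive1n k f x = 0.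
Proof.
move=> oU h k x Ux.
have -> : derive1n k f x = derive1n k (cst 0 : R -> V) x.
  exact: (@derive1n_local _ _ U).
have -> // : derive1n k (cst 0 : R -> V) = cst 0.
elim: k => [//|k ih]; rewrite derive1nS ih; apply/funext => y; exact: derive1_cst.
Qed.

Lemma stepc_left a b t : a < b -> t < a + (b - a) / 3 -> stepc a b t = 0.
Proof.
move=> ab ta; apply: step0; rewrite mxE subr_le0.
rewrite ler_pdivrMr ?subr_gt0// mul1r.
lra.
Qed.

Lemma stepc_right a b t : a < b -> b - (b - a) / 3 < t -> stepc a b t = 1.
Proof.
move=> ab ta; apply: step1; rewrite mxE lerBrDr.
rewrite ler_pdivlMr ?subr_gt0//.
lra.
Qed.

Lemma open_lt_set (c : R) : open [set t : R | t < c].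
Proof. exact: open_lt. Qed.

Lemma open_gt_set (c : R) : open [set t : R | c < t].
Proof. exact: open_gt. Qed.

Lemma Mop_eq0 (U : set R) u (g : R -> 'cV[R]_p) : open U -> (forall x, U x -> g x = 0) ->
  forall x, U x -> Mop lam q u g x = 0 :> 'cV[R]_N.
Proof.
move=> oU h x Ux; rewrite /Mop big1// => j _.
rewrite (@derive1_eq0 _ U (fun y => bcoef lam u j y *m g y) oU _ j x Ux) ?scaler0//.
by move=> y Uy; rewrite h// mulmx0.
Qed.

Lemma wcurve_left a b u i t : a < b -> t < a + (b - a) / 3 -> wcurve a b u i t = 0.
Proof.
move=> ab ta; rewrite /wcurve (stepc_left ab ta) scale0r add0r.
rewrite (Mop_eq0 _ (@open_lt_set (a + (b - a) / 3)))// ?trmx0// => x xa.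
rewrite /gsrc (_ : derive1 (stepc a b) x = 0) ?mulr0 ?scale0r//.
have := @derive1_eq0 R^o _ (stepc a b) (@open_lt_set (a + (b - a) / 3)) (fun y => stepc_left ab) 1%N x xa.
by rewrite derive1n1.
Qed.

Lemma wcurve_right a b u i t : a < b -> b - (b - a) / 3 < t ->
  wcurve a b u i t = fund a b u i t.
Proof.
move=> ab ta; rewrite /wcurve (stepc_right ab ta) scale1r.
rewrite (Mop_eq0 _ (@open_gt_set (b - (b - a) / 3)))// ?trmx0 ?addr0// => x xa.
rewrite /gsrc (_ : derive1 (stepc a b) x = 0) ?mulr0 ?scale0r//.
have -> := @eq_derive1_on R _ (stepc a b) (cst 1) (@open_gt_set (b - (b - a) / 3))
  (fun y => stepc_right ab) x xa.
exact: derive1_cst.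
Qed.

Lemma kapr_left a b u i t : a < b -> t < a + (b - a) / 3 -> kapr a b u i t = 0.
Proof.
move=> ab ta; rewrite /kapr; case: ifP => // _; rewrite /kapf wcurve_left// mul0mx subr0.
have := @derive1_eq0 _ _ (wcurve a b u i) (@open_lt_set (a + (b - a) / 3)) (fun y => wcurve_left u i ab) 1%N t ta.
by rewrite derive1n1.
Qed.

Section OneCell.
Variables (a b : R) (U : set R) (u : R -> 'rV[R]_N) (L : R).
Hypothesis ab : a < b.
Hypothesis oU : open U.
Hypothesis abU : forall t, a <= t <= b -> U t.
Hypothesis su : smooth_on U u.
Hypothesis hu : forall t, U t -> derive1 u t *m proj (u t) = derive1 u t.
Hypothesis du : forall t, a < t < b -> detA lam q u t != 0.
Hypothesis L0 : 0 <= L.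
Hypothesis Lab : L * (b - a) <= 2^-1.
Hypothesis hL : forall t (w : 'rV[R]_N), a <= t <= b -> `|w *m Hmx u t| <= L * `|w|.

Lemma smooth_Hmx : smooth_on U (Hmx u).
Proof.
apply/smooth_entryP; first exact: oU.
move=> s mu.
apply: (@jcv_smooth _ U set0 (fun _ x => Hmx u x s mu) (fun _ x => Hmx u x s mu)) => k.
pose f (_ : unit) x := \sum_nu derive1 u x 0 nu * partial s (fun y => proj y nu mu) (u x).
have hf : jcv U set0 k f f.
  apply: (cvb_sum (fun=> oU) (fun=> @sub0set _ _) (fun=> lexx 1)) => nu _.
  apply: (cvbM (fun=> oU) (fun=> @sub0set _ _) (fun=> lexx 1)).
    exact: (smooth_vjcv k oU (smooth_on_derive1 su)).
  apply: (cvb_comp (B := 0) (fun=> oU) (fun=> @sub0set _ _) (fun=> lexx 1)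
    (smooth_funD s (proj_smooth lam_smooth lam_free nu mu)) (smooth_vjcv k oU su)).
  by apply/near_unit.
by apply: jcv_ext hf => // x _; rewrite /f mxE.
Qed.

Lemma fundP i : is_fund a b u i (fund a b u i).
Proof.
have bab : a <= b <= b by rewrite lexx ltW.
have cH t : a <= t <= b -> {for t, continuous (Hmx u)}.
  move=> tab; apply: differentiable_continuous; apply/derivable1_diffP.
  exact: (@smooth_Hmx 0%N t (abU tab)).
have [W hW] := linear_ode_exists (delta_mx 0 i) ab bab L0 Lab cH hL.
by apply: (@xgetI _ _ (is_fund a b u i) W).
Qed.

Lemma sub_cell t : `]a, b[%classic t -> U t.
Proof. by rewrite /= in_itv/= => /andP[? ?]; apply: abU; rewrite !ltW. Qed.

Lemma open_cell : open (`]a, b[%classic : set R).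
Proof. exact: interval_open. Qed.

Lemma smooth_fund i : smooth_on `]a, b[ (fund a b u i).
Proof.
have oC := open_cell.
apply/smooth_entryP; first exact: oC.
move=> j mu; rewrite (ord1 j).
have sH s nu : smooth_on (V := R^o) `]a, b[ (fun x => Hmx u x s nu).
  have h := smooth_on_sub sub_cell smooth_Hmx.
  by have /smooth_entryP := h; apply.
have [_ dW] := fundP i.
have h k : vcvb unit_filter (fun=> `]a, b[%classic) (fun=> set0) (fun=> 1) k
    (fun=> fund a b u i) (fun=> fund a b u i).
  have dW' : \forall _ \near unit_filter, forall x, `]a, b[%classic x ->
      is_derive x 1 (fund a b u i) (fund a b u i x *m Hmx u x).
    by apply/near_unit => x; rewrite /= in_itv/= => /andP[? ?]; apply: dW; rewrite !ltW.
  have h0 : vcvb unit_filter (fun=> `]a, b[%classic) (fun=> set0) (fun=> 1) 0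
      (fun=> fund a b u i) (fun=> fund a b u i).
    apply: (@vcvb0 _ _ _ unit_filter _ (fun=> `]a, b[%classic) (fun=> set0) (fun=> 1) (fun=> lexx 1) _ _ 0).
    - by apply/near_unit => x Ox; case: (dW' tt I x Ox).
    - by apply/near_unit => x Ox; case: (dW' tt I x Ox).
    - by apply/near_unit.
    - by move=> m e e0; apply/near_unit.
  elim: k => [//|k ih].
  apply: (vcvb_ode (fun=> oC) (fun=> @sub0set _ _) dW' dW' h0) => nu.
  pose f (_ : unit) x := \sum_s fund a b u i x 0 s * Hmx u x s nu.
  have hf : jcv `]a, b[ set0 k f f.
    apply: (cvb_sum (fun=> oC) (fun=> @sub0set _ _) (fun=> lexx 1)) => s _.
    apply: (cvbM (fun=> oC) (fun=> @sub0set _ _) (fun=> lexx 1)); first exact: ih.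
    exact: smooth_jcv0.
  by apply: jcv_ext hf => // x _; rewrite /f mxE.
exact: (@jcv_smooth _ `]a, b[%classic set0 (fun _ x => fund a b u i x 0 mu) _ (fun k => h k mu)).
Qed.

End OneCell.
End CellLinear.

Section MatrixDerivatives.
Context {R : realType}.

Lemma derive1_scale m n (s : R -> R) (f : R -> 'M[R]_(m, n)) x :
  derivable s x 1 -> derivable f x 1 ->
  derivable (fun x => s x *: f x) x 1 /\
  derive1 (fun x => s x *: f x) x = derive1 s x *: f x + s x *: derive1 f x.
Proof.
move=> ds df.
have dfe i j : derivable (fun x => f x i j) x 1 by have /derivable_mxP := df; apply.
have e i j : (fun x => (s x *: f x) i j) = (fun x => s x * f x i j).
  by apply/funext => y; rewrite mxE.
have dsf : derivable (fun x => s x *: f x) x 1.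
  by apply/derivable_mxP => i j; rewrite e; exact: (derivableM ds (dfe i j)).
split => //; apply/matrixP => i j.
rewrite derive1E (derive_mx dsf) mxE e -derive1E derive1M_pt// !mxE.
by congr (_ + _ * _); rewrite !derive1E (derive_mx df) mxE.
Qed.

Lemma derive1_trmx m n (f : R -> 'M[R]_(m, n)) x : derivable f x 1 ->
  derivable (fun x => (f x)^T) x 1 /\ derive1 (fun x => (f x)^T) x = (derive1 f x)^T.
Proof.
move=> df.
have dfe i j : derivable (fun x => f x i j) x 1 by have /derivable_mxP := df; apply.
have e i j : (fun x => (f x)^T i j) = (fun x => f x j i).
  by apply/funext => y; rewrite mxE.
have dft : derivable (fun x => (f x)^T) x 1.
  by apply/derivable_mxP => i j; rewrite e.
split => //; apply/matrixP => i j.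
by rewrite derive1E (derive_mx dft) !mxE e derive1E (derive_mx df) mxE.
Qed.

Lemma smooth_on_trmx m n (U : set R) (f : R -> 'M[R]_(m, n)) : open U ->
  smooth_on U f -> smooth_on U (fun x => (f x)^T).
Proof.
move=> oU sf; apply/smooth_entryP; first exact: oU.
move=> i j; have e : (fun x => (f x)^T i j) = (fun x => f x j i).
  by apply/funext => y; rewrite mxE.
by rewrite e; have /smooth_entryP := sf; apply.
Qed.

Lemma unit_cvb_smooth (U D : set R) (w : unit -> R) (f g : unit -> R -> R) :
  (forall k, cvb unit_filter (fun=> U) (fun=> D) w k f g) -> smooth_on (V := R^o) U (f tt).
Proof.
move=> h k x Ux; have /cvbP/(_ k (leqnn k)) [/near_unit d _ _ _] := h k.
exact: d.
Qed.

(** Each derivative of [stepc] costs a factor [(b - a)^-1], which the weight dominates. *)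
Lemma stepc_cvb {I : Type} (G : set_system I) {FG : Filter G}
    (O D : I -> set R) (w : I -> R) (oO : forall i, open (O i))
    (DO : forall i, D i `<=` O i) (w1 : forall i, 1 <= w i) (a b : I -> R) k :
  (\forall i \near G, [/\ a i < b i, b i - a i <= 1 & (b i - a i)^-1 <= w i]) ->
  (\forall i \near G, forall x, D i x -> a i < x < b i) ->
  cvb G O D w k (fun i => stepc (a i) (b i)) (fun i => stepc (a i) (b i)).
Proof.
move=> hab hD.
have hx l : cvb G O D w l (fun i x => x - a i) (fun i x => x - a i).
  have h0 : cv0 G O D w (fun i x => x - a i) (fun i x => x - a i).
    have d : \forall i \near G, forall x, O i x -> derivable (fun x => x - a i) x 1.
      by apply: nearW => i x _; apply: derivableB; [exact: derivable_id|exact: derivable_cst].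
    split => //.
    - exists 1, 0%N; apply: filterS2 hab hD => i [ab ab1 _] hD x Dx.
      have /andP[ax xb] := hD x Dx; rewrite expr0 mulr1 gtr0_norm ?subr_gt0//; lra.
    - by move=> m e e0; apply: nearW => i x _; rewrite subrr normr0 mul0r ltW.
  case: l => [//|l]; split => //.
  have h1 : cvb G O D w l (fun _ _ => 1) (fun _ _ => 1) := @cvb_cst R I G FG O D w oO DO l 1.
  have e i : derive1 (fun x => x - a i) = (fun=> 1 : R).
    apply/funext => x; rewrite derive1E.
    by have [_ ->] := is_deriveB (is_derive_id x (1 : R)) (is_derive_cst (a i) x (1 : R)); rewrite subr0.
  by apply: (cvb_congr oO DO _ _ h1) => i x _; rewrite e.
have hi l : cvb G O D w l (fun i _ => (b i - a i)^-1) (fun i _ => (b i - a i)^-1).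
  apply: (@cvb_cst_gen R I G FG O D w oO DO).
    exists 1, 1%N; apply: filterS hab => i [ab _ h].
    have h0 : 0 <= (b i - a i)^-1 by rewrite invr_ge0 subr_ge0 ltW.
    by rewrite mul1r expr1 (ger0_norm h0).
  by move=> m e e0; apply: nearW => i; rewrite subrr normr0 mul0r ltW.
apply: (@cvb_comp _ 1 I G FG O D w oO DO w1 k step
  (fun i x => \row_(_ < 1) (3 * (x - a i) * (b i - a i)^-1 - 1))
  (fun i x => \row_(_ < 1) (3 * (x - a i) * (b i - a i)^-1 - 1)) 3 step_smooth).
  move=> mu.
  have h : cvb G O D w k (fun i x => 3 * (x - a i) * (b i - a i)^-1 - 1)
     (fun i x => 3 * (x - a i) * (b i - a i)^-1 - 1).
    apply: (cvbB oO DO w1); last exact: cvb_cst.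
    apply: (cvbM oO DO w1) => //; apply: (cvbM oO DO w1) => //; exact: cvb_cst.
  by apply: (cvb_congr oO DO) h => i x _; rewrite mxE.
apply: filterS2 hab hD => i [ab _ _] hD x Dx.
have /andP[ax xb] := hD x Dx; apply: row_norm_le => // mu; rewrite mxE.
have h0 : 0 < b i - a i by rewrite subr_gt0.
have h1 : 0 < (x - a i) * (b i - a i)^-1 by rewrite divr_gt0// subr_gt0.
have h2 : (x - a i) * (b i - a i)^-1 < 1 by rewrite ltr_pdivrMr//; lra.
rewrite -mulrA ler_norml; apply/andP; split; lra.
Qed.

End MatrixDerivatives.

Section CellLinear2.
Context {R : realType} {N p : nat}.
Variable lam : 'rV[R]_N -> 'M[R]_(p, N).
Hypothesis lam_smooth : smooth_forms lam.
Hypothesis lam_free : forall y, row_free (lam y).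
Variable q : nat.
Local Notation proj := (proj lam).
Local Notation dproj := (dproj lam).
Implicit Types (u : R -> 'rV[R]_N) (a b t : R) (i : 'I_N).
Local Notation fund := (fund lam).
Local Notation Hmx := (Hmx lam).
Local Notation wcurve := (wcurve lam q).
Local Notation kapf := (kapf lam q).
Local Notation kapr := (kapr lam q).
Local Notation gsrc := (gsrc lam q).

(** Differentiate the identity [proj y *m (lam y)^T = 0]. *)
Lemma partial_proj_lam (s : 'I_p) (y : 'rV[R]_N) (nu ta : 'I_N) :
  \sum_k partial ta (fun y => proj y nu k) y * lam y s k =
  - \sum_k proj y nu k * partial ta (fun y => lam y s k) y.
Proof.
apply/eqP; rewrite -addr_eq0 -big_split /=.
have dP k : derivable (fun y => proj y nu k) y (delta_mx 0 ta).
  by have [_] := proj_smooth lam_smooth lam_free nu k [::]; apply.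
have dL k : derivable (fun y => lam y s k) y (delta_mx 0 ta).
  by have [_] := lam_smooth s k [::]; apply.
have : partial ta (fun y => (\sum_k (fun y => proj y nu k) * (fun y => lam y s k)) y) y = 0.
  rewrite (_ : (fun y => _) = cst 0) ?/partial ?derive_cst//.
  apply/funext => z; rewrite fct_sumE /=.
  have /matrixP/(_ nu s) := proj_lam lam_free z; rewrite mxE [RHS]mxE => e.
  by rewrite -[RHS]e; apply: eq_bigr => k _; rewrite [(_^T) _ _]mxE.
rewrite /partial derive_sum; last by move=> k; exact: (derivableM (dP k) (dL k)).
move=> h; apply/eqP; rewrite -[RHS]h; apply: eq_bigr => k _.
rewrite [RHS](deriveM (dP k) (dL k)) /GRing.scale/= addrC; congr (_ + _).
exact: mulrC.
Qed.

Section OneCell.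
Variables (a b : R) (U : set R) (u : R -> 'rV[R]_N) (L : R).
Hypothesis ab : a < b.
Hypothesis ab1 : b - a <= 1.
Hypothesis oU : open U.
Hypothesis abU : forall t, a <= t <= b -> U t.
Hypothesis su : smooth_on U u.
Hypothesis hu : forall t, U t -> derive1 u t *m proj (u t) = derive1 u t.
Hypothesis du : forall t, a < t < b -> detA lam q u t != 0.
Hypothesis L0 : 0 <= L.
Hypothesis Lab : L * (b - a) <= 2^-1.
Hypothesis hL : forall t (w : 'rV[R]_N), a <= t <= b -> `|w *m Hmx u t| <= L * `|w|.

(** Bridge between two linearisations: on the left that of the forms along [u], on the right the
    forms applied to the control that the linearised control equation assigns to [w]. So [w] is
    infinitesimally horizontal iff that control is horizontal. *)
Lemma linop (w : R -> 'rV[R]_N) t : U t -> derivable w t 1 ->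
  derive1 (fun y => Lmx lam u y *m (w y)^T) t - Rmx lam u t *m (w t)^T =
  lam (u t) *m (derive1 w t - w t *m Hmx u t)^T.
Proof.
move=> Ut dw; have [dwT eT] := derive1_trmx dw.
have dLm : derivable (Lmx lam u) t 1 := @smooth_Lmx _ _ _ lam lam_smooth U u oU su 0%N t Ut.
rewrite (derive1_mulmx dLm dwT) eT linearB /= mulmxBr -/(Lmx lam u t).
rewrite addrAC addrC; congr (_ + _); rewrite -mulmxBl.
have du0 : derivable u t 1 := @su 0%N t Ut.
have eL s mu : derive1 (Lmx lam u) t s mu =
    \sum_nu partial nu (fun z => lam z s mu) (u t) * derive1 u t 0 nu.
  rewrite derive1E (derive_mx dLm) mxE.
  by have [_ ->] := is_derive_chain (smooth_C1 (lam_smooth s mu)) du0.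
have eR s mu : Rmx lam u t s mu =
    \sum_nu partial nu (fun z => lam z s mu) (u t) * derive1 u t 0 nu -
    \sum_nu partial mu (fun z => lam z s nu) (u t) * derive1 u t 0 nu.
  rewrite mxE /dform.
  under eq_bigr => nu _ do under eq_bigr => ta _ do rewrite !mxE !eqxx /= mulrBr.
  under eq_bigr => nu _ do rewrite sumrB.
  rewrite sumrB; congr (_ - _).
    apply: eq_bigr => nu _; rewrite (bigD1 mu)//= eqxx mulr1 big1 ?addr0// => ta tm.
    by rewrite (negbTE tm) !mulr0.
  rewrite (bigD1 mu)//= [X in _ + X]big1 ?addr0 => [|nu nm].
    by apply: eq_bigr => ta _; rewrite eqxx mulr1.
  by rewrite big1// => ta _; rewrite (negbTE nm) !mulr0.
apply/matrixP => s j; rewrite (ord1 j) {j} [LHS]mxE [RHS]mxE [X in _ = - X]mxE -sumrN.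
(* The derivatives of the forms along [u] cancel between the two matrices; what is left is their
   derivative along [w]. *)
have e0 mu : (derive1 (Lmx lam u) t - Rmx lam u t) s mu * (w t)^T mu 0 =
    (\sum_nu partial mu (fun z : 'rV_N => lam z s nu) (u t) * derive1 u t 0 nu) * w t 0 mu.
  have -> : (derive1 (Lmx lam u) t - Rmx lam u t) s mu = derive1 (Lmx lam u) t s mu - Rmx lam u t s mu.
    by rewrite mxE; congr (_ + _); rewrite mxE.
  by rewrite eL eR [(_^T) _ _]mxE opprB addrC subrK.
rewrite (eq_bigr _ (fun mu _ => e0 mu)).
have e1 k : - (lam (u t) s k * (w t *m Hmx u t)^T k 0) =
    \sum_ta w t 0 ta * \sum_nu derive1 u t 0 nu * - (partial ta (fun y => proj y nu k) (u t) * lam (u t) s k).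
  rewrite !mxE mulr_sumr -sumrN; apply: eq_bigr => ta _.
  rewrite mxE !mulr_sumr -sumrN; apply: eq_bigr => nu _; ring.
rewrite (eq_bigr _ (fun k _ => e1 k)) exchange_big /=; apply: eq_bigr => ta _.
rewrite -mulr_sumr mulrC; congr (_ * _).
rewrite exchange_big /=.
(* [partial_proj_lam] shifts the derivative from [proj] to the forms; the projection that remains
   next to the derivative of [u] disappears by [hu]. *)
have e2 nu : \sum_k derive1 u t 0 nu * - (partial ta (fun y => proj y nu k) (u t) * lam (u t) s k)
   = \sum_k derive1 u t 0 nu * proj (u t) nu k * partial ta (fun y => lam y s k) (u t).
  rewrite -mulr_sumr sumrN partial_proj_lam opprK mulr_sumr.
  by apply: eq_bigr => k _; rewrite mulrA.
rewrite (eq_bigr _ (fun nu _ => e2 nu)) exchange_big /=; apply: eq_bigr => k _.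
rewrite -mulr_suml mulrC; congr (_ * _).
by have /rowP/(_ k) := hu Ut; rewrite mxE.
Qed.

Lemma smooth_gsrc i : smooth_on `]a, b[ (gsrc a b u i).
Proof.
have oC := @open_cell R a b.
have sC := sub_cell abU.
have suC : smooth_on `]a, b[ u := smooth_on_sub sC su.
have suN : \forall j \near unit_filter, smooth_on `]a, b[ u by apply/near_unit.
have hB : \forall j \near unit_filter, forall y, (set0 : set R) y -> `|u y| <= 0 by apply/near_unit.
pose w (_ : unit) := Num.max 1 (b - a)^-1.
have w1 j : 1 <= w j by rewrite /w le_max lexx.
have hs k : cvb unit_filter (fun=> `]a, b[%classic) (fun=> set0) w k
   (fun=> stepc a b) (fun=> stepc a b).
  apply: (stepc_cvb (fun=> oC) (fun=> @sub0set _ _) w1); apply/near_unit => //.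
  by rewrite ab ab1 /w le_max lexx orbT.
have sstep := unit_cvb_smooth hs.
have sdet : smooth_on (V := R^o) `]a, b[ (detA lam q u).
  apply: (@jcv_smooth _ _ set0 (fun=> detA lam q u) (fun=> detA lam q u)) => k.
  apply: (@detA_cvb _ _ _ lam lam_smooth q unit unit_filter _ (fun=> `]a, b[%classic) (fun=> set0)
    (fun=> 1) (fun=> oC) (fun=> @sub0set _ _) (fun=> lexx 1) (fun=> u) (fun=> u) 0 suN suN hB).
  exact: smooth_vjcv.
apply: (smooth_onM oC).
  apply: (@jcv_smooth _ _ set0 (fun _ t => (detA lam q u t)^-1 * derive1 (stepc a b) t)
     (fun _ t => (detA lam q u t)^-1 * derive1 (stepc a b) t)) => k.
  apply: (cvbM (fun=> oC) (fun=> @sub0set _ _) (fun=> lexx 1)).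
    apply: (cvbV (c := 1) (fun=> oC) (fun=> @sub0set _ _) (fun=> lexx 1)) => //.
    - exact: smooth_jcv0.
    - apply/near_unit => x; rewrite /= in_itv/= => xab; split; exact: du.
  exact: (cvb_derive (smooth_jcv0 k.+1 oC sstep)).
apply: (smooth_on_mulmx oC); first exact: (smooth_Lmx lam_smooth oC suC).
apply: (smooth_on_trmx oC).
exact: (smooth_fund lam_smooth lam_free ab oU abU su L0 Lab hL).
Qed.

End OneCell.
End CellLinear2.

Section CellAdmissible.
Context {R : realType} {N p : nat}.
Variable lam : 'rV[R]_N -> 'M[R]_(p, N).
Hypothesis lam_smooth : smooth_forms lam.
Hypothesis lam_free : forall y, row_free (lam y).
Variable q : nat.
Local Notation proj := (proj lam).
Local Notation dproj := (dproj lam).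
Implicit Types (u : R -> 'rV[R]_N) (a b t : R) (i : 'I_N).
Local Notation fund := (fund lam).
Local Notation Hmx := (Hmx lam).
Local Notation wcurve := (wcurve lam q).
Local Notation kapf := (kapf lam q).
Local Notation kapr := (kapr lam q).
Local Notation kapm := (kapm lam q).
Local Notation wm := (wm lam q).
Local Notation gsrc := (gsrc lam q).

Lemma is_derive_on (V : normedModType R) (U : set R) (f g : R -> V) (x : R) d : open U -> U x ->
  (forall y, U y -> f y = g y) -> is_derive x 1 f d -> is_derive x 1 g d.
Proof.
move=> oU Ux fg [df ef]; apply: DeriveDef; first exact: (eq_derivable_onV oU fg Ux df).
have := @derive1n_local _ _ U f g 1 oU fg x Ux.
by rewrite !derive1n1 !derive1E => <-.
Qed.

Section OneCell.
Variables (a b : R) (U : set R) (u : R -> 'rV[R]_N) (L : R).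
Hypothesis ab : a < b.
Hypothesis ab1 : b - a <= 1.
Hypothesis oU : open U.
Hypothesis abU : forall t, a <= t <= b -> U t.
Hypothesis su : smooth_on U u.
Hypothesis hu : forall t, U t -> derive1 u t *m proj (u t) = derive1 u t.
Hypothesis du : forall t, a < t < b -> detA lam q u t != 0.
Hypothesis L0 : 0 <= L.
Hypothesis Lab : L * (b - a) <= 2^-1.
Hypothesis hL : forall t (w : 'rV[R]_N), a <= t <= b -> `|w *m Hmx u t| <= L * `|w|.
Local Notation C := (`]a, b[%classic : set R).
Let oC : open C := @open_cell R a b.
Let sC : forall t, C t -> U t := sub_cell abU.
Let suC : smooth_on C u := smooth_on_sub sC su.

Lemma smooth_stepc : smooth_on (V := R^o) C (stepc a b).
Proof.
pose w (_ : unit) := Num.max 1 (b - a)^-1.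
have w1 j : 1 <= w j by rewrite /w le_max lexx.
have hs k : cvb unit_filter (fun=> C) (fun=> set0) w k (fun=> stepc a b) (fun=> stepc a b).
  apply: (stepc_cvb (fun=> oC) (fun=> @sub0set _ _) w1); apply/near_unit => //.
  by rewrite ab ab1 /w le_max lexx orbT.
exact: unit_cvb_smooth hs.
Qed.

Lemma fund_smooth i : smooth_on C (fund a b u i).
Proof. exact: (smooth_fund lam_smooth lam_free ab oU abU su L0 Lab hL). Qed.

Lemma Mop_gsrc_smooth i : smooth_on C (Mop lam q u (gsrc a b u i)).
Proof.
have h := smooth_gsrc lam_smooth lam_free ab ab1 oU abU su du L0 Lab hL (i := i).
exact: (Mop_smooth lam_smooth oC suC h).
Qed.

Lemma smooth_wcurve i : smooth_on C (wcurve a b u i).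
Proof.
have h1 := smooth_onM oC smooth_stepc (@fund_smooth i).
have h2 := smooth_on_trmx oC (@Mop_gsrc_smooth i).
exact: (smooth_onD oC h1 h2).1.
Qed.

Lemma fund_deriv i t : a <= t <= b -> is_derive t 1 (fund a b u i) (fund a b u i t *m Hmx u t).
Proof. by have [_] := fundP lam_smooth lam_free ab oU abU su L0 Lab hL i; apply. Qed.

Lemma fund_b i : fund a b u i b = delta_mx 0 i.
Proof. by have [] := fundP lam_smooth lam_free ab oU abU su L0 Lab hL i. Qed.

(** By [linop] it suffices to linearise along [wcurve]: [fund] contributes nothing, its control
    being zero, the cut-off contributes the derivative of [stepc] times the forms on [fund], and
    [Mop_inverse] applied to [gsrc] cancels precisely this. *)
Lemma kapf_lam i t : C t -> lam (u t) *m (kapf a b u i t)^T = 0.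
Proof.
move=> Ct; have Ut := sC Ct.
have /andP[ta tb] : a < t < b by have := Ct; rewrite /= in_itv.
have tab : a <= t <= b by rewrite !ltW.
have dw : derivable (wcurve a b u i) t 1 := @smooth_wcurve i 0%N t Ct.
rewrite -(linop lam_smooth lam_free oU su hu Ut dw).
have sf := @fund_smooth i; have sM := @Mop_gsrc_smooth i.
have sL : smooth_on C (Lmx lam u) := smooth_Lmx lam_smooth oC suC.
have sLf := smooth_on_mulmx oC sL (smooth_on_trmx oC sf).
have sLM := smooth_on_mulmx oC sL sM.
have s1 := smooth_onM oC smooth_stepc sLf.
have wT y : (wcurve a b u i y)^T = stepc a b y *: (fund a b u i y)^T + Mop lam q u (gsrc a b u i) y.
  by rewrite /wcurve linearD /= trmxK linearZ.
have e : eqU C (fun y => Lmx lam u y *m (wcurve a b u i y)^T)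
   (fun y => stepc a b y *: (Lmx lam u y *m (fund a b u i y)^T) + Lmx lam u y *m Mop lam q u (gsrc a b u i) y).
  by move=> y _; rewrite wT mulmxDr scalemxAr.
rewrite (eqU_derive1 oC e Ct) wT mulmxDr.
have := (smooth_onD oC s1 sLM).2 1%N t Ct; rewrite !derive1n1 => ->.
have [_ ->] := derive1_scale (@smooth_stepc 0%N t Ct) (sLf 0%N t Ct).
have hM := @Mop_inverse _ _ _ lam lam_smooth q C oC u suC _
  (smooth_gsrc lam_smooth lam_free ab ab1 oU abU su du L0 Lab hL (i := i)) t Ct.
have df : derivable (fund a b u i) t 1 := sf 0%N t Ct.
have hf := linop lam_smooth lam_free oU su hu Ut df.
rewrite (is_derive_derive1 (fund_deriv i tab)) subrr trmx0 mulmx0 in hf.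
move/eqP: hf; rewrite subr_eq0 => /eqP hf.
move/(congr1 -%R): hM; rewrite opprB => hM.
have alg (V : zmodType) (A B' X Y : V) : A + B' + X - (B' + Y) = A + (X - Y).
  by rewrite (addrAC A) opprD addrA addrK addrA.
rewrite hf -scalemxAr alg.
rewrite hM /gsrc scalerA mulrA mulfV ?du ?ta// mul1r.
by rewrite -/(Lmx lam u t) subrr.
Qed.

Lemma kapf_proj i t : C t -> kapf a b u i t *m proj (u t) = kapf a b u i t.
Proof.
move=> Ct; apply: proj_id; apply: trmx_inj.
by rewrite trmx_mul trmxK trmx0; exact: kapf_lam.
Qed.

Lemma kapr_right i t : b - (b - a) / 3 < t -> kapr a b u i t = 0.
Proof.
move=> tb; rewrite /kapr; case: ifP => // /andP[ta tb'].
have := @eqU_derive1 R _ (@open_gt_set R (b - (b - a) / 3)) 1 N (wcurve a b u i) (fund a b u i)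
  (fun y hy => wcurve_right lam q u i ab hy) t tb.
rewrite /kapf => ->; rewrite (wcurve_right lam q u i ab tb).
have tab : a <= t <= b by rewrite !ltW.
by rewrite (is_derive_derive1 (fund_deriv i tab)) subrr.
Qed.

Lemma cell_cases t : a <= t <= b ->
  [\/ t < a + (b - a) / 3, b - (b - a) / 3 < t | C t].
Proof.
move=> /andP[ta tb]; have ab' := ab.
have [h|h] := ltrP t (a + (b - a) / 3); first by constructor 1.
have [h'|h'] := ltrP (b - (b - a) / 3) t; first by constructor 2.
by constructor 3; rewrite /= in_itv/=; apply/andP; split; lra.
Qed.

Lemma wcurve_deriv i t : a <= t <= b ->
  is_derive t 1 (wcurve a b u i) (wcurve a b u i t *m Hmx u t + kapr a b u i t).
Proof.
move=> tab; have [h|h|h] := cell_cases tab.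
- rewrite (wcurve_left lam q u i ab h) (kapr_left lam q u i ab h) mul0mx addr0.
  apply: (is_derive_on (f := cst 0) (@open_lt_set R (a + (b - a) / 3)) h).
  by move=> y hy; rewrite (wcurve_left lam q u i ab hy).
- rewrite (wcurve_right lam q u i ab h) (kapr_right i h) addr0.
  apply: (is_derive_on (f := fund a b u i) (@open_gt_set R (b - (b - a) / 3)) h _ (fund_deriv i tab)) => y hy.
  by rewrite (wcurve_right lam q u i ab hy).
- have /andP[ta tb] : a < t < b by have := h; rewrite /= in_itv.
  rewrite /kapr ta tb /= /kapf addrC subrK; apply: DeriveDef; last by rewrite derive1E.
  exact: (@smooth_wcurve i 0%N t h).
Qed.

Lemma smooth_kapf i : smooth_on C (kapf a b u i).
Proof.
have h1 := smooth_on_derive1 (@smooth_wcurve i).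
have h2 := smooth_on_mulmx oC (@smooth_wcurve i)
  (smooth_on_sub sC (smooth_Hmx lam_smooth lam_free oU su)).
have h3 := (smooth_onZ oC (-1) h2).1.
have := (smooth_onD oC h1 h3).1.
by apply: (smooth_on_ext oC) => x _; rewrite scaleN1r.
Qed.

Lemma continuous_on (U' : set R) (f g : R -> 'rV[R]_N) (t : R) : open U' -> U' t ->
  (forall y, U' y -> f y = g y) -> {for t, continuous f} -> {for t, continuous g}.
Proof.
move=> oU' Ut fg cf; rewrite /prop_for /continuous_at -(fg t Ut).
apply: cvg_trans cf; apply: near_eq_cvg.
have := open_nbhs_nbhs (conj oU' Ut); apply: filterS => y Uy.
by first [apply: fg | apply: esym; apply: fg].
Qed.

Lemma kapr_continuous i t : a <= t <= b -> {for t, continuous (kapr a b u i)}.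
Proof.
move=> tab; have [h|h|h] := cell_cases tab.
- apply: (continuous_on (f := cst 0) (@open_lt_set R (a + (b - a) / 3)) h); last exact: cst_continuous.
  by move=> y hy; rewrite (kapr_left lam q u i ab hy).
- apply: (continuous_on (f := cst 0) (@open_gt_set R (b - (b - a) / 3)) h); last exact: cst_continuous.
  by move=> y hy; rewrite (kapr_right i hy).
- apply: (continuous_on (f := kapf a b u i) oC h).
    by move=> y; rewrite /= in_itv /kapr => /= ->.
  by apply: differentiable_continuous; apply/derivable1_diffP; exact: (@smooth_kapf i 0%N t h).
Qed.

Lemma th_kapm (th : 'rV[R]_N) t : th *m kapm a b u t = \sum_i th 0 i *: kapr a b u i t.
Proof. by rewrite mulmx_sum_row; apply: eq_bigr => i _; rewrite rowK. Qed.

Lemma th_wm (th : 'rV[R]_N) t : th *m wm a b u t = \sum_i th 0 i *: wcurve a b u i t.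
Proof. by rewrite mulmx_sum_row; apply: eq_bigr => i _; rewrite rowK. Qed.

Lemma cell_admissible B C1 C2 V0 K : 1 <= K -> C1 * (V0 + 2) * (b - a) <= 2^-1 ->
  C2 * V0 * (b - a) <= 2^-1 ->
  (forall t, a <= t <= b -> `|u t| <= B) -> (forall t, a <= t <= b -> `|derive1 u t| <= V0) ->
  (forall (th : 'rV[R]_N) t, a < t < b -> `|th *m kapm a b u t| <= K * `|th|) ->
  admissible lam B C1 C2 V0 a b u (kapm a b u) (wm a b u) K.
Proof.
move=> K1 hC1 hC2 hB hV hK.
split; [exact: ab|exact: ab1|exact: K1|exact: hC1|exact: hC2|exact: hB|exact: hV|..].
- move=> t tab; apply: differentiable_continuous; apply/derivable1_diffP.
  exact: (@su 1%N t (abU tab)).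
- move=> t tab; rewrite (hu (abU tab)); apply: DeriveDef; last by rewrite derive1E.
  exact: (@su 0%N t (abU tab)).
- move=> th t _; have [/hK//|h] := boolP (a < t < b).
  rewrite th_kapm big1 ?normr0 ?mulr_ge0//; first by rewrite (le_trans _ K1).
  by move=> i _; rewrite /kapr (negbTE h) scaler0.
- move=> th t tab.
  rewrite (_ : (fun t => _) = fun t => \sum_i th 0 i *: kapr a b u i t); last first.
    by apply/funext => s; rewrite th_kapm.
  apply: cvg_big => [|i _]; first exact: add_continuous.
  by apply: cvgZ; [exact: cvg_cst|exact: kapr_continuous].
- move=> t tab; apply/row_matrixP => i; rewrite row_mul rowK /kapr.
  case: ifP => [h|_]; last by rewrite mul0mx.
  by rewrite kapf_proj//= in_itv.
- apply/matrixP => i j; rewrite mxE [RHS]mxE (wcurve_left lam q u i ab) ?mxE// ltrDl divr_gt0 ?subr_gt0 //.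
- apply/matrixP => i j; rewrite mxE (wcurve_right lam q u i ab) ?fund_b ?mxE ?eqxx 1?eq_sym//=; rewrite ?(eq_sym j)//.
  by rewrite ltrBlDr ltrDl divr_gt0 ?subr_gt0 //.
- move=> th t tab; rewrite -Hmx_dproj.
  rewrite (_ : (fun t => _) = fun t => \sum_i th 0 i *: wcurve a b u i t); last first.
    by apply/funext => s; rewrite th_wm.
  rewrite th_wm th_kapm mulmx_suml -big_split /=.
  have -> : (fun t => \sum_i th 0 i *: wcurve a b u i t) = \sum_i (th 0 i \*: wcurve a b u i).
    by apply/funext => s; rewrite fct_sumE.
  apply: is_derive_sum => i; rewrite -scalemxAl -scalerDr.
  by apply: is_deriveZ; exact: wcurve_deriv.
Qed.

End OneCell.
End CellAdmissible.

Lemma linear_ode_compare (R : realType) N (f1 f2 : R -> 'rV[R]_N) (H1 H2 : R -> 'M[R]_N)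
    (a b L h : R) : a < b -> b - a <= 1 -> 0 <= h -> 0 <= L -> L * (b - a) <= 2^-1 ->
  (forall t, a <= t <= b -> is_derive t 1 f1 (f1 t *m H1 t)) ->
  (forall t, a <= t <= b -> is_derive t 1 f2 (f2 t *m H2 t)) ->
  f1 b = f2 b -> (forall t, a <= t <= b -> `|f2 t| <= 2) ->
  (forall t (w : 'rV[R]_N), a <= t <= b -> `|w *m H1 t| <= L * `|w|) ->
  (forall t, a < t < b -> forall i j, `|H1 t i j - H2 t i j| <= h) ->
  forall x, a <= x <= b -> `|f1 x - f2 x| <= 4 * N%:R * h.
Proof.
move=> ab ab1 h0 L0 Lab d1 d2 fb f2b hL hH x xab.
have bb : a <= b <= b by rewrite lexx ltW.
have eN : 0 <= N%:R * h * 2 := (mulr_ge0 (mulr_ge0 (ler0n _ _) h0) (ler0n _ 2)).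
have := ode_dependence L0 eN Lab bb d1 d2 _ xab.
rewrite fb subrr normr0 add0r => hh; apply: le_trans (hh _) _.
  move=> s /[dup] sab' /andP[s1 s2]; have sab : a <= s <= b by rewrite !ltW.
  have -> : f1 s *m H1 s - f2 s *m H2 s = (f1 s - f2 s) *m H1 s + f2 s *m (H1 s - H2 s).
    by rewrite mulmxBl mulmxBr addrA subrK.
  apply: le_trans (ler_normD _ _) _; apply: lerD; first exact: hL.
  apply: le_trans (mulmx_row_le _ h0 _) _.
    by move=> i j; rewrite !mxE; exact: hH.
  by apply: ler_wpM2l; [exact: (mulr_ge0 (ler0n _ _) h0)|exact: f2b].
have ba0 : 0 <= b - a by rewrite subr_ge0 ltW.
have t0 : 0 <= 4 * N%:R * h := mulr_ge0 (mulr_ge0 (ler0n _ 4) (ler0n _ _)) h0.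
rewrite (_ : 2 * _ = (b - a) * (4 * N%:R * h)); last by ring.
by rewrite ler_piMl.
Qed.

(** * Dependence of linear steering on the curve, uniformly in the cell *)

Section CellFamilies.
Context {R : realType} {N p : nat}.
Variable lam : 'rV[R]_N -> 'M[R]_(p, N).
Hypothesis lam_smooth : smooth_forms lam.
Hypothesis lam_free : forall y, row_free (lam y).
Variable q : nat.
Local Notation proj := (proj lam).
Local Notation fund := (fund lam).
Local Notation Hmx := (Hmx lam).
Local Notation wcurve := (wcurve lam q).
Local Notation kapf := (kapf lam q).
Local Notation gsrc := (gsrc lam q).
Variables (U : set R) (L : R).
Hypotheses (oU : open U) (L0 : 0 <= L).

Record good_cell (a b : R) (u : R -> 'rV[R]_N) : Prop := GoodCell {
  gc_ab : a < b; gc_ab1 : b - a <= 1;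
  gc_U : forall t, a <= t <= b -> U t;
  gc_s : smooth_on U u;
  gc_h : forall t, U t -> derive1 u t *m proj (u t) = derive1 u t;
  gc_d : forall t, a < t < b -> detA lam q u t != 0;
  gc_L : L * (b - a) <= 2^-1;
  gc_hL : forall t (w : 'rV[R]_N), a <= t <= b -> `|w *m Hmx u t| <= L * `|w| }.

Lemma gc_fund a b u i t : good_cell a b u -> a <= t <= b ->
  is_derive t 1 (fund a b u i) (fund a b u i t *m Hmx u t).
Proof. by case=> ab ab1 aU su hu du Lab hL; exact: (fund_deriv lam_smooth lam_free ab oU aU su L0 Lab hL). Qed.

Lemma gc_fund_b a b u i : good_cell a b u -> fund a b u i b = delta_mx 0 i.
Proof. by case=> ab ab1 aU su hu du Lab hL; exact: (fund_b lam_smooth lam_free ab oU aU su L0 Lab hL). Qed.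

Lemma gc_sub a b u : good_cell a b u -> smooth_on `]a, b[ u.
Proof. by case=> ab ab1 aU su hu du Lab hL; exact: smooth_on_sub (sub_cell aU) su. Qed.

Lemma gc_gsrc a b u i : good_cell a b u -> smooth_on `]a, b[ (gsrc a b u i).
Proof. by case=> ab ab1 aU su hu du Lab hL; exact: (smooth_gsrc lam_smooth lam_free ab ab1 oU aU su du L0 Lab hL). Qed.

Lemma gc_wcurve a b u i : good_cell a b u -> smooth_on `]a, b[ (wcurve a b u i).
Proof. by case=> ab ab1 aU su hu du Lab hL; exact: (smooth_wcurve lam_smooth lam_free ab ab1 oU aU su du L0 Lab hL). Qed.

Lemma delta_norm (i : 'I_N) : `|delta_mx 0 i : 'rV[R]_N| <= 1.
Proof.
apply: row_norm_le => // mu; rewrite mxE eqxx /=.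
by case: (mu == i); rewrite ?normr1 ?normr0.
Qed.

Lemma fund_le a b u i t : good_cell a b u -> a <= t <= b -> `|fund a b u i t| <= 2.
Proof.
move=> gc tab; have ab := gc_ab gc.
have bb : a <= b <= b by rewrite lexx ltW.
have := ode_dependence L0 (lexx 0) (gc_L gc) bb (fun s hs => gc_fund i gc hs)
  (fun s hs => is_derive_cst (0 : 'rV[R]_N) s (1 : R)) _ tab.
rewrite !subr0 mulr0 addr0 (gc_fund_b i gc) => h.
apply: le_trans (h _) _; last first.
  by rewrite -[leRHS]mulr1 ler_pM2l//; exact: delta_norm.
by move=> s /andP[? ?]; rewrite !subr0 addr0; apply: (gc_hL gc); rewrite !ltW.
Qed.

Context {I : Type} (G : set_system I) {FG : Filter G}.
Variables (a b w : I -> R) (u v : I -> R -> 'rV[R]_N) (B c : R).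
Hypothesis w1 : forall i, 1 <= w i.
Hypothesis hw : \forall i \near G, (b i - a i)^-1 <= w i.
Hypothesis gu : \forall i \near G, good_cell (a i) (b i) (u i).
Hypothesis gv : \forall i \near G, good_cell (a i) (b i) (v i).
Hypothesis vB : \forall i \near G, forall t, a i < t < b i -> `|v i t| <= B.
Hypothesis c0 : 0 < c.
Hypothesis hc : \forall i \near G, forall t, a i < t < b i ->
  c <= `|detA lam q (u i) t| /\ c <= `|detA lam q (v i) t|.
Let O i : set R := `]a i, b i[.
Let oO i : open (O i) := @open_cell R (a i) (b i).
Let OO i : O i `<=` O i := @subset_refl _ (O i).
Local Notation cvb := (cvb G O O w).
Local Notation vcvb := (vcvb G O O w).
Hypothesis uv : forall k, vcvb k u v.

Let su : \forall i \near G, smooth_on (O i) (u i).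
Proof. by apply: filterS gu => i; exact: gc_sub. Qed.
Let sv : \forall i \near G, smooth_on (O i) (v i).
Proof. by apply: filterS gv => i; exact: gc_sub. Qed.
Let vBO : \forall i \near G, forall x, O i x -> `|v i x| <= B.
Proof. by apply: filterS vB => i h x; rewrite /O /= in_itv /=; exact: h. Qed.

Lemma Hmx_cvb k s mu :
  cvb k (fun i x => Hmx (u i) x s mu) (fun i x => Hmx (v i) x s mu).
Proof.
have h : cvb k (fun i x => \sum_nu derive1 (u i) x 0 nu * partial s (fun y => proj y nu mu) (u i x))
   (fun i x => \sum_nu derive1 (v i) x 0 nu * partial s (fun y => proj y nu mu) (v i x)).
  apply: (cvb_sum oO OO w1) => nu _; apply: (cvbM oO OO w1).
    exact: (vcvb_derive1 oO OO su sv (uv k.+1)).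
  exact: (cvb_comp oO OO w1 (smooth_funD s (proj_smooth lam_smooth lam_free nu mu)) (uv k) vBO).
by apply: (cvb_congr oO OO _ _ h) => i x _; rewrite mxE.
Qed.

(** Both solutions have the same value at [b], so order zero is [linear_ode_compare]; higher orders
    follow from the equation by bootstrap. *)
Lemma fund_cvb j k : vcvb k (fun i => fund (a i) (b i) (u i) j) (fun i => fund (a i) (b i) (v i) j).
Proof.
have du : \forall i \near G, forall x, O i x ->
    is_derive x 1 (fund (a i) (b i) (u i) j) (fund (a i) (b i) (u i) j x *m Hmx (u i) x).
  by apply: filterS gu => i g x; rewrite /O /= in_itv /= => /andP[? ?]; apply: gc_fund => //; rewrite !ltW.
have dv : \forall i \near G, forall x, O i x ->
    is_derive x 1 (fund (a i) (b i) (v i) j) (fund (a i) (b i) (v i) j x *m Hmx (v i) x).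
  by apply: filterS gv => i g x; rewrite /O /= in_itv /= => /andP[? ?]; apply: gc_fund => //; rewrite !ltW.
have h0 : vcvb 0 (fun i => fund (a i) (b i) (u i) j) (fun i => fund (a i) (b i) (v i) j).
  apply: (vcvb0 w1 (B := 2)).
  - by apply: filterS du => i h x Ox; case: (h x Ox).
  - by apply: filterS dv => i h x Ox; case: (h x Ox).
  - by apply: filterS gv => i g x; rewrite /O /= in_itv /= => /andP[? ?]; apply: fund_le => //; rewrite !ltW.
  move=> m e e0.
  (* Absorbs the factor [4 N] of [linear_ode_compare]; [N.+1] rather than [N] avoids a zero
     denominator. *)
  pose e1 := e / (8 * N.+1%:R).
  have N0 : 0 < N.+1%:R :> R by rewrite ltr0n.
  have e10 : 0 < e1 by rewrite divr_gt0// mulr_gt0.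
  have hH : \forall i \near G, forall s mu x, O i x -> `|Hmx (u i) x s mu - Hmx (v i) x s mu| * w i ^+ m <= e1.
    apply: (@cv0_near_forall N I G FG (fun s i => forall mu x, O i x -> _)) => s.
    apply: (@cv0_near_forall N I G FG (fun mu i => forall x, O i x -> _)) => mu.
    by have [_ _ _ h] := cvb_cv0 (Hmx_cvb 0 s mu); exact: h.
  apply: filterS3 gu gv hH => i g1 g2 hHi x Ox.
  have W0 : 0 < w i ^+ m by rewrite exprn_gt0// (lt_le_trans ltr01).
  have xab : a i <= x <= b i by move: Ox; rewrite /O /= in_itv /= => /andP[? ?]; rewrite !ltW.
  have h00 : 0 <= e1 / w i ^+ m by rewrite divr_ge0// ltW.
  have hH' t : a i < t < b i -> forall s mu, `|Hmx (u i) t s mu - Hmx (v i) t s mu| <= e1 / w i ^+ m.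
    move=> ht s mu; rewrite ler_pdivlMr//; apply: hHi.
    by rewrite /O /= in_itv.
  have hh := linear_ode_compare (gc_ab g1) (gc_ab1 g1) h00 L0 (gc_L g1) (fun t => @gc_fund _ _ _ j t g1)
    (fun t => @gc_fund _ _ _ j t g2) (etrans (gc_fund_b j g1) (esym (gc_fund_b j g2)))
    (fun t => @fund_le _ _ _ j t g2) (gc_hL g1) hH' xab.
  rewrite -ler_pdivlMr//; apply: le_trans hh _.
  rewrite mulrA ler_pM2r ?invr_gt0// /e1 mulrA ler_pdivrMr ?mulr_gt0// [leRHS]mulrC ler_pM2r//.
  have NN : N%:R <= N.+1%:R :> R by rewrite ler_nat.
  have Nn : 0 <= N%:R :> R by rewrite ler0n.
  lra.
elim: k => [//|k ih].
apply: (vcvb_ode oO OO du dv h0) => mu.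
have h : cvb k (fun i x => \sum_s fund (a i) (b i) (u i) j x 0 s * Hmx (u i) x s mu)
    (fun i x => \sum_s fund (a i) (b i) (v i) j x 0 s * Hmx (v i) x s mu).
  apply: (cvb_sum oO OO w1) => s _; apply: (cvbM oO OO w1); [exact: ih|exact: Hmx_cvb].
by apply: (cvb_congr oO OO _ _ h) => i x _; rewrite [RHS]mxE.
Qed.

Lemma stepc_fam k : cvb k (fun i => stepc (a i) (b i)) (fun i => stepc (a i) (b i)).
Proof.
apply: (stepc_cvb oO OO w1); first by apply: filterS2 gu hw => i [? ? _ _ _ _ _ _] ?.
by apply: nearW => i x; rewrite /O /= in_itv.
Qed.

Lemma gsrc_cvb j k s : cvb k (fun i x => gsrc (a i) (b i) (u i) j x s 0)
  (fun i x => gsrc (a i) (b i) (v i) j x s 0).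
Proof.
pose g (z : I -> R -> 'rV[R]_N) i x := ((detA lam q (z i) x)^-1 * derive1 (stepc (a i) (b i)) x) *
   \sum_m Lmx lam (z i) x s m * fund (a i) (b i) (z i) j x 0 m.
have h : cvb k (g u) (g v).
  apply: (cvbM oO OO w1); first apply: (cvbM oO OO w1).
  - apply: (cvbV (c := c) oO OO w1 c0).
    + exact: (detA_cvb lam_smooth oO OO w1 su sv vBO (uv _)).
    + apply: filterS2 gu gv => i g1 g2 x; rewrite /O /= in_itv /= => hx.
      by split; [exact: (gc_d g1)|exact: (gc_d g2)].
    + by apply: filterS hc => i hi x; rewrite /O /= in_itv /=; exact: hi.
  - exact: (cvb_derive (stepc_fam k.+1)).
  apply: (cvb_sum oO OO w1) => m _; apply: (cvbM oO OO w1); last exact: fund_cvb.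
  exact: (Lmx_cvb lam_smooth oO OO w1 s m vBO (uv k)).
apply: (cvb_congr oO OO _ _ h) => i x _; rewrite /g /gsrc [RHS]mxE; congr (_ * _);
  by rewrite [RHS]mxE; apply: eq_bigr => m _; rewrite [(_^T) _ _]mxE.
Qed.

Lemma Mop_cvb j k mu : cvb k (fun i x => Mop lam q (u i) (gsrc (a i) (b i) (u i) j) x mu 0)
  (fun i x => Mop lam q (v i) (gsrc (a i) (b i) (v i) j) x mu 0).
Proof.
pose g (z : I -> R -> 'rV[R]_N) i x := \sum_(l < q.+1) (-1) ^+ l *
   derive1n l (fun y => \sum_s bcoef lam (z i) l y mu s * gsrc (a i) (b i) (z i) j y s 0) x.
have h : cvb k (g u) (g v).
  apply: (cvb_sum oO OO w1) => l _; apply: (cvbM oO OO w1); first exact: (@cvb_cst R I G FG O O w oO OO k ((-1) ^+ l)).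
  apply: (cvb_deriven (j := l)); apply: (cvb_sum oO OO w1) => s _; apply: (cvbM oO OO w1).
    exact: (bcoef_cvb lam_smooth oO OO w1 su sv vBO l mu s (uv _)).
  exact: gsrc_cvb.
have e (z : I -> R -> 'rV[R]_N) : (\forall i \near G, good_cell (a i) (b i) (z i)) ->
    eq_fam G O (g z) (fun i x => Mop lam q (z i) (gsrc (a i) (b i) (z i) j) x mu 0).
  apply: filterS => i gz x Ox; rewrite /g /Mop summxE; apply: eq_bigr => l _.
  rewrite [RHS]mxE; congr (_ * _).
  have sz := gc_sub gz.
  have sm := smooth_on_mulmx (@oO i) (@bcoef_smooth R N p lam lam_smooth q (O i) (@oO i) (z i) sz l) (@gc_gsrc _ _ _ j gz).
  rewrite (derive1n_entryE l mu 0 (@oO i) sm Ox); congr (derive1n l _ x).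
  by apply/funext => y; rewrite [RHS]mxE.
exact: (cvb_ext oO OO (e u gu) (e v gv) h).
Qed.

Lemma wcurve_cvb j k : vcvb k (fun i => wcurve (a i) (b i) (u i) j) (fun i => wcurve (a i) (b i) (v i) j).
Proof.
move=> mu; pose g (z : I -> R -> 'rV[R]_N) i x := stepc (a i) (b i) x * fund (a i) (b i) (z i) j x 0 mu +
   Mop lam q (z i) (gsrc (a i) (b i) (z i) j) x mu 0.
have h : cvb k (g u) (g v).
  apply: (cvbD oO OO w1); last exact: Mop_cvb.
  by apply: (cvbM oO OO w1); [exact: stepc_fam|exact: fund_cvb].
apply: (cvb_congr oO OO _ _ h) => i x _; rewrite /g /wcurve [RHS]mxE; congr (_ + _);
  by rewrite [RHS]mxE.
Qed.

(** The control is assembled from the curve, its derivatives, the inverse determinant and [stepc] by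
    operations that the calculus respects. Taken with [u = v] the statement still has content: the
    control grows at most like a power of the weight. *)
Lemma kapf_cvb j k : vcvb k (fun i => kapf (a i) (b i) (u i) j) (fun i => kapf (a i) (b i) (v i) j).
Proof.
move=> mu; pose g (z : I -> R -> 'rV[R]_N) i x := derive1 (wcurve (a i) (b i) (z i) j) x 0 mu -
   \sum_s wcurve (a i) (b i) (z i) j x 0 s * Hmx (z i) x s mu.
have sw (z : I -> R -> 'rV[R]_N) : (\forall i \near G, good_cell (a i) (b i) (z i)) ->
    \forall i \near G, smooth_on (O i) (wcurve (a i) (b i) (z i) j).
  by apply: filterS => i gz; exact: gc_wcurve.
have h : cvb k (g u) (g v).
  apply: (cvbB oO OO w1).
    exact: (vcvb_derive1 oO OO (sw u gu) (sw v gv) (wcurve_cvb j k.+1)).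
  apply: (cvb_sum oO OO w1) => s _; apply: (cvbM oO OO w1); [exact: wcurve_cvb|exact: Hmx_cvb].
apply: (cvb_congr oO OO _ _ h) => i x _; rewrite /g /kapf [RHS]mxE; congr (_ + _);
  by rewrite [RHS]mxE [in RHS]mxE.
Qed.

End CellFamilies.

(** * Compact parameter spaces and families of curves *)

Section Compactness.
Context {R : realType}.

Lemma set_type_compact (X : topologicalType) (A : set X) :
  compact A -> compact [set: set_type A].
Proof.
move=> /compact_near_coveringP cA; apply/compact_near_coveringP => I F P FF h.
have := cA I F (fun i x => forall hx : x \in A, P i (exist _ x hx)) FF.
have hh x : A x -> \near x & F, forall hx : x \in A, P F (exist _ x hx).
  move=> Ax; have hx : x \in A by rewrite inE.
  have [[U V] /= [nU nV] UV] := h (exist _ x hx) Logic.I.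
  case: nU => W [[B oB <-] /= Bx BU].
  exists (B, V) => /=; first by split => //; exact: open_nbhs_nbhs.
  move=> [y i] /= [By Vi] hy; apply: (UV (exist _ y hy, i)); split => //=.
  exact: BU.
move=> /(_ hh); apply: filterS => i hi [y hy] _.
by apply: hi; have := hy; rewrite inE.
Qed.

Lemma compact_tube (Z : topologicalType) (X : topologicalType) (x0 : X)
    (Q : Z -> X -> Prop) : compact [set: Z] ->
  (forall z : Z, \forall p \near ((z, x0) : (Z * X)%type), Q p.1 p.2) ->
  \forall x \near x0, forall z, Q z x.
Proof.
move=> /compact_near_coveringP cZ h.
have FF : Filter (nbhs x0) by exact: nbhs_filter.
have := cZ X (nbhs x0) (fun x z => Q z x) FF (fun z _ => h z).
by apply: (@filterS _ _ FF) => x hx z; exact: hx.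
Qed.

(** Near-covering compactness with the filter at infinity: since [Q] is monotone in the bound, local
    bounds combine into one. *)
Lemma compact_bound (Z : topologicalType) (Q : Z -> R -> Prop) : compact [set: Z] ->
  (forall z B B', B <= B' -> Q z B -> Q z B') ->
  (forall z : Z, exists B, \forall z' \near z, Q z' B) -> exists B, forall z, Q z B.
Proof.
move=> /compact_near_coveringP cZ mono h.
have FF : Filter (pinfty_nbhs R) by exact: filter_filter.
have := cZ R (pinfty_nbhs R) (fun B z => Q z B) FF.
have hh z : [set: Z] z -> \forall z' \near z & B \near +oo%R, Q z' B.
  move=> _; have [B hB] := h z.
  exists ([set z' | Q z' B], [set B' | B < B']) => /=.
    by split => //; exists B; split => //; exact: num_real.
  by move=> [z' B'] /= [Qz' BB']; apply: mono Qz'; exact: ltW.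
move=> /(_ hh) [B [_ hB]]; exists (B + 1) => z.
by apply: (hB (B + 1)) => //; rewrite ltrDl.
Qed.

Lemma continuous_sum (T : topologicalType) (V : normedModType R) (J : Type) (r : seq J)
    (f : J -> T -> V) : (forall j, continuous (f j)) ->
  continuous (fun v => \sum_(j <- r) f j v).
Proof.
move=> h v; apply: cvg_big => [|i _]; [exact: add_continuous|exact: h].
Qed.

Lemma cube_compact k : compact (cube R k).
Proof.
have -> : cube R k = [set v | forall i, `[0, 1]%classic (v ord0 i)].
  by apply/seteqP; split => v h i; have := h i; rewrite /= in_itv.
by apply: (@rV_compact R k (fun=> `[0, 1]%classic)) => i; exact: segment_compact.
Qed.

Lemma simplex_compact k : compact [set v : 'rV[R]_k | (forall i, 0 <= v 0 i) /\ \sum_i v 0 i = 1].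
Proof.
have -> : [set v : 'rV[R]_k | (forall i, 0 <= v 0 i) /\ \sum_i v 0 i = 1] =
    cube R k `&` [set v | \sum_i v 0 i = 1].
  apply/seteqP; split => v [h0 h1]; split => //.
    move=> i; rewrite h0 /= -h1 (bigD1 i)//= lerDl.
    by apply: sumr_ge0 => j _; exact: h0.
  by move=> i; have /andP[] := h0 i.
have cl : closed ((fun v : 'rV[R]_k => \sum_i v 0 i) @^-1` [set 1]).
  apply: closed_comp; last exact: closed_eq.
  move=> v _; apply: (@continuous_sum _ R^o _ _ (fun i (v : 'rV[R]_k) => v 0 i)) => i.
  exact: coord_continuous.
exact: (compact_closedI (@cube_compact k) cl).
Qed.

Lemma polyhedron_compact m (P : set 'rV[R]_m) : compact_polyhedron P -> compact P.
Proof.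
move=> [S ->].
have h s : compact (conv_hull s : set 'rV[R]_m).
  have -> : conv_hull s = (fun v : 'rV[R]_(size s) => \sum_i v 0 i *: s`_i) @`
     [set v : 'rV[R]_(size s) | (forall i, 0 <= v 0 i) /\ \sum_i v 0 i = 1].
    apply/seteqP; split => y.
      move=> [al [al0 al1 ->]]; exists (\row_i al i).
        split => [i|]; rewrite ?mxE//.
        by rewrite -al1; apply: eq_bigr => i _; rewrite mxE.
      by apply: eq_bigr => i _; rewrite mxE.
    by move=> [v [v0 v1] <-]; exists (fun i => v 0 i).
  apply: continuous_compact; last exact: simplex_compact.
  apply: continuous_subspaceT; apply: continuous_sum => i v.
  exact: (cvgZ (@coord_continuous R 1 _ 0 i v) (cvg_cst _)).
elim: S => [|s S ih].
  have -> : \bigcup_(s in [set` [::]]) (conv_hull s : set 'rV[R]_m) = set0 by rewrite set_nil bigcup_set0.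
  exact: compact0.
have -> : \bigcup_(s in [set` s :: S]) (conv_hull s : set 'rV[R]_m) =
   conv_hull s `|` \bigcup_(s in [set` S]) conv_hull s.
  apply/seteqP; split => y.
    move=> [s' /=]; rewrite inE => /orP[/eqP -> ?|s'S ?]; [by left|by right; exists s'].
  move=> [ys|[s' /= s'S ys]]; first by exists s; rewrite //= inE eqxx.
  by exists s'; rewrite //= inE s'S orbT.
exact: compactU.
Qed.

End Compactness.

Section FamilyTopology.
Context {R : realType}.

Lemma unif_famP (V : pseudoMetricType R) (Z : topologicalType) (U : set R) (F : Z -> R -> V) :
  (continuous (fun z => F z : {family compactly_in U, R -> V})) <->
  forall (z0 : Z) K e, K `<=` U -> compact K -> 0 < e ->
    \forall z \near z0, forall x, K x -> ball (F z0 x) e (F z x).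
Proof.
split=> [h z0 K e KU cK e0|h z0].
  have /fam_cvgP/(_ K (conj KU cK)) := h z0.
  have hn : nbhs (F z0 : {uniform` K -> V}) [set g | forall x, K x -> ball (F z0 x) e (g x)].
    apply/uniform_nbhs; exists [set xy | ball xy.1 e xy.2]; split => //.
    exact: (entourage_ball _ (PosNum e0)).
  by move=> /(_ _ hn).
apply/fam_cvgP => K [KU cK] Q /uniform_nbhs [E [entE EQ]].
move: entE; rewrite -entourage_ballE => -[e e0 eE].
have := h z0 K e KU cK e0; apply: filterS => z hz; apply: EQ => /= x Kx.
exact: (eE (_, _) (hz x Kx)).
Qed.

End FamilyTopology.

Section UniformFamilies.
Context {R : realType} {N : nat}.
Implicit Types (U K : set R).

(** Epsilon form of continuity for uniform convergence of all derivatives on compact sets; [famP]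
    identifies it with [fam] of [Phi]. *)
Definition ufam (Z : topologicalType) U (f : Z -> R -> 'rV[R]_N) : Prop :=
  forall (z0 : Z) K k e, K `<=` U -> compact K -> 0 < e ->
    \forall z \near z0, forall x, K x -> `|derive1n k (f z) x - derive1n k (f z0) x| <= e.

Lemma famP p (lam : 'rV[R]_N -> 'M[R]_(p, N)) q (Z : topologicalType) U (f : Z -> R -> 'rV[R]_N) :
  fam (Phi lam q) U f <-> ufam U f.
Proof.
split=> [h z0 K k e KU cK e0|h k].
  have /(unif_famP U (fun z => derive1n k (f z)))/(_ z0 K e KU cK e0) := h k.
  apply: filterS => z hz x Kx; have := hz x Kx.
  by rewrite -ball_normE /= distrC => /ltW.
apply/(unif_famP U (fun z => derive1n k (f z))) => z0 K e KU cK e0.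
have e2 : 0 < e / 2 by rewrite divr_gt0.
have := h z0 K k (e / 2) KU cK e2.
apply: filterS => z hz x Kx; rewrite -ball_normE /= distrC.
by apply: le_lt_trans (hz x Kx) _; rewrite ltr_pdivrMr// ltr_pMr// ltr1n.
Qed.

Lemma smooth_bounded U K (f : R -> 'rV[R]_N) k : K `<=` U -> compact K ->
  smooth_on U f -> exists B, forall x, K x -> `|derive1n k f x| <= B.
Proof.
move=> KU cK sf.
have cw : {within K, continuous (derive1n k f)}.
  apply: continuous_in_subspaceT => x; rewrite inE => Kx.
  by apply: differentiable_continuous; apply/derivable1_diffP; exact: (@sf k x (KU x Kx)).
have [B [_ hB]] := compact_bounded (continuous_compact cw cK).
exists (B + 1) => x Kx; apply: (hB (B + 1)); first by rewrite ltrDl.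
by exists x.
Qed.

Lemma row_norm_coord (y : 'rV[R]_N) mu : `|y 0 mu| <= `|y|.
Proof. exact: coord_le_norm. Qed.

Lemma vcvb_pointwise (I : Type) (G : set_system I) {FG : Filter G} (O D : I -> set R)
    (w : I -> R) (oO : forall i, open (O i)) (DO : forall i, D i `<=` O i)
    (u v : I -> R -> 'rV[R]_N) k j :
  (\forall i \near G, smooth_on (O i) (u i)) -> (\forall i \near G, smooth_on (O i) (v i)) ->
  vcvb G O D w k u v -> (j <= k)%N -> forall m e, 0 < e ->
  \forall i \near G, forall x, D i x -> `|derive1n j (u i) x - derive1n j (v i) x| * w i ^+ m <= e.
Proof.
move=> su sv h jk m e e0.
have h1 : \forall i \near G, forall mu x, D i x ->
    `|derive1n j (fun x => u i x 0 mu) x - derive1n j (fun x => v i x 0 mu) x| * w i ^+ m <= e.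
  apply: (@cv0_near_forall N I G FG (fun mu i => forall x, D i x -> _)) => mu.
  by have /cvbP/(_ j jk) [_ _ _ /(_ m e e0)] := h mu.
apply: filterS3 su sv h1 => i sui svi hi x Dx; have Ox := DO i x Dx.
have [w0|w0] := ltrP 0 (w i ^+ m); last first.
  apply: le_trans (ltW e0); rewrite -[leRHS](mulr0 `|derive1n j (u i) x - derive1n j (v i) x|).
  by rewrite ler_wpM2l.
rewrite -ler_pdivlMr//; apply: row_norm_le => [|mu].
  by rewrite divr_ge0// ltW.
rewrite 2!mxE ler_pdivlMr//.
rewrite (derive1n_entryE j 0 mu (oO i) sui Ox) (derive1n_entryE j 0 mu (oO i) svi Ox).
exact: hi.
Qed.

Lemma pointwise_vcvb (I : Type) (G : set_system I) {FG : Filter G} (O D : I -> set R)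
    (w : I -> R) (oO : forall i, open (O i)) (DO : forall i, D i `<=` O i)
    (w1 : forall i, 1 <= w i)
    (u v : I -> R -> 'rV[R]_N) k :
  (\forall i \near G, smooth_on (O i) (u i)) -> (\forall i \near G, smooth_on (O i) (v i)) ->
  (forall j, (j <= k)%N -> exists B, \forall i \near G, forall x, D i x -> `|derive1n j (v i) x| <= B) ->
  (forall j, (j <= k)%N -> forall m e, 0 < e ->
     \forall i \near G, forall x, D i x -> `|derive1n j (u i) x - derive1n j (v i) x| * w i ^+ m <= e) ->
  vcvb G O D w k u v.
Proof.
move=> su sv hB h mu; apply/cvbP => j jk.
have dE (f : I -> R -> 'rV[R]_N) : (\forall i \near G, smooth_on (O i) (f i)) ->
    \forall i \near G, forall x, O i x -> derivable (derive1n j (fun x => f i x 0 mu)) x 1.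
  apply: filterS => i /(smooth_entryP _ (oO i)) hs x Ox.
  exact: (hs 0 mu j x Ox).
split; [exact: dE|exact: dE| |].
  have [B hBj] := hB j jk; exists B, 0%N.
  apply: filterS2 sv hBj => i svi hi x Dx; have Ox := DO i x Dx.
  rewrite expr0 mulr1 -(derive1n_entryE j 0 mu (oO i) svi Ox).
  by apply: le_trans (coord_le_norm _ _) _; exact: hi.
move=> m e e0; apply: filterS3 su sv (h j jk m e e0) => i sui svi hi x Dx.
have Ox := DO i x Dx.
rewrite -(derive1n_entryE j 0 mu (oO i) svi Ox) -(derive1n_entryE j 0 mu (oO i) sui Ox).
apply: le_trans (hi x Dx); rewrite ler_wpM2r ?exprn_ge0 ?(le_trans ler01)//.
have := coord_le_norm (derive1n j (u i) x - derive1n j (v i) x) mu.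
by rewrite 2!mxE.
Qed.

(** With weight 1 and the neighbourhood filter of [z0], the calculus expresses continuity of the
    family at [z0]; [vcvb_ufam] is the converse. *)
Lemma ufam_vcvb (Z : topologicalType) U (f : Z -> R -> 'rV[R]_N) (z0 : Z) K k : open U ->
  (forall z, smooth_on U (f z)) -> ufam U f -> K `<=` U -> compact K ->
  vcvb (nbhs z0) (fun=> U) (fun=> K) (fun=> 1) k f (fun=> f z0).
Proof.
move=> oU sf uf KU cK.
apply: (pointwise_vcvb (fun=> oU) (fun=> KU) (fun=> lexx 1)).
- by apply: nearW => z; exact: sf.
- by apply: nearW => z; exact: sf.
- move=> j _; have [B hB] := smooth_bounded j KU cK (sf z0).
  by exists B; apply: nearW => z; exact: hB.
- move=> j _ m e e0; have := uf z0 K j e KU cK e0.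
  by apply: filterS => z hz x Kx; rewrite expr1n mulr1; exact: hz.
Qed.

Lemma vcvb_ufam (Z : topologicalType) U (f : Z -> R -> 'rV[R]_N) : open U ->
  (forall z, smooth_on U (f z)) ->
  (forall (z0 : Z) K k, K `<=` U -> compact K ->
     vcvb (nbhs z0) (fun=> U) (fun=> K) (fun=> 1) k f (fun=> f z0)) -> ufam U f.
Proof.
move=> oU sf h z0 K k e KU cK e0.
have s1 : \forall z \near z0, smooth_on U (f z) by apply: nearW => z; exact: sf.
have s2 : \forall z \near z0, smooth_on U (f z0) by apply: nearW => z; exact: sf.
have := vcvb_pointwise (fun=> oU) (fun=> KU) s1 s2 (h z0 K k KU cK) (leqnn k) 0%N e0.
move=> /(_ (nbhs_filter z0)); apply: filterS => z hz x Kx.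
by have := hz x Kx; rewrite expr0 mulr1.
Qed.

Lemma ufam_bound (Z : topologicalType) U (f : Z -> R -> 'rV[R]_N) K k : compact [set: Z] ->
  (forall z, smooth_on U (f z)) -> ufam U f -> K `<=` U -> compact K ->
  exists B, forall z x, K x -> `|derive1n k (f z) x| <= B.
Proof.
move=> cZ sf uf KU cK.
apply: (@compact_bound R Z (fun z B => forall x, K x -> `|derive1n k (f z) x| <= B) cZ).
  by move=> z B B' BB' h x Kx; apply: le_trans BB'; exact: h.
move=> z0; have [B hB] := smooth_bounded k KU cK (sf z0); exists (1 + B).
have := uf z0 K k 1 KU cK ltr01; apply: filterS => z hz x Kx.
rewrite -(subrK (derive1n k (f z0) x) (derive1n k (f z) x)).
by apply: le_trans (ler_normD _ _) _; apply: lerD; [exact: hz|exact: hB].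
Qed.

Lemma ufam_sub (Z : topologicalType) U U' (f : Z -> R -> 'rV[R]_N) :
  U' `<=` U -> ufam U f -> ufam U' f.
Proof. by move=> UU h z0 K k e KU; apply: h; exact: subset_trans UU. Qed.

Lemma ufam_ext (Z : topologicalType) U (f g : Z -> R -> 'rV[R]_N) : open U ->
  (forall z x, U x -> f z x = g z x) -> ufam U f -> ufam U g.
Proof.
move=> oU fg h z0 K k e KU cK e0; have := h z0 K k e KU cK e0.
apply: filterS => z hz x Kx; have Ux := KU x Kx.
by rewrite -!(@derive1n_local _ _ U _ _ k oU (fg _) x Ux); exact: hz.
Qed.

Lemma ufam_pull (Z Y : topologicalType) U (f : Z -> R -> 'rV[R]_N) (s : Y -> Z) :
  continuous s -> ufam U f -> ufam U (fun y => f (s y)).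
Proof.
move=> cs h y0 K k e KU cK e0.
exact: (cs y0 _ (h (s y0) K k e KU cK e0)).
Qed.

End UniformFamilies.

Section SolutionRegularity.
Context {R : realType} {N p : nat}.
Variable lam : 'rV[R]_N -> 'M[R]_(p, N).
Hypothesis lam_smooth : smooth_forms lam.
Hypothesis lam_free : forall y, row_free (lam y).
Local Notation proj := (proj lam).

Lemma sol_smooth (U : set R) (u v : R -> 'rV[R]_N) : open U -> smooth_on U v ->
  (forall x, U x -> is_derive x 1 u (v x *m proj (u x))) -> smooth_on U u.
Proof.
move=> oU sv du.
have ud : \forall i \near unit_filter, forall x, U x -> is_derive x 1 u (v x *m proj (u x)).
  exact/near_unit.
have h k : vcvb unit_filter (fun=> U) (fun=> set0) (fun=> 1) k (fun=> u) (fun=> u).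
  case: k => [|k].
    apply: (@vcvb0 _ _ _ unit_filter _ (fun=> U) (fun=> set0) (fun=> 1) (fun=> lexx 1) _ _ 0).
    - by apply/near_unit => x Ux; case: (du x Ux).
    - by apply/near_unit => x Ux; case: (du x Ux).
    - exact/near_unit.
    - by move=> m e e0; exact/near_unit.
  apply: (sol_cvb lam_smooth lam_free (fun=> oU) (fun=> @sub0set _ _) (fun=> lexx 1) (B := 0) ud ud).
  - exact/near_unit.
  - by move=> m e e0; exact/near_unit.
  - exact: smooth_vjcv.
apply/smooth_entryP; first exact: oU.
move=> i mu; rewrite (ord1 i).
exact: (@jcv_smooth _ U set0 (fun _ x => u x 0 mu) _ (fun k => h k mu)).
Qed.

Lemma sol_horiz (u v : R -> 'rV[R]_N) (x : R) : is_derive x 1 u (v x *m proj (u x)) ->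
  horiz lam u x = 0.
Proof.
by move=> h; rewrite horizE (is_derive_derive1 h) -mulmxA (proj_lam lam_free) mulmx0.
Qed.

Lemma horiz_sol (u : R -> 'rV[R]_N) (x : R) : derivable u x 1 -> horiz lam u x = 0 ->
  is_derive x 1 u (derive1 u x *m proj (u x)).
Proof.
move=> du; rewrite horizE => /proj_id ->.
by apply: DeriveDef; rewrite ?derive1E.
Qed.

End SolutionRegularity.

(** * Horizontal germs with a prescribed jet *)

Section TaylorMonomials.
Context {R : realType}.

Definition pw (x0 : R) j (t : R) : R := (t - x0) ^+ j / j`!%:R.

Lemma pw_is_derive x0 j (t : R) : is_derive t 1 (pw x0 j) (if j is i.+1 then pw x0 i t else 0).
Proof.
case: j => [|j].
  have -> : pw x0 0 = cst 1 by apply/funext => s; rewrite /pw expr0 fact0 divr1.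
  exact: is_derive_cst.
have h := is_deriveB (is_derive_id t (1 : R)) (is_derive_cst x0 t (1 : R)).
have h1 := is_deriveX j.+1 h.
have h2 := is_deriveZ (W := R^o) ((j.+1)`!%:R^-1) h1.
have -> : pw x0 j.+1 = ((j.+1)`!%:R^-1 \*: ((id - cst x0 : R -> R) ^+ j.+1 : R -> R^o)).
  by apply/funext => s; rewrite /pw mulrC exprfctE.
apply: (is_derive_eq h2).
rewrite subr0 /GRing.scale /= mulr1 /pw factS natrM invfM.
have n0 : j.+1%:R != 0 :> R by rewrite pnatr_eq0.
by rewrite mulrACA mulVf// mul1r mulrC.
Qed.

Lemma derive1_pw x0 j : derive1 (pw x0 j) = if j is i.+1 then pw x0 i else cst 0.
Proof.
apply/funext => t; rewrite derive1E; have [_ ->] := pw_is_derive x0 j t.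
by case: j.
Qed.

Lemma derive1n_pw x0 i j : derive1n i (pw x0 j) =
  if (i <= j)%N then pw x0 (j - i) else cst 0.
Proof.
elim: i => [|i ih]; first by rewrite leq0n subn0.
rewrite derive1nS ih; case: (ltnP i j) => ij.
  by rewrite (ltnW ij) derive1_pw -(subnSK ij).
case: ifP => ij'; last by apply/funext => t; rewrite derive1_cst.
by rewrite derive1_pw (_ : (j - i)%N = 0%N)//; apply/eqP; rewrite subn_eq0.
Qed.

Lemma derive1n_pw0 x0 i j : derive1n i (pw x0 j) x0 = (i == j)%:R.
Proof.
rewrite derive1n_pw; case: (ltngtP i j) => [ij|ij|->] //=.
  by rewrite /pw subrr expr0n subn_eq0 leqNgt ij mul0r.
by rewrite subnn /pw expr0 fact0 divr1.
Qed.

Lemma smooth_pw x0 j (U : set R) : smooth_on (V := R^o) U (pw x0 j).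
Proof.
move=> k x _; rewrite derive1n_pw; case: ifP => _; last exact: derivable_cst.
by case: (pw_is_derive x0 (j - k) x).
Qed.

End TaylorMonomials.

Section Builder.
Context {R : realType} {N p : nat}.
Variable lam : 'rV[R]_N -> 'M[R]_(p, N).
Hypothesis lam_smooth : smooth_forms lam.
Hypothesis lam_free : forall y, row_free (lam y).
Local Notation proj := (proj lam).
Variables (Z : topologicalType) (cZ : compact [set: Z]).
Variables (x0 : R) (U0 : set R) (a : nat).
Hypotheses (oU0 : open U0) (U0x : U0 x0).
Variable v0 : Z -> R -> 'rV[R]_N.
Hypothesis sv0 : forall z, smooth_on U0 (v0 z).
Hypothesis fv0 : ufam U0 v0.
Variable M : Z -> 'M[R]_(a.+2, N).
Hypothesis cM : continuous M.

(** Row 0 of [M] is the initial point and row [j.+1] prescribes the [j]-th derivative of the control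
    at [x0]. Taylor monomials weighted by the missing amounts correct [v0], and leave it unchanged
    when its derivatives are already right. *)
Definition bcf (j : 'I_a.+1) z : 'rV[R]_N := row (lift ord0 j) (M z) - derive1n j (v0 z) x0.
Definition bctl z t : 'rV[R]_N := v0 z t + \sum_(j < a.+1) pw x0 j t *: bcf j z.

Let polyS z : smooth_on U0 (fun t => \sum_(j < a.+1) pw x0 j t *: bcf j z) /\
  forall k, eqU U0 (derive1n k (fun t => \sum_(j < a.+1) pw x0 j t *: bcf j z))
    (fun t => \sum_(j < a.+1) derive1n k (fun t => pw x0 j t *: bcf j z) t).
Proof.
apply: (smooth_on_sum oU0) => j; apply: (smooth_onM oU0); first exact: smooth_pw.
move=> k x _; rewrite (_ : derive1n k (cst (bcf j z)) = cst (if k is 0 then bcf j z else 0)).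
  exact: derivable_cst.
by elim: k => [//|k ih]; rewrite derive1nS ih; apply/funext => y; rewrite derive1_cst.
Qed.

Lemma bctl_smooth z : smooth_on U0 (bctl z).
Proof. have h := (smooth_onD oU0 (@sv0 z) (polyS z).1).1; exact: h. Qed.

Lemma bctl_jet z (j : 'I_a.+1) : derive1n j (bctl z) x0 = row (lift ord0 j) (M z).
Proof.
rewrite ((smooth_onD oU0 (@sv0 z) (polyS z).1).2 j x0 U0x) ((polyS z).2 j x0 U0x).
have e (i : 'I_a.+1) : derive1n j (fun t => pw x0 i t *: bcf i z) x0 = (j == i)%:R *: bcf i z.
  have sm : smooth_on setT (fun t => pw x0 i t *: bcf i z).
    apply: smooth_onM; [exact: openT|exact: smooth_pw|].
    move=> k x _; rewrite (_ : derive1n k (cst (bcf i z)) = cst (if k is 0 then bcf i z else 0)).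
      exact: derivable_cst.
    by elim: k => [//|k ih]; rewrite derive1nS ih; apply/funext => y; rewrite derive1_cst.
  apply/rowP => mu; rewrite (derive1n_entryE j 0 mu openT sm Logic.I) mxE.
  have -> : (fun x => (pw x0 i x *: bcf i z) 0 mu) = bcf i z 0 mu \*: (pw x0 i : R -> R^o).
    by apply/funext => t; rewrite mxE mulrC.
  have -> : derive1n j (bcf i z 0 mu \*: (pw x0 i : R -> R^o)) = bcf i z 0 mu \*: (derive1n j (pw x0 i) : R -> R^o).
    elim: (nat_of_ord j) => [//|k ih]; rewrite !derive1nS ih; apply/funext => t.
    have dp := DeriveDef (@smooth_pw R x0 i setT k t Logic.I) erefl.
    have [_ e] := is_deriveZ (W := R^o) (bcf i z 0 mu) dp.
    by rewrite derive1E; apply: (etrans e); rewrite /= derive1E.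
  by rewrite /= derive1n_pw0 /GRing.scale /= mulrC.
rewrite (eq_bigr _ (fun i _ => e i)) (bigD1 j)//= eqxx scale1r big1 ?addr0.
  by rewrite /bcf addrC subrK.
by move=> i ij; rewrite eq_sym (negbTE ij) scale0r.
Qed.

Lemma row_continuous (i : 'I_a.+2) : continuous (fun z => row i (M z)).
Proof.
move=> z; apply/cvg_ballP => e e0.
have /cvg_ballP/(_ e e0) := @cM z.
by apply: filterS => z' h; have [] := h => ? hh; split => // k mu; rewrite !mxE; exact: hh.
Qed.

Lemma bcf_cvg j (z0 : Z) : bcf j z @[z --> z0] --> bcf j z0.
Proof.
apply: cvgB; first exact: row_continuous.
apply/cvgrPdist_le => e e0.
have K1 : [set x0] `<=` U0 by move=> _ ->.
have cK1 : compact [set x0] := @compact_set1 _ x0.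
have := fv0 z0 j K1 cK1 e0.
by apply: filterS => z /(_ x0 erefl); rewrite distrC.
Qed.

Lemma bctl_ufam : ufam U0 bctl.
Proof.
apply: (vcvb_ufam oU0 bctl_smooth) => z0 K k KU cK mu.
have h1 := ufam_vcvb z0 k oU0 sv0 fv0 KU cK mu.
have h2 : cvb (nbhs z0) (fun=> U0) (fun=> K) (fun=> 1) k
   (fun z t => \sum_(j < a.+1) pw x0 j t * bcf j z 0 mu)
   (fun _ t => \sum_(j < a.+1) pw x0 j t * bcf j z0 0 mu).
  apply: (cvb_sum (fun=> oU0) (fun=> KU) (fun=> lexx 1)) => j _.
  apply: (cvbM (fun=> oU0) (fun=> KU) (fun=> lexx 1)).
    have hj : jcv U0 K k (fun=> pw x0 j) (fun=> pw x0 j).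
      apply: (smooth_jcv oU0 KU); [exact: smooth_pw|exact: smooth_pw| |by []].
      move=> i _; have sm : smooth_on (V := R^o) U0 (pw x0 j) by exact: smooth_pw.
      have cw : {within K, continuous (derive1n i (pw x0 j))}.
        apply: continuous_in_subspaceT => x; rewrite inE => Kx.
        apply: differentiable_continuous; apply/derivable1_diffP; exact: (@sm i x (KU x Kx)).
      have [B [_ hB]] := compact_bounded (continuous_compact cw cK : compact (_ : set R^o)).
      exists (B + 1) => x Kx; apply: (hB (B + 1)); first by rewrite ltrDl.
      by exists x.
    apply: (@cvb_pull_refl R unit Z unit_filter (nbhs z0) _ _ (fun=> tt) (fun=> U0) (fun=> K)
      (fun=> U0) (fun=> K) (fun=> 1) (fun=> 1) k (fun=> pw x0 j)
      (fun=> lexx 1) (fun=> lexx 1) _ _ _ _ hj); last 3 first.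
    - by apply: nearW => z; exact: subset_refl.
    - by apply: nearW => z; exact: subset_refl.
    - by apply: nearW => z; exact: lexx.
    by move=> Q /near_unit Qt; apply: nearW.
  apply: (@cvb_cst_gen R Z (nbhs z0) _ (fun=> U0) (fun=> K) (fun=> 1) (fun=> oU0) (fun=> KU)).
    by exists `|bcf j z0 0 mu|, 0%N; apply: nearW => z; rewrite expr0 mulr1.
  move=> m e e0; have /cvgrPdist_le/(_ e e0) := @bcf_cvg j z0.
  apply: filterS => z hz; rewrite expr1n mulr1; apply: le_trans hz.
  rewrite distrC; have := coord_le_norm (bcf j z0 - bcf j z) mu; by rewrite !mxE.
have h3 := cvbD (fun=> oU0) (fun=> KU) (fun=> lexx 1) h1 h2.
have {}h3 := h3 (nbhs_filter z0).
by apply: (cvb_congr (fun=> oU0) (fun=> KU) _ _ h3) => z x _; rewrite [RHS]mxE summxE; congr (_ + _);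
  apply: eq_bigr => j _; rewrite [RHS]mxE.
Qed.

End Builder.

Section Translation.
Context {R : realType}.

Lemma derive1n_shift (V : normedModType R) k (f : R -> V) (c x : R) :
  derive1n k (fun s => f (s + c)) x = derive1n k f (x + c).
Proof.
elim: k x => [//|k ih] x; rewrite !derive1nS /derive1.
have -> : derive1n k (fun s => f (s + c)) = fun s => derive1n k f (s + c).
  by apply/funext => s; exact: ih.
by under eq_fun do rewrite -addrA.
Qed.

Lemma derivable_shift (V : normedModType R) (f : R -> V) (c x : R) :
  derivable f (x + c) 1 -> derivable (fun s => f (s + c)) x 1.
Proof.
move=> h; rewrite /derivable.
rewrite (_ : (fun h => h^-1 *: _) = (fun h => h^-1 *: ((f \o shift (x + c)) (h *: 1) - f (x + c))))//.
by apply/funext => s; rewrite /= addrA.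
Qed.

Lemma derive1_shift (V : normedModType R) (f : R -> V) (c x : R) :
  derive1 (fun s => f (s + c)) x = derive1 f (x + c).
Proof. by have := derive1n_shift 1 f c x; rewrite !derive1n1. Qed.

Lemma smooth_on_shift (V : normedModType R) (U : set R) (f : R -> V) (c : R) :
  smooth_on U f -> smooth_on [set s | U (s + c)] (fun s => f (s + c)).
Proof.
move=> sf k x Ux.
have -> : derive1n k (fun s => f (s + c)) = fun s => derive1n k f (s + c).
  by apply/funext => s; exact: derive1n_shift.
by apply: derivable_shift; exact: (@sf k _ Ux).
Qed.

Lemma open_shift (U : set R) (c : R) : open U -> open [set s | U (s + c)].
Proof.
move=> oU; have := @open_comp _ _ (fun s : R => s + c) U; apply => //.
by move=> x _; apply: cvgD; [exact: cvg_id|exact: cvg_cst].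
Qed.

Context {N p : nat}.
Implicit Types (u : R -> 'rV[R]_N) (lam : 'rV[R]_N -> 'M[R]_(p, N)).

Lemma smooth_near_shift u (c x : R) : smooth_near u (x + c) ->
  smooth_near (fun s => u (s + c)) x.
Proof.
move=> [U [oU Ux su]]; exists [set s | U (s + c)]; split => //; first exact: open_shift.
exact: smooth_on_shift.
Qed.

Lemma jet_shift n k (u : R -> 'rV[R]_n) (c x : R) : (jet k (fun s => u (s + c)) x).2 = (jet k u (x + c)).2.
Proof. by apply/matrixP => i mu; rewrite !mxE derive1n_shift. Qed.

Lemma horiz_shift lam u (c : R) :
  horiz lam (fun s => u (s + c)) = fun s => horiz lam u (s + c).
Proof.
apply/funext => s; apply/rowP => i; rewrite [LHS]mxE [RHS]mxE; apply: eq_bigr => mu _.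
by rewrite (derive1_shift u).
Qed.

(** The forms do not depend on time, so a jet can be moved along the line. This allows solutions to
    be computed at time 0 whatever the base point of the jet. *)
Lemma Rtang_shift lam a x x' (M : 'M[R]_(a.+2, N)) : Rtang lam a (x, M) -> Rtang lam a (x', M).
Proof.
move=> [u [y [sn e h]]]; move: e => [xy eM]; subst y.
exists (fun s => u (s + (x - x'))), x'.
have ex : x' + (x - x') = x by rewrite addrC subrK.
split; first by apply: smooth_near_shift; rewrite ex.
  congr (_, _); have := jet_shift a.+1 u (x - x') x'; rewrite ex /= => ->; exact: eM.
by rewrite horiz_shift -[RHS]h; have := jet_shift a (fun s => horiz lam u s) (x - x') x'; rewrite ex.
Qed.
End Translation.

Section TranslationReg.
Context {R : realType} {N p : nat}.
Variable lam : 'rV[R]_N -> 'M[R]_(p, N).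
Hypothesis lam_smooth : smooth_forms lam.
Variable q : nat.

Lemma reg_shift (u : R -> 'rV[R]_N) (c x : R) :
  reg lam q (fun s => u (s + c)) x = reg lam q u (x + c).
Proof.
have d1 s : derive1 (fun s => u (s + c)) s = derive1 u (s + c).
  exact: derive1_shift.
have eR : Rmx lam (fun s => u (s + c)) = fun s => Rmx lam u (s + c).
  by apply/funext => s; apply/matrixP => i j; rewrite [LHS]mxE [RHS]mxE d1.
have eA : Amx lam q (fun s => u (s + c)) x = Amx lam q u (x + c).
  rewrite /Amx; apply/eq_mxblock => i j; congr (_ *: _ + _).
    by rewrite eR; exact: derive1n_shift.
  have -> : Lmx lam (fun s => u (s + c)) = fun s => Lmx lam u (s + c) by [].
  by rewrite derive1n_shift.
by rewrite /reg /detA eA d1.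
Qed.

Lemma Wset_shift x x' (M : 'M[R]_(q.+2, N)) : Wset lam q (x, M) -> Wset lam q (x', M).
Proof.
move=> W; have [u [y [sn e _ _]]] := W.
move: (e) => [xy eM]; subst y.
move: W; rewrite e => /(WsetP lam_smooth q sn) r.
have ex : x' + (x - x') = x by rewrite addrC subrK.
have -> : (x', M) = jet q.+1 (fun s => u (s + (x - x'))) x'.
  congr (_, _); have := jet_shift q.+1 u (x - x') x'; rewrite ex /= => ->; exact: eM.
have sn' : smooth_near (fun s => u (s + (x - x'))) x'.
  by apply: smooth_near_shift; rewrite ex.
by apply/(WsetP lam_smooth q sn'); rewrite reg_shift ex.
Qed.

Lemma Wa_shift a x x' (M : 'M[R]_(a.+2, N)) : Wa lam q a (x, M) -> Wa lam q a (x', M).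
Proof. by move=> [/= h1 h2]; split; [exact: Wset_shift h1|exact: Rtang_shift h2]. Qed.

Lemma jet_Wa a (U : set R) (u : R -> 'rV[R]_N) x : (q <= a)%N -> open U -> U x ->
  smooth_on U u -> (forall x, U x -> horiz lam u x = 0) -> reg lam q u x != 0 ->
  Wa lam q a (jet a.+1 u x).
Proof.
move=> qa oU Ux su hu r.
have sn : smooth_near u x by exists U.
split; first by rewrite /= jet_projE ?ltnS//; apply/(WsetP lam_smooth q sn).
exists u, x; split => //; apply/matrixP => i s.
rewrite mxE (@derive1n_local _ _ U _ (cst 0) i oU hu) //.
suff -> : derive1n i (cst 0 : R -> 'rV[R]_p) = cst 0 by rewrite !mxE.
elim: (nat_of_ord i) => [//|k ih].
by rewrite derive1nS ih; apply/funext => y; rewrite derive1_cst.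
Qed.

Lemma reg_continuous (U : set R) (u : R -> 'rV[R]_N) x : open U -> U x ->
  smooth_on U u -> {for x, continuous (reg lam q u)}.
Proof.
move=> oU Ux su.
have sn : \forall i \near unit_filter, smooth_on U u by apply/near_unit; exact: su.
have hB : \forall i \near unit_filter, forall y, (set0 : set R) y -> `|u y| <= 0 by apply/near_unit.
have [h _ _ _] := cvb_cv0 (@reg_cvb _ _ _ lam lam_smooth q unit unit_filter _ (fun=> U) (fun=> set0)
    (fun=> 1) (fun=> oU) (fun=> @sub0set _ _) (fun=> lexx 1) (fun=> u) (fun=> u) 0 sn sn hB 0
    (smooth_vjcv _ oU su)).
apply: differentiable_continuous; apply/derivable1_diffP.
by move/near_unit : h; exact.
Qed.

Lemma reg_near (Z : topologicalType) (U : set R) (u : Z -> R -> 'rV[R]_N) (z0 : Z) x :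
  open U -> U x -> (forall z, smooth_on U (u z)) -> ufam U u -> reg lam q (u z0) x != 0 ->
  \forall z \near z0 & y \near x, reg lam q (u z) y != 0.
Proof.
move=> oU Ux su uu r.
have [d /= d0 hd] : nbhs x U by exact: open_nbhs_nbhs.
pose K : set R := `[x - d / 2, x + d / 2]%classic.
have KU : K `<=` U.
  move=> y; rewrite /K /= in_itv /= => /andP[h1 h2]; apply: hd.
  rewrite /= ltr_norml; apply/andP; split; lra.
have cK : compact K by exact: segment_compact.
have s1 : \forall z \near z0, smooth_on U (u z) by apply: nearW => z; exact: su.
have s2 : \forall z \near z0, smooth_on U (u z0) by apply: nearW => z; exact: su.
have [B hB] := smooth_bounded 0 KU cK (su z0).
have hB' : \forall z \near z0, forall y, K y -> `|u z0 y| <= B by apply: nearW => z; exact: hB.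
have h := reg_cvb lam_smooth (fun=> oU) (fun=> KU) (fun=> lexx 1) s1 s2 hB' 
   (ufam_vcvb z0 (0 + q).+1 oU su uu KU cK).
have {h} [_ _ _ h] := cvb_cv0 (h (nbhs_filter z0)).
have e0 : 0 < `|reg lam q (u z0) x| / 3 by rewrite divr_gt0// normr_gt0.
have h1 := h 0%N _ e0.
have /cvgrPdist_le/(_ _ e0) h2 := @reg_continuous U (u z0) x oU Ux (su z0).
have h3 : \forall y \near x, K y.
  exists (d / 2) => /=; first by rewrite divr_gt0.
  move=> y; rewrite /= ltr_norml /K /= in_itv /= => /andP[? ?]; apply/andP; split; lra.
exists ([set z | forall y, K y -> `|reg lam q (u z) y - reg lam q (u z0) y| * 1 ^+ 0 <= `|reg lam q (u z0) x| / 3],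
   [set y | `|reg lam q (u z0) x - reg lam q (u z0) y| <= `|reg lam q (u z0) x| / 3 /\ K y]) => /=.
  by split => //; apply: filterI.
move=> [z y] /= [hz [hy Ky]]; have := hz y Ky; rewrite expr0 mulr1 => hzy.
apply/eqP => r0; rewrite r0 sub0r normrN in hzy.
have := ler_normD (reg lam q (u z0) x - reg lam q (u z0) y) (reg lam q (u z0) y).
rewrite subrK => hn; have p0 : 0 < `|reg lam q (u z0) x| by rewrite normr_gt0.
lra.
Qed.

End TranslationReg.

Section SolutionJets.
Context {R : realType} {N p : nat}.
Variable lam : 'rV[R]_N -> 'M[R]_(p, N).
Hypothesis lam_smooth : smooth_forms lam.
Hypothesis lam_free : forall y, row_free (lam y).
Local Notation proj := (proj lam).

Lemma sol_unique_near (U : set R) (v u1 u2 : R -> 'rV[R]_N) (x : R) : open U -> U x ->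
  smooth_on U v ->
  (forall t, U t -> is_derive t 1 u1 (v t *m proj (u1 t))) ->
  (forall t, U t -> is_derive t 1 u2 (v t *m proj (u2 t))) ->
  u1 x = u2 x -> \forall t \near x, u1 t = u2 t.
Proof.
move=> oU Ux sv d1 d2 e12.
have bd (f : R -> 'rV[R]_N) : {for x, continuous f} -> \forall t \near x, `|f t| <= `|f x| + 1.
  move=> /cvgrPdist_le/(_ 1 ltr01); apply: filterS => t h.
  rewrite -(subrK (f x) (f t)) addrC; apply: le_trans (ler_normD _ _) _.
  by rewrite lerD2l distrC.
have b1 := bd u1 (is_derive_continuous (d1 x Ux)).
have b2 := bd u2 (is_derive_continuous (d2 x Ux)).
have cv : {for x, continuous v}.
  by apply: differentiable_continuous; apply/derivable1_diffP; exact: (@sv 0%N x Ux).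
have b3 := bd v cv.
have b4 : \forall t \near x, U t by exact: open_nbhs_nbhs.
have [r1 /= r10 hr] := filterI (filterI b1 b2) (filterI b3 b4).
pose B := `|u1 x| + 1; pose V := `|v x| + 1.
have [C hC] := proj_constP lam_smooth lam_free B.
have C1 : 1 <= C by case: hC.
have V0 : 0 < V by rewrite /V ltr_pwDr.
have CV0 : 0 < 4 * (C * V) by rewrite !mulr_gt0// (lt_le_trans ltr01).
pose r := Num.min (r1 / 2) (4 * (C * V))^-1.
have r0 : 0 < r by rewrite lt_min divr_gt0//= invr_gt0.
have rr1 : r <= r1 / 2 by rewrite ge_min lexx.
have rCV : r <= (4 * (C * V))^-1 by rewrite ge_min lexx orbT.
have hin t : x - r <= t <= x + r -> [/\ `|u1 t| <= B, `|u2 t| <= B, `|v t| <= V & U t].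
  move=> /andP[h1 h2].
  have : `|x - t| < r1 by rewrite ltr_norml; apply/andP; split; lra.
  by move=> /hr [[? h] [? ?]]; split => //; move: h; rewrite -e12.
have CVr : C * V * (x + r - (x - r)) <= 2^-1.
  have -> : x + r - (x - r) = 2 * r by ring.
  have := ler_wpM2l (ltW CV0) rCV; rewrite divff ?gt_eqF// => h; lra.
have xin : x - r <= x <= x + r by apply/andP; split; lra.
have s1 : sol lam (x - r) (x + r) v u1 by move=> t /hin[_ _ _ Ut]; exact: d1.
have s2 : sol lam (x - r) (x + r) v u2 by move=> t /hin[_ _ _ Ut]; exact: d2.
exists r => //= t; rewrite /= ltr_norml => /andP[h1 h2].
have := sol_dependence hC xin (ltW V0) (lexx 0) CVr _ _ s1 s2 _ _ (t := t).
rewrite e12 subrr normr0 mulr0 mulr0 addr0 mulr0 => h.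
apply/eqP; rewrite -subr_eq0 -normr_le0; apply: h.
- by move=> s /andP[? ?]; have [] := hin s _ => //; rewrite !ltW.
- by move=> s _; rewrite subrr normr0.
- by move=> s /hin [].
- by move=> s /hin [].
- by apply/andP; split; lra.
Qed.

Lemma horiz_smooth (U : set R) (u : R -> 'rV[R]_N) : open U -> smooth_on U u ->
  smooth_on U (horiz lam u).
Proof.
move=> oU su; have h := smooth_on_mulmx oU (smooth_on_derive1 su)
  (smooth_on_trmx oU (smooth_Lmx lam_smooth oU su)).
by apply: (smooth_on_ext oU _ h) => x _; rewrite horizE.
Qed.

Lemma jet_sol a (U : set R) (v u : R -> 'rV[R]_N) (x : R) (M : 'M[R]_(a.+2, N)) :
  open U -> U x -> smooth_on U v ->
  (forall t, U t -> is_derive t 1 u (v t *m proj (u t))) ->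
  u x = row ord0 M -> (forall j : 'I_a.+1, derive1n j v x = row (lift ord0 j) M) ->
  Rtang lam a (x, M) -> jet a.+1 u x = (x, M).
Proof.
move=> oU Ux sv du ux vj [u' [y [sn e hh]]]; move: (e) => [xy eM]; subst y.
have su : smooth_on U u := sol_smooth lam_smooth lam_free oU sv du.
have sn1 : smooth_near u x by exists U.
have [U' [oU' U'x su1 su']] := smooth_near2 sn1 sn.
pose W := U `&` U'.
have oW : open W by exact: openI.
have Wx : W x by [].
have svW : smooth_on W v by apply: smooth_on_sub sv => t [].
have suW : smooth_on W u by apply: smooth_on_sub su => t [].
have su'W : smooth_on W u' by apply: smooth_on_sub su' => t [].
have xW : [set x] `<=` W by move=> _ ->.
have rowM (i : 'I_a.+2) : row i M = derive1n i u' x.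
  by apply/rowP => mu; rewrite eM !mxE.
have hB : \forall i \near unit_filter, forall t, [set x] t -> `|u' t| <= `|u' x|.
  by apply/near_unit => t ->.
pose V k (f g : unit -> R -> 'rV[R]_N) := vcvb unit_filter (fun=> W) (fun=> [set x]) (fun=> 1) k f g.
have vv k : (k <= a)%N -> V k (fun=> v) (fun=> derive1 u').
  move=> ka; apply: (jet_vcvb oW Wx svW (smooth_on_derive1 su'W)) => j mu jk.
  have ja : (j < a.+1)%N by rewrite ltnS (leq_trans jk).
  have := vj (Ordinal ja); rewrite rowM /= => ->.
  by rewrite add0n -derive1nS derive1Sn.
(* With [D] the point [x], the calculus identifies [horiz lam u'] with 0 up to order [a]. *)
have hz k : (k <= a)%N -> forall s, cvb unit_filter (fun=> W) (fun=> [set x]) (fun=> 1) k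
    (fun _ t => horiz lam u' t 0 s) (fun _ _ => 0).
  move=> ka s; have sh := horiz_smooth oW su'W.
  have shs : smooth_on (V := R^o) W (fun t => horiz lam u' t 0 s).
    by have /smooth_entryP := sh; apply.
  have d0 j : derive1n j (fun _ : R => 0 : R^o) = fun=> 0.
    by elim: j => [//|j ih]; rewrite derive1nS ih; apply/funext => t; exact: derive1_cst.
  apply: (smooth_jcv oW xW shs).
  - by move=> j t _; rewrite d0; exact: derivable_cst.
  - by move=> j _; exists 0 => t _; rewrite d0 normr0.
  - move=> j t jk ->; rewrite d0 -(derive1n_entryE j 0 s oW sh Wx).
    have ja : (j < a.+1)%N by rewrite ltnS (leq_trans jk).
    have /matrixP/(_ (Ordinal ja) s) := hh; rewrite !mxE /=; exact.
(* Projecting the derivative of [u'] subtracts the product of [horiz lam u'] with a smooth matrix,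
   which is invisible in jets of order [a]. *)
have hp k : (k <= a)%N -> V k (fun=> u') (fun=> u') ->
    V k (fun _ t => derive1 u' t *m proj (u' t)) (fun=> derive1 u').
  move=> ka hu mu.
  pose X y := invmx (gram lam y) *m lam y.
  have sX i j : smooth_fun (fun y => X y i j).
    apply: smooth_fun_mulmx => [i' j'|]; last exact: lam_smooth.
    apply: smooth_fun_invmx => [z|]; first exact: gram_unit.
    by apply: smooth_fun_mulmx => [|i2 j2]; [exact: lam_smooth|rewrite /=];
      apply: (smooth_fun_ext (f := fun y => lam y j2 i2)) => [z|]; rewrite ?mxE//; exact: lam_smooth.
  have h1 : V k (fun=> derive1 u') (fun=> derive1 u').
    by apply: (jet_vcvb oW Wx (smooth_on_derive1 su'W) (smooth_on_derive1 su'W)).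
  have h2 : cvb unit_filter (fun=> W) (fun=> [set x]) (fun=> 1) k
     (fun _ t => \sum_s horiz lam u' t 0 s * X (u' t) s mu) (fun _ t => \sum_s 0 * X (u' t) s mu).
    apply: (cvb_sum (fun=> oW) (fun=> xW) (fun=> lexx 1)) => s _.
    apply: (cvbM (fun=> oW) (fun=> xW) (fun=> lexx 1)); first exact: hz.
    exact: (cvb_comp (fun=> oW) (fun=> xW) (fun=> lexx 1) (sX s mu) hu hB).
  have h3 := @cvbB R unit unit_filter _ (fun=> W) (fun=> [set x]) (fun=> 1) (fun=> oW) (fun=> xW) (fun=> lexx 1) k _ _ _ _ (h1 mu) h2.
  have {}h3 := h3 unit_filter_filter.
  apply: (cvb_congr (fun=> oW) (fun=> xW) _ _ h3) => i t _.
    rewrite /proj mulmxBr mulmx1 !mulmxA -(horizE lam u' t) -mulmxA [RHS]mxE; congr (_ + _).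
    by rewrite [RHS]mxE; congr (- _); rewrite [RHS]mxE.
  by rewrite big1 ?subr0// => s _; rewrite mul0r.
have du1 : \forall i \near unit_filter, forall t, W t -> is_derive t 1 u (v t *m proj (u t)).
  by apply/near_unit => t [Ut _]; exact: du.
have du2 : \forall i \near unit_filter, forall t, W t -> is_derive t 1 u' (derive1 u' t).
  by apply/near_unit => t Wt; apply: DeriveDef; rewrite ?derive1E//; exact: (@su'W 0%N t Wt).
have uu k : (k <= a.+1)%N -> V k (fun=> u) (fun=> u').
  have h0 : V 0 (fun=> u) (fun=> u').
    apply: (jet_vcvb oW Wx suW su'W) => j mu; rewrite leqn0 => /eqP ->.
    by rewrite !derive1n0 ux rowM derive1n0.
  elim: k => [//|k ih] ka.
  have {}ih := ih (ltnW ka).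
  have hu' : V k (fun=> u') (fun=> u').
    by apply: (jet_vcvb oW Wx su'W su'W).
  apply: (vcvb_ode (fun=> oW) (fun=> xW) du1 du2 h0) => mu.
  have g1 := vcvb_mulproj lam_smooth lam_free (fun=> oW) (fun=> xW) (fun=> lexx 1) hB ih (vv k ka) mu.
  have g2 := hp k ka hu' mu.
  exact: (cvb_trans (fun=> lexx 1) (g1 unit_filter_filter) g2).
congr (_, _); apply/matrixP => i mu; rewrite eM !mxE.
have ia : (i <= a.+1)%N by rewrite -ltnS.
have := jcv_eq (uu i ia mu) (leqnn i) (erefl x).
by rewrite -(derive1n_entryE i 0 mu oW suW Wx) -(derive1n_entryE i 0 mu oW su'W Wx).
Qed.

End SolutionJets.

Section BuilderSolutions.
Context {R : realType} {N p : nat}.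
Variable lam : 'rV[R]_N -> 'M[R]_(p, N).
Hypothesis lam_smooth : smooth_forms lam.
Hypothesis lam_free : forall y, row_free (lam y).
Local Notation proj := (proj lam).
Variables (Z : topologicalType) (cZ : compact [set: Z]).
Variables (x0 : R) (U0 : set R) (a : nat).
Hypotheses (oU0 : open U0) (U0x : U0 x0).
Variable v0 : Z -> R -> 'rV[R]_N.
Hypothesis sv0 : forall z, smooth_on U0 (v0 z).
Hypothesis fv0 : ufam U0 v0.
Variable M : Z -> 'M[R]_(a.+2, N).
Hypothesis cM : continuous M.
Local Notation bctl := (bctl x0 v0 M).

(** Compactness of [Z] bounds initial points and controls, giving one existence interval for all
    [z]. Continuity in [z] needs only an estimate of order zero; [sol_cvb] does the rest. *)
Lemma builder : exists (r : R) (u : Z -> R -> 'rV[R]_N), [/\ 0 < r,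
  forall t, x0 - r <= t <= x0 + r -> U0 t,
  forall z, u z x0 = row ord0 (M z),
  forall z t, x0 - r <= t <= x0 + r -> is_derive t 1 (u z) (bctl z t *m proj (u z t))
  & (forall z, smooth_on `]x0 - r, x0 + r[ (u z)) /\ ufam `]x0 - r, x0 + r[ u].
Proof.
have sb z : smooth_on U0 (bctl z) := @bctl_smooth R N Z x0 U0 a oU0 v0 sv0 M z.
have fb : ufam U0 bctl := bctl_ufam oU0 U0x sv0 fv0 cM.
have [d /= d0 hd] : nbhs x0 U0 by exact: open_nbhs_nbhs.
pose K : set R := `[x0 - d / 2, x0 + d / 2]%classic.
have KU : K `<=` U0.
  move=> y; rewrite /K /= in_itv /= => /andP[h1 h2]; apply: hd.
  rewrite /= ltr_norml; apply/andP; split; lra.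
have cK : compact K by exact: segment_compact.
have [V1 hV1] := ufam_bound 0 cZ sb fb KU cK.
pose V := Num.max 0 V1 + 1.
have V0 : 0 < V by rewrite /V ltr_pwDr// le_max lexx.
have hV z t : K t -> `|bctl z t| <= V.
  move=> Kt; apply: le_trans (hV1 z t Kt) _; rewrite /V.
  by apply: (@le_trans _ _ (Num.max 0 V1)); rewrite ?le_max ?lexx ?orbT// lerDl.
have [B1 hB1] : exists B, forall z, `|row ord0 (M z)| <= B.
  apply: (@compact_bound R Z (fun z B => `|row ord0 (M z)| <= B) cZ).
    by move=> z B B' BB' h; exact: le_trans BB'.
  move=> z; exists (`|row ord0 (M z)| + 1).
  have /cvgrPdist_le/(_ 1 ltr01) := @row_continuous R N Z a M cM ord0 z.
  apply: filterS => z' h; rewrite -(subrK (row ord0 (M z)) (row ord0 (M z'))) addrC.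
  by apply: le_trans (ler_normD _ _) _; rewrite lerD2l distrC.
pose B := Num.max 0 B1.
have B0 : 0 <= B by rewrite le_max lexx.
have hB z : `|row ord0 (M z)| <= B by apply: le_trans (hB1 z) _; rewrite le_max lexx orbT.
have [C hC] := proj_constP lam_smooth lam_free (B + 1).
have C1 : 1 <= C by case: hC.
have C0 : 0 < C by rewrite (lt_le_trans ltr01).
have CV0 : 0 < 4 * (C * V) by rewrite !mulr_gt0.
pose r := Num.min (d / 2) (4 * (C * V))^-1.
have r0 : 0 < r by rewrite lt_min divr_gt0//= invr_gt0.
have rd : r <= d / 2 by rewrite ge_min lexx.
have rCV : r <= (4 * (C * V))^-1 by rewrite ge_min lexx orbT.
have b2r : x0 + r - (x0 - r) = 2 * r by ring.
have CVr : C * V * (x0 + r - (x0 - r)) <= 2^-1.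
  by rewrite b2r; have := ler_wpM2l (ltW CV0) rCV; rewrite divff ?gt_eqF// => h; lra.
have inK t : x0 - r <= t <= x0 + r -> K t.
  by move=> /andP[h1 h2]; rewrite /K /= in_itv /=; apply/andP; split; lra.
have xin : x0 - r <= x0 <= x0 + r by apply/andP; split; lra.
have ab : x0 - r < x0 + r by lra.
have cv z t : x0 - r <= t <= x0 + r -> {for t, continuous (bctl z)}.
  move=> /inK /KU Ut; apply: differentiable_continuous; apply/derivable1_diffP.
  exact: (@sb z 0%N t Ut).
have ex z := sol_exists B0 hC ab xin (ltW V0) (cv z) (fun t h => hV z t (inK t h)) (hB z) CVr.
have [u hu] := choice ex.
have ub z t : x0 - r <= t <= x0 + r -> `|u z t| <= B + 1.
  move=> h; have [_ _ /(_ t h) hh] := hu z.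
  rewrite -(subrK (row ord0 (M z)) (u z t)) addrC; apply: le_trans (ler_normD _ _) _.
  apply: lerD; first exact: hB.
  by apply: le_trans hh _; apply: le_trans CVr _; lra.
have oO : open (`]x0 - r, x0 + r[%classic : set R) by exact: interval_open.
have OK t : `]x0 - r, x0 + r[%classic t -> x0 - r <= t <= x0 + r.
  by rewrite /= in_itv /= => /andP[? ?]; rewrite !ltW.
have OU t : `]x0 - r, x0 + r[%classic t -> U0 t by move=> /OK /inK /KU.
have su z : smooth_on `]x0 - r, x0 + r[ (u z).
  apply: (sol_smooth lam_smooth lam_free oO (smooth_on_sub OU (sb z))) => t Ot.
  by have [_ h _] := hu z; exact: h (OK t Ot).
exists r, u; split => //.
- by move=> t /inK /KU.
- by move=> z; case: (hu z).
- by move=> z t h; have [_ hs _] := hu z; exact: hs.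
split; first exact: su.
apply: (vcvb_ufam oO su) => z0 K' k K'O cK'.
have dO (z : Z) : forall t, `]x0 - r, x0 + r[%classic t -> is_derive t 1 (u z) (bctl z t *m proj (u z t)).
  by move=> t Ot; have [_ h _] := hu z; exact: h (OK t Ot).
have d1 : \forall z \near z0, forall t, `]x0 - r, x0 + r[%classic t ->
   is_derive t 1 (u z) (bctl z t *m proj (u z t)) by apply: nearW.
have d2 : \forall z \near z0, forall t, `]x0 - r, x0 + r[%classic t ->
   is_derive t 1 (u z0) (bctl z0 t *m proj (u z0 t)) by apply: nearW => z; exact: dO.
have hb : \forall z \near z0, forall t, K' t -> `|u z0 t| <= B + 1.
  by apply: nearW => z t K't; apply: ub; exact: OK (K'O t K't).
suff h : vcvb (nbhs z0) (fun=> `]x0 - r, x0 + r[%classic) (fun=> K') (fun=> 1) k.+1 u (fun=> u z0).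
  by move=> mu; apply: cvbW; exact: h.
apply: (sol_cvb lam_smooth lam_free (fun=> oO) (fun=> K'O) (fun=> lexx 1) d1 d2 hb); last first.
  apply: (ufam_vcvb z0 k oO (fun z => smooth_on_sub OU (sb z)) (ufam_sub OU fb) K'O cK').
move=> m e e0.
have e1 : 0 < e / (8 * (C * r)) by rewrite divr_gt0// !mulr_gt0.
have n1 := fb z0 K 0%N _ KU cK e1.
have e4 : 0 < e / 4 by rewrite divr_gt0.
have /cvgrPdist_le/(_ _ e4) n2 := @row_continuous R N Z a M cM ord0 z0.
apply: filterS2 n1 n2 => z h1 h2 t K't; rewrite expr1n mulr1.
have [u0 s0 _] := hu z; have [u1 s1 _] := hu z0.
have tin := OK t (K'O t K't).
have hK s : x0 - r < s < x0 + r -> K s by move=> /andP[? ?]; apply: inK; rewrite !ltW.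
have h := sol_dependence hC xin (ltW V0) (ltW e1) CVr
  (fun s hs => hV z s (hK s hs)) (fun s hs => h1 s (hK s hs)) s0 s1 (ub z) (ub z0) tin.
apply: le_trans h _.
rewrite u0 u1 b2r distrC.
have -> : 2 * r * (C * (e / (8 * (C * r)))) = e / 4.
  by field; rewrite !gt_eqF.
lra.
Qed.

End BuilderSolutions.

(** * Joint continuity, germs and parameter spaces *)

Section Uniformity.
Context {R : realType}.

(** Joint continuity in parameter and time becomes uniform on compact sets of times; [unif_joint]
    goes back, over an open set and for continuous sections. *)
Lemma joint_unif (V : pseudoMetricType R) (Z : topologicalType) (U : set R) (F : Z -> R -> V) :
  (forall (z : Z) x, U x -> (fun q : Z * R => F q.1 q.2) @ ((z, x) : (Z * R)%type) --> F z x) ->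
  continuous (fun z => F z : {family compactly_in U, R -> V}).
Proof.
move=> h; apply/(unif_famP U F) => z0 K e KU cK e0.
have e2 : 0 < e / 2 by rewrite divr_gt0.
have /compact_near_coveringP cov := cK.
have FF : Filter (nbhs z0) by exact: nbhs_filter.
apply: (cov Z (nbhs z0) (fun z x => ball (F z0 x) e (F z x)) FF) => x Kx.
have /cvg_ballP/(_ _ e2) [[A B] /= [nA nB] AB] := h z0 x (KU x Kx).
exists (B, A) => //= -[y z] /= [By Az].
have h1 := AB (z, y) (conj Az By); have h2 := AB (z0, y) (conj (nbhs_singleton nA) By).
by rewrite [e]splitr; apply: (ball_triangle (ball_sym h2) h1).
Qed.

Lemma unif_joint (V : pseudoMetricType R) (Z : topologicalType) (U : set R) (F : Z -> R -> V) :
  open U ->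
  continuous (fun z => F z : {family compactly_in U, R -> V}) ->
  (forall z x, U x -> {for x, continuous (F z)}) ->
  forall (z : Z) x, U x -> (fun q : Z * R => F q.1 q.2) @ ((z, x) : (Z * R)%type) --> F z x.
Proof.
move=> oU /(unif_famP U F) h cF z x Ux; apply/cvg_ballP => e e0.
have e2 : 0 < e / 2 by rewrite divr_gt0.
have [d /= d0 hd] : nbhs x U by exact: open_nbhs_nbhs.
pose K : set R := `[x - d / 2, x + d / 2]%classic.
have KU : K `<=` U.
  move=> y; rewrite /K /= in_itv /= => /andP[h1 h2]; apply: hd.
  rewrite /= ltr_norml; apply/andP; split; lra.
have cK : compact K by exact: segment_compact.
have h1 := h z K _ KU cK e2.
have /cvg_ballP/(_ _ e2) h2 := cF z x Ux.
have h3 : \forall y \near x, K y.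
  exists (d / 2) => /=; first by rewrite divr_gt0.
  move=> y; rewrite /= ltr_norml /K /= in_itv /= => /andP[? ?]; apply/andP; split; lra.
exists ([set z' | forall y, K y -> ball (F z y) (e / 2) (F z' y)], [set y | ball (F z x) (e / 2) (F z y) /\ K y]).
  by split => //; exact: filterI.
move=> [z' y] /= [hz [hy Ky]]; rewrite [e]splitr.
exact: (ball_triangle hy (hz y Ky)).
Qed.

End Uniformity.

Section GermTools.
Context {R : realType} {T : Type}.
Implicit Types (F : line_sheaf R T) (C : set R).

Lemma germ_eq F C (g g' : germ F C) : sval g = sval g' -> g = g'.
Proof.
case: g g' => [G p] [G' p'] /= e; subst G'; congr exist; exact: Prop_irrelevance.
Qed.

Lemma germ_rep F C (g : germ F C) : exists U f,
  [/\ open U, C `<=` U, sec F U f & sval g = germ_class C f].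
Proof.
have [U [oU CU sU]] := germ_repr_sec g.
by exists U, (germ_repr g); split => //; exact: germ_reprE.
Qed.

Lemma germ_family F C (P : topologicalType) (U : set R) (f : P -> R -> T) :
  open U -> C `<=` U -> (forall z, sec F U (f z)) -> fam F U f ->
  exists h : P -> germ_space F C, qcont _ h /\ forall z, sval (h z) = germ_class C (f z).
Proof.
move=> oU CU sf ff.
have ns z : near_sec F C (f z) by exists U.
exists (fun z => germ_of (ns z)); split => //.
by exists U, f; split.
Qed.

Lemma germ1P x (f g : R -> T) :
  germ_class [set x] f = germ_class [set x] g <-> \forall t \near x, f t = g t.
Proof.
split=> [/germ_classP h|h]; first exact: h.
by apply/germ_classP => _ ->.
Qed.
End GermTools.

Section Topology.
Context {R : realType}.

Lemma set_val_continuous (X : topologicalType) (A : set X) : continuous (set_val : set_type A -> X).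
Proof. exact: initial_continuous. Qed.

Lemma continuous_set_type (Y X : topologicalType) (A : set X) (g : Y -> set_type A) :
  continuous (fun y => set_val (g y)) -> continuous g.
Proof.
move=> h y W [V [[B oB <-] /= Bx BV]].
have hB : nbhs y (fun y' => B (set_val (g y'))) := h y B (open_nbhs_nbhs (conj oB Bx)).
change (nbhs y (fun y' => W (g y'))).
by apply: filterS hB => y' By'; exact: BV.
Qed.

Lemma compact_prod (X Y : topologicalType) : compact [set: X] -> compact [set: Y] ->
  compact [set: (X * Y)%type].
Proof. by move=> cX cY; rewrite -setXTT; exact: compact_setX. Qed.

Lemma unitI_compact : compact [set: set_type (unitI R)].
Proof. by apply: set_type_compact; exact: segment_compact. Qed.

Lemma cont_fst (X Y : topologicalType) : continuous (fst : X * Y -> X).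
Proof. by move=> p; exact: cvg_fst. Qed.

Lemma cont_snd (X Y : topologicalType) : continuous (snd : X * Y -> Y).
Proof. by move=> p; exact: cvg_snd. Qed.

End Topology.

Section UfamAlgebra.
Context {R : realType} {N : nat} (Z : topologicalType) (U : set R).
Hypothesis oU : open U.
Implicit Types (f g : Z -> R -> 'rV[R]_N).

Lemma ufamD f g : (forall z, smooth_on U (f z)) -> (forall z, smooth_on U (g z)) ->
  ufam U f -> ufam U g -> ufam U (fun z t => f z t + g z t).
Proof.
move=> sf sg uf ug z0 K k e KU cK e0.
have e2 : 0 < e / 2 by rewrite divr_gt0.
apply: filterS2 (uf z0 K k _ KU cK e2) (ug z0 K k _ KU cK e2) => z hf hg x Kx.
have hD z' := (smooth_onD oU (@sf z') (@sg z')).2 k x (KU x Kx).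
rewrite !hD opprD addrACA [e]splitr; apply: le_trans (ler_normD _ _) _.
by apply: lerD; [exact: hf|exact: hg].
Qed.

Lemma ufamZ (c : Z -> R) f : continuous c -> (forall z, smooth_on U (f z)) ->
  ufam U f -> ufam U (fun z t => c z *: f z t).
Proof.
move=> cc sf uf z0 K k e KU cK e0.
have [B hB] := smooth_bounded k KU cK (@sf z0).
pose B' := `|B| + 1; have B'0 : 0 < B' by rewrite /B' ltr_pwDr.
pose D := `|c z0| + 1; have D0 : 0 < D by rewrite /D ltr_pwDr.
have e1 : 0 < e / 2 / D by rewrite !divr_gt0.
have e2 : 0 < e / 2 / B' by rewrite !divr_gt0.
have /cvgrPdist_le h := cc z0.
apply: filterS3 (uf z0 K k _ KU cK e1) (h _ e2) (h _ ltr01) => z hf hc hc1 x Kx.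
have hZ z' := (smooth_onZ oU (c z') (@sf z')).2 k x (KU x Kx).
rewrite !hZ.
have -> : c z *: derive1n k (f z) x - c z0 *: derive1n k (f z0) x =
    c z *: (derive1n k (f z) x - derive1n k (f z0) x) + (c z - c z0) *: derive1n k (f z0) x.
  by rewrite scalerBr scalerBl addrA subrK.
rewrite [e]splitr; apply: le_trans (ler_normD _ _) _; rewrite !normrZ; apply: lerD.
  have cD : `|c z| <= D.
    rewrite -(subrK (c z0) (c z)) addrC; apply: le_trans (ler_normD _ _) _.
    by rewrite lerD2l distrC.
  apply: le_trans (ler_pM (normr_ge0 _) (normr_ge0 _) cD (hf x Kx)) _.
  by rewrite mulrC divfK ?gt_eqF.
have fB : `|derive1n k (f z0) x| <= B'.
  by apply: le_trans (hB x Kx) _; rewrite /B'; have := ler_norm B; lra.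
rewrite distrC; apply: le_trans (ler_pM (normr_ge0 _) (normr_ge0 _) hc fB) _.
by rewrite divfK ?gt_eqF.
Qed.

Lemma ufam_derive1 f : ufam U f -> ufam U (fun z => derive1 (f z)).
Proof.
by move=> uf z0 K k e KU cK e0; have := uf z0 K k.+1 e KU cK e0; apply: filterS => z h x Kx;
  rewrite -!derive1Sn; exact: h.
Qed.

Lemma ufam_eval f k x : U x -> ufam U f -> continuous (fun z => derive1n k (f z) x).
Proof.
move=> Ux uf z0; apply/cvgrPdist_le => e e0.
have K1 : [set x] `<=` U by move=> _ ->.
have := uf z0 [set x] k e K1 (@compact_set1 _ x) e0.
by apply: filterS => z /(_ x erefl); rewrite distrC.
Qed.

Lemma ufam_jet_eval f k x : U x -> ufam U f -> continuous (fun z => (jet k (f z) x).2).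
Proof.
move=> Ux uf z0; apply/cvg_ballP => e e0.
have h (i : 'I_k.+1) : \forall z \near z0, forall mu : 'I_N, ball (derive1n i (f z0) x 0 mu) e (derive1n i (f z) x 0 mu).
  have /cvg_ballP/(_ e e0) := @ufam_eval f i x Ux uf z0.
  by apply: filterS => z [_ h] mu; exact: h.
have := @filter_forall Z _ (fun (i : 'I_k.+1) z => forall mu : 'I_N, ball (derive1n i (f z0) x 0 mu) e (derive1n i (f z) x 0 mu)) (nbhs z0) (nbhs_filter z0) h.
by apply: filterS => z hz; split => // i mu; rewrite !mxE; exact: hz.
Qed.

End UfamAlgebra.

(** * Stalks: realising jets and lifting homotopies *)

Section LocalEquivalence.
Context {R : realType} {N p : nat}.
Variable lam : 'rV[R]_N -> 'M[R]_(p, N).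
Hypothesis lam_smooth : smooth_forms lam.
Hypothesis lam_free : forall y, row_free (lam y).
Variables (q a : nat) (ha : (2 * q <= a)%N).
Let qa : (q <= a)%N. Proof. by apply: leq_trans ha; rewrite leq_pmull. Qed.
Variable x0 : R.
Local Notation proj := (proj lam).

Lemma sec_jet (u : R -> 'rV[R]_N) (U : set R) : open U -> sec (Phi lam q) U u ->
  forall x, U x -> Wa lam q a (jet a.+1 u x).
Proof. by move=> oU su x Ux; have [_ _] := jet_sec lam q a ha U u oU su; exact. Qed.

(** The last clause makes later constructions relative: a horizontal curve whose derivative is [v0]
    and whose jet is the prescribed one already solves the same control equation, so uniqueness
    identifies the two germs. *)
Lemma phi_build (Z : topologicalType) (U0 : set R) (v0 : Z -> R -> 'rV[R]_N)
    (M : Z -> 'M[R]_(a.+2, N)) : compact [set: Z] -> open U0 -> U0 x0 ->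
  (forall z, smooth_on U0 (v0 z)) -> ufam U0 v0 -> continuous M ->
  (forall z, Wa lam q a (x0, M z)) ->
  exists (r : R) (u : Z -> R -> 'rV[R]_N), [/\ 0 < r,
    forall z, sec (Phi lam q) `]x0 - r, x0 + r[ (u z),
    ufam `]x0 - r, x0 + r[ u, forall z, jet a.+1 (u z) x0 = (x0, M z)
  & forall z u', smooth_near u' x0 -> (\forall t \near x0, derive1 u' t = v0 z t /\ horiz lam u' t = 0) ->
      jet a.+1 u' x0 = (x0, M z) -> \forall t \near x0, u z t = u' t].
Proof.
move=> cZ oU0 U0x sv0 fv0 cM hW.
have [r1 [u [r10 rU ux du [su fu]]]] := builder lam_smooth lam_free cZ oU0 U0x sv0 fv0 cM.
have sb z : smooth_on U0 (bctl x0 v0 M z) := @bctl_smooth R N Z x0 U0 a oU0 v0 sv0 M z.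
pose O1 : set R := `]x0 - r1, x0 + r1[%classic.
have oO1 : open O1 by exact: interval_open.
have O1x : O1 x0 by rewrite /O1 /= in_itv /=; apply/andP; split; lra.
have O1c t : O1 t -> x0 - r1 <= t <= x0 + r1.
  by rewrite /O1 /= in_itv /= => /andP[? ?]; rewrite !ltW.
have sbO z : smooth_on O1 (bctl x0 v0 M z) by apply: smooth_on_sub (sb z) => t /O1c /rU.
have duO z t : O1 t -> is_derive t 1 (u z) (bctl x0 v0 M z t *m proj (u z t)).
  by move=> /O1c; exact: du.
have huO z t : O1 t -> horiz lam (u z) t = 0 by move=> /(duO z); exact: sol_horiz.
have ju z : jet a.+1 (u z) x0 = (x0, M z).
  apply: (jet_sol lam_smooth lam_free oO1 O1x (sbO z) (duO z) (ux z)); last by case: (hW z).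
  exact: (bctl_jet oU0 U0x sv0).
have rx z : reg lam q (u z) x0 != 0.
  have [+ _] := hW z; rewrite -ju /= jet_projE ?ltnS// => /WsetP; apply => //.
  by exists O1.
have nr z := reg_near lam_smooth oO1 O1x su fu (rx z).
(* Regularity at [x0] is an open condition; the tube lemma gives a radius valid for every [z]. *)
have /= [r2 /= r20 hr2] := compact_tube (Q := fun z y => reg lam q (u z) y != 0) cZ nr.
pose r := Num.min r1 r2.
have r0 : 0 < r by rewrite lt_min r10.
have rr1 : r <= r1 by rewrite ge_min lexx.
have rr2 : r <= r2 by rewrite ge_min lexx orbT.
have rO t : `]x0 - r, x0 + r[%classic t -> O1 t.
  by rewrite /O1 /= !in_itv /= => /andP[? ?]; apply/andP; split; lra.
exists r, u; split => //.
- move=> z; split; first exact: smooth_on_sub (su z).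
    move=> t Ot; apply/(WsetP lam_smooth); first by exists O1; split => //; exact: rO.
    apply: hr2; move: Ot; rewrite /= in_itv /= ltr_norml => /andP[? ?].
    by apply/andP; split; lra.
  by move=> t /rO; exact: huO.
- exact: ufam_sub fu.
move=> z u' [U' [oU' U'x su']] nu' ju'.
have [d /= d0 hd] := filterI nu' (open_nbhs_nbhs (conj (openI oU' oO1) (conj U'x O1x))).
pose W : set R := `]x0 - d, x0 + d[%classic.
have oW : open W by exact: interval_open.
have Wx : W x0 by rewrite /W /= in_itv /=; apply/andP; split; lra.
have WP t : W t -> [/\ derive1 u' t = v0 z t, horiz lam u' t = 0, U' t & O1 t].
  rewrite /W /= in_itv /= => /andP[? ?].
  have : `|x0 - t| < d by rewrite ltr_norml; apply/andP; split; lra.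
  by move=> /hd [[? ?] [? ?]].
(* As [u'] has derivative [v0] and the prescribed jet, all coefficients of the Taylor correction
   vanish. *)
have bE : bctl x0 v0 M z = v0 z.
  apply/funext => t; rewrite /bctl big1 ?addr0// => j _.
  rewrite /bcf (_ : derive1n j (v0 z) x0 = row (lift ord0 j) (M z)) ?subrr ?scaler0//.
  rewrite -(@derive1n_local _ _ W (derive1 u') (v0 z) j oW _ x0 Wx); last by move=> s /WP[].
  rewrite -derive1Sn; apply/rowP => mu; rewrite mxE.
  by have [/matrixP/(_ (lift ord0 j) mu)] := ju'; rewrite mxE.
have WO : W `<=` O1 by move=> t /WP[].
have sbW : smooth_on W (bctl x0 v0 M z) := smooth_on_sub WO (sbO z).
have du1 t : W t -> is_derive t 1 (u z) (bctl x0 v0 M z t *m proj (u z t)) by move=> /WO; exact: duO.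
have du2 t : W t -> is_derive t 1 u' (bctl x0 v0 M z t *m proj (u' t)).
  by move=> /WP[e h U't _]; rewrite bE -e; apply: (horiz_sol _ h); exact: (@su' 0%N t U't).
apply: (sol_unique_near lam_smooth lam_free oW Wx sbW du1 du2).
rewrite ux; apply/rowP => mu; rewrite mxE.
by have [/matrixP/(_ ord0 mu)] := ju'; rewrite mxE.
Qed.

Local Notation PhiG := (germ_space (Phi lam q) [set x0]).
Local Notation PsiG := (germ_space (Psi lam q a) [set x0]).
Local Notation phi := (germ_map (jet_map lam q a ha) (C := [set x0]) : PhiG -> PsiG).

Lemma psi_eval (Z : topologicalType) (V : set R) (s : Z -> R -> jet_space R N a.+1) x :
  V x -> fam (Psi lam q a) V s -> continuous (fun z => (s z x).2).
Proof.
move=> Vx /(unif_famP V s) h z0; apply/cvg_ballP => e e0.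
have K1 : [set x] `<=` V by move=> _ ->.
have := h z0 [set x] e K1 (@compact_set1 _ x) e0.
by apply: filterS => z /(_ x erefl) [].
Qed.

Lemma psi_Wa (V : set R) (s : R -> jet_space R N a.+1) x : V x -> sec (Psi lam q a) V s ->
  Wa lam q a (x, (s x).2).
Proof.
move=> Vx [_ h1 h2]; have := h2 x Vx; have := h1 x Vx.
by case: (s x) => y m /= ->.
Qed.

(** The derivatives of the two families are joined by a straight line of controls, while the jet at
    [x0] follows the given homotopy of sections. The uniqueness clause of [phi_build] gives the
    right germs at both ends, and over [A], where the two controls coincide. *)
Lemma homotopy_lift (P : topologicalType) (A : set P) (al al' : P -> PhiG) :
  compact [set: P] -> qcont _ al -> qcont _ al' ->
  homotopic_rel R A (phi \o al) (phi \o al') -> (forall z, A z -> al z = al' z) ->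
  homotopic_rel R A al al'.
Proof.
move=> cP [U1 [f1 [oU1 C1 s1 F1 e1]]] [U2 [f2 [oU2 C2 s2 F2 e2]]].
move=> [H [[V [sg [oV CV sV FV eV]]] H0 H1 HA]] hA.
have U1x : U1 x0 by exact: C1.
have U2x : U2 x0 by exact: C2.
have Vx : V x0 by exact: CV.
pose Z := (P * set_type (unitI R))%type.
have cZ : compact [set: Z] by apply: compact_prod => //; exact: unitI_compact.
pose U0 := U1 `&` U2.
have oU0 : open U0 by exact: openI.
have sm1 z : smooth_on U0 (derive1 (f1 z)).
  by apply: smooth_on_derive1; have [h _ _] := s1 z; apply: smooth_on_sub h => t [].
have sm2 z : smooth_on U0 (derive1 (f2 z)).
  by apply: smooth_on_derive1; have [h _ _] := s2 z; apply: smooth_on_sub h => t [].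
have uf1 : ufam U0 (fun z : Z => derive1 (f1 z.1)).
  apply: (ufam_pull (f := fun z => derive1 (f1 z)) (@cont_fst P _)).
  by apply: ufam_derive1; apply: ufam_sub ((famP lam q U1 f1).1 F1) => t [].
have uf2 : ufam U0 (fun z : Z => derive1 (f2 z.1)).
  apply: (ufam_pull (f := fun z => derive1 (f2 z)) (@cont_fst P _)).
  by apply: ufam_derive1; apply: ufam_sub ((famP lam q U2 f2).1 F2) => t [].
have cs : continuous (fun z : Z => set_val z.2 : R).
  by move=> z; apply: continuous_comp; [exact: cont_snd|exact: set_val_continuous].
have cs1 : continuous (fun z : Z => 1 - set_val z.2 : R).
  by move=> z; apply: cvgB; [exact: cvg_cst|exact: cs].
pose v0 (z : Z) t := (1 - set_val z.2) *: derive1 (f1 z.1) t + set_val z.2 *: derive1 (f2 z.1) t.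
have sv0 z : smooth_on U0 (v0 z).
  exact: (smooth_onD oU0 (smooth_onZ oU0 _ (sm1 z.1)).1 (smooth_onZ oU0 _ (sm2 z.1)).1).1.
have fv0 : ufam U0 v0.
  have g1 := ufamZ oU0 cs1 (fun z => sm1 z.1) uf1.
  have g2 := ufamZ oU0 cs (fun z => sm2 z.1) uf2.
  exact: (ufamD oU0 (fun z : Z => (smooth_onZ oU0 _ (sm1 z.1)).1) (fun z : Z => (smooth_onZ oU0 _ (sm2 z.1)).1) g1 g2).
have cM : continuous (fun z : Z => (sg z x0).2) := psi_eval Vx FV.
have [r [w [r0 sw fw jw uw]]] := phi_build cZ oU0 (conj U1x U2x) sv0 fv0 cM (fun z => psi_Wa Vx (sV z)).
have oO : open (`]x0 - r, x0 + r[%classic : set R) by exact: interval_open.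
have Ox : [set x0] `<=` (`]x0 - r, x0 + r[%classic : set R).
  by move=> _ ->; rewrite /= in_itv /=; apply/andP; split; lra.
have [K [qK eK]] := germ_family oO Ox sw ((famP lam q _ w).2 fw).
have sgE z : forall u, sval (H z) = germ_class [set x0] (jet a.+1 u) -> jet a.+1 u x0 = (x0, (sg z x0).2).
  move=> u; rewrite eV => /germ1P /nbhs_singleton <-.
  by have [_ h _] := sV z; have := h x0 Vx; case: (sg z x0) => y m /= ->.
have m1 z : sval (phi (al z)) = germ_class [set x0] (jet a.+1 (f1 z)) by exact: germ_mapE.
have m2 z : sval (phi (al' z)) = germ_class [set x0] (jet a.+1 (f2 z)) by exact: germ_mapE.
have n1 z : smooth_near (f1 z) x0 by exists U1; split => //; case: (s1 z).
have n2 z : smooth_near (f2 z) x0 by exists U2; split => //; case: (s2 z).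
have h1 z : \forall t \near x0, horiz lam (f1 z) t = 0.
  by apply: filterS (open_nbhs_nbhs (conj oU1 U1x)) => t U1t; have [_ _] := s1 z; exact.
have h2 z : \forall t \near x0, horiz lam (f2 z) t = 0.
  by apply: filterS (open_nbhs_nbhs (conj oU2 U2x)) => t U2t; have [_ _] := s2 z; exact.
exists K; split => //.
- move=> z t t0; apply: germ_eq; rewrite eK e1; apply/germ1P; apply: uw => //.
    by apply: filterS (h1 z) => y hy; split => //; rewrite /v0 /= t0 subr0 scale1r scale0r addr0.
  by apply: sgE; rewrite H0//; exact: m1.
- move=> z t t1; apply: germ_eq; rewrite eK e2; apply/germ1P; apply: uw => //.
    by apply: filterS (h2 z) => y hy; split => //; rewrite /v0 /= t1 subrr scale1r scale0r add0r.
  by apply: sgE; rewrite H1//; exact: m2.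
- move=> z t Az; apply: germ_eq; rewrite eK e1; apply/germ1P; apply: uw => //; last first.
    by apply: sgE; rewrite HA//; exact: m1.
  have : \forall t \near x0, f1 z t = f2 z t by apply/germ1P; rewrite -e1 -e2 hA.
  move=> /nbhs_interior /= n12; near=> y; split; last by near: y; exact: h1.
  have e12 : derive1 (f1 z) y = derive1 (f2 z) y.
    rewrite !derive1E; apply: near_eq_derive; near: y; exact: n12.
  by rewrite /v0 /= -e12 -scalerDl subrK scale1r.
Unshelve. all: by end_near. Qed.

End LocalEquivalence.

Section ContinuousMaps.
Variables X Y Z : topologicalType.

Lemma cont_pair (f : X -> Y) (g : X -> Z) : continuous f -> continuous g ->
  continuous (fun x => (f x, g x)).
Proof. by move=> cf cg x; exact: (cvg_pair (cf x) (cg x)). Qed.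

Lemma cont_comp (f : X -> Y) (g : Y -> Z) : continuous f -> continuous g ->
  continuous (fun x => g (f x)).
Proof. by move=> cf cg x; exact: (cvg_comp _ _ (cf x) (cg (f x))). Qed.

Lemma cont_cst (z : Z) : continuous (fun _ : X => z).
Proof. exact: cst_continuous. Qed.

End ContinuousMaps.

Section JointJets.
Context {R : realType} {N p : nat}.

Lemma ufam_cst (Z : topologicalType) (U : set R) (f : R -> 'rV[R]_N) : ufam U (fun _ : Z => f).
Proof. by move=> z0 K k e _ _ e0; apply: nearW => z x _; rewrite subrr normr0 ltW. Qed.

Lemma jet_joint (lam : 'rV[R]_N -> 'M[R]_(p, N)) (Z : topologicalType) (U : set R)
    (f : Z -> R -> 'rV[R]_N) k : open U ->
  (forall z, smooth_on U (f z)) -> ufam U f -> forall (z : Z) x, U x ->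
  (fun y : Z * R => (jet k (f y.1) y.2).2) @ ((z, x) : (Z * R)%type) --> (jet k (f z) x).2.
Proof.
move=> oU sf uf z x Ux.
have cf (i : nat) : (fun y : Z * R => derive1n i (f y.1) y.2) @ ((z, x) : (Z * R)%type) --> derive1n i (f z) x.
  apply: (unif_joint oU (F := fun z => derive1n i (f z))) => //.
    by have /(famP lam 0 U f) h := uf; exact: h.
  move=> z' x' Ux'; apply: differentiable_continuous; apply/derivable1_diffP.
  exact: (@sf z' i x' Ux').
apply/cvg_ballP => e e0.
have h (i : 'I_k.+1) : \forall y \near ((z, x) : (Z * R)%type), forall mu : 'I_N,
    ball (derive1n i (f z) x 0 mu) e (derive1n i (f y.1) y.2 0 mu).
  have /cvg_ballP/(_ e e0) := cf i.
  by apply: filterS => y [_ hh] mu; exact: hh.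
have := @filter_forall (Z * R)%type _ (fun (i : 'I_k.+1) y => forall mu : 'I_N,
   ball (derive1n i (f z) x 0 mu) e (derive1n i (f y.1) y.2 0 mu)) (nbhs ((z, x) : (Z * R)%type)) (nbhs_filter _) h.
by apply: filterS => y hy; split => // i mu; rewrite !mxE; exact: hy.
Qed.

End JointJets.

(** * Stalks: lifting families of sections up to homotopy *)

Section LocalEquivalenceSurj.
Context {R : realType} {N p : nat}.
Variable lam : 'rV[R]_N -> 'M[R]_(p, N).
Hypothesis lam_smooth : smooth_forms lam.
Hypothesis lam_free : forall y, row_free (lam y).
Variables (q a : nat) (ha : (2 * q <= a)%N).
Let qa : (q <= a)%N. Proof. by apply: leq_trans ha; rewrite leq_pmull. Qed.
Variable x0 : R.
Local Notation proj := (proj lam).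
Local Notation PhiG := (germ_space (Phi lam q) [set x0]).
Local Notation PsiG := (germ_space (Psi lam q a) [set x0]).
Local Notation phi := (germ_map (jet_map lam q a ha) (C := [set x0]) : PhiG -> PsiG).

Lemma wa_solution (J : 'M[R]_(a.+2, N)) (r : R) (v u : R -> 'rV[R]_N) (t : R) :
  0 < r -> smooth_on `]0 - r, 0 + r[ v ->
  (forall t, 0 - r <= t <= 0 + r -> is_derive t 1 u (v t *m proj (u t))) ->
  u 0 = row ord0 J -> (forall j : 'I_a.+1, derive1n j v 0 = row (lift ord0 j) J) ->
  Wa lam q a (t, J) -> (jet a.+1 u 0).2 = J.
Proof.
move=> r0 sv du u0 vj hW.
have O0 : (`]0 - r, 0 + r[%classic : set R) 0 by rewrite /= in_itv /=; apply/andP; split; lra.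
have oO : open (`]0 - r, 0 + r[%classic : set R) by exact: interval_open.
have duO s : `]0 - r, 0 + r[%classic s -> is_derive s 1 u (v s *m proj (u s)).
  by rewrite /= in_itv /= => /andP[? ?]; apply: du; rewrite !ltW.
have [_ hR] := Wa_shift lam_smooth 0 hW.
by rewrite (jet_sol lam_smooth lam_free oO O0 sv duO u0 vj hR).
Qed.

(** Germs with the jets of [be] at [x0] exist by [phi_build]. The straight line between their jets
    and [be] may leave the tangency relation; it is brought back by replacing a matrix with the jet
    of the solution that has it as Taylor data. On a jet already in the relation this is the
    identity, so the two ends and the part over [A] are preserved. *)
Lemma surj_lift (P : topologicalType) (A : set P) (be : P -> PsiG) (U1 : set R)
    (u : R -> 'rV[R]_N) :
  compact [set: P] -> qcont _ be -> open U1 -> U1 x0 -> smooth_on U1 u ->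
  (forall z, A z -> sec (Phi lam q) U1 u /\ sval (be z) = germ_class [set x0] (jet a.+1 u)) ->
  exists al : P -> PhiG, [/\ qcont _ al, forall z, A z -> sval (al z) = germ_class [set x0] u
    & homotopic_rel R A (phi \o al) be].
Proof.
move=> cP [V [sg [oV CV sV FV eV]]] oU1 U1x su hA.
have Vx : V x0 by exact: CV.
have fv0 : ufam U1 (fun _ : P => derive1 u).
  by move=> z0 K k e _ _ e0; apply: nearW => z x _; rewrite subrr normr0 ltW.
have cM : continuous (fun z => (sg z x0).2) := psi_eval Vx FV.
have hW z : Wa lam q a (x0, (sg z x0).2) := psi_Wa Vx (sV z).
have [r [w [r0 sw fw jw uw]]] := phi_build lam_smooth lam_free ha cP oU1 U1x
  (fun _ => smooth_on_derive1 su) fv0 cM hW.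
pose O : set R := `]x0 - r, x0 + r[%classic.
have oO : open O by exact: interval_open.
have Oxx : O x0 by rewrite /O /= in_itv /=; apply/andP; split; lra.
have Ox : [set x0] `<=` O by move=> _ ->.
have [al [qal eal]] := germ_family oO Ox sw ((famP lam q _ w).2 fw).
have swO z : smooth_on O (w z) by case: (sw z).
have sgE z t : V t -> sg z t = (t, (sg z t).2).
  by move=> Vt; have [_ h _] := sV z; have := h t Vt; case: (sg z t) => y m /= ->.
have AE z : A z -> \forall t \near x0, sg z t = jet a.+1 u t.
  by move=> /hA[_]; rewrite eV => /germ1P.
have Au z : A z -> \forall t \near x0, w z t = u t.
  move=> Az; have [[_ _ hu] _] := hA z Az; apply: uw; first by exists U1.
    by apply: filterS (open_nbhs_nbhs (conj oU1 U1x)) => t U1t; split => //; exact: hu.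
  by rewrite -(nbhs_singleton (AE z Az)) -sgE.
exists al; split => //.
  by move=> z Az; rewrite eal; apply/germ1P; exact: Au.
have [d /= d0 hd] : nbhs x0 (V `&` O) by apply: open_nbhs_nbhs; split; [exact: openI|].
pose r2 := d / 2; have r20 : 0 < r2 by rewrite divr_gt0.
pose I : set R := `[x0 - r2, x0 + r2]%classic.
have IV t : I t -> V t /\ O t.
  rewrite /I /r2 /= in_itv /= => /andP[? ?]; apply: hd.
  by rewrite /= ltr_norml; apply/andP; split; lra.
have ab2 : x0 - r2 <= x0 + r2 by lra.
have clI t : clamp_time (x0 - r2) (x0 + r2) t \in I.
  by rewrite inE /I /= in_itv; exact: clamp_time_in.
(* Time is clamped to a compact interval, so that parameters and time together form a compact
   space. *)
pose cl t : set_type I := exist _ (clamp_time (x0 - r2) (x0 + r2) t) (clI t).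
have clE t : I t -> set_val (cl t) = t.
  by move=> It; rewrite /= set_valE /=; apply: clamp_time_id; move: It; rewrite /I /= in_itv.
have ccl : continuous cl.
  apply: continuous_set_type.
  by apply: (continuous_clamp_time (f := id) ab2) => t _; exact: cvg_id.
pose PP := (P * set_type (unitI R))%type.
pose Z := (PP * set_type I)%type.
have cPP : compact [set: PP] by apply: compact_prod => //; exact: unitI_compact.
have cZ : compact [set: Z].
  by apply: compact_prod => //; apply: set_type_compact; exact: segment_compact.
have It (y : set_type I) : I (set_val y) by have := svalP y; rewrite inE.
pose J (y : Z) := (1 - set_val y.1.2) *: (jet a.+1 (w y.1.1) (set_val y.2)).2 +
   set_val y.1.2 *: (sg y.1.1 (set_val y.2)).2.
have cy1 : continuous (fun y : Z => y.1.1) := cont_comp (@cont_fst PP _) (@cont_fst P _).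
have cy2 : continuous (fun y : Z => set_val y.2 : R) := cont_comp (@cont_snd PP _) (@set_val_continuous _ I).
have cy : continuous (fun y : Z => (y.1.1, set_val y.2) : (P * R)%type) := cont_pair cy1 cy2.
have cs : continuous (fun y : Z => set_val y.1.2 : R) :=
  cont_comp (@cont_fst PP _) (cont_comp (@cont_snd P _) (@set_val_continuous _ (unitI R))).
have cs1 : continuous (fun y : Z => 1 - set_val y.1.2 : R).
  by move=> y; apply: cvgB; [exact: cvg_cst|exact: cs].
have k1 : continuous (fun y : Z => (jet a.+1 (w y.1.1) (set_val y.2)).2).
  move=> y; have [_ Oy] := IV _ (It y.2).
  exact: (cvg_comp (fun y : Z => (y.1.1, set_val y.2) : (P * R)%type)
    (fun y : P * R => (jet a.+1 (w y.1) y.2).2) (cy y) (@jet_joint R N p lam P O w a.+1 oO swO fw y.1.1 (set_val y.2) Oy)).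
have k2 : continuous (fun y : Z => (sg y.1.1 (set_val y.2)).2).
  move=> y; have [Vy _] := IV _ (It y.2).
  have h := @unif_joint R _ P V sg oV FV (fun z => let: And3 h _ _ := sV z in h) y.1.1 (set_val y.2) Vy.
  have h1 := cvg_comp (fun y : Z => (y.1.1, set_val y.2) : (P * R)%type)
    (fun y : P * R => sg y.1 y.2) (cy y) h.
  exact: (cvg_comp _ snd h1 (@cont_snd R 'M[R]_(a.+2, N) _)).
have cJ : continuous J.
  by move=> y; exact: (cvgD (cvgZ (cs1 y) (k1 y)) (cvgZ (cs y) (k2 y))).
have sz (_ : Z) : smooth_on setT (fun _ : R => 0 : 'rV[R]_N).
  by have [h _] := @smooth_on0 R setT 1 N; exact: h.
have fz : ufam setT (fun (_ : Z) (_ : R) => 0 : 'rV[R]_N) := @ufam_cst R N Z setT (fun=> 0).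
have [r3 [uu [r30 _ uu0 duu [suu fuu]]]] := builder lam_smooth lam_free cZ
  (openT : open [set: R]) (Logic.I : [set: R] 0) sz fz cJ.
pose O3 : set R := `]0 - r3, 0 + r3[%classic.
have oO3 : open O3 by exact: interval_open.
have O30 : O3 0 by rewrite /O3 /= in_itv /=; apply/andP; split; lra.
(* The retraction: the background control is zero, so the control is the Taylor polynomial given by
   [J y], and the jet of the solution at time 0 is read off. *)
pose rho (y : Z) := (jet a.+1 (uu y) 0).2.
have crho : continuous rho := @ufam_jet_eval R N Z O3 uu a.+1 0 O30 fuu.
have rhoE y t : Wa lam q a (t, J y) -> rho y = J y.
  move=> hWy; rewrite /rho.
  have sb := @bctl_smooth R N Z 0 setT a openT (fun _ _ => 0) sz J y.
  have sb3 := smooth_on_sub (@subsetT _ O3) sb.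
  have bj := @bctl_jet R N Z 0 setT a openT Logic.I (fun _ _ => 0) sz J y.
  exact: (wa_solution r30 sb3 (duu y) (uu0 y) bj hWy).
have hor y t : O3 t -> horiz lam (uu y) t = 0.
  rewrite /O3 /= in_itv /= => /andP[h1 h2].
  have hh : 0 - r3 <= t <= 0 + r3 by rewrite !ltW.
  exact: (sol_horiz lam_free (duu y t hh)).
have Ix0 : I x0 by rewrite /I /= in_itv /=; apply/andP; split; lra.
(* At time [x0] both ends of the line are the same jet, so the line is constant there and regular;
   openness carries this to nearby times. *)
have regx zs : reg lam q (uu (zs, cl x0)) 0 != 0.
  have [Vx1 Ox1] := IV _ Ix0.
  have JM : J (zs, cl x0) = (sg zs.1 x0).2.
    have cx := clE x0 Ix0.
    by rewrite /J [(zs, cl x0).1]/= [(zs, cl x0).2]/= cx jw -scalerDl subrK scale1r.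
  have hJ : Wa lam q a (x0, J (zs, cl x0)) by rewrite JM.
  have e := rhoE _ _ hJ.
  have [+ _] := Wa_shift lam_smooth 0 hJ; rewrite -e.
  have -> : (0, rho (zs, cl x0)) = jet a.+1 (uu (zs, cl x0)) 0 by [].
  rewrite /= jet_projE ?ltnS// => /WsetP; apply => //.
  by exists O3.
have nr zs : \forall y \near ((zs, cl x0) : Z), reg lam q (uu (y.1, y.2)) 0 != 0.
  have h := reg_near lam_smooth oO3 O30 suu fuu (regx zs).
  case: h => -[B1 B2] /= [nB1 nB2] hB.
  apply: filterS nB1 => -[y1 y2] B1y; apply: (hB ((y1, y2), 0)); split => //=.
  exact: nbhs_singleton nB2.
have tube := compact_tube (x0 := cl x0) (Q := fun zs i => reg lam q (uu (zs, i)) 0 != 0) cPP nr.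
have {tube} tube : \forall t \near x0, forall zs, reg lam q (uu (zs, cl t)) 0 != 0 := ccl x0 _ tube.
have nI : \forall t \near x0, I t.
  exists r2 => // t; rewrite /= ltr_norml /I /= in_itv /= => /andP[? ?]; apply/andP; split; lra.
have [r4 /= r40 h4] := filterI tube nI.
pose O5 : set R := `]x0 - r4, x0 + r4[%classic.
have oO5 : open O5 by exact: interval_open.
have O5x : [set x0] `<=` O5 by move=> _ ->; rewrite /O5 /= in_itv /=; apply/andP; split; lra.
have h5 t : O5 t -> (forall zs, reg lam q (uu (zs, cl t)) 0 != 0) /\ I t.
  rewrite /O5 /= in_itv /= => /andP[? ?]; apply: h4.
  by rewrite /= ltr_norml; apply/andP; split; lra.
pose Hs (zs : PP) (t : R) : jet_space R N a.+1 := (t, rho (zs, cl t)).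
have cc : continuous (fun y : PP * R => ((y.1, cl y.2) : Z)).
  exact: (cont_pair (@cont_fst PP R) (cont_comp (@cont_snd PP R) ccl)).
have cHs : continuous (fun y : PP * R => Hs y.1 y.2 : (R * 'M[R]_(a.+2, N))%type).
  exact: (cont_pair (@cont_snd PP R) (cont_comp cc crho)).
have cH : forall (zs : PP) t, O5 t ->
   (fun y : PP * R => Hs y.1 y.2) @ ((zs, t) : (PP * R)%type) --> Hs zs t.
  by move=> zs t _; exact: (cHs (zs, t)).
have sH zs : sec (Psi lam q a) O5 (Hs zs).
  split => // t O5t.
    have h := cH zs t O5t.
    have ct : continuous (fun t => ((zs, t) : (PP * R)%type)).
      by apply: cont_pair; [exact: cont_cst|move=> ?; exact: cvg_id].
    exact: (cvg_comp _ _ (ct t) h).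
  have [hr _] := h5 t O5t.
  apply: (Wa_shift lam_smooth (x := 0)).
  exact: (jet_Wa lam_smooth qa oO3 O30 (suu _) (@hor _) (hr zs)).
have fH : fam (Psi lam q a) O5 Hs by exact: (joint_unif cH).
have [K [qK eK]] := germ_family oO5 O5x sH fH.
have pal z : sval (phi (al z)) = germ_class [set x0] (jet a.+1 (w z)) by exact: germ_mapE.
have nO5 : \forall t \near x0, O5 t by apply: open_nbhs_nbhs; split => //; exact: O5x.
have HE (zs : PP) t m : O5 t -> Wa lam q a (t, m) -> J (zs, cl t) = m -> Hs zs t = (t, m).
  by move=> O5t hm e; rewrite /Hs (rhoE (zs, cl t) t) e.
exists K; split => //.
- move=> z t t0; apply: germ_eq; rewrite eK; apply: etrans (esym (pal z)); apply/germ1P.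
  apply: filterS nO5 => s O5s; have [_ Is] := h5 s O5s; have [_ Os] := IV s Is.
  apply: HE => //; first exact: (sec_jet ha oO (sw z) Os).
  have cx := clE s Is; rewrite /J [(_, cl s).1]/= [(_, cl s).2]/= cx.
  by rewrite [(z, t).1]/= [(z, t).2]/= t0 subr0 scale1r scale0r addr0.
- move=> z t t1; apply: germ_eq; rewrite eK eV; apply/germ1P.
  apply: filterS nO5 => s O5s; have [_ Is] := h5 s O5s; have [Vs _] := IV s Is.
  rewrite (sgE z s Vs); apply: HE => //; first exact: (psi_Wa Vs (sV z)).
  have cx := clE s Is; rewrite /J [(_, cl s).1]/= [(_, cl s).2]/= cx.
  by rewrite [(z, t).1]/= [(z, t).2]/= t1 subrr scale1r scale0r add0r.
- move=> z t Az; apply: germ_eq; rewrite eK; apply: etrans (esym (pal z)); apply/germ1P.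
  have n1 : \forall s \near x0, jet a.+1 (w z) s = jet a.+1 u s.
    have [d1 /= d10 hd1] := Au z Az.
    have oB : open (ball x0 d1) by exact: ball_open.
    by exists d1 => // s hs; exact: (jet_local a.+1 (ball x0 d1) (w z) u oB hd1 s hs).
  apply: filterS3 nO5 n1 (AE z Az) => s O5s e1 e2.
  have [_ Is] := h5 s O5s; have [_ Os] := IV s Is.
  apply: HE => //; first exact: (sec_jet ha oO (sw z) Os).
  have cx := clE s Is; rewrite /J [(_, cl s).1]/= [(_, cl s).2]/= cx.
  by rewrite [(z, t).1]/= [(z, t).2]/= e2 -e1 -scalerDl subrK scale1r.
Qed.

Lemma qcont_pull_phi (P Q : topologicalType) (h : P -> PhiG) (s : Q -> P) :
  continuous s -> qcont _ h -> qcont _ (fun y => h (s y)).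
Proof.
move=> cs [U [f [oU CU sf ff ef]]]; exists U, (fun y => f (s y)); split => //.
by apply/famP; apply: (ufam_pull cs); apply/famP; exact: ff.
Qed.

Lemma qcont_pull_psi (P Q : topologicalType) (h : P -> PsiG) (s : Q -> P) :
  continuous s -> qcont _ h -> qcont _ (fun y => h (s y)).
Proof.
move=> cs [U [f [oU CU sf ff ef]]]; exists U, (fun y => f (s y)); split => //.
by move=> y; apply: (cvg_comp _ _ (cs y) (ff (s y))).
Qed.

Lemma qcont_cst_phi (P : topologicalType) (g : PhiG) : qcont _ (fun _ : P => g).
Proof.
have [U [f [oU CU sf ef]]] := germ_rep g; exists U, (fun=> f); split => //.
by move=> k; exact: cst_continuous.
Qed.

Lemma qcont_cst_psi (P : topologicalType) (g : PsiG) : qcont _ (fun _ : P => g).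
Proof.
have [U [f [oU CU sf ef]]] := germ_rep g; exists U, (fun=> f); split => //.
exact: cst_continuous.
Qed.

Lemma unitI0 : exists z : set_type (unitI R), set_val z = 0.
Proof.
have h : (0 : R) \in unitI R by rewrite inE /unitI /= in_itv /= lexx ler01.
by exists (exist _ 0 h); rewrite set_valE.
Qed.

Lemma pair_continuous (P Q : topologicalType) (z : P) : continuous (fun t : Q => ((z, t) : (P * Q)%type)).
Proof. by apply: cont_pair; [exact: cont_cst|move=> ?; exact: cvg_id]. Qed.

(** [surj_lift] gives surjectivity, relative to the boundary of the cube with the base point as
    fixed curve, and [homotopy_lift] gives injectivity. *)
Lemma stalk_equivalence : @weak_homotopy_equivalence R PhiG PsiG phi.
Proof.
have [z0 _] := unitI0.
split.
(* For path components, points are regarded as constant families over the interval, with empty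
   [A]. *)
- move=> y; pose be (_ : set_type (unitI R)) := y.
  have s0 : smooth_on setT (fun _ : R => 0 : 'rV[R]_N) by have [h _] := @smooth_on0 R setT 1 N; exact: h.
  have [al [qal _ [K [qK K0 K1 _]]]] := @surj_lift _ set0 be setT (fun=> 0) (@unitI_compact R)
    (@qcont_cst_psi _ y) openT Logic.I s0 (fun z (h : set0 z) => False_ind _ h).
  exists (al z0), (fun t => K (z0, t)); split.
  + exact: (qcont_pull_psi (@pair_continuous (set_type (unitI R)) (set_type (unitI R)) z0) qK).
  + by move=> t t0; rewrite K0.
  + by move=> t t1; rewrite K1.
- move=> x x' [g [qg g0 g1]].
  have hh : homotopic_rel R set0 (phi \o (fun _ : set_type (unitI R) => x)) (phi \o (fun=> x')).
    exists (fun z => g z.2); split => //.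
    exact: (qcont_pull_psi (@cont_snd _ _) qg).
  have [K [qK K0 K1 _]] := homotopy_lift lam_smooth lam_free (@unitI_compact R)
    (@qcont_cst_phi _ x) (@qcont_cst_phi _ x') hh (fun z (h : set0 z) => False_ind _ h).
  exists (fun t => K (z0, t)); split.
  + exact: (qcont_pull_phi (@pair_continuous (set_type (unitI R)) (set_type (unitI R)) z0) qK).
  + by move=> t t0; rewrite K0.
  + by move=> t t1; rewrite K1.
move=> k x k0; have cC : compact [set: set_type (cube R k)].
  by apply: set_type_compact; exact: cube_compact.
split.
  move=> b [qb hb]; have [U [u [oU CU su eu]]] := germ_rep x.
  have [al [qal hal hh]] := @surj_lift _ (@cube_boundary R k) b U u cC qb oU (CU _ erefl)
    (let: And3 h _ _ := su in h) (fun z hz => conj su (etrans (congr1 sval (hb z hz)) (germ_mapE (jet_map lam q a ha) eu))).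
  exists al => //; split => // y hy.
  by apply: germ_eq; rewrite hal.
move=> al al' [qa1 h1] [qa2 h2] hh.
apply: (homotopy_lift lam_smooth lam_free cC qa1 qa2 hh) => z hz.
by rewrite h1// h2.
Qed.

End LocalEquivalenceSurj.

(** * The intervals complementary to a compact set *)

Section Cells.
Context {R : realType}.
Implicit Types (S : set R).

Definition is_cell S (a b : R) : Prop :=
  [/\ a < b, forall x, a < x < b -> S x, ~ S a & ~ S b].

Lemma left_end S (x : R) : open S -> S x -> (exists2 y, y < x & ~ S y) ->
  exists a, [/\ a < x, ~ S a & forall y, a < y -> y <= x -> S y].
Proof.
move=> oS Sx [y0 y0x nSy0].
pose E := [set y | y <= x /\ ~ S y].
have E0 : E !=set0 by exists y0; split => //; exact: ltW.
have ubE : ubound E x by move=> y [].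
have hub : has_ubound E by exists x.
have hE : has_sup E by split.
have [d /= d0 hd] : nbhs x S by exact: open_nbhs_nbhs.
have ax : sup E <= x - d.
  apply: ge_sup => // y [yx nSy]; rewrite leNgt; apply/negP => yd; apply: nSy; apply: hd.
  by rewrite /= ltr_norml; apply/andP; split; lra.
exists (sup E); split; first lra.
- move=> Sa; have [d1 /= d10 hd1] : nbhs (sup E) S by exact: open_nbhs_nbhs.
  have [y [yx nSy] hy] := sup_adherent d10 hE.
  have ys : y <= sup E := ub_le_sup hub (conj yx nSy).
  apply: nSy; apply: hd1.
  by rewrite /= ltr_norml; apply/andP; split; lra.
- move=> y ay yx; apply: contrapT => nSy.
  have : y <= sup E := ub_le_sup hub (conj yx nSy).
  by rewrite leNgt ay.
Qed.

Lemma cell_exists S (x : R) : open S -> S x -> (exists2 y, y < x & ~ S y) ->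
  (exists2 y, x < y & ~ S y) -> exists a b, is_cell S a b /\ a < x < b.
Proof.
move=> oS Sx hl [y xy nSy].
have [a [ax nSa ha]] := left_end oS Sx hl.
pose S' := [set t | S (- t)].
have oS' : open S'.
  have := @open_comp _ _ (fun t : R => - t) S; apply => // t _; exact: cvgN.
have Sx' : S' (- x) by rewrite /S' /= opprK.
have hl' : exists2 y, y < - x & ~ S' y by exists (- y); rewrite ?ltrN2// /S' /= opprK.
have [b [bx nSb hb]] := left_end oS' Sx' hl'.
exists a, (- b); split; last by rewrite ax ltrNr.
split => //; first by apply: (lt_trans ax); rewrite ltrNr.
move=> t /andP[at_ tb]; case: (leP t x) => tx; first exact: ha.
have : S' (- t) by apply: hb; rewrite ?lerN2 1?ltrNr// ltW.
by rewrite /S' /= opprK.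
Qed.

Lemma cell_inj S a b a' b' x : is_cell S a b -> is_cell S a' b' ->
  a < x < b -> a' < x < b' -> a = a' /\ b = b'.
Proof.
move=> [_ h nSa nSb] [_ h' nSa' nSb'] /andP[ax xb] /andP[a'x xb']; split.
- case: (ltgtP a a') => // aa; exfalso.
    by apply: nSa'; apply: h; rewrite aa (lt_trans a'x).
  by apply: nSa; apply: h'; rewrite aa (lt_trans ax).
- case: (ltgtP b b') => // bb; exfalso.
    by apply: nSb; apply: h'; rewrite bb (lt_trans a'x).
  by apply: nSb'; apply: h; rewrite bb (lt_trans ax).
Qed.

Section Gaps.
Variables (C : set R) (d : R).
Hypothesis cC : compact C.
Hypothesis d0 : 0 < d.

(** [C] is an arbitrary compact set, possibly with infinitely many complementary intervals
    accumulating on it. Only the part of the complement close to [C] is cut into cells; farther away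
    the given extension is kept. *)
Definition gapset : set R := [set x | ~ C x /\ exists2 c, C c & `|x - c| < d].

Lemma gap_open : open gapset.
Proof.
have clC : closed C by apply: compact_closed => //; exact: Rhausdorff.
have o1 : open (~` C) by exact: closed_openC.
have o2 : open [set x | exists2 c, C c & `|x - c| < d].
  rewrite (_ : [set x | _] = \bigcup_(c in C) ball c d).
    by apply: bigcup_open => c _; exact: ball_open.
  apply/seteqP; split => x.
    by move=> [c Cc xc]; exists c => //; rewrite -ball_normE /= distrC.
  by move=> [c Cc]; rewrite -ball_normE /= distrC => xc; exists c.
exact: openI.
Qed.

Lemma gap_cell x : gapset x -> exists a b, is_cell gapset a b /\ a < x < b.
Proof.
move=> gx; have [M [_ hM]] := compact_bounded cC.
have bd c : C c -> `|c| <= M + 1 by apply: hM; rewrite ltrDl.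
apply: (cell_exists gap_open gx).
  exists (Num.min (- (M + 1) - d) (x - 1)); first by rewrite gt_min; apply/orP; right; lra.
  move=> [_ [c /bd]]; rewrite ler_norml => /andP[h1 h2].
  rewrite ltr_norml => /andP[h3 h4].
  have : Num.min (- (M + 1) - d) (x - 1) <= - (M + 1) - d by rewrite ge_min lexx.
  lra.
exists (Num.max (M + 1 + d) (x + 1)); first by rewrite lt_max; apply/orP; right; lra.
move=> [_ [c /bd]]; rewrite ler_norml => /andP[h1 h2].
rewrite ltr_norml => /andP[h3 h4].
have : M + 1 + d <= Num.max (M + 1 + d) (x + 1) by rewrite le_max lexx.
lra.
Qed.

Lemma cell_near a b x : is_cell gapset a b -> a < x < b ->
  (C a /\ x - a < d) \/ (C b /\ b - x < d).
Proof.
move=> [ab h na nb] xab; have [nCx [c Cc xc]] := h x xab.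
move: xab xc => /andP[ax xb]; rewrite ltr_norml => /andP[h1 h2].
have [ca|ac] := leP c a.
  left; split; last lra.
  apply: contrapT => nCa; apply: na; split => //; exists c => //.
  have ca' : c < a by rewrite lt_neqAle ca andbT; apply/eqP => e; apply: nCa; rewrite -e.
  by rewrite ltr_norml; apply/andP; split; lra.
have [bc|cb] := leP b c; last first.
  by have [] := h c; rewrite ?ac ?cb.
right; split; last lra.
apply: contrapT => nCb; apply: nb; split => //; exists c => //.
have bc' : b < c by rewrite lt_neqAle bc andbT; apply/eqP => e; apply: nCb; rewrite e.
by rewrite ltr_norml; apply/andP; split; lra.
Qed.

Lemma cell_length a b : is_cell gapset a b -> b - a < 2 * d.
Proof.
move=> cab; have [ab _ _ _] := cab.
have xab : a < (a + b) / 2 < b by apply/andP; split; lra.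
by case: (cell_near cab xab) => -[_]; lra.
Qed.

Lemma cell_end a b : is_cell gapset a b -> C a \/ C b.
Proof.
move=> cab; have [ab _ _ _] := cab.
have xab : a < (a + b) / 2 < b by apply/andP; split; lra.
by case: (cell_near cab xab) => -[h _]; [left|right].
Qed.

(** One end lies in [C]. If the other does not, it is at distance at least [d] from [C], for
    otherwise it would belong to the gap set. *)
Lemma cell_mixed a b : is_cell gapset a b -> ~ (C a /\ C b) -> d <= b - a.
Proof.
move=> cab nn; have [ab _ na nb] := cab.
rewrite leNgt; apply/negP => ld; case: (cell_end cab) => h.
  by apply: nb; split; [move=> Cb; exact: nn|exists a => //; rewrite gtr0_norm ?subr_gt0].
by apply: na; split; [move=> Ca; exact: nn|exists b => //; rewrite distrC gtr0_norm ?subr_gt0].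
Qed.

Lemma cell_close a b x : is_cell gapset a b -> a <= x <= b ->
  exists2 c, C c & `|x - c| <= b - a /\ (c = a \/ c = b).
Proof.
move=> cab /andP[ax xb]; case: (cell_end cab) => h; [exists a|exists b] => //.
  by split; [rewrite ger0_norm ?subr_ge0// lerB|left].
by split; [rewrite distrC ger0_norm ?subr_ge0// lerB|right].
Qed.

End Gaps.

Lemma stepc01 (a b x : R) : 0 <= stepc a b x <= 1.
Proof.
rewrite /stepc /step; set s := (\row__ _) 0 0.
have p1 := @flat_ge0 R s; have p2 := @flat_ge0 R (1 - s).
have p3 : 0 < flat 1 s + flat 1 (1 - s).
  have [s0|s0] := ltP 0 s; first by rewrite ltr_pwDl// flat_gt0.
  by rewrite ltr_wpDl// flat_gt0// subr_gt0; apply: le_lt_trans s0 _.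
by rewrite divr_ge0 ?addr_ge0//= ler_pdivrMr// mul1r lerDl.
Qed.

End Cells.

Section FlatBound.
Context {R : realType} {N : nat} {Y : Type}.
Variables (V D0 : set R) (C : set R).
Hypotheses (oV : open V) (DV : D0 `<=` V).
Variables (f0 g : Y -> R -> 'rV[R]_N).
Hypothesis sf0 : forall y, smooth_on V (f0 y).
Hypothesis sg : forall y, smooth_on V (g y).
Hypothesis b0 : forall k, exists B, forall y x, D0 x -> `|derive1n k (f0 y) x| <= B.
Hypothesis bg : forall k, exists B, forall y x, D0 x -> `|derive1n k (g y) x| <= B.
Hypothesis fl : forall y c, C c -> \forall x \near c, f0 y x = g y x.

(** For each [y] the two curves agree near [C], but on a neighbourhood depending on [y]. Applying
    the mean value estimate [m] times from a point of [C] gives flatness of every order, with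
    constants independent of [y] because the bounds on derivatives are. *)
Lemma flat_bound m k : exists2 M, 0 <= M & forall y c x, C c ->
  (forall t, `|t - c| <= `|x - c| -> D0 t) ->
  `|derive1n k (f0 y) x - derive1n k (g y) x| <= M * `|x - c| ^+ m.
Proof.
elim: m k => [|m ih] k.
  have [B hB] := b0 k; have [B' hB'] := bg k.
  exists (`|B| + `|B'|); first exact: addr_ge0.
  move=> y c x Cc hD; rewrite expr0 mulr1; apply: le_trans (ler_normB _ _) _.
  have Dx : D0 x by exact: hD.
  by apply: lerD; apply: le_trans (ler_norm _); [exact: hB|exact: hB'].
have [M M0 hM] := ih k.+1; exists M => // y c x Cc hD.
pose et t := derive1n k (f0 y) t - derive1n k (g y) t.
pose r := `|x - c|.
have tr t : c - r <= t <= c + r -> `|t - c| <= r.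
  by move=> /andP[h1 h2]; rewrite ler_norml; apply/andP; split; lra.
have det t : c - r <= t <= c + r ->
    is_derive t 1 et (derive1n k.+1 (f0 y) t - derive1n k.+1 (g y) t).
  move=> /tr ht; have Vt := DV (hD t ht).
  rewrite !derive1nS !derive1E; apply: is_deriveB; apply: DeriveDef => //.
    exact: (@sf0 y k t Vt).
  exact: (@sg y k t Vt).
have et0 : et c = 0.
  have [e /= e0 he] := fl y Cc.
  have oB : open (ball c e) by exact: ball_open.
  rewrite /et (@derive1n_local _ _ (ball c e) _ (g y) k oB he c) ?subrr//.
  exact: ballxx.
have B0 : 0 <= M * r ^+ m by apply: mulr_ge0 => //; apply: exprn_ge0; exact: normr_ge0.
have hb t : c - r < t < c + r -> `|derive1n k.+1 (f0 y) t - derive1n k.+1 (g y) t| <= M * r ^+ m.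
  move=> /andP[h1 h2]; have ht : `|t - c| <= r by apply: tr; rewrite !ltW.
  apply: le_trans (hM y c t Cc _) _.
    by move=> s hs; apply: hD; exact: le_trans ht.
  by apply: ler_wpM2l => //; apply: lerXn2r => //; rewrite nnegrE; exact: normr_ge0.
have r0 : 0 <= r by exact: normr_ge0.
have xin : c - r <= x <= c + r.
  have : `|x - c| <= r by []. by rewrite ler_norml => /andP[? ?]; apply/andP; split; lra.
have cin : c - r <= c <= c + r by apply/andP; split; lra.
have := mvt_row B0 det hb xin cin.
by rewrite et0 subr0 exprSr mulrA.
Qed.

End FlatBound.

Section LengthFilter.
Context {R : realType} {I : Type} (A : I -> Prop) (len : I -> R).

(** The length tends to 0, uniformly in everything else that the index contains. *)
Definition lenf : set_system I :=
  [set Q : set I | exists2 l, 0 < l & forall i, A i -> len i < l -> Q i].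

Global Instance lenf_filter : Filter lenf.
Proof.
split; first by exists 1.
- move=> P Q [l l0 hP] [l' l'0 hQ]; exists (Num.min l l'); first by rewrite lt_min l0.
  by move=> i Ai; rewrite lt_min => /andP[h h']; split; [exact: hP|exact: hQ].
- by move=> P Q PQ [l l0 hP]; exists l => // i Ai il; apply: PQ; exact: hP.
Qed.
End LengthFilter.

(** * Gluing the homotopy and the extension across the cells *)

Section Core.
Context {R : realType} {N p : nat}.
Variable lam : 'rV[R]_N -> 'M[R]_(p, N).
Hypothesis lam_smooth : smooth_forms lam.
Hypothesis lam_free : forall y, row_free (lam y).
Variable q : nat.
Local Notation proj := (proj lam).
Local Notation kapm := (kapm lam q).
Local Notation kapr := (kapr lam q).
Local Notation wm := (wm lam q).
Local Notation sol := (sol lam).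
Variables (Y : Type) (V D0 C : set R).
Hypotheses (oV : open V) (DV : D0 `<=` V) (cC : compact C).
Variables (f g f0 : Y -> R -> 'rV[R]_N).
Hypothesis sf : forall y, smooth_on V (f y).
Hypothesis sg : forall y, smooth_on V (g y).
Hypothesis sf0 : forall y, smooth_on V (f0 y).
Hypothesis hf : forall y x, V x -> horiz lam (f y) x = 0.
Hypothesis hf0 : forall y x, V x -> horiz lam (f0 y) x = 0.
Hypothesis bf : forall k, exists B, forall y x, D0 x -> `|derive1n k (f y) x| <= B.
Hypothesis fl : forall y c, C c -> \forall x \near c, f0 y x = g y x.
Variables (cdet B V0 C1 C2 : R).
Hypothesis cdet0 : 0 < cdet.
Hypothesis hdet : forall y x, D0 x -> cdet <= `|detA lam q (f y) x|.
Hypotheses (B0 : 0 <= B) (V00 : 0 <= V0).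
Hypothesis hB : forall y x, D0 x -> `|f y x| <= B.
Hypothesis hB0 : forall y x, D0 x -> `|f0 y x| <= B.
Hypothesis hV0 : forall y x, D0 x -> `|derive1 (f y) x| <= V0.
Hypothesis hC1 : proj_const lam (B + 2) C1.
Hypothesis hC2 : taylor_const lam (B + 2) C2.

Definition wgt (a b : R) := Num.max 1 (b - a)^-1.

Lemma wgt_ge1 a b : 1 <= wgt a b.
Proof. by rewrite /wgt le_max lexx. Qed.

(** The calculus is indexed by all pairs of a parameter and an interval, with the inverse length as
    weight, and [kapf_cvb] is applied to [f] against itself: the growth bound it contains is the
    power of [wgt] bounding [kapm]. *)
Lemma kap_bound : exists K1 m1 l1, [/\ 1 <= K1, 0 < l1 &
  forall y a b, a < b -> b - a < l1 -> (forall t, a <= t <= b -> D0 t) ->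
    good_cell lam q V (C2 * V0) a b (f y) /\
    admissible lam B C1 C2 V0 a b (f y) (kapm a b (f y)) (wm a b (f y)) (K1 * wgt a b ^+ m1)].
Proof.
have C20 : 0 <= C2 by case: hC2.
have C11 : 1 <= C1 by case: hC1.
pose L := C2 * V0; have L0 : 0 <= L by exact: mulr_ge0.
pose I := (Y * (R * R))%type.
pose A (i : I) := i.2.1 < i.2.2 /\ forall t, i.2.1 <= t <= i.2.2 -> D0 t.
pose G := lenf A (fun i => i.2.2 - i.2.1).
have FG : Filter G by exact: lenf_filter.
(* A length below [1 / M] meets all smallness conditions at once. *)
pose M := 2 * (C1 * (V0 + 2) + L + 1).
have M0 : 0 < M by rewrite mulr_gt0// ltr_wpDl// addr_ge0// mulr_ge0 ?addr_ge0// (le_trans ler01).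
have M1 : 1 <= M.
  have : 0 <= C1 * (V0 + 2) by rewrite mulr_ge0 ?addr_ge0// (le_trans ler01).
  rewrite /M; lra.
have small (a b : R) : a < b -> b - a < M^-1 ->
    [/\ b - a <= 1, L * (b - a) <= 2^-1 & C1 * (V0 + 2) * (b - a) <= 2^-1].
  move=> ab hl; have h0 : 0 <= b - a by rewrite subr_ge0 ltW.
  have hM : M * (b - a) <= 1 by rewrite -ler_pdivlMl// mulr1 ltW.
  have C10 : 0 <= C1 by rewrite (le_trans ler01).
  have t1 : 0 <= C1 * (V0 + 2) * (b - a) := mulr_ge0 (mulr_ge0 C10 (addr_ge0 V00 (ler0n _ 2))) h0.
  have t2 : 0 <= L * (b - a) by exact: mulr_ge0.
  have {}hM : 2 * (C1 * (V0 + 2) * (b - a) + L * (b - a) + (b - a)) <= 1.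
    by rewrite (_ : _ * _ = M * (b - a))// /M; ring.
  move: t1 t2 hM h0; move: (C1 * (V0 + 2) * (b - a)) (L * (b - a)) (b - a) => x y z x0 y0 hM z0.
  by split; lra.
have gc y a b : a < b -> b - a < M^-1 -> (forall t, a <= t <= b -> D0 t) -> good_cell lam q V L a b (f y).
  move=> ab hl hD; have [h1 h2 h3] := small a b ab hl.
  split; [exact: ab|exact: h1|by move=> t /hD /DV|exact: (@sf y)| | |exact: h2|].
  - by move=> t Vt; apply: proj_id; rewrite -horizE; exact: hf.
  - move=> t /andP[? ?]; rewrite -normr_gt0; apply: lt_le_trans cdet0 _; apply: hdet; apply: hD; rewrite !ltW//.
  - move=> t w ht; rewrite Hmx_dproj.
    have hx : `|f y t| <= B + 2 by apply: le_trans (hB _ (hD t ht)) _; lra.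
    have [_ /(_ (f y t) w w (derive1 (f y) t) hx) [_ h]] := hC2.
    apply: le_trans h _; rewrite ler_wpM2r// /L ler_wpM2l//; exact: hV0 (hD t ht).
have gu : \forall i \near G, good_cell lam q V L i.2.1 i.2.2 (f i.1).
  by exists M^-1; [rewrite invr_gt0|move=> [y [a b]] [/= ab hD] hl; exact: gc].
pose w (i : I) := wgt i.2.1 i.2.2.
have w1 i : 1 <= w i by exact: wgt_ge1.
have hw : \forall i \near G, (i.2.2 - i.2.1)^-1 <= w i.
  by exists 1 => // i _ _; rewrite /w /wgt le_max lexx orbT.
pose O (i : I) : set R := `]i.2.1, i.2.2[%classic.
have oO i : open (O i) by exact: open_cell.
have OO i : O i `<=` O i by exact: subset_refl.
have OD : \forall i \near G, forall x, O i x -> D0 x.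
  exists 1 => // i [_ hD] _ x; rewrite /O /= in_itv /= => /andP[? ?]; apply: hD; rewrite !ltW//.
have fB : \forall i \near G, forall t, i.2.1 < t < i.2.2 -> `|f i.1 t| <= B.
  by apply: filterS OD => i hi t ht; apply: hB; apply: hi; rewrite /O /= in_itv.
have hc : \forall i \near G, forall t, i.2.1 < t < i.2.2 ->
    cdet <= `|detA lam q (f i.1) t| /\ cdet <= `|detA lam q (f i.1) t|.
  by apply: filterS OD => i hi t ht; split; apply: hdet; apply: hi; rewrite /O /= in_itv.
have sO : \forall i \near G, smooth_on (O i) (f i.1).
  by apply: filterS gu => i; exact: gc_sub.
have uv k : vcvb G O O w k (fun i => f i.1) (fun i => f i.1).
  apply: (pointwise_vcvb oO OO w1 sO sO).
    move=> j _; have [Bj hBj] := bf j; exists Bj.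
    by apply: filterS OD => i hi x Ox; apply: hBj; exact: hi.
  by move=> j _ m e e0; apply: nearW => i x _; rewrite subrr normr0 mul0r ltW.
have kc := kapf_cvb lam_smooth lam_free oV L0 w1 hw gu gu fB cdet0 hc uv.
have kb (jm : 'I_N * 'I_N) : exists Bm : R * nat, \forall i \near G, forall x, O i x ->
    `|kapf lam q i.2.1 i.2.2 (f i.1) jm.1 x 0 jm.2| <= Bm.1 * w i ^+ Bm.2.
  by have [_ _ [Bj [m h]] _] := cvb_cv0 (kc FG jm.1 0%N jm.2); exists (Bj, m).
have [bm hbm] := choice kb.
pose Bs := \sum_jm `|(bm jm).1|; pose m1 := (\sum_jm (bm jm).2)%N.
have Bs0 : 0 <= Bs by apply: sumr_ge0.
have hk : \forall i \near G, forall j mu x, O i x ->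
    `|kapf lam q i.2.1 i.2.2 (f i.1) j x 0 mu| <= Bs * w i ^+ m1.
  apply: (@cv0_near_forall N I G FG (fun j i => forall mu x, O i x -> _)) => j.
  apply: (@cv0_near_forall N I G FG (fun mu i => forall x, O i x -> _)) => mu.
  apply: filterS (hbm (j, mu)) => i hi x Ox; apply: le_trans (hi x Ox) _.
  apply: (wX_bound w1) => //.
    apply: le_trans (ler_norm _) _; rewrite /Bs (bigD1 (j, mu))//= lerDl; exact: sumr_ge0.
  by rewrite /m1 (bigD1 (j, mu))//= leq_addr.
have [l l0 hl] := filterI gu hk.
exists (1 + N%:R * Bs), m1, (Num.min l M^-1); split.
- by rewrite lerDl mulr_ge0 ?ler0n.
- by rewrite lt_min l0 invr_gt0.
move=> y a b ab; rewrite lt_min => /andP[ll lM] hD.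
have [g1 hk1] := hl (y, (a, b)) (conj ab hD) ll.
split; first exact: g1.
have [h1 h2 h3] := small a b ab lM.
have W1 : 1 <= wgt a b ^+ m1 by rewrite exprn_ege1// wgt_ge1.
have NB : 0 <= N%:R * Bs by rewrite mulr_ge0 ?ler0n.
apply: (cell_admissible lam_smooth lam_free ab h1 oV (gc_U g1) (@sf y) (gc_h g1) (gc_d g1) L0 h2 (gc_hL g1)).
- by apply: (le_trans W1); rewrite ler_peMl ?(le_trans ler01)// lerDl.
- exact: h3.
- exact: h2.
- by move=> t /hD; exact: hB.
- by move=> t /hD; exact: hV0.
- move=> th t tab; have h0 : 0 <= Bs * wgt a b ^+ m1 by rewrite mulr_ge0// (le_trans ler01).
  apply: le_trans (mulmx_row_le _ h0 _) _.
    move=> i j; rewrite mxE /kapr tab; apply: (hk1 i j t).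
    by rewrite /O /= in_itv.
  rewrite ler_wpM2r// mulrA ler_wpM2r ?(le_trans ler01)// lerDr//.
Qed.

Section Selection.
Variables (K1 : R) (m1 : nat) (d : R) (Yg : Y -> Prop).
Hypothesis d0 : 0 < d.
Local Notation S := (gapset C d).
Let Kc a b := K1 * wgt a b ^+ m1.
Hypothesis hD : forall a b, is_cell S a b -> forall t, a <= t <= b -> D0 t.
Hypothesis CD : forall c, C c -> D0 c.
Hypothesis hgc : forall y a b, is_cell S a b -> good_cell lam q V (C2 * V0) a b (f y).
Hypothesis hadm : forall y a b, is_cell S a b ->
  admissible lam B C1 C2 V0 a b (f y) (kapm a b (f y)) (wm a b (f y)) (Kc a b).

Definition sgn (a : R) : R := if `[< C a >] then 1 else 0.
Definition chi a b x : R := sgn a + (sgn b - sgn a) * stepc a b x.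
(** The uncorrected control. On an outer third [chi] is the indicator of [C] at the adjacent end: 1
    at an end in [C], where close to [C] also [f0 = g], leaving the derivative of [f]; 0 at an end
    off [C], leaving the derivative of [f0]. If [f = g] it is that of [f0] throughout. *)
Definition vc y a b x : 'rV[R]_N :=
  derive1 (f0 y) x + chi a b x *: (derive1 (f y) x - derive1 (g y) x).
Definition pt y a : 'rV[R]_N := if `[< C a >] then f y a else f0 y a.

Hypothesis he : forall y a b, Yg y -> is_cell S a b -> exists e,
  [/\ e <= eps C1 C2 V0 (Kc a b),
      forall t, a <= t <= b -> `|vc y a b t - derive1 (f y) t| <= e,
      `|pt y a - f y a| <= e & `|pt y b - f y b| <= e].

Definition selP y a b (s : 'rV[R]_N * (R -> 'rV[R]_N)) : Prop :=
  [/\ `|s.1| <= rho C1 C2 V0 (Kc a b), s.2 a = pt y a, s.2 b = pt y b,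
      sol a b (ctl (kapm a b (f y)) (vc y a b) s.1) s.2
    & forall t, a <= t <= b -> `|s.2 t| <= B + 2].

Definition sel y a b := xget (0, fun=> 0) (selP y a b).

Lemma cell_D a b t : is_cell S a b -> a <= t <= b -> V t.
Proof. by move=> cab tab; apply: DV; exact: hD cab t tab. Qed.

Lemma chi_cont a b : continuous (chi a b).
Proof.
have cst1 : continuous (stepc a b).
  have [cs _] := @step_smooth R [::].
  move=> x; apply: (@continuous_comp _ _ _ (fun t => \row_(_ < 1) (3 * (t - a) * (b - a)^-1 - 1)) (@step R)); last exact: cs.
  apply: differentiable_continuous; apply/derivable1_diffP; apply: derivable_rowP => mu.
  rewrite (_ : (fun x => _) = fun t => 3 * (t - a) * (b - a)^-1 - 1); last by apply/funext => t; rewrite mxE.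
  by [].
move=> x; apply: cvgD; first exact: cvg_cst.
by apply: cvgM; [exact: cvg_cst|exact: cst1].
Qed.

Lemma vc_cont y a b t : is_cell S a b -> a <= t <= b -> {for t, continuous (vc y a b)}.
Proof.
move=> cab tab; have Vt := cell_D cab tab.
have cd (h : R -> 'rV[R]_N) : smooth_on V h -> {for t, continuous (derive1 h)}.
  move=> sh; apply: differentiable_continuous; apply/derivable1_diffP; exact: (@sh 1%N t Vt).
exact: (cvgD (cd _ (@sf0 y)) (cvgZ (@chi_cont a b t) (cvgB (cd _ (@sf y)) (cd _ (@sg y))))).
Qed.

Lemma sel_ex y a b : Yg y -> is_cell S a b -> selP y a b (sel y a b).
Proof.
move=> Yy cab; have [e [e1 e2 e3 e4]] := he Yy cab.
have [th [F [h1 h2 h3 h4 [h5 h6]]]] := steer_exists B0 V00 hC1 hC2 (hadm y cab)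
  (fun t => @vc_cont y a b t cab) e1 e2 e3 e4.
by apply: (@xgetI _ _ (selP y a b) (th, F)); split.
Qed.

(** [sel] is obtained by choice, but injectivity of the endpoint map makes it canonical on the cell:
    it is recognised by exhibiting any solution with a small parameter, such as 0 ([sel_C_both],
    [FF_eq0]). *)
Lemma sel_uniq y a b s s' : Yg y -> is_cell S a b -> selP y a b s -> selP y a b s' ->
  s.1 = s'.1 /\ forall t, a <= t <= b -> s.2 t = s'.2 t.
Proof.
move=> Yy cab [h1 h2 h3 h4 h5] [h1' h2' h3' h4' h5'].
have [e [e1 e2 e3 e4]] := he Yy cab.
have adm := hadm y cab.
have := key_injective V00 hC1 hC2 adm e1 e2 e3 h1 h1' h2 h2' h4 h4' h5 h5'.
rewrite h3 h3' subrr normr0 mulr0 normr_le0 subr_eq0 => /eqP e12; split => // t tab.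
have ab := adm_ab adm; have aab : a <= a <= b by rewrite lexx ltW.
have ba : 0 <= b - a by rewrite subr_ge0 ltW.
have hC : C1 * (V0 + 1) * (b - a) <= 2^-1.
  apply: le_trans (adm_C1 adm); rewrite ler_wpM2r// ler_wpM2l; [by []| |by lra].
  by rewrite (le_trans ler01)//; case: hC1.
have V1 : 0 <= V0 + 1 by rewrite addr_ge0.
have := sol_dependence hC1 aab V1 (lexx 0) hC _ _ h4 h4' h5 h5' tab.
rewrite h2 h2' subrr normr0 !mulr0 addr0 mulr0 => h.
apply/eqP; rewrite -subr_eq0 -normr_le0; apply: h.
- move=> x /andP[x1 x2]; apply: (ctl_le V00 hC1 hC2 adm e1 e2) => //; rewrite !ltW//.
- by move=> x _; rewrite e12 subrr normr0.
Qed.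

Lemma kapm_left y a b t : is_cell S a b -> t < a + (b - a) / 3 -> kapm a b (f y) t = 0.
Proof.
move=> [ab _ _ _] h; apply/row_matrixP => i; rewrite rowK row0; exact: kapr_left.
Qed.

Lemma kapm_right y a b t : is_cell S a b -> b - (b - a) / 3 < t -> kapm a b (f y) t = 0.
Proof.
move=> cab h; apply/row_matrixP => i; rewrite rowK row0.
have [ab ab1 aU su hu du Lab hL] := hgc y cab.
have L0 : 0 <= C2 * V0 by apply: mulr_ge0 => //; case: hC2.
exact: (kapr_right lam_smooth lam_free q ab oV aU su L0 Lab hL).
Qed.

Lemma horiz_is_derive h t : smooth_on V h -> (forall x, V x -> horiz lam h x = 0) -> V t ->
  is_derive t 1 h (derive1 h t *m proj (h t)).
Proof. by move=> sh hh Vt; apply: horiz_sol; [exact: (@sh 0%N t Vt)|exact: hh]. Qed.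

(** Where [kapm] vanishes and the control is the derivative of [h], the steered curve and [h] obey
    the same equation, so one common value propagates. *)
Lemma sel_on y a b a' b' c h : Yg y -> is_cell S a b -> a <= a' -> b' <= b -> a' <= c <= b' ->
  (forall t, a' < t < b' -> kapm a b (f y) t = 0) ->
  (forall t, a' < t < b' -> vc y a b t = derive1 h t) ->
  smooth_on V h -> (forall x, V x -> horiz lam h x = 0) ->
  (forall t, a' <= t <= b' -> `|h t| <= B) -> (sel y a b).2 c = h c ->
  forall t, a' <= t <= b' -> (sel y a b).2 t = h t.
Proof.
move=> Yy cab aa bb cin hk hv sh hh hb hc t tin.
have [e [e1 e2 e3 e4]] := he Yy cab; have adm := hadm y cab.
have [h1 h2 h3 h4 h5] := sel_ex Yy cab.
have sub x : a' <= x <= b' -> a <= x <= b.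
  by move=> /andP[x1 x2]; rewrite (le_trans aa x1) (le_trans x2 bb).
have h4' : sol a' b' (ctl (kapm a b (f y)) (vc y a b) (sel y a b).1) (sel y a b).2.
  by move=> x /sub; exact: h4.
have s2 : sol a' b' (derive1 h) h by move=> x /sub xab; apply: horiz_is_derive => //; exact: cell_D cab xab.
have ab := adm_ab adm.
have C10 : 0 <= C1 by rewrite (le_trans ler01)//; case: hC1.
have V1 : 0 <= V0 + 1 by rewrite addr_ge0.
have hC : C1 * (V0 + 1) * (b' - a') <= 2^-1.
  have ba : 0 <= b - a by rewrite subr_ge0 ltW.
  apply: (@le_trans _ _ (C1 * (V0 + 1) * (b - a))).
    by rewrite ler_wpM2l ?mulr_ge0//; apply: lerB.
  by apply: le_trans (adm_C1 adm); rewrite ler_wpM2r// ler_wpM2l//; lra.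
have := sol_dependence hC1 cin V1 (lexx 0) hC _ _ h4' s2 _ _ tin.
rewrite hc subrr normr0 !mulr0 addr0 mulr0 => hd.
apply/eqP; rewrite -subr_eq0 -normr_le0; apply: hd.
- by move=> x /andP[x1 x2]; apply: (ctl_le V00 hC1 hC2 adm e1 e2) => //; apply: sub; rewrite !ltW.
- by move=> x hx; rewrite /ctl hk// mulmx0 addr0 hv// subrr normr0.
- by move=> x /sub; exact: h5.
- by move=> x hx; apply: le_trans (hb x hx) _; rewrite lerDl.
Qed.

Definition cellof x : R * R := xget (0, 0) [set ab | is_cell S ab.1 ab.2 /\ ab.1 < x < ab.2].

Definition FF y x : 'rV[R]_N := if `[< C x >] then f y x
  else if `[< S x >] then (sel y (cellof x).1 (cellof x).2).2 x else f0 y x.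

Lemma FF_C y x : C x -> FF y x = f y x.
Proof. by move=> Cx; rewrite /FF asboolT. Qed.

Lemma FF_far y x : ~ C x -> ~ S x -> FF y x = f0 y x.
Proof. by move=> nC nS; rewrite /FF !asboolF. Qed.

Lemma FF_cell y a b x : is_cell S a b -> a < x < b -> FF y x = (sel y a b).2 x.
Proof.
move=> cab xab; have Sx : S x by case: cab => _ h _ _; exact: h.
have [nC _] := Sx; rewrite /FF asboolF// asboolT//.
have [c1 c2] : is_cell S (cellof x).1 (cellof x).2 /\ (cellof x).1 < x < (cellof x).2.
  by apply: (@xgetI _ _ [set ab | is_cell S ab.1 ab.2 /\ ab.1 < x < ab.2] (a, b)).
by have [-> ->] := cell_inj c1 cab c2 xab.
Qed.

Lemma cell_C_out a b c : is_cell S a b -> C c -> c <= a \/ b <= c.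
Proof.
move=> [ab h _ _] Cc; have [ca|ac] := leP c a; first by left.
have [bc|cb] := leP b c; first by right.
by have [] := h c; rewrite ?ac ?cb.
Qed.

(** The radius is uniform over [C] but depends on [y]: enough to identify germs for a fixed
    parameter, whereas estimates uniform in [y] rely on [flat_bound]. *)
Lemma flat_unif y : exists2 r, 0 < r & forall c x, C c -> `|x - c| < r -> f0 y x = g y x.
Proof.
have /compact_near_coveringP cov := cC.
have := cov R (nbhs (0 : R)) (fun r c => forall x, `|x - c| < `|r| -> f0 y x = g y x) _ _.
case=> [c Cc|e /= e0 he'].
  have [e /= e0 hE] := fl y Cc.
  exists ([set c' | `|c - c'| < e / 2], [set r | `|r| < e / 2]) => /=.
    split; first by exists (e / 2) => //=; rewrite divr_gt0.
    by exists (e / 2) => //=; [rewrite divr_gt0|move=> r /=; rewrite sub0r normrN].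
  move=> [c' r] /= [h1 h2] x hx; apply: hE => /=.
  have := ler_distD c' c x; rewrite (distrC c' x); lra.
have e2 : 0 < e / 2 by rewrite divr_gt0.
exists (e / 2) => // c x Cc hx; apply: (he' (e / 2) _ c Cc).
  by rewrite /= sub0r normrN gtr0_norm// ltr_pdivrMr// ltr_pMr// ltr1n.
by rewrite (gtr0_norm e2).
Qed.

Lemma vc_f y a b t r : (forall c x, C c -> `|x - c| < r -> f0 y x = g y x) ->
  (exists2 c, C c & `|t - c| < r) -> chi a b t = 1 -> vc y a b t = derive1 (f y) t.
Proof.
move=> hr [c Cc tc] ch; rewrite /vc ch scale1r.
have r0 : 0 < r by apply: le_lt_trans tc.
have oB : open (ball c r) by exact: ball_open.
have := @derive1n_local _ _ (ball c r) (f0 y) (g y) 1 oB _ t _.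
rewrite !derive1n1 => ->; first by rewrite addrC subrK.
  by move=> x; rewrite -ball_normE /= distrC; exact: hr.
by rewrite -ball_normE /= distrC.
Qed.

Lemma chi_left a b t : a < b -> t < a + (b - a) / 3 -> chi a b t = sgn a.
Proof. by move=> ab h; rewrite /chi stepc_left// mulr0 addr0. Qed.

Lemma chi_right a b t : a < b -> b - (b - a) / 3 < t -> chi a b t = sgn b.
Proof. by move=> ab h; rewrite /chi stepc_right// mulr1 addrC subrK. Qed.

Lemma chi_both a b t : C a -> C b -> chi a b t = 1.
Proof. by move=> Ca Cb; rewrite /chi /sgn !asboolT// subrr mul0r addr0. Qed.

Lemma sel_C_both y a b r : Yg y -> is_cell S a b -> C a -> C b -> b - a < r ->
  (forall c x, C c -> `|x - c| < r -> f0 y x = g y x) ->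
  forall t, a <= t <= b -> (sel y a b).2 t = f y t.
Proof.
move=> Yy cab Ca Cb bar hr.
have K0 : 0 <= rho C1 C2 V0 (Kc a b).
  apply: ltW; apply: (rho_gt0 V00 hC1 hC2); exact: (adm_K (hadm y cab)).
have sP : selP y a b (0, f y).
  split; rewrite /= ?normr0//; rewrite /pt ?asboolT//.
    move=> t tab; rewrite /ctl mul0mx addr0.
    rewrite (vc_f hr _ (chi_both t Ca Cb)).
      by apply: horiz_is_derive; [exact: (@sf y)|exact: hf|exact: cell_D cab tab].
    exists a => //; move: tab => /andP[t1 t2]; rewrite ger0_norm ?subr_ge0//.
    by apply: le_lt_trans bar; rewrite lerB.
  by move=> t tab; apply: le_trans (hB _ (hD cab tab)) _; rewrite lerDl.
by have [_] := sel_uniq Yy cab (sel_ex Yy cab) sP.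
Qed.

(** A cell shorter than [s] has both ends in [C] and the derivative of [f] as control, so the
    steered curve is [f]. In a longer cell a point within [s / 3] of [C] lies in an outer third next
    to an end in [C], where [kapm] is 0. *)
Lemma near_C y c : Yg y -> C c -> \forall x \near c, FF y x = f y x.
Proof.
move=> Yy Cc; have [r r0 hr] := flat_unif y.
pose s := Num.min r d; have s0 : 0 < s by rewrite lt_min r0.
have sr : s <= r by rewrite ge_min lexx.
have sd : s <= d by rewrite ge_min lexx orbT.
exists (s / 3) => /=; first by rewrite divr_gt0.
move=> x; rewrite /= distrC => xc.
have [Cx|nCx] := pselect (C x); first exact: FF_C.
have Sx : S x by split => //; exists c => //; lra.
have [a [b [cab /andP[ax xb]]]] := gap_cell cC Sx.
rewrite (FF_cell y cab); last by rewrite ax xb.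
have [ab hS nSa nSb] := cab.
have small : b - a < s -> C a /\ C b.
  move=> h; apply: contrapT => nn; have := cell_mixed cab nn; lra.
have full : b - a < s -> (sel y a b).2 x = f y x.
  move=> h; have [Ca Cb] := small h.
  by apply: (sel_C_both Yy cab Ca Cb (lt_le_trans h sr) hr); rewrite !ltW.
have [hl|hl] := ltP (b - a) s; first exact: full.
move: xc; rewrite ltr_norml => /andP[xc1 xc2].
case: (cell_C_out cab Cc) => cout.
  have Ca : C a.
    apply: contrapT => nCa; apply: nSa; split => //; exists c => //.
    by rewrite ltr_norml; apply/andP; split; lra.
  apply: (sel_on (a' := a) (b' := x) (c := a) Yy cab).
  - by [].
  - exact: ltW.
  - by rewrite lexx ltW.
  - by move=> t /andP[t1 t2]; apply: kapm_left => //; lra.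
  - move=> t /andP[t1 t2]; apply: (vc_f hr).
      by exists a => //; rewrite ltr_norml; apply/andP; split; lra.
    by rewrite chi_left// ?/sgn ?asboolT//; lra.
  - exact: (@sf y).
  - exact: hf.
  - by move=> t /andP[t1 t2]; apply: hB; apply: (hD cab); apply/andP; split; lra.
  - by have [_ -> _ _ _] := sel_ex Yy cab; rewrite /pt asboolT.
  - by rewrite lexx ltW.
have Cb : C b.
  apply: contrapT => nCb; apply: nSb; split => //; exists c => //.
  by rewrite ltr_norml; apply/andP; split; lra.
apply: (sel_on (a' := x) (b' := b) (c := b) Yy cab).
- exact: ltW.
- by [].
- by rewrite lexx ltW.
- by move=> t /andP[t1 t2]; apply: kapm_right => //; lra.
- move=> t /andP[t1 t2]; apply: (vc_f hr).
    by exists b => //; rewrite ltr_norml; apply/andP; split; lra.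
  by rewrite chi_right// ?/sgn ?asboolT//; lra.
- exact: (@sf y).
- exact: hf.
- by move=> t /andP[t1 t2]; apply: hB; apply: (hD cab); apply/andP; split; lra.
- by have [_ _ -> _ _] := sel_ex Yy cab; rewrite /pt asboolT.
- by rewrite lexx ltW.
Qed.

(** A cell that comes within [d / 3] of [x] does so through an end off [C]. Its length is then at
    least [d], so [x'] sits in an outer third, where the control is the derivative of [f0]. *)
Lemma near_far y x : Yg y -> ~ C x -> ~ S x -> \forall x' \near x, FF y x' = f0 y x'.
Proof.
move=> Yy nC nS.
have clC : closed C by apply: compact_closed => //; exact: Rhausdorff.
have nC' : \forall x' \near x, ~ C x'.
  by apply: open_nbhs_nbhs; split => //; exact: closed_openC.
have nd : \forall x' \near x, `|x - x'| < d / 3.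
  by exists (d / 3) => //=; rewrite divr_gt0.
apply: filterS2 nC' nd => x' nCx'; rewrite ltr_norml => /andP[xx1 xx2].
have [Sx'|nSx'] := pselect (S x'); last exact: FF_far.
have [a [b [cab /andP[ax xb]]]] := gap_cell cC Sx'.
rewrite (FF_cell y cab); last by rewrite ax xb.
have [ab hS nSa nSb] := cab.
have [xa|ax0] := leP x a.
  have nCa : ~ C a.
    move=> Ca; apply: nS; split => //; exists a => //.
    by rewrite ltr_norml; apply/andP; split; lra.
  have ld : d <= b - a by apply: (cell_mixed cab) => -[].
  apply: (sel_on (a' := a) (b' := x') (c := a) Yy cab).
  - by [].
  - exact: ltW.
  - by rewrite lexx ltW.
  - by move=> t /andP[t1 t2]; apply: kapm_left => //; lra.
  - move=> t /andP[t1 t2]; rewrite /vc chi_left//; last lra.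
    by rewrite /sgn asboolF// scale0r addr0.
  - exact: (@sf0 y).
  - exact: hf0.
  - by move=> t /andP[t1 t2]; apply: hB0; apply: (hD cab); apply/andP; split; lra.
  - by have [_ -> _ _ _] := sel_ex Yy cab; rewrite /pt asboolF.
  - by rewrite lexx ltW.
have bx : b <= x.
  by rewrite leNgt; apply/negP => xb0; apply: nS; apply: hS; rewrite ax0 xb0.
have nCb : ~ C b.
  move=> Cb; apply: nS; split => //; exists b => //.
  by rewrite ltr_norml; apply/andP; split; lra.
have ld : d <= b - a by apply: (cell_mixed cab) => -[].
apply: (sel_on (a' := x') (b' := b) (c := b) Yy cab).
- exact: ltW.
- by [].
- by rewrite lexx ltW.
- by move=> t /andP[t1 t2]; apply: kapm_right => //; lra.
- move=> t /andP[t1 t2]; rewrite /vc chi_right//; last lra.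
  by rewrite /sgn asboolF// scale0r addr0.
- exact: (@sf0 y).
- exact: hf0.
- by move=> t /andP[t1 t2]; apply: hB0; apply: (hD cab); apply/andP; split; lra.
- by have [_ _ -> _ _] := sel_ex Yy cab; rewrite /pt asboolF.
- by rewrite lexx ltW.
Qed.

(** In every cell [f0] is then itself a solution with parameter 0 and the right endpoints, so
    [sel_uniq] applies. *)
Lemma FF_eq0 y x : Yg y -> (forall t, V t -> f y t = g y t) -> FF y x = f0 y x.
Proof.
move=> Yy fg.
have fC c : C c -> f y c = f0 y c.
  by move=> Cc; rewrite (nbhs_singleton (fl y Cc)) fg//; apply: DV; exact: CD.
have [Cx|nCx] := pselect (C x); first by rewrite FF_C// fC.
have [Sx|nSx] := pselect (S x); last exact: FF_far.
have [a [b [cab xab]]] := gap_cell cC Sx.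
rewrite (FF_cell y cab xab).
have K0 : 0 <= rho C1 C2 V0 (Kc a b).
  apply: ltW; apply: (rho_gt0 V00 hC1 hC2); exact: (adm_K (hadm y cab)).
have ptE c : pt y c = f0 y c.
  by rewrite /pt; case: asboolP => // Cc; exact: fC.
have sP : selP y a b (0, f0 y).
  split; rewrite /= ?normr0 ?ptE//.
    move=> t tab; have Vt := cell_D cab tab; rewrite /ctl mul0mx addr0 /vc.
    have := @derive1n_local _ _ V (f y) (g y) 1 oV fg t Vt; rewrite !derive1n1 => ->.
    by rewrite subrr scaler0 addr0; apply: horiz_is_derive; [exact: (@sf0 y)|exact: hf0|].
  by move=> t tab; apply: le_trans (hB0 _ (hD cab tab)) _; rewrite lerDl.
have [_ h] := sel_uniq Yy cab (sel_ex Yy cab) sP.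
by apply: h; move: xab => /andP[? ?]; rewrite !ltW.
Qed.

Lemma sel_small y a b e : Yg y -> is_cell S a b -> e <= eps C1 C2 V0 (Kc a b) ->
  (forall t, a <= t <= b -> `|vc y a b t - derive1 (f y) t| <= e) ->
  `|pt y a - f y a| <= e -> `|pt y b - f y b| <= e ->
  `|(sel y a b).1| <= 10 * C1 * e.
Proof.
move=> Yy cab e1 e2 e3 e4.
have [th [F [h1 h2 h3 h4 [h5 h6]]]] := steer_exists B0 V00 hC1 hC2 (hadm y cab)
  (fun t => @vc_cont y a b t cab) e1 e2 e3 e4.
have sP : selP y a b (th, F) by split.
by have [-> _] := sel_uniq Yy cab (sel_ex Yy cab) sP.
Qed.

Lemma sel_deriv y a b t : Yg y -> is_cell S a b -> a <= t <= b ->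
  is_derive t 1 (sel y a b).2
    (ctl (kapm a b (f y)) (vc y a b) (sel y a b).1 t *m proj ((sel y a b).2 t)).
Proof. by move=> Yy cab tab; have [_ _ _ h _] := sel_ex Yy cab; exact: h. Qed.

End Selection.
End Core.

Section FiberFilter.
Context {Y : topologicalType} {T : Type} (A : Y * T -> Prop) (y0 : Y).

(** [y] tends to [y0] while the second component ranges freely over the fibre, so eventual
    statements are uniform in the cell. *)
Definition nearf : set_system (Y * T) :=
  [set Q | \forall y \near y0, forall t, A (y, t) -> Q (y, t)].

Global Instance nearf_filter : Filter nearf.
Proof.
split; first by apply: (@nearW _ (nbhs y0)).
- move=> P Q hP hQ.
  have hP' : \forall y \near y0, forall t, A (y, t) -> P (y, t) by exact: hP.
  have hQ' : \forall y \near y0, forall t, A (y, t) -> Q (y, t) by exact: hQ.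
  suff : \forall y \near y0, forall t, A (y, t) -> (P `&` Q) (y, t) by [].
  by apply: filterS2 hP' hQ' => y h1 h2 t At; split; [exact: h1|exact: h2].
- move=> P Q PQ hP.
  have hP' : \forall y \near y0, forall t, A (y, t) -> P (y, t) by exact: hP.
  suff : \forall y \near y0, forall t, A (y, t) -> Q (y, t) by [].
  by apply: filterS hP' => y h t At; apply: PQ; exact: h.
Qed.
End FiberFilter.

Lemma norm_sub1 (R : realType) (c : R) : 0 <= c <= 1 -> `|c - 1| <= 1.
Proof. by move=> /andP[c0 c1]; rewrite ler_norml; apply/andP; split; lra. Qed.

Lemma affine_near (R : realType) (N : nat) (c e : R) (x y z x' y' z' : 'rV[R]_N) :
  0 <= c <= 1 -> `|x - x'| <= e / 3 -> `|y - y'| <= e / 3 -> `|z - z'| <= e / 3 ->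
  `|(x + c *: (y - z)) - (x' + c *: (y' - z'))| <= e.
Proof.
move=> /andP[c0 c1] hx hy hz.
have -> : (x + c *: (y - z)) - (x' + c *: (y' - z')) = (x - x') + c *: ((y - y') - (z - z')).
  rewrite opprD addrACA -scalerBr; congr (_ + _ *: _).
  by rewrite !opprB addrACA [RHS]addrACA; congr (_ + _); rewrite addrC.
apply: (@le_trans _ _ (e / 3 + (e / 3 + e / 3))); last by lra.
apply: le_trans (ler_normD _ _) _; apply: lerD => //.
rewrite normrZ -[leRHS]mul1r; apply: ler_pM => //; first by rewrite ger0_norm.
by apply: le_trans (ler_normB _ _) _; apply: lerD.
Qed.

Lemma inv16_le1 (R : realType) (c K : R) : 1 <= c -> 1 <= K -> (16 * c * K ^+ 2)^-1 <= 1.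
Proof.
move=> c1 K1; have x1 : 1 <= 16 * c by lra.
have K2 : 1 <= K ^+ 2 by rewrite exprn_ege1.
rewrite invf_le1; last by rewrite (lt_le_trans ltr01)// mulr_ege1.
exact: mulr_ege1.
Qed.

Lemma third_le (R : realType) (e : R) : 0 < e -> e / 3 <= e.
Proof. by move=> e0; lra. Qed.

Lemma thirdsE (R : realType) (e : R) : e = e / 3 + (e / 3 + e / 3).
Proof. by lra. Qed.

Lemma half_addE (R : realType) (e c : R) : 0 <= c ->
  2 * (e / (2 * (1 + c)) + c * (e / (2 * (1 + c)))) = e.
Proof. by move=> c0; field; rewrite gt_eqF// ltr_wpDr. Qed.

Lemma half_add_le (R : realType) (e c P len : R) : 0 < e -> 0 <= c -> len <= 1 ->
  P <= e / (2 * (1 + c)) -> 2 * (P + len * (c * (e / (2 * (1 + c))))) <= e.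
Proof.
move=> e0 c0 l1 hP; have e1 : 0 <= e / (2 * (1 + c)) by rewrite divr_ge0 ?(ltW e0)// mulr_ge0// addr_ge0.
rewrite -[leRHS](half_addE e c0) ler_wpM2l// lerD// ler_piMl// mulr_ge0//.
Qed.

Lemma dist_eq (R : realType) (N : nat) (x y x' y' : 'rV[R]_N) (e : R) :
  x = x' -> y = y' -> `|x' - y'| <= e -> `|x - y| <= e.
Proof. by move=> -> ->. Qed.

Lemma dist_via (R : realType) (N : nat) (a b c d : 'rV[R]_N) (e : R) :
  `|a - b| <= e / 3 -> `|b - c| <= e / 3 -> `|d - c| <= e / 3 -> `|a - d| <= e.
Proof.
move=> h1 h2 h3; rewrite (thirdsE e).
apply: le_trans (ler_distD b _ _) _; apply: lerD => //.
by apply: le_trans (ler_distD c _ _) _; apply: lerD => //; rewrite distrC.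
Qed.

(** * Continuity of the glued family in the parameter *)

Section CoreContinuity.
Context {R : realType} {N p : nat}.
Variable lam : 'rV[R]_N -> 'M[R]_(p, N).
Hypothesis lam_smooth : smooth_forms lam.
Hypothesis lam_free : forall y, row_free (lam y).
Variable q : nat.
Local Notation proj := (proj lam).
Local Notation kapm := (kapm lam q).
Local Notation kapr := (kapr lam q).
Local Notation wm := (wm lam q).
Local Notation sol := (sol lam).
Variables (Y : topologicalType) (V D0 C : set R).
Hypotheses (oV : open V) (DV : D0 `<=` V) (cC : compact C).
Variables (f g f0 : Y -> R -> 'rV[R]_N).
Hypothesis sf : forall y, smooth_on V (f y).
Hypothesis sg : forall y, smooth_on V (g y).
Hypothesis sf0 : forall y, smooth_on V (f0 y).
Hypothesis hf : forall y x, V x -> horiz lam (f y) x = 0.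
Hypothesis hf0 : forall y x, V x -> horiz lam (f0 y) x = 0.
Hypothesis bf : forall k, exists B, forall y x, D0 x -> `|derive1n k (f y) x| <= B.
Hypothesis fl : forall y c, C c -> \forall x \near c, f0 y x = g y x.
Variables (cdet B V0 C1 C2 : R).
Hypothesis cdet0 : 0 < cdet.
Hypothesis hdet : forall y x, D0 x -> cdet <= `|detA lam q (f y) x|.
Hypotheses (B0 : 0 <= B) (V00 : 0 <= V0).
Hypothesis hB : forall y x, D0 x -> `|f y x| <= B.
Hypothesis hB0 : forall y x, D0 x -> `|f0 y x| <= B.
Hypothesis hV0 : forall y x, D0 x -> `|derive1 (f y) x| <= V0.
Hypothesis hC1 : proj_const lam (B + 2) C1.
Hypothesis hC2 : taylor_const lam (B + 2) C2.

Variables (K1 : R) (m1 : nat) (d : R) (Yg : Y -> Prop).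
Hypothesis d0 : 0 < d.
Local Notation S := (gapset C d).
Local Notation Kc a b := (K1 * wgt a b ^+ m1) (only parsing).
Hypothesis hD : forall a b, is_cell S a b -> forall t, a <= t <= b -> D0 t.
Hypothesis CD : forall c, C c -> D0 c.
Hypothesis hgc : forall y a b, is_cell S a b -> good_cell lam q V (C2 * V0) a b (f y).
Hypothesis hadm : forall y a b, is_cell S a b ->
  admissible lam B C1 C2 V0 a b (f y) (kapm a b (f y)) (wm a b (f y)) (Kc a b).
Local Notation chiC := (chi C).
Local Notation vcC := (vc C f g f0).
Local Notation ptC := (pt C f f0).
Hypothesis bg : forall k, exists B, forall y x, D0 x -> `|derive1n k (g y) x| <= B.
Hypothesis bf0 : forall k, exists B, forall y x, D0 x -> `|derive1n k (f0 y) x| <= B.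
Hypothesis hball : forall c x, C c -> `|x - c| <= 2 * d -> D0 x.
Variable tau : R.
Hypothesis tau0 : 0 <= tau.
Hypothesis htau : forall y x, Yg y -> D0 x ->
  `|f y x - g y x| <= tau /\ `|derive1 (f y) x - derive1 (g y) x| <= tau.

Lemma chi01 a b x : 0 <= chiC a b x <= 1.
Proof.
have /andP[s0 s1] := stepc01 a b x; rewrite /chi /sgn.
by case: asboolP => _; case: asboolP => _; apply/andP; split; nra.
Qed.

(** The gap between [f] and [g] enters only in cells with an end off [C]; with both ends in [C],
    [chi] is identically 1. *)
Definition mix a b : R := if `[< C a /\ C b >] then 0 else tau.

(** Each point of a cell is within the length of the cell of an end in [C], and that length is below
    [2 d], so the flatness estimates between [f0] and [g] apply on the whole cell. *)
Lemma dev_le m M0 M1 : 0 <= M0 -> 0 <= M1 ->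
  (forall y c x, C c -> (forall t, `|t - c| <= `|x - c| -> D0 t) ->
    `|derive1n 0 (f0 y) x - derive1n 0 (g y) x| <= M0 * `|x - c| ^+ m) ->
  (forall y c x, C c -> (forall t, `|t - c| <= `|x - c| -> D0 t) ->
    `|derive1n 1 (f0 y) x - derive1n 1 (g y) x| <= M1 * `|x - c| ^+ m) ->
  forall y a b, Yg y -> is_cell S a b ->
  [/\ forall t, a <= t <= b -> `|vcC y a b t - derive1 (f y) t| <= (M0 + M1) * (b - a) ^+ m + mix a b,
     `|ptC y a - f y a| <= (M0 + M1) * (b - a) ^+ m + mix a b
   & `|ptC y b - f y b| <= (M0 + M1) * (b - a) ^+ m + mix a b].
Proof.
move=> M00 M10 hM0 hM1 y a b Yy cab; have [ab _ _ _] := cab; have lab := cell_length cab.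
have ba : 0 <= b - a by rewrite subr_ge0 ltW.
have mx0 : 0 <= mix a b by rewrite /mix; case: asboolP.
have key k M x : (k = 0%N /\ M = M0) \/ (k = 1%N /\ M = M1) -> a <= x <= b ->
    `|derive1n k (f0 y) x - derive1n k (g y) x| <= (M0 + M1) * (b - a) ^+ m.
  move=> kM xab; have [c Cc [xc _]] := cell_close cab xab.
  have hb t : `|t - c| <= `|x - c| -> D0 t.
    by move=> h; apply: (hball Cc); apply: le_trans h _; apply: (le_trans xc); exact: ltW.
  have pw : `|x - c| ^+ m <= (b - a) ^+ m.
    by apply: lerXn2r => //; rewrite nnegrE.
  have Mle : 0 <= M /\ M <= M0 + M1 by case: kM => -[_ ->]; split => //; lra.
  apply: (@le_trans _ _ (M * `|x - c| ^+ m)).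
    by case: kM => -[-> ->]; [exact: hM0|exact: hM1].
  by case: Mle => M_0 M_1; exact: (ler_pM M_0 (exprn_ge0 _ (normr_ge0 _)) M_1 pw).
have aab : a <= a <= b by rewrite lexx ltW.
have bab : a <= b <= b by rewrite lexx ltW.
have ptb c : a <= c <= b -> (C c \/ ~ (C a /\ C b)) -> `|ptC y c - f y c| <= (M0 + M1) * (b - a) ^+ m + mix a b.
  move=> cin hc; have k0 := key 0%N M0 c (or_introl (conj erefl erefl)) cin.
  rewrite /pt; case: asboolP => Cc.
    by rewrite subrr normr0 addr_ge0// (le_trans _ k0).
  case: hc => // nb; rewrite /mix asboolF//.
  rewrite -(subrK (g y c) (f0 y c)) -addrA; apply: le_trans (ler_normD _ _) _.
  apply: lerD; first exact: k0.
  by rewrite distrC; have [] := htau Yy (hD cab cin).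
split.
- move=> t tab; have k1 := key 1%N M1 t (or_intror (conj erefl erefl)) tab.
  have -> : vcC y a b t - derive1 (f y) t = (derive1 (f0 y) t - derive1 (g y) t) +
      (chiC a b t - 1) *: (derive1 (f y) t - derive1 (g y) t).
    rewrite /vc scalerBl scale1r opprB addrACA [RHS]addrA.
    by rewrite [RHS]addrA subrK.
  apply: le_trans (ler_normD _ _) _; apply: lerD; first by rewrite -!derive1n1.
  rewrite normrZ /mix; case: asboolP => [[Ca Cb]|nb].
    by rewrite (chi_both t Ca Cb) subrr normr0 mul0r.
  have [_ ht] := htau Yy (hD cab tab).
  rewrite -[leRHS]mul1r; apply: ler_pM => //.
  by apply: norm_sub1; exact: chi01.
- by apply: ptb => //; have [Ca|nCa] := pselect (C a); [left|right => -[]].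
- by apply: ptb => //; have [Cb|nCb] := pselect (C b); [left|right => -[]].
Qed.

Lemma dev_bound m : exists2 M, 0 <= M & forall y a b, Yg y -> is_cell S a b ->
  [/\ forall t, a <= t <= b -> `|vcC y a b t - derive1 (f y) t| <= M * (b - a) ^+ m + mix a b,
     `|ptC y a - f y a| <= M * (b - a) ^+ m + mix a b
   & `|ptC y b - f y b| <= M * (b - a) ^+ m + mix a b].
Proof.
have [M0 M00 hM0] := flat_bound DV sf0 sg bf0 bg fl m 0.
have [M1 M10 hM1] := flat_bound DV sf0 sg bf0 bg fl m 1.
exists (M0 + M1); first exact: addr_ge0.
exact: dev_le.
Qed.

Hypothesis he : forall y a b, Yg y -> is_cell S a b -> exists e,
  [/\ e <= eps C1 C2 V0 (Kc a b),
      forall t, a <= t <= b -> `|vcC y a b t - derive1 (f y) t| <= e,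
      `|ptC y a - f y a| <= e & `|ptC y b - f y b| <= e].
Local Notation sel := (sel lam q C f g f0 B V0 C1 C2 K1 m1).
Local Notation FF := (FF lam q C f g f0 B V0 C1 C2 K1 m1 d).
Let selex := sel_ex DV sf sg sf0 B0 V00 hC1 hC2 hD hadm he.
Let selsmall := sel_small DV sf sg sf0 B0 V00 hC1 hC2 hD hadm he.
Let selderiv := sel_deriv DV sf sg sf0 B0 V00 hC1 hC2 hD hadm he.
Let C11 : 1 <= C1. Proof. by case: hC1. Qed.
Let C20 : 0 <= C2. Proof. by case: hC2. Qed.
Let L0 : 0 <= C2 * V0. Proof. exact: mulr_ge0. Qed.

Lemma kapmE a b u t r s : a < t < b -> kapm a b u t r s = kapf lam q a b u r t 0 s.
Proof. by move=> tab; rewrite [LHS]mxE /kapr tab. Qed.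

Lemma th_kapf (th : 'rV[R]_N) a b u t mu : a < t < b ->
  (th *m kapm a b u t) 0 mu = \sum_j th 0 j * kapf lam q a b u j t 0 mu.
Proof.
by move=> tab; rewrite mxE; apply: eq_bigr => j _; rewrite mxE /kapr tab.
Qed.

Lemma ctl_smooth y a b (th : 'rV[R]_N) : is_cell S a b ->
  smooth_on `]a, b[ (ctl (kapm a b (f y)) (vcC y a b) th).
Proof.
move=> cab; have [ab ab1 aU su hu du Lab hL] := hgc y cab.
have oC := @open_cell R a b; have sC := sub_cell aU.
have s0 := smooth_on_sub sC (smooth_on_derive1 (@sf0 y)).
have s1 := smooth_on_sub sC (smooth_on_derive1 (@sf y)).
have s2 := smooth_on_sub sC (smooth_on_derive1 (@sg y)).
have s3 := (smooth_onD oC s1 (smooth_onZ oC (-1) s2).1).1.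
have s4 := smooth_onM oC (smooth_stepc ab ab1) s3.
have s5 := (smooth_onD oC (smooth_onZ oC (sgn C a) s3).1 (smooth_onZ oC (sgn C b - sgn C a) s4).1).1.
have sk j := (smooth_onZ oC (th 0 j) (smooth_kapf lam_smooth lam_free ab ab1 oV aU su du L0 Lab hL (i := j))).1.
have s6 := (smooth_on_sum oC (index_enum _) sk).1.
have s7 := (smooth_onD oC (smooth_onD oC s0 s5).1 s6).1.
apply: (smooth_on_ext oC _ s7) => t; rewrite /= in_itv /= => tab.
rewrite /ctl /vc /chi; congr (_ + _ + _).
  by rewrite scaleN1r [RHS]scalerDl scalerA.
by apply/rowP => mu; rewrite th_kapf// summxE; apply: eq_bigr => j _; rewrite mxE.
Qed.

Lemma sel_smooth y a b : Yg y -> is_cell S a b -> smooth_on `]a, b[ (sel y a b).2.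
Proof.
move=> Yy cab; have oC := @open_cell R a b.
apply: (sol_smooth lam_smooth lam_free oC (@ctl_smooth y a b (sel y a b).1 cab)) => t.
by rewrite /= in_itv /= => /andP[t1 t2]; apply: selderiv => //; rewrite !ltW.
Qed.

Section Tiny.
Let I := (Y * (R * R))%type.
Let A (i : I) := Yg i.1 /\ is_cell S i.2.1 i.2.2.
Let len (i : I) := i.2.2 - i.2.1.
Let G := lenf A len.
Let FG : Filter G := lenf_filter A len.
Let w (i : I) := wgt i.2.1 i.2.2.
Let w1 i : 1 <= w i := wgt_ge1 _ _.
Let O (i : I) : set R := `]i.2.1, i.2.2[%classic.
Let oO i : open (O i) := @open_cell R _ _.
Let OO i : O i `<=` O i := @subset_refl _ _.
Let F (i : I) := (sel i.1 i.2.1 i.2.2).2.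
Let th (i : I) := (sel i.1 i.2.1 i.2.2).1.

Lemma nearA : \forall i \near G, A i.
Proof. by exists 1. Qed.

Lemma OD : \forall i \near G, forall x, O i x -> D0 x.
Proof.
exists 1 => // i [_ cab] _ x; rewrite /O /= in_itv /= => /andP[? ?].
by apply: (hD cab); rewrite !ltW.
Qed.

Lemma len_w m e (M : R) : 0 <= M -> 0 < e -> \forall i \near G, M * len i ^+ m.+1 * w i ^+ m <= e.
Proof.
move=> M0 e0; pose l := Num.min 1 (e / (M + 1)).
have M1 : 0 < M + 1 by rewrite ltr_wpDl.
exists l; first by rewrite lt_min ltr01 divr_gt0.
move=> i [_ [ab _ _ _]]; rewrite /l lt_min => /andP[l1 l2].
have lp : 0 < len i by rewrite subr_gt0.
have -> : w i = (len i)^-1.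
  by rewrite /w /wgt max_r// -[leLHS]invr1 lef_pV2 ?posrE// ltW.
rewrite exprVn exprS -!mulrA mulfV ?mulr1; last by rewrite expf_neq0// gt_eqF.
apply: (@le_trans _ _ (M * (e / (M + 1)))); first by rewrite ler_wpM2l// ltW.
by rewrite mulrA ler_pdivrMr// [leLHS]mulrC ler_wpM2l ?(ltW e0)// lerDl.
Qed.

Lemma both_near : \forall i \near G, C i.2.1 /\ C i.2.2.
Proof.
exists d => // i [_ cab] h; apply: contrapT => nn.
by have := cell_mixed cab nn; rewrite leNgt h.
Qed.

(** The defect is smaller than any power of the length, whereas [eps] is of order [len] to the power
    [2 m1]. This explains the exponent: [2 m1] to pay for [eps], [m] to absorb a weight, and one
    more to obtain smallness. *)
Lemma dev_near m : exists2 M, 0 <= M & \forall i \near G,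
  [/\ M * len i ^+ (m + m1.*2).+1 <= eps C1 C2 V0 (Kc i.2.1 i.2.2),
     `|th i| <= 10 * C1 * (M * len i ^+ (m + m1.*2).+1)
   & forall x, O i x -> `|F i x - f i.1 x| <=
       4 * C1 * (M * len i ^+ (m + m1.*2).+1 + Kc i.2.1 i.2.2 * (10 * C1 * (M * len i ^+ (m + m1.*2).+1)))].
Proof.
have [M M0 hM] := dev_bound (m + m1.*2).+1.
exists M => //.
have C50 := C5_ge1 V00 hC1 hC2.
have M'0 : 0 <= M * (160 * C1 * C5 C1 C2 V0 * K1 ^+ 2).
  have c10 := le_trans ler01 C11; have c50 := le_trans ler01 C50.
  exact: (mulr_ge0 M0 (mulr_ge0 (mulr_ge0 (mulr_ge0 (ler0n _ 160) c10) c50) (sqr_ge0 K1))).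
have h1 := len_w (m + m1.*2) M'0 ltr01.
apply: filterS3 nearA both_near h1 => i [Yi cab] [Ca Cb] hl.
have [d1 d2 d3] := hM i.1 i.2.1 i.2.2 Yi cab.
have mx : mix i.2.1 i.2.2 = 0 by rewrite /mix asboolT.
rewrite mx !addr0 in d1 d2 d3.
have adm := hadm i.1 cab; have K1' := adm_K adm.
have W1 : forall n, 1 <= w i ^+ n by move=> n; rewrite exprn_ege1.
have le0 : 0 <= M * len i ^+ (m + m1.*2).+1.
  by rewrite mulr_ge0// exprn_ge0// subr_ge0 ltW//; exact: adm_ab adm.
have ee : M * len i ^+ (m + m1.*2).+1 <= eps C1 C2 V0 (Kc i.2.1 i.2.2).
  rewrite /eps -[leRHS]mul1r ler_pdivlMr; last first.
    by apply: mulr_gt0; [rewrite !mulr_gt0// (lt_le_trans ltr01)|rewrite exprn_gt0// (lt_le_trans ltr01)].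
  apply: le_trans hl; rewrite exprMn -exprM -/(w i).
  rewrite [leRHS](_ : _ = M * len i ^+ (m + m1.*2).+1 * (160 * C1 * C5 C1 C2 V0 * (K1 ^+ 2 * w i ^+ (m + m1.*2)))); last by ring.
  apply: ler_wpM2l => //; apply: ler_wpM2l; first by rewrite !mulr_ge0// (le_trans ler01).
  apply: ler_wpM2l; first by rewrite exprn_even_ge0.
  by apply: ler_weXn2l => //; rewrite muln2 leq_addl.
have ht := selsmall Yi cab ee d1 d2 d3.
split => // x Ox; have [h1' h2' h3' h4' h5'] := selex Yi cab.
have xab : i.2.1 <= x <= i.2.2 by move: Ox; rewrite /O /= in_itv /= => /andP[? ?]; rewrite !ltW.
have := ctl_near_u V00 hC1 hC2 adm ee d1 d2 h1' h2' h4' h5' xab.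
move=> h; apply: le_trans h _; apply: ler_wpM2l; first exact: (mulr_ge0 (ler0n _ 4) (le_trans ler01 C11)).
by rewrite lerD2l ler_wpM2l ?(le_trans ler01).
Qed.

Lemma gcA : \forall i \near G, good_cell lam q V (C2 * V0) i.2.1 i.2.2 (f i.1).
Proof. by apply: filterS nearA => i [_ cab]; exact: hgc. Qed.

Lemma smA (h : Y -> R -> 'rV[R]_N) : (forall y, smooth_on V (h y)) ->
  \forall i \near G, smooth_on (O i) (h i.1).
Proof.
move=> sh; apply: filterS OD => i hi; apply: smooth_on_sub (sh i.1) => x Ox.
by apply: DV; exact: hi.
Qed.

Lemma tiny_refl (h : Y -> R -> 'rV[R]_N) k : (forall y, smooth_on V (h y)) ->
  (forall k, exists B, forall y x, D0 x -> `|derive1n k (h y) x| <= B) ->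
  vcvb G O O w k (fun i => h i.1) (fun i => h i.1).
Proof.
move=> sh bh; apply: (pointwise_vcvb oO OO w1 (smA sh) (smA sh)).
  by move=> j _; have [Bj hBj] := bh j; exists Bj; apply: filterS OD => i hi x Ox; apply: hBj; exact: hi.
by move=> j _ m e e0; apply: nearW => i x _; rewrite subrr normr0 mul0r ltW.
Qed.

Lemma tiny_flat k : vcvb G O O w k (fun i => f0 i.1) (fun i => g i.1).
Proof.
apply: (pointwise_vcvb oO OO w1 (smA sf0) (smA sg)).
  by move=> j _; have [Bj hBj] := bg j; exists Bj; apply: filterS OD => i hi x Ox; apply: hBj; exact: hi.
move=> j _ m e e0; have [M M0 hM] := flat_bound DV sf0 sg bf0 bg fl m.+1 j.
apply: filterS2 nearA (len_w m M0 e0) => i [_ cab] hl x; rewrite /O /= in_itv /= => /andP[x1 x2].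
apply: le_trans hl; rewrite ler_wpM2r ?exprn_ge0 ?(le_trans ler01)//.
have xab : i.2.1 <= x <= i.2.2 by rewrite !ltW.
have [c Cc [xc _]] := cell_close cab xab.
have lab := cell_length cab.
apply: le_trans (hM i.1 c x Cc _) _.
  by move=> t h; apply: (hball Cc); apply: le_trans h _; apply: (le_trans xc); exact: ltW.
by rewrite ler_wpM2l//; apply: lerXn2r => //; rewrite nnegrE// (le_trans _ xc).
Qed.

Lemma tiny_kapf j k : vcvb G O O w k (fun i => kapf lam q i.2.1 i.2.2 (f i.1) j)
  (fun i => kapf lam q i.2.1 i.2.2 (f i.1) j).
Proof.
have hw : \forall i \near G, (i.2.2 - i.2.1)^-1 <= w i.
  by apply: nearW => i; rewrite /w /wgt le_max lexx orbT.
have fB : \forall i \near G, forall t, i.2.1 < t < i.2.2 -> `|f i.1 t| <= B.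
  by apply: filterS OD => i hi t ht; apply: hB; apply: hi; rewrite /O /= in_itv.
have hc : \forall i \near G, forall t, i.2.1 < t < i.2.2 ->
    cdet <= `|detA lam q (f i.1) t| /\ cdet <= `|detA lam q (f i.1) t|.
  by apply: filterS OD => i hi t ht; split; apply: hdet; apply: hi; rewrite /O /= in_itv.
exact: (kapf_cvb lam_smooth lam_free oV L0 w1 hw gcA gcA fB cdet0 hc (fun k => @tiny_refl f k sf bf)).
Qed.

(** On short cells both ends lie in [C]. The control differs from the derivative of [f] by that of
    [f0 - g], which is flat, and by a negligible multiple of [kapm], which is moderate; [sol_cvb]
    turns this into closeness of all derivatives. *)
Lemma tiny_vcvb k : vcvb G O O w k F (fun i => f i.1).
Proof.
suff h : vcvb G O O w k.+1 F (fun i => f i.1) by move=> mu; apply: cvbW; exact: h.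
pose cc (i : I) := ctl (kapm i.2.1 i.2.2 (f i.1)) (vcC i.1 i.2.1 i.2.2) (th i).
have dF : \forall i \near G, forall x, O i x -> is_derive x 1 (F i) (cc i x *m proj (F i x)).
  apply: filterS nearA => i [Yi cab] x; rewrite /O /= in_itv /= => /andP[? ?].
  by apply: selderiv => //; rewrite !ltW.
have df : \forall i \near G, forall x, O i x ->
    is_derive x 1 (f i.1) (derive1 (f i.1) x *m proj (f i.1 x)).
  apply: filterS OD => i hi x Ox; apply: (horiz_is_derive (V := V)).
  - exact: (@sf i.1).
  - exact: hf.
  - by apply: DV; exact: hi.
have fB : \forall i \near G, forall x, O i x -> `|f i.1 x| <= B.
  by apply: filterS OD => i hi x Ox; apply: hB; exact: hi.
apply: (sol_cvb lam_smooth lam_free oO OO w1 dF df fB).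
  move=> m e e0; have [M M0 hM] := dev_near m.
  have M'0 : 0 <= 4 * C1 * (1 + 10 * C1 * `|K1|) * M.
    by rewrite !mulr_ge0 ?addr_ge0 ?mulr_ge0// (le_trans ler01).
  apply: filterS3 nearA hM (len_w (m + m1.*2) M'0 e0) => i Ai [_ _ h] hl x Ox.
  apply: le_trans hl.
  set E := M * len i ^+ (m + m1.*2).+1 in h *.
  have W1 n : 1 <= w i ^+ n by rewrite exprn_ege1.
  have E0 : 0 <= 4 * C1 * (E + Kc i.2.1 i.2.2 * (10 * C1 * E)) by apply: le_trans (h x Ox).
  apply: le_trans (ler_wpM2r (le_trans ler01 (W1 m)) (h x Ox)) _.
  have adm := hadm i.1 (b := i.2.2) (a := i.2.1).
  have cab : is_cell S i.2.1 i.2.2 by case: Ai.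
  have {}adm := adm cab; have ab := adm_ab adm.
  have Ep : 0 <= E by rewrite /E mulr_ge0// exprn_ge0// subr_ge0 ltW.
  have c10 : 0 <= C1 := le_trans ler01 C11.
  have t0 : 0 <= 10 * C1 * `|K1| by rewrite !mulr_ge0.
  have W0 n : 0 <= w i ^+ n := le_trans ler01 (W1 n).
  have wm2 : w i ^+ m <= w i ^+ (m + m1.*2) by apply: ler_weXn2l => //; exact: leq_addr.
  have wm3 : w i ^+ m1 * w i ^+ m <= w i ^+ (m + m1.*2).
    by rewrite -exprD; apply: ler_weXn2l => //; rewrite -addnn addnA (addnC m1) leq_addr.
  have hK : Kc i.2.1 i.2.2 <= `|K1| * w i ^+ m1 by rewrite ler_wpM2r// ler_norm.
  have -> : 4 * C1 * (1 + 10 * C1 * `|K1|) * M * len i ^+ (m + m1.*2).+1 * w i ^+ (m + m1.*2) =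
     4 * C1 * E * w i ^+ (m + m1.*2) + 4 * C1 * E * (10 * C1 * `|K1|) * w i ^+ (m + m1.*2).
    by rewrite /E; ring.
  have -> : 4 * C1 * (E + Kc i.2.1 i.2.2 * (10 * C1 * E)) * w i ^+ m =
     4 * C1 * E * w i ^+ m + (4 * C1 * E * (10 * C1) * w i ^+ m) * Kc i.2.1 i.2.2 by ring.
  have h4 : 0 <= 4 * C1 * E := mulr_ge0 (mulr_ge0 (ler0n _ 4) c10) Ep.
  have h5 : 0 <= 4 * C1 * E * (10 * C1) * w i ^+ m := mulr_ge0 (mulr_ge0 h4 (mulr_ge0 (ler0n _ 10) c10)) (W0 m).
  apply: lerD; first exact: ler_wpM2l.
  apply: (@le_trans _ _ ((4 * C1 * E * (10 * C1) * w i ^+ m) * (`|K1| * w i ^+ m1))).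
    exact: ler_wpM2l.
  rewrite [leLHS](_ : _ = 4 * C1 * E * (10 * C1 * `|K1|) * (w i ^+ m1 * w i ^+ m)); last by ring.
  by apply: ler_wpM2l => //; exact: mulr_ge0 h4 t0.
have dsub (h : Y -> R -> 'rV[R]_N) (sh : forall y, smooth_on V (h y)) := smA sh.
have dg := vcvb_derive1 oO OO (smA sg) (smA sg) (@tiny_refl g k.+1 sg bg).
have df' := vcvb_derive1 oO OO (smA sf) (smA sf) (@tiny_refl f k.+1 sf bf).
have d0g := vcvb_derive1 oO OO (smA sf0) (smA sg) (tiny_flat k.+1).
have thc j : cvb G O O w k (fun i _ => th i 0 j) (fun _ _ => 0).
  apply: (@cvb_cst_gen R I G FG O O w oO OO k (fun i => th i 0 j) (fun=> 0)).
    by exists 0, 0%N; apply: nearW => i; rewrite normr0 mul0r.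
  move=> m e e0; have [M M0 hM] := dev_near m.
  have c10 : 0 <= C1 := le_trans ler01 C11.
  have M'0 : 0 <= 10 * C1 * M by rewrite !mulr_ge0.
  apply: filterS3 nearA hM (len_w (m + m1.*2) M'0 e0) => i [_ [ab _ _ _]] [_ h _] hl; rewrite subr0.
  apply: le_trans hl; have W1 n : 1 <= w i ^+ n by rewrite exprn_ege1.
  apply: (@le_trans _ _ (`|th i| * w i ^+ m)).
    by rewrite ler_wpM2r ?(le_trans ler01)//; exact: row_norm_coord.
  apply: ler_pM => //; first exact: le_trans ler01 (W1 m).
    by rewrite -!mulrA in h *.
  by apply: ler_weXn2l => //; exact: leq_addr.
move=> mu.
pose c0 (i : I) x := derive1 (f0 i.1) x 0 mu + (derive1 (f i.1) x 0 mu - derive1 (g i.1) x 0 mu) +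
  \sum_j th i 0 j * kapf lam q i.2.1 i.2.2 (f i.1) j x 0 mu.
pose c1 (i : I) x := derive1 (g i.1) x 0 mu + (derive1 (f i.1) x 0 mu - derive1 (g i.1) x 0 mu) +
  \sum_j 0 * kapf lam q i.2.1 i.2.2 (f i.1) j x 0 mu.
have h : cvb G O O w k c0 c1.
  apply: (cvbD oO OO w1).
    apply: (cvbD oO OO w1); first exact: d0g.
    by apply: (cvbB oO OO w1); [exact: df'|exact: dg].
  by apply: (cvb_sum oO OO w1) => j _; apply: (cvbM oO OO w1); [exact: thc|exact: tiny_kapf].
apply: (cvb_ext oO OO _ _ h).
  apply: filterS both_near => i [Ca Cb] x; rewrite /O /= in_itv /= => xab.
  rewrite /c0 /cc /ctl mxE th_kapf// /vc (chi_both x Ca Cb) scale1r; congr (_ + _).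
  by rewrite mxE [in RHS]mxE [in RHS]mxE.
apply: nearW => i x _; rewrite /c1 big1 ?addr0; last by move=> j _; rewrite mul0r.
by rewrite addrC subrK.
Qed.

Lemma tiny_cells k e : 0 < e -> exists2 l, 0 < l & forall y a b, Yg y -> is_cell S a b -> b - a < l ->
  forall x, a < x < b -> `|derive1n k (sel y a b).2 x - derive1n k (f y) x| <= e.
Proof.
move=> e0; have sF : \forall i \near G, smooth_on (O i) (F i).
  by apply: filterS nearA => i [Yi cab]; exact: sel_smooth.
have [l l0 hl] := vcvb_pointwise oO OO sF (smA sf) (tiny_vcvb k) (leqnn k) 0%N e0.
exists l => // y a b Yy cab bal x xab.
have := hl (y, (a, b)) (conj Yy cab) bal x; rewrite expr0 mulr1; apply.
by rewrite /O /= in_itv.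
Qed.

End Tiny.

Lemma derive1n_near (u v : R -> 'rV[R]_N) k (x : R) : (\forall x' \near x, u x' = v x') ->
  derive1n k u x = derive1n k v x.
Proof.
move=> h; have oI : open [set x' | u x' = v x']° by exact: open_interior.
apply: (@derive1n_local _ _ _ u v k oI) => // x'; exact: interior_subset.
Qed.

Section Long.
Variables (y0 : Y) (l : R).
Hypotheses (Yg0 : Yg y0) (l0 : 0 < l).
Hypotheses (cD0 : compact D0) (uf : ufam V f) (ug : ufam V g) (uf0 : ufam V f0).
Let I := (Y * (R * R))%type.
Let A (i : I) := [/\ Yg i.1, is_cell S i.2.1 i.2.2 & l <= i.2.2 - i.2.1].
Let G := nearf A y0.
Let FG : Filter G := nearf_filter A y0.
(** All lengths are at least [l] here, so a constant weight dominates the inverse length and the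
    calculus reduces to uniform convergence. *)
Let W : R := Num.max 1 l^-1.
Let w (i : I) : R := W.
Let w1 i : 1 <= w i. Proof. by rewrite /w /W le_max lexx. Qed.
Let O (i : I) : set R := `]i.2.1, i.2.2[%classic.
Let oO i : open (O i) := @open_cell R _ _.
Let OO i : O i `<=` O i := @subset_refl _ _.
Let F (i : I) := (sel i.1 i.2.1 i.2.2).2.
Let th (i : I) := (sel i.1 i.2.1 i.2.2).1.
Let F' (i : I) := (sel y0 i.2.1 i.2.2).2.
Let th' (i : I) := (sel y0 i.2.1 i.2.2).1.

Lemma longA : \forall i \near G, A i.
Proof. by apply: (@nearW _ (nbhs y0)) => y ab. Qed.

Lemma longD : \forall i \near G, forall x, O i x -> D0 x.
Proof.
apply: filterS longA => i [_ cab _] x; rewrite /O /= in_itv /= => /andP[? ?].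
by apply: (hD cab); rewrite !ltW.
Qed.

Lemma long_near (Q : Y -> Prop) : (\forall y \near y0, Q y) -> \forall i \near G, Q i.1.
Proof. by move=> h; apply: (@filterS _ (nbhs y0) _ Q _ _ h) => y Qy ab _. Qed.

Lemma long_sm (h : Y -> R -> 'rV[R]_N) (s : I -> Y) : (forall y, smooth_on V (h y)) ->
  \forall i \near G, smooth_on (O i) (h (s i)).
Proof.
move=> sh; apply: filterS longD => i hi; apply: smooth_on_sub (sh (s i)) => x Ox.
by apply: DV; exact: hi.
Qed.

Lemma long_vcvb (h : Y -> R -> 'rV[R]_N) k : (forall y, smooth_on V (h y)) -> ufam V h ->
  vcvb G O O w k (fun i => h i.1) (fun i => h y0).
Proof.
move=> sh uh; apply: (pointwise_vcvb oO OO w1 (long_sm (fun i => i.1) sh) (long_sm (fun=> y0) sh)).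
  move=> j _; have [Bj hBj] := smooth_bounded j DV cD0 (sh y0).
  by exists Bj; apply: filterS longD => i hi x Ox; apply: hBj; exact: hi.
move=> j _ m e e0; have W0 : 0 < W ^+ m by rewrite exprn_gt0// /W lt_max ltr01.
have e1 : 0 < e / W ^+ m by rewrite divr_gt0.
apply: filterS2 longD (long_near (uh y0 D0 j _ DV cD0 e1)) => i hi hy x Ox.
by rewrite -ler_pdivlMr//; apply: hy; exact: hi.
Qed.

Lemma long_kapf j k : vcvb G O O w k (fun i => kapf lam q i.2.1 i.2.2 (f i.1) j)
  (fun i => kapf lam q i.2.1 i.2.2 (f y0) j).
Proof.
have hw : \forall i \near G, (i.2.2 - i.2.1)^-1 <= w i.
  apply: filterS longA => i [_ [ab _ _ _] li]; rewrite /w /W le_max; apply/orP; right.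
  by rewrite lef_pV2// posrE subr_gt0.
have gc1 : \forall i \near G, good_cell lam q V (C2 * V0) i.2.1 i.2.2 (f i.1).
  by apply: filterS longA => i [_ cab _]; exact: hgc.
have gc2 : \forall i \near G, good_cell lam q V (C2 * V0) i.2.1 i.2.2 (f y0).
  by apply: filterS longA => i [_ cab _]; exact: hgc.
have fB : \forall i \near G, forall t, i.2.1 < t < i.2.2 -> `|f y0 t| <= B.
  by apply: filterS longD => i hi t ht; apply: hB; apply: hi; rewrite /O /= in_itv.
have hc : \forall i \near G, forall t, i.2.1 < t < i.2.2 ->
    cdet <= `|detA lam q (f i.1) t| /\ cdet <= `|detA lam q (f y0) t|.
  by apply: filterS longD => i hi t ht; split; apply: hdet; apply: hi; rewrite /O /= in_itv.
exact: (kapf_cvb lam_smooth lam_free oV L0 w1 hw gc1 gc2 fB cdet0 hc (fun k => @long_vcvb f k sf uf)).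
Qed.

Lemma vc_near e : 0 < e -> \forall i \near G,
  [/\ forall t, i.2.1 <= t <= i.2.2 -> `|vcC i.1 i.2.1 i.2.2 t - vcC y0 i.2.1 i.2.2 t| <= e,
     `|ptC i.1 i.2.1 - ptC y0 i.2.1| <= e & `|ptC i.1 i.2.2 - ptC y0 i.2.2| <= e].
Proof.
move=> e0; have e3 : 0 < e / 3 by rewrite divr_gt0.
have nd (h : Y -> R -> 'rV[R]_N) k : ufam V h -> \forall i \near G, forall x, D0 x ->
    `|derive1n k (h i.1) x - derive1n k (h y0) x| <= e / 3.
  by move=> uh; exact: (long_near (uh y0 D0 k _ DV cD0 e3)).
have n0 := @filterI _ G FG _ _ (nd f 0%N uf) (nd f0 0%N uf0).
have n1 := @filterI _ G FG _ _ (nd f 1%N uf) (nd g 1%N ug).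
have n01 := @filterI _ G FG _ _ n0 n1.
apply: filterS3 longA n01 (nd f0 1%N uf0) => i [_ cab _] [[h1 h2] [h3 h4]] h5.
have [ab _ _ _] := cab.
have ptb c : D0 c -> `|ptC i.1 c - ptC y0 c| <= e.
  move=> Dc; have l3 := third_le e0.
  by rewrite /pt; case: asboolP => _; apply: le_trans l3; [exact: h1|exact: h2].
split; last 2 first.
- by apply: ptb; apply: (hD cab); rewrite lexx ltW.
- by apply: ptb; apply: (hD cab); rewrite lexx ltW.
move=> t tab; have Dt := hD cab tab; have := h3 t Dt; have := h4 t Dt; have := h5 t Dt.
rewrite !derive1n1 => k1 k2 k3.
exact (affine_near (chi01 i.2.1 i.2.2 t) k1 k3 k2).
Qed.

(** [steer_compare] between the problems at [y] and at [y0]: uncorrected controls and endpoints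
    converge by [vc_near], the matrices [kapm] by [long_kapf]. *)
Lemma th_near e : 0 < e -> \forall i \near G, `|th i - th' i| <= e.
Proof.
move=> e0; have C10 : 0 <= C1 := le_trans ler01 C11.
have c0 : 0 < 6 + 4 * C1 by rewrite ltr_pwDl// mulr_ge0.
(* [6 + 4 * C1] is the constant of [steer_compare]; the factor 2 leaves room for the two
   contributions to the difference of controls. *)
pose e1 := e / (6 + 4 * C1) / 2; have e1p : 0 < e1 by rewrite /e1 !divr_gt0.
have NN : 0 < N%:R + 1 :> R by rewrite ltr_wpDl.
have e2 : 0 < e1 / (N%:R + 1) by rewrite divr_gt0.
have hk : \forall i \near G, forall j x, O i x ->
    `|kapf lam q i.2.1 i.2.2 (f i.1) j x - kapf lam q i.2.1 i.2.2 (f y0) j x| <= e1 / (N%:R + 1).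
  apply: (@cv0_near_forall N I G FG (fun j i => forall x, O i x -> _)) => j.
  have hm mu : \forall i \near G, forall x, O i x ->
      `|kapf lam q i.2.1 i.2.2 (f i.1) j x 0 mu - kapf lam q i.2.1 i.2.2 (f y0) j x 0 mu| <= e1 / (N%:R + 1).
    have [_ _ _ /(_ 0%N _ e2)] := @long_kapf j 0%N mu.
    by apply: filterS => i hi x Ox; have := hi x Ox; rewrite expr0 mulr1.
  have := @cv0_near_forall N I G FG (fun mu i => forall x, O i x -> _) hm.
  apply: filterS => i hi x Ox; apply: row_norm_le => [|mu]; first exact: ltW.
  have := hi mu x Ox; congr (`|_| <= _).
  by rewrite [RHS]mxE; congr (_ + _); rewrite [RHS]mxE.
apply: filterS3 longA (vc_near e1p) hk => i [Yi cab _] [hv ha hb] {}hk.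
have ab : i.2.1 < i.2.2 by case: cab.
have [e3 [b1 b2 b3 b4]] := he Yg0 cab.
have [h1 h2 h3 h4 h5] := selex Yg0 cab; have [k1 k2 k3 k4 k5] := selex Yi cab.
have rho1 : rho C1 C2 V0 (Kc i.2.1 i.2.2) <= 1.
  exact: inv16_le1 (C5_ge1 V00 hC1 hC2) (adm_K (hadm y0 cab)).
have hh : forall t, i.2.1 < t < i.2.2 ->
   `|ctl (kapm i.2.1 i.2.2 (f y0)) (vcC y0 i.2.1 i.2.2) (th i) t -
     ctl (kapm i.2.1 i.2.2 (f i.1)) (vcC i.1 i.2.1 i.2.2) (th i) t| <= e1 * 2.
  move=> t tab; rewrite /ctl opprD addrACA -mulmxBr.
  apply: le_trans (ler_normD _ _) _; rewrite mulr_natr mulr2n; apply: lerD.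
    by rewrite distrC; apply: hv; case/andP: tab => ? ?; rewrite !ltW.
  have e2' := ltW e2.
  apply: le_trans (mulmx_row_le _ e2' _) _.
    move=> r s; have := hk r t; rewrite /O /= in_itv /= => /(_ tab).
    rewrite distrC => /(le_trans (row_norm_coord _ s)); congr (`|_| <= _).
    rewrite [LHS]mxE [RHS]mxE; congr (_ + _); first by rewrite kapmE.
    by rewrite [LHS]mxE [RHS]mxE kapmE.
  have t1 : `|th i| <= 1 by apply: le_trans rho1.
  apply: (@le_trans _ _ (N%:R * (e1 / (N%:R + 1)) * 1)).
    by rewrite ler_wpM2l// mulr_ge0.
  by rewrite mulr1 mulrA ler_pdivrMr// [leLHS]mulrC ler_wpM2l ?(ltW e1p)// lerDl.
have e1le : e1 <= e1 * 2 by rewrite ler_peMr// ?ler1n// ltW.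
have cv t (tab : i.2.1 <= t <= i.2.2) : {for t, continuous (vcC y0 i.2.1 i.2.2)}.
  exact: (vc_cont DV sf sg sf0 hD).
have ha' : `|ptC y0 i.2.1 - ptC i.1 i.2.1| <= e1 * 2 by rewrite distrC; exact: le_trans ha e1le.
have hb' : `|ptC y0 i.2.2 - ptC i.1 i.2.2| <= e1 * 2 by rewrite distrC; exact: le_trans hb e1le.
have h := steer_compare B0 V00 hC1 hC2 (hadm y0 cab) cv b1 b2 b3 h1 h2 h3 h4 h5 k1 k2 k3 k4 k5 ha' hb' hh.
rewrite distrC; apply: le_trans h _.
by rewrite /e1 [leLHS](_ : _ = e)//; field; rewrite gt_eqF.
Qed.

(** With the lengths bounded below, control, steering parameter and endpoints all depend
    continuously on [y], uniformly in the cell; [sol_cvb] passes to all derivatives. *)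
Lemma long_cells k e : 0 < e -> \forall y \near y0, Yg y -> forall a b, is_cell S a b ->
  l <= b - a -> forall x, a < x < b ->
  `|derive1n k (sel y a b).2 x - derive1n k (sel y0 a b).2 x| <= e.
Proof.
move=> e0.
have thc j : cvb G O O w k (fun i _ => th i 0 j) (fun i _ => th' i 0 j).
  apply: (@cvb_cst_gen R I G FG O O w oO OO k (fun i => th i 0 j) (fun i => th' i 0 j)).
    have [M M0 hM] : exists2 M : R, 0 <= M & forall i, A i -> `|th' i| <= M.
      exists (rho C1 C2 V0 1); first by apply: ltW; exact: (rho_gt0 V00 hC1 hC2 (lexx 1)).
      move=> i [_ cab _]; have [h1 _ _ _ _] := selex Yg0 cab; apply: le_trans h1 _.
      have K1' := adm_K (hadm y0 cab); have C50 := lt_le_trans ltr01 (C5_ge1 V00 hC1 hC2).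
      have K2 : 1 <= (Kc i.2.1 i.2.2) ^+ 2 by rewrite exprn_ege1.
      have x0 : 0 < 16 * C5 C1 C2 V0 by rewrite mulr_gt0.
      rewrite /rho expr1n mulr1 lef_pV2 ?posrE//; first by rewrite ler_pMr.
      by rewrite mulr_gt0// (lt_le_trans ltr01).
    exists M, 0%N; apply: filterS longA => i Ai; rewrite expr0 mulr1.
    exact: le_trans (row_norm_coord _ j) (hM i Ai).
  move=> m e' e'0; have W0 : 0 < W ^+ m by rewrite exprn_gt0// /W lt_max ltr01.
  have e1 : 0 < e' / W ^+ m by rewrite divr_gt0.
  apply: filterS (th_near e1) => i hi; rewrite -ler_pdivlMr//.
  apply: le_trans hi; have := row_norm_coord (th i - th' i) j.
  by rewrite [in X in X <= _ -> _]mxE [in X in X <= _ -> _]mxE.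
pose c (i : I) := ctl (kapm i.2.1 i.2.2 (f i.1)) (vcC i.1 i.2.1 i.2.2) (th i).
pose c' (i : I) := ctl (kapm i.2.1 i.2.2 (f y0)) (vcC y0 i.2.1 i.2.2) (th' i).
have cc : vcvb G O O w k c c'.
  move=> mu.
  pose s (y : I -> Y) (t : I -> 'rV[R]_N) (i : I) x := derive1 (f0 (y i)) x 0 mu +
    (sgn C i.2.1 + (sgn C i.2.2 - sgn C i.2.1) * stepc i.2.1 i.2.2 x) *
     (derive1 (f (y i)) x 0 mu - derive1 (g (y i)) x 0 mu) +
    \sum_j t i 0 j * kapf lam q i.2.1 i.2.2 (f (y i)) j x 0 mu.
  have dv (h : Y -> R -> 'rV[R]_N) (sh : forall y, smooth_on V (h y)) (uh : ufam V h) :=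
    vcvb_derive1 oO OO (long_sm (fun i => i.1) sh) (long_sm (fun=> y0) sh) (@long_vcvb h k.+1 sh uh).
  have sg' (r : I -> R) : cvb G O O w k (fun i _ => sgn C (r i)) (fun i _ => sgn C (r i)).
    apply: (@cvb_cst_gen R I G FG O O w oO OO k (fun i => sgn C (r i)) (fun i => sgn C (r i))).
      exists 1, 0%N; apply: nearW => i; rewrite expr0 mulr1 /sgn.
      by case: asboolP => _; rewrite ?normr1 ?normr0.
    by move=> m e' e'0; apply: nearW => i; rewrite subrr normr0 mul0r ltW.
  have st : cvb G O O w k (fun i => stepc i.2.1 i.2.2) (fun i => stepc i.2.1 i.2.2).
    apply: (stepc_cvb oO OO w1).
      apply: filterS longA => i [_ cab li]; have [ab ab1 _ _ _ _ _ _] := hgc y0 cab.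
      split; [exact: ab|exact: ab1|].
      by rewrite /w /W le_max; apply/orP; right; rewrite lef_pV2// posrE subr_gt0.
    by apply: nearW => i x; rewrite /O /= in_itv.
  have h : cvb G O O w k (s (fun i => i.1) th) (s (fun=> y0) th').
    apply: (cvbD oO OO w1).
      apply: (cvbD oO OO w1); first exact: dv sf0 uf0 mu.
      apply: (cvbM oO OO w1).
        apply: (cvbD oO OO w1); first exact: sg'.
        by apply: (cvbM oO OO w1); [apply: (cvbB oO OO w1); exact: sg'|exact: st].
      by apply: (cvbB oO OO w1); [exact: dv sf uf mu|exact: dv sg ug mu].
    by apply: (cvb_sum oO OO w1) => j _; apply: (cvbM oO OO w1); [exact: thc|exact: long_kapf].
  have ext (y : I -> Y) (t : I -> 'rV[R]_N) i x : O i x ->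
      s y t i x = ctl (kapm i.2.1 i.2.2 (f (y i))) (vcC (y i) i.2.1 i.2.2) (t i) x 0 mu.
    rewrite /O /= in_itv /= => xab.
    rewrite /s /ctl [RHS]mxE th_kapf//; congr (_ + _).
    by rewrite /vc /chi [RHS]mxE; congr (_ + _); rewrite [RHS]mxE; congr (_ * _); rewrite [RHS]mxE; congr (_ + _); rewrite [RHS]mxE.
  by apply: (cvb_congr oO OO _ _ h) => i x Ox; exact: ext.
have dF : \forall i \near G, forall x, O i x -> is_derive x 1 (F i) (c i x *m proj (F i x)).
  apply: filterS longA => i [Yi cab _] x; rewrite /O /= in_itv /= => /andP[? ?].
  by apply: selderiv => //; rewrite !ltW.
have dF' : \forall i \near G, forall x, O i x -> is_derive x 1 (F' i) (c' i x *m proj (F' i x)).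
  apply: filterS longA => i [_ cab _] x; rewrite /O /= in_itv /= => /andP[? ?].
  by apply: selderiv => //; rewrite !ltW.
have FB : \forall i \near G, forall x, O i x -> `|F' i x| <= B + 2.
  apply: filterS longA => i [_ cab _] x; rewrite /O /= in_itv /= => /andP[? ?].
  by have [_ _ _ _ h] := selex Yg0 cab; apply: h; rewrite !ltW.
have F0 m e' : 0 < e' -> \forall i \near G, forall x, O i x -> `|F i x - F' i x| * w i ^+ m <= e'.
  move=> e'0; have W0 : 0 < W ^+ m by rewrite exprn_gt0// /W lt_max ltr01.
  have e1 : 0 < e' / W ^+ m / (2 * (1 + C1)).
    by rewrite !divr_gt0// mulr_gt0// addr_gt0// (lt_le_trans ltr01).
  have cm mu : \forall i \near G, forall x, O i x -> `|c i x 0 mu - c' i x 0 mu| <= e' / W ^+ m / (2 * (1 + C1)).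
    have [_ _ _ /(_ 0%N _ e1)] := cvb_cv0 (cc mu).
    by apply: filterS => i hi x Ox; have := hi x Ox; rewrite expr0 mulr1.
  have := @cv0_near_forall N I G FG (fun mu i => forall x, O i x -> _) cm.
  apply: filterS3 longA (vc_near e1) => i [Yi cab _] [_ ha _] hc x; rewrite /O /= in_itv /= => /andP[x1 x2].
  rewrite -ler_pdivlMr//.
  have [h1 h2 h3 h4 h5] := selex Yg0 cab; have [k1 k2 k3 k4 k5] := selex Yi cab.
  have adm := hadm i.1 cab; have ab := adm_ab adm.
  have aab : i.2.1 <= i.2.1 <= i.2.2 by rewrite lexx ltW.
  have [e3 [b1 b2 b3 b4]] := he Yi cab.
  have V1 : 0 <= V0 + 1 by rewrite addr_ge0.
  have ba : 0 <= i.2.2 - i.2.1 by rewrite subr_ge0 ltW.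
  have C10 : 0 <= C1 := le_trans ler01 C11.
  have hC : C1 * (V0 + 1) * (i.2.2 - i.2.1) <= 2^-1.
    by apply: le_trans (adm_C1 adm); rewrite ler_wpM2r// ler_wpM2l// lerD2l ler1n.
  have cl s : i.2.1 < s < i.2.2 -> `|c i s| <= V0 + 1.
    by move=> /andP[? ?]; apply: (ctl_le V00 hC1 hC2 adm b1 b2) => //; rewrite !ltW.
  have cd s : i.2.1 < s < i.2.2 -> `|c i s - c' i s| <= e' / W ^+ m / (2 * (1 + C1)).
    move=> sab; apply: row_norm_le => [|mu]; first exact: ltW.
    have Os : O i s by rewrite /O /= in_itv.
    have := hc mu s Os; congr (`|_| <= _).
    by rewrite [RHS]mxE; congr (_ + _); rewrite [RHS]mxE.
  have xab : i.2.1 <= x <= i.2.2 by rewrite !ltW.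
  have h := sol_dependence hC1 aab V1 (ltW e1) hC cl cd k4 h4 k5 h5 xab.
  have W1 : 0 < e' / W ^+ m by rewrite divr_gt0.
  have ha' := dist_eq k2 h2 ha.
  exact (le_trans h (half_add_le W1 C10 (adm_len adm) ha')).
have hF : vcvb G O O w k F F'.
  suff h : vcvb G O O w k.+1 F F' by move=> mu; apply: cvbW; exact: h.
  exact: (sol_cvb lam_smooth lam_free oO OO w1 dF dF' FB F0 cc).
have sF : \forall i \near G, smooth_on (O i) (F i).
  by apply: filterS longA => i [Yi cab _]; exact: sel_smooth.
have sF' : \forall i \near G, smooth_on (O i) (F' i).
  by apply: filterS longA => i [Yi cab _]; exact: sel_smooth.
have h : \forall y \near y0, forall ab, A (y, ab) -> forall x, O (y, ab) x ->
    `|derive1n k (F (y, ab)) x - derive1n k (F' (y, ab)) x| * w (y, ab) ^+ 0 <= e.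
  exact: (vcvb_pointwise oO OO sF sF' hF (leqnn k) 0%N e0).
apply: filterS h => y hy Yy a b cab lab x xab.
by have := hy (a, b) (And3 Yy cab lab) x; rewrite expr0 mulr1; apply; rewrite /O /= in_itv.
Qed.

End Long.

(** Infinitely many cells are handled by a threshold [l]: in shorter ones every curve is within
    [e / 3] of the corresponding [f], which is continuous in [y]; in longer ones [long_cells]
    applies. Near [C] the curve is [f], and off [C] and the gap set it is locally [f0]. *)
Lemma FF_cont (W0 K : set R) (y0 : Y) k e : compact D0 -> ufam V f -> ufam V g -> ufam V f0 ->
  open W0 -> ufam W0 f0 -> K `<=` W0 -> compact K -> Yg y0 -> 0 < e ->
  \forall y \near y0, Yg y -> forall x, K x ->
    `|derive1n k (FF y) x - derive1n k (FF y0) x| <= e.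
Proof.
move=> cD0 uf ug uf0 oW uW KW cK Yg0 e0.
have e3 : 0 < e / 3 by rewrite divr_gt0.
have [l l0 hl] := tiny_cells k e3.
apply: filterS3 (uf y0 D0 k _ DV cD0 e3) (uW y0 K k e KW cK e0) (long_cells Yg0 l0 cD0 uf ug uf0 k e0).
move=> y h1 h2 h3 Yy x Kx.
have e3e := third_le e0.
have [Cx|nCx] := pselect (C x).
  rewrite (derive1n_near k (near_C lam_smooth lam_free oV DV cC sf sg sf0 hf fl B0 V00 hB hC1 hC2 d0 hD hgc hadm he Yy Cx)).
  rewrite (derive1n_near k (near_C lam_smooth lam_free oV DV cC sf sg sf0 hf fl B0 V00 hB hC1 hC2 d0 hD hgc hadm he Yg0 Cx)).
  by apply: le_trans e3e; apply: h1; exact: CD.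
have [Sx|nSx] := pselect (S x); last first.
  rewrite (derive1n_near k (near_far lam_smooth lam_free oV DV cC sf sg sf0 hf0 B0 V00 hB0 hC1 hC2 d0 hD hgc hadm he Yy nCx nSx)).
  rewrite (derive1n_near k (near_far lam_smooth lam_free oV DV cC sf sg sf0 hf0 B0 V00 hB0 hC1 hC2 d0 hD hgc hadm he Yg0 nCx nSx)).
  exact: h2.
have [a [b [cab xab]]] := gap_cell cC Sx.
have cell z : \forall x' \near x, FF z x' = (sel z a b).2 x'.
  have : nbhs x (`]a, b[%classic : set R).
    by apply: open_nbhs_nbhs; split; [exact: open_cell|rewrite /= in_itv].
  by apply: filterS => x'; rewrite /= in_itv /= => hx'; exact: FF_cell cab hx'.
rewrite (derive1n_near k (cell y)) (derive1n_near k (cell y0)).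
have [la|la] := leP l (b - a); first exact: h3.
have t1 := hl y a b Yy cab la x xab; have t2 := hl y0 a b Yg0 cab la x xab.
have Dx : D0 x by apply: (hD cab); move: xab => /andP[? ?]; rewrite !ltW.
have t3 := h1 x Dx.
exact (dist_via t1 t3 t2).
Qed.

End CoreContinuity.

(** * Locality of derivatives and bounds on compact sets *)

Section NearEqual.
Context {R : realType} {N p : nat}.
Implicit Types (u v : R -> 'rV[R]_N).

Lemma derivable_near u v k (x : R) : (\forall x' \near x, u x' = v x') ->
  derivable (derive1n k v) x 1 -> derivable (derive1n k u) x 1.
Proof.
move=> h dv; have oI : open [set x' | u x' = v x']° by exact: open_interior.
have e : \forall x' \near x, derive1n k v x' = derive1n k u x'.
  apply: filterS (open_nbhs_nbhs (conj oI h)) => x' Ix; apply: derive1n_near.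
  have : \forall z \near x', [set x' | u x' = v x'] z by exact: Ix.
  by apply: filterS => z /= ->.
by move: dv; apply: near_eq_derivable.
Qed.

Lemma horiz_near (lam : 'rV[R]_N -> 'M[R]_(p, N)) u v (x : R) :
  (\forall x' \near x, u x' = v x') -> horiz lam v x = 0 -> horiz lam u x = 0.
Proof.
move=> h hv; rewrite -hv; apply/rowP => s; rewrite [LHS]mxE [RHS]mxE.
have e1 := derive1n_near 1 h; rewrite !derive1n1 in e1.
by apply: eq_bigr => mu _; rewrite e1 (nbhs_singleton h).
Qed.
End NearEqual.

Lemma compact_thickening (R : realType) (C V : set R) : compact C -> open V -> C `<=` V ->
  exists2 d, 0 < d & let D := [set x | exists2 c, C c & `|x - c| <= 2 * d] in compact D /\ D `<=` V.
Proof.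
move=> cC oV CV.
have /compact_near_coveringP cov := cC.
have := cov R (nbhs (0 : R)) (fun r c => forall x, `|x - c| < `|r| -> V x) _ _.
case=> [c Cc|e /= e0 he].
  have [e /= e0 hE] : nbhs c V by apply: open_nbhs_nbhs; split => //; exact: CV.
  exists ([set c' | `|c - c'| < e / 2], [set r | `|r| < e / 2]) => /=.
    split; first by exists (e / 2) => //=; rewrite divr_gt0.
    by exists (e / 2) => //=; [rewrite divr_gt0|move=> r /=; rewrite sub0r normrN].
  move=> [c' r] /= [h1 h2] x hx; apply: hE => /=.
  have := ler_distD c' c x; rewrite (distrC c' x); lra.
have e2 : 0 < e / 2 by rewrite divr_gt0.
have e8 : 0 < e / 8 by rewrite divr_gt0.
exists (e / 8) => //; split; last first.
  move=> x [c Cc xc]; apply: (he (e / 2) _ c Cc).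
    by rewrite /= sub0r normrN gtr0_norm// ltr_pdivrMr// ltr_pMr// ltr1n.
  by rewrite (gtr0_norm e2); lra.
have -> : [set x | exists2 c, C c & `|x - c| <= 2 * (e / 8)] =
    (fun z : R * R => z.1 + z.2) @` (C `*` `[- (2 * (e / 8)), 2 * (e / 8)]).
  apply/seteqP; split => x.
    move=> [c Cc xc]; exists (c, x - c); last by rewrite /= addrC subrK.
    by split => //=; rewrite in_itv /= -ler_norml.
  move=> [[c s] [/= Cc]]; rewrite in_itv /= -ler_norml => hs <-.
  by exists c => //; rewrite addrC addKr.
apply: continuous_compact; last by apply: compact_setX => //; exact: segment_compact.
by apply: continuous_subspaceT => z; exact: add_continuous.
Qed.

Lemma compact_lower (R : realType) (phi : R -> R) (D : set R) : compact D ->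
  (forall x, D x -> {for x, continuous phi}) -> (forall x, D x -> phi x != 0) ->
  exists2 c, 0 < c & forall x, D x -> c <= `|phi x|.
Proof.
move=> cD cphi nz.
have ci : {within D, continuous (fun x => (phi x)^-1)}.
  by apply: continuous_in_subspaceT => x; rewrite inE => Dx; exact: (cvgV (nz x Dx) (cphi x Dx)).
have [M [_ hM]] := compact_bounded (continuous_compact ci cD).
pose M' := `|M| + 1; have M'0 : 0 < M' by rewrite ltr_wpDl.
exists M'^-1; first by rewrite invr_gt0.
move=> x Dx; have := hM M' _ (phi x)^-1.
move=> h; have {}h : `|(phi x)^-1| <= M'.
  by apply: h; [rewrite /M'; have := ler_norm M; lra|exists x].
rewrite normfV in h.
have p0 : 0 < `|phi x| by rewrite normr_gt0; exact: nz.
by rewrite -[leRHS]invrK lef_pV2 ?posrE// invr_gt0.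
Qed.

Section DetBound.
Context {R : realType} {N p : nat}.
Variable lam : 'rV[R]_N -> 'M[R]_(p, N).
Hypothesis lam_smooth : smooth_forms lam.
Variable q : nat.

Lemma detA_continuous (U : set R) (u : R -> 'rV[R]_N) x : open U -> U x ->
  smooth_on U u -> {for x, continuous (detA lam q u)}.
Proof.
move=> oU Ux su.
have sn : \forall i \near unit_filter, smooth_on U u by apply/near_unit; exact: su.
have hB : \forall i \near unit_filter, forall y, (set0 : set R) y -> `|u y| <= 0 by apply/near_unit.
have [h _ _ _] := cvb_cv0 (@detA_cvb _ _ _ lam lam_smooth q unit unit_filter _ (fun=> U) (fun=> set0)
    (fun=> 1) (fun=> oU) (fun=> @sub0set _ _) (fun=> lexx 1) (fun=> u) (fun=> u) 0 sn sn hB 0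
    (smooth_vjcv _ oU su)).
apply: differentiable_continuous; apply/derivable1_diffP.
by move/near_unit : h; exact.
Qed.

Lemma detA_lower (Y : topologicalType) (V D0 : set R) (f : Y -> R -> 'rV[R]_N) :
  compact [set: Y] -> open V -> D0 `<=` V -> compact D0 ->
  (forall y, smooth_on V (f y)) -> ufam V f ->
  (forall y x, V x -> detA lam q (f y) x != 0) ->
  exists2 c, 0 < c & forall y x, D0 x -> c <= `|detA lam q (f y) x|.
Proof.
move=> cY oV DV cD sf uf nz.
have [B hB] : exists B, forall y x, D0 x -> 1 <= B * `|detA lam q (f y) x|.
  apply: (@compact_bound R Y (fun y B => forall x, D0 x -> 1 <= B * `|detA lam q (f y) x|) cY).
    by move=> y B B' BB h x Dx; apply: le_trans (h x Dx) _; rewrite ler_wpM2r.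
  move=> y0.
  have [c c0 lo] := compact_lower cD (fun x Dx => detA_continuous oV (DV x Dx) (@sf y0)) (fun x Dx => nz y0 x (DV x Dx)).
  have s1 : \forall z \near y0, smooth_on V (f z) by apply: nearW => z; exact: sf.
  have s2 : \forall z \near y0, smooth_on V (f y0) by apply: nearW => z; exact: sf.
  have [B hB] := smooth_bounded 0 DV cD (sf y0).
  have hB' : \forall z \near y0, forall y, D0 y -> `|f y0 y| <= B by apply: nearW => z; exact: hB.
  have h := detA_cvb lam_smooth (fun=> oV) (fun=> DV) (fun=> lexx 1) s1 s2 hB'
     (ufam_vcvb y0 (0 + q).+1 oV sf uf DV cD).
  have {h} [_ _ _ h] := cvb_cv0 (h (nbhs_filter y0)).
  have e0 : 0 < c / 2 by rewrite divr_gt0.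
  exists (2 * c^-1); apply: filterS (h 0%N _ e0) => y hy x Dx.
  have := hy x Dx; have := lo x Dx; rewrite expr0 mulr1 => h1 h2.
  have h3 := ler_normD (detA lam q (f y0) x - detA lam q (f y) x) (detA lam q (f y) x).
  rewrite subrK distrC in h3.
  rewrite -ler_pdivrMl ?mulr_gt0 ?invr_gt0// mulr1 invfM invrK mulrC.
  by move: h1 h2 h3; move: `|_| `|_| `|_| => *; lra.
pose B' := `|B| + 1; have B'0 : 0 < B' by rewrite ltr_wpDl.
exists B'^-1; first by rewrite invr_gt0.
move=> y x Dx; rewrite -[leLHS]mulr1 ler_pdivrMl//; apply: le_trans (hB y x Dx) _.
by rewrite ler_wpM2r// /B'; have := ler_norm B; lra.
Qed.
End DetBound.

Lemma dev_arith (R : realType) (Q Mf len mx : R) n : 0 < Q -> 0 < len ->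
  Mf * len <= (2 * Q)^-1 -> mx <= len ^+ n / (2 * Q) -> Mf * len ^+ n.+1 + mx <= len ^+ n / Q.
Proof.
move=> Q0 l0 h1 h2.
have -> : len ^+ n / Q = len ^+ n * (2 * Q)^-1 + len ^+ n / (2 * Q) by field; rewrite gt_eqF.
by apply: lerD => //; rewrite exprS mulrA mulrC ler_wpM2l// exprn_ge0// ltW.
Qed.

Lemma eps_wgt (R : realType) (C1 C2 V0 K1 : R) m1 (a b : R) : a < b -> b - a <= 1 ->
  eps C1 C2 V0 (K1 * wgt a b ^+ m1) = (b - a) ^+ (m1.*2) / (160 * C1 * C5 C1 C2 V0 * K1 ^+ 2).
Proof.
move=> ab ab1; have l0 : 0 < b - a by rewrite subr_gt0.
have -> : wgt a b = (b - a)^-1.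
  by rewrite /wgt max_r// -[leLHS]invr1 lef_pV2 ?posrE.
rewrite /eps exprMn -exprM muln2 exprVn mulrA invfM invrK mulrC.
by [].
Qed.

Lemma half_le_id (R : realType) (l : R) : 0 < l -> 2 * (l / 4) <= l.
Proof. by move=> l0; lra. Qed.

(** * Extension of homotopies and microflexibility *)

Section Extension.
Context {R : realType} {N p : nat}.
Variable lam : 'rV[R]_N -> 'M[R]_(p, N).
Hypothesis lam_smooth : smooth_forms lam.
Hypothesis lam_free : forall y, row_free (lam y).
Variable q : nat.
Variables (Y : topologicalType) (V U C : set R).
Hypotheses (cY : compact [set: Y]) (oV : open V) (oU : open U) (VU : V `<=` U).
Hypotheses (cC : compact C) (CV : C `<=` V).
Variables (f g f0 : Y -> R -> 'rV[R]_N).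
Hypothesis sf : forall y, smooth_on V (f y).
Hypothesis sg : forall y, smooth_on V (g y).
Hypothesis sf0 : forall y, smooth_on U (f0 y).
Hypothesis hf : forall y x, V x -> horiz lam (f y) x = 0.
Hypothesis hf0 : forall y x, U x -> horiz lam (f0 y) x = 0.
Hypotheses (uf : ufam V f) (ug : ufam V g) (uf0 : ufam U f0).
Hypothesis fl : forall y c, C c -> \forall x \near c, f0 y x = g y x.
Hypothesis nz : forall y x, V x -> detA lam q (f y) x != 0.

Definition close (D : set R) (tau : R) y := forall x, D x ->
  `|f y x - g y x| <= tau /\ `|derive1 (f y) x - derive1 (g y) x| <= tau.

(** Steering succeeds only while [f] is [tau]-close to [g], so every clause, continuity included, is
    relative to such parameters. *)
Definition extends (D : set R) (tau : R) (F : Y -> R -> 'rV[R]_N) : Prop :=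
  [/\ forall y, close D tau y -> smooth_on U (F y) /\ (forall x, U x -> horiz lam (F y) x = 0),
      forall y c, close D tau y -> C c -> \forall x \near c, F y x = f y x,
      forall y x, close D tau y -> (forall t, V t -> f y t = g y t) -> F y x = f0 y x
    & forall K y0 k e, K `<=` U -> compact K -> close D tau y0 -> 0 < e ->
      \forall y \near y0, close D tau y -> forall x, K x ->
        `|derive1n k (F y) x - derive1n k (F y0) x| <= e].

(** The balance of constants: on a cell of length [len] the tolerance is [len] to the power [2 m1],
    divided by [Q] ([eps_wgt]). Half of it is granted to the flat error, of one order more in [len],
    by taking [d] small; the other half to the gap [tau], which occurs only on cells of length at
    least [d]. *)
Lemma extension : exists D tau F, [/\ 0 < tau, compact D, D `<=` V & extends D tau F].
Proof.
have [r0 r00 [cD DV]] := compact_thickening cC oV CV.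
set D0 := [set x | _] in cD DV.
have DU : D0 `<=` U := subset_trans DV VU.
have sf0V y : smooth_on V (f0 y) := smooth_on_sub VU (@sf0 y).
have hf0V y x (Vx : V x) : horiz lam (f0 y) x = 0 := @hf0 y x (VU Vx).
have uf0V := ufam_sub VU uf0.
have bf k := ufam_bound k cY sf uf DV cD.
have bg k := ufam_bound k cY sg ug DV cD.
have bf0 k := ufam_bound k cY sf0 uf0 DU cD.
have CD c : C c -> D0 c by move=> Cc; exists c => //; rewrite subrr normr0 mulr_ge0// ltW.
have [cdet cdet0 hdet] := detA_lower lam_smooth cY oV DV cD sf uf nz.
have [Bf hBf] := bf 0%N; have [Bf0 hBf0] := bf0 0%N; have [Bd hBd] := bf 1%N.
pose B := `|Bf| + `|Bf0|; have B0 : 0 <= B := addr_ge0 (normr_ge0 _) (normr_ge0 _).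
pose V0 := `|Bd|; have V00 : 0 <= V0 by exact: normr_ge0.
have hB y x (Dx : D0 x) : `|f y x| <= B.
  by apply: le_trans (hBf y x Dx) _; apply: le_trans (ler_norm _) _; rewrite /B lerDl.
have hB0 y x (Dx : D0 x) : `|f0 y x| <= B.
  by apply: le_trans (hBf0 y x Dx) _; apply: le_trans (ler_norm _) _; rewrite /B lerDr.
have hV0 y x (Dx : D0 x) : `|derive1 (f y) x| <= V0.
  by rewrite -derive1n1; apply: le_trans (hBd y x Dx) _; exact: ler_norm.
have [C1 hC1] := proj_constP lam_smooth lam_free (B + 2).
have [C2 hC2] := taylor_constP lam_smooth lam_free (B + 2).
have [K1 [m1 [l1 [K11 l10 hK]]]] := kap_bound lam_smooth lam_free oV DV sf hf bf cdet0 hdet V00 hB hV0 hC1 hC2.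
have [M0 M00 hM0] := flat_bound DV sf0V sg bf0 bg fl (m1.*2).+1 0.
have [M1 M10 hM1] := flat_bound DV sf0V sg bf0 bg fl (m1.*2).+1 1.
pose Q := 160 * C1 * C5 C1 C2 V0 * K1 ^+ 2.
have Q0 : 0 < Q.
  have C11 : 1 <= C1 by case: hC1.
  have C51 := C5_ge1 V00 hC1 hC2.
  by rewrite /Q !mulr_gt0 ?exprn_gt0// (lt_le_trans ltr01).
(* In order: stay inside the thickening of [C]; meet the length bound of [kap_bound]; keep lengths
   at most 1; keep the flat error below half the tolerance. Cells are shorter than [2 d]. *)
pose d := Num.min (Num.min r0 (l1 / 4)) (Num.min (1 / 4) (4 * (M0 + M1 + 1) * Q)^-1).
have Mp : 0 < M0 + M1 + 1 by rewrite ltr_wpDl// addr_ge0.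
have d0 : 0 < d.
  rewrite /d !lt_min r00 !divr_gt0// invr_gt0.
  by apply: mulr_gt0 => //; apply: mulr_gt0.
have [dr dl d1 dQ] : [/\ d <= r0, d <= l1 / 4, d <= 1 / 4 & d <= (4 * (M0 + M1 + 1) * Q)^-1].
  by split; rewrite /d !ge_min lexx ?orbT.
(* Half the tolerance of a cell of length [d], the least length possible for a cell with an end off
   [C]. *)
pose tau := d ^+ m1.*2 / (2 * Q).
have Q2 : 0 < 2 * Q by apply: mulr_gt0.
have tau0 : 0 < tau := divr_gt0 (exprn_gt0 _ d0) Q2.
have hball c x : C c -> `|x - c| <= 2 * d -> D0 x.
  by move=> Cc h; exists c => //; apply: le_trans h _; rewrite ler_wpM2l.
have hD a b : is_cell (gapset C d) a b -> forall t, a <= t <= b -> D0 t.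
  move=> cab t tab; have [c Cc [tc _]] := cell_close cab tab.
  by apply: (hball c) => //; apply: (le_trans tc); apply: ltW; exact: cell_length cab.
have len a b : is_cell (gapset C d) a b -> b - a < l1 /\ b - a <= 1.
  move=> cab; have h := cell_length cab.
  split; [apply: lt_le_trans h _|apply: (le_trans (ltW h))].
    by apply: (le_trans (ler_wpM2l (ler0n _ 2) dl)); exact: half_le_id.
  by apply: (le_trans (ler_wpM2l (ler0n _ 2) d1)); exact: half_le_id.
have hK' y a b (cab : is_cell (gapset C d) a b) :
    good_cell lam q V (C2 * V0) a b (f y) /\
    admissible lam B C1 C2 V0 a b (f y) (kapm lam q a b (f y)) (wm lam q a b (f y)) (K1 * wgt a b ^+ m1).
  by have [ab _ _ _] := cab; apply: hK ab (len a b cab).1 (hD a b cab).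
have hgc y a b (cab : is_cell (gapset C d) a b) := (hK' y a b cab).1.
have hadm y a b (cab : is_cell (gapset C d) a b) := (hK' y a b cab).2.
have htau y x : close D0 tau y -> D0 x ->
    `|f y x - g y x| <= tau /\ `|derive1 (f y) x - derive1 (g y) x| <= tau by move=> h; exact: h.
have he y a b : close D0 tau y -> is_cell (gapset C d) a b -> exists e,
    [/\ e <= eps C1 C2 V0 (K1 * wgt a b ^+ m1),
     forall t, a <= t <= b -> `|vc C f g f0 y a b t - derive1 (f y) t| <= e,
     `|pt C f f0 y a - f y a| <= e & `|pt C f f0 y b - f y b| <= e].
  move=> Yy cab; have [ab _ _ _] := cab; have [lab lab1] := len a b cab.
  have [h1 h2 h3] := dev_le hD hball (ltW tau0) htau M00 M10 hM0 hM1 Yy cab.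
  exists ((M0 + M1) * (b - a) ^+ (m1.*2).+1 + mix C tau a b); split => //.
  rewrite eps_wgt//; apply: dev_arith => //; first by rewrite subr_gt0.
    have ba0 : 0 <= b - a by rewrite subr_ge0 ltW.
    have ld : b - a <= 2 * (4 * (M0 + M1 + 1) * Q)^-1.
      by apply: le_trans (ltW (cell_length cab)) _; rewrite ler_wpM2l.
    apply: (@le_trans _ _ ((M0 + M1 + 1) * (2 * (4 * (M0 + M1 + 1) * Q)^-1))).
      by apply: ler_pM => //; [exact: addr_ge0|rewrite lerDl].
    by rewrite [leLHS](_ : _ = (2 * Q)^-1)//; field; rewrite !gt_eqF.
  rewrite /mix; case: asboolP => hab.
    by apply: divr_ge0; [rewrite exprn_ge0 ?subr_ge0 ?(ltW ab)|exact: ltW Q2].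
  rewrite /tau; apply: ler_wpM2r; first by rewrite invr_ge0; exact: ltW Q2.
  by apply: lerXn2r; rewrite ?nnegrE ?(ltW d0) ?subr_ge0 ?(ltW ab)//; exact: cell_mixed cab hab.
pose F := FF lam q C f g f0 B V0 C1 C2 K1 m1 d.
exists D0, tau, F; split => //.
have nC y c (Yy : close D0 tau y) (Cc : C c) : \forall x \near c, F y x = f y x :=
  near_C lam_smooth lam_free oV DV cC sf sg sf0V hf fl B0 V00 hB hC1 hC2 d0 hD hgc hadm he Yy Cc.
(* Around each point of [U] the glued curve coincides with [f], with a steered curve or with [f0],
   each of them smooth and horizontal at that point. *)
have loc y x : close D0 tau y -> U x -> exists v, [/\ \forall x' \near x, F y x' = v x',
    forall k, derivable (derive1n k v) x 1 & horiz lam v x = 0].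
  move=> Yy Ux.
  have [Cx|nCx] := pselect (C x).
    exists (f y); split; [exact: nC|by move=> k; apply: (@sf y); exact: CV|by apply: hf; exact: CV].
  have [Sx|nSx] := pselect (gapset C d x).
    have [a [b [cab xab]]] := gap_cell cC Sx.
    have [ab ab1 aU su hu du Lab hL] := hgc y a b cab.
    exists (sel lam q C f g f0 B V0 C1 C2 K1 m1 y a b).2; split.
    - have : nbhs x (`]a, b[%classic : set R).
        by apply: open_nbhs_nbhs; split; [exact: open_cell|rewrite /= in_itv].
      by apply: filterS => x'; rewrite /= in_itv /= => hx'; exact: FF_cell cab hx'.
    - move=> k; apply: (@sel_smooth _ _ _ _ lam_smooth lam_free q _ _ _ _ oV DV _ _ _ sf sg sf0V _ _ _ _ B0 V00 hC1 hC2 _ _ _ _ hD hgc hadm he y a b Yy cab k x).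
      by rewrite /= in_itv.
    - have xab' : a <= x <= b by move: xab => /andP[? ?]; rewrite !ltW.
      exact: (sol_horiz lam_free (sel_deriv DV sf sg sf0V B0 V00 hC1 hC2 hD hadm he Yy cab xab')).
  exists (f0 y); split; [|by move=> k; exact: (@sf0 y)|exact: hf0].
  exact: (near_far lam_smooth lam_free oV DV cC sf sg sf0V hf0V B0 V00 hB0 hC1 hC2 d0 hD hgc hadm he Yy nCx nSx).
split.
- move=> y Yy; split.
    move=> k x Ux; have [v [h1 h2 _]] := loc y x Yy Ux.
    exact: derivable_near h1 (h2 k).
  move=> x Ux; have [v [h1 _ h3]] := loc y x Yy Ux.
  exact: horiz_near h1 h3.
- exact: nC.
- by move=> y x Yy fg; apply: (FF_eq0 oV DV cC sf sg sf0V hf0V fl B0 V00 hB0 hC1 hC2 hD CD hadm he) Yy fg.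
- move=> K y0 k e KU cK Yy0 e0.
  exact: (FF_cont lam_smooth lam_free oV DV cC sf sg sf0V hf hf0V bf fl cdet0 hdet B0 V00 hB hB0 hC1 hC2 d0 hD CD hgc hadm bg bf0 hball (ltW tau0) htau he k cD uf ug uf0V oU uf0 KU cK Yy0 e0).
Qed.
End Extension.

Lemma ufam_pull_on (R : realType) (N : nat) (Z Y : topologicalType) (U : set R)
    (F : Y -> R -> 'rV[R]_N) (Yg : Y -> Prop) (s : Z -> Y) : continuous s -> (forall z, Yg (s z)) ->
  (forall K y0 k e, K `<=` U -> compact K -> Yg y0 -> 0 < e ->
     \forall y \near y0, Yg y -> forall x, K x -> `|derive1n k (F y) x - derive1n k (F y0) x| <= e) ->
  ufam U (fun z => F (s z)).
Proof.
move=> cs sY h z0 K k e KU cK e0.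
have h1 : \forall z \near z0, Yg (s z) -> forall x, K x ->
    `|derive1n k (F (s z)) x - derive1n k (F (s z0)) x| <= e.
  exact: (cs z0 _ (h K (s z0) k e KU cK (sY z0) e0)).
by apply: filterS h1 => z hz x Kx; exact: (hz (sY z) x Kx).
Qed.

Section Microflexibility.
Context {R : realType} {N p : nat}.
Variable lam : 'rV[R]_N -> 'M[R]_(p, N).
Hypothesis lam_smooth : smooth_forms lam.
Hypothesis lam_free : forall y, row_free (lam y).
Variable q : nat.

Lemma unitI_near (W : set (set_type (unitI R))) (t0 : set_type (unitI R)) : set_val t0 = 0 ->
  nbhs t0 W -> exists2 e, 0 < e <= 1 & forall t, set_val t <= e -> W t.
Proof.
move=> t00 [W' [[B oB <-] /= Bx BV]]; rewrite t00 in Bx.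
have [e /= e0 he] : nbhs (0 : R) B by exact: open_nbhs_nbhs.
exists (Num.min 1 (e / 2)); first by rewrite lt_min ltr01 divr_gt0// ge_min lexx.
move=> [t ht]; rewrite le_min /= => /andP[_ te]; apply: BV => /=; apply: he.
have := ht; rewrite inE /unitI /= in_itv /= => /andP[t1 _].
by rewrite /= sub0r normrN ger0_norm//; apply: le_lt_trans te _; rewrite ltr_pdivrMr// ltr_pMr// ltr1n.
Qed.

Lemma reg_near_family (Y : topologicalType) (U K : set R) (F : Y -> R -> 'rV[R]_N) (y0 : Y)
    (Yg : set Y) : open U -> K `<=` U -> compact K ->
  (\forall y \near y0, Yg y) -> (forall y, Yg y -> smooth_on U (F y)) -> Yg y0 ->
  (forall k e, 0 < e -> \forall y \near y0, Yg y -> forall x, K x ->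
     `|derive1n k (F y) x - derive1n k (F y0) x| <= e) ->
  (forall x, K x -> reg lam q (F y0) x != 0) ->
  \forall y \near y0, forall x, K x -> reg lam q (F y) x != 0.
Proof.
move=> oU KU cK nY sF Y0 hF nz.
have s1 : \forall y \near y0, smooth_on U (F y) by apply: filterS nY => y; exact: sF.
have s2 : \forall y \near y0, smooth_on U (F y0) by apply: nearW => y; exact: sF.
have [B hB] := smooth_bounded 0 KU cK (sF y0 Y0).
have hB' : \forall y \near y0, forall x, K x -> `|F y0 x| <= B by apply: nearW => z; exact: hB.
have v : vcvb (nbhs y0) (fun=> U) (fun=> K) (fun=> 1) (0 + q).+1 F (fun=> F y0).
  apply: (pointwise_vcvb (fun=> oU) (fun=> KU) (fun=> lexx 1) s1 s2).
    move=> j _; have [Bj hBj] := smooth_bounded j KU cK (sF y0 Y0).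
    by exists Bj; apply: nearW => z; exact: hBj.
  move=> j _ m e e0; apply: filterS2 nY (hF j e e0) => y Yy h x Kx.
  by rewrite expr1n mulr1; exact: h.
have h := reg_cvb lam_smooth (fun=> oU) (fun=> KU) (fun=> lexx 1) s1 s2 hB' v.
have {h} [_ _ _ h] := cvb_cv0 (h (nbhs_filter y0)).
have [c c0 lo] := compact_lower cK (fun x Kx => reg_continuous lam_smooth oU (KU x Kx) (sF y0 Y0)) nz.
have c2 : 0 < c / 2 by rewrite divr_gt0.
apply: filterS (h 0%N _ c2) => y hy x Kx; apply/eqP => r0.
have := hy x Kx; rewrite r0 sub0r normrN expr0 mulr1 => h1.
by have := lo x Kx; move: h1 c0; move: `|_| => z; lra.
Qed.

(** [extension] is used over the polyhedron times the interval, with [f] the homotopy, [g] its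
    initial value and [f0] the given lift. At time 0, [f = g], so [F] is the lift itself, regular on
    a compact neighbourhood of [C]. Closeness of [f] to [g] and regularity of [F] persist for a
    short time, uniformly over the polyhedron, by the tube lemma. *)
Lemma Phi_microflexible : microflexible (Phi lam q).
Proof.
move=> C C' sC cC cC' m P h h0 pP [U1 [fh [oU1 C1 s1 F1 e1]]] [U0 [fh0 [oU0 CU0 s0 F0 e0]]] compat.
have cP : compact [set: set_type P] := set_type_compact (polyhedron_compact pP).
pose I := set_type (unitI R); pose Y := (set_type P * I)%type.
have cY : compact [set: Y] := compact_prod cP (@unitI_compact R).
have in0 : 0 \in unitI R by rewrite inE /unitI /= in_itv /= lexx ler01.
pose t0 : I := exist _ 0 in0.
have t0E : set_val t0 = 0 by [].
pose V := U1 `&` U0.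
have oV : open V by exact: openI.
have VU1 : V `<=` U1 by move=> x [].
have VU0 : V `<=` U0 by move=> x [].
have CV : C' `<=` V by move=> x Cx; exact (conj (C1 x Cx) (CU0 x (sC x Cx))).
pose f (y : Y) := fh y; pose g (y : Y) := fh (y.1, t0); pose f0 (y : Y) := fh0 y.1.
have sf y : smooth_on V (f y) by have [s _ _] := s1 y; exact: smooth_on_sub VU1 s.
have sg y : smooth_on V (g y) by have [s _ _] := s1 (y.1, t0); exact: smooth_on_sub VU1 s.
have sf0 y : smooth_on U0 (f0 y) by have [] := s0 y.1.
have hf y x : V x -> horiz lam (f y) x = 0 by move=> [U1x _]; have [_ _] := s1 y; exact.
have hf0 y x : U0 x -> horiz lam (f0 y) x = 0 by have [_ _] := s0 y.1; exact.
have uh : ufam U1 fh := (famP lam q U1 fh).1 F1.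
have uh0 : ufam U0 fh0 := (famP lam q U0 fh0).1 F0.
have uf : ufam V f := ufam_sub VU1 uh.
have cg : continuous (fun y : Y => (y.1, t0) : Y).
  by apply: cont_pair; [exact: cont_fst|exact: cont_cst].
have ug : ufam V g := ufam_pull cg (ufam_sub VU1 uh).
have uf0 : ufam U0 f0 := ufam_pull (@cont_fst _ _) uh0.
have fl (y : Y) c : C' c -> \forall x \near c, f0 y x = g y x.
  have := germ_restrE sC (e0 y.1); rewrite (compat y.1 t0 t0E) e1 => /germ_classP hh Cc.
  by have := hh c Cc; apply: filterS => x /= hx; rewrite /f0 /g hx.
have nz (y : Y) x : V x -> detA lam q (f y) x != 0.
  move=> [U1x _]; have [sy Wy _] := s1 y.
  have sn : smooth_near (f y) x by exists U1.
  by have /(WsetP lam_smooth q sn) := Wy x U1x; rewrite /reg mulf_eq0 negb_or => /andP[].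
have [D [tau [F [tau0 cD DV [hF1 hF2 hF3 hF4]]]]] :=
  extension lam_smooth lam_free cY oV oU0 VU0 cC' CV sf sg sf0 hf hf0 uf ug uf0 fl nz.
have [r r0 [cK KU0]] := compact_thickening cC oU0 CU0.
set K := [set x | _] in cK KU0.
have fg z : f (z, t0) = g (z, t0) by [].
have cl0 z : close f g D tau (z, t0).
  by move=> x _; rewrite fg !subrr !normr0; split; exact: ltW.
have ncl z : \forall y \near ((z, t0) : Y), close f g D tau y.
  have t2 : 0 < tau / 2 by rewrite divr_gt0.
  have n0 := @filterI _ _ (nbhs_filter ((z, t0) : Y)) _ _ (uf (z, t0) D 0%N _ DV cD t2) (ug (z, t0) D 0%N _ DV cD t2).
  have n1 := @filterI _ _ (nbhs_filter ((z, t0) : Y)) _ _ (uf (z, t0) D 1%N _ DV cD t2) (ug (z, t0) D 1%N _ DV cD t2).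
  apply: (@filterS2 _ _ (nbhs_filter ((z, t0) : Y)) _ _ _ _ n0 n1) => y [h1 h2] [h3 h4] x Dx.
  have key (a b c : 'rV[R]_N) : `|a - c| <= tau / 2 -> `|b - c| <= tau / 2 -> `|a - b| <= tau.
    move=> k1 k2; rewrite [tau]splitr; apply: le_trans (ler_distD c _ _) _.
    by apply: lerD => //; rewrite distrC.
  split; first exact: key (h1 x Dx) (h2 x Dx).
  by have := key _ _ _ (h3 x Dx) (h4 x Dx); rewrite !derive1n1.
have F00 z : F (z, t0) = fh0 z by apply/funext => x; apply: (hF3 (z, t0) x (cl0 z)).
have nreg z : \forall y \near ((z, t0) : Y), forall x, K x -> reg lam q (F y) x != 0.
  apply: (reg_near_family (U := U0) (Yg := close f g D tau)) => //.
  - by move=> y /hF1 [].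
  - by move=> k e e'0; exact: (hF4 K (z, t0) k e KU0 cK (cl0 z) e'0).
  - move=> x Kx; rewrite F00; have [sy Wy _] := s0 z; have Ux := KU0 x Kx.
    have sn : smooth_near (fh0 z) x by exists U0.
    exact/(WsetP lam_smooth q sn)/Wy.
have tube : \forall t \near t0, forall z, close f g D tau (z, t) /\ forall x, K x -> reg lam q (F (z, t)) x != 0.
  apply: (compact_tube (Q := fun z t => close f g D tau (z, t) /\ forall x, K x -> reg lam q (F (z, t)) x != 0) cP) => z.
  apply: (@filterS2 _ _ (nbhs_filter ((z, t0) : Y)) _ _ _ _ (ncl z) (nreg z)) => -[z' t'] h1 h2.
  by split.
have [e /andP[e'0 e'1] he] : exists2 e, 0 < e <= 1 & forall t : I, set_val t <= e ->
    forall z, close f g D tau (z, t) /\ forall x, K x -> reg lam q (F (z, t)) x != 0.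
  exact: (unitI_near t0E tube).
pose J := set_type (`[0, e] : set R).
have jin (t : J) : set_val t \in unitI R.
  case: t => t ht; have := ht; rewrite !inE /unitI /= !in_itv /= => /andP[-> te] /=.
  exact: le_trans e'1.
have jle (t : J) : set_val t <= e.
  by case: t => t ht; have := ht; rewrite inE /= in_itv /= => /andP[].
pose j (t : J) : I := exist _ (set_val t) (jin t).
have jE t : set_val (j t) = set_val t by [].
have cj : continuous j by apply: continuous_set_type; exact: set_val_continuous.
(* An open neighbourhood of [C] inside the compact [K] on which regularity was secured. *)
pose W0 := [set x | exists2 c, C c & `|x - c| < 2 * r].
have oW0 : open W0.
  rewrite (_ : W0 = \bigcup_(c in C) ball c (2 * r)).
    by apply: bigcup_open => c _; exact: ball_open.
  apply/seteqP; split => x.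
    by move=> [c Cc xc]; exists c => //; rewrite -ball_normE /= distrC.
  by move=> [c Cc]; rewrite -ball_normE /= distrC => xc; exists c.
have CW0 : C `<=` W0 by move=> c Cc; exists c => //; rewrite subrr normr0 mulr_gt0.
have W0K : W0 `<=` K by move=> x [c Cc xc]; exists c => //; exact: ltW.
have W0U : W0 `<=` U0 := subset_trans W0K KU0.
pose Ff (z : set_type P * J) := F (z.1, j z.2).
have clz (z : set_type P * J) : close f g D tau (z.1, j z.2) by have [] := he (j z.2) (jle z.2) z.1.
have sFf z : sec (Phi lam q) W0 (Ff z).
  have [sm hz] := hF1 _ (clz z); have [_ rg] := he (j z.2) (jle z.2) z.1.
  split; first exact: smooth_on_sub W0U sm.
    move=> x Wx; apply/(WsetP lam_smooth); first by exists U0; split => //; exact: W0U.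
    by apply: rg; exact: W0K.
  by move=> x Wx; apply: hz; exact: W0U.
have cpj : continuous (fun z : set_type P * J => (z.1, j z.2) : Y).
  apply: cont_pair; first exact: cont_fst.
  by apply: cont_comp; [exact: cont_snd|exact: cj].
have uFf : ufam W0 Ff.
  apply: (ufam_pull_on (Yg := close f g D tau) cpj clz) => K' y k e' K'W cK' cy e''0.
  exact: (hF4 K' y k e' (subset_trans K'W W0U) cK' cy e''0).
have [H [qH HE]] := germ_family oW0 CW0 sFf ((famP lam q W0 Ff).2 uFf).
exists e, H; split => //; first by rewrite e'0.
- move=> z t t00; apply: germ_eq; rewrite HE e0 /Ff /=.
  have -> : j t = t0 by apply: val_inj; exact: t00.
  by rewrite F00.
- move=> z t t' tt'; apply: germ_eq; rewrite e1 (germ_restrE sC (HE (z, t))).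
  have jt : j t = t' by apply: val_inj; exact: tt'.
  apply/germ_classP => c Cc; have := hF2 (z, j t) c (clz (z, t)) Cc.
  by rewrite /Ff /= /f jt.
Qed.
End Microflexibility.

Unset Implicit Arguments.

Theorem theorem3p4 (R : realType) (n p q : nat)
    (lam : 'rV[R]_(n + p) -> 'M[R]_(p, n + p))
    (lam_smooth : smooth_forms lam)
    (lam_indep : forall y, row_free (lam y))
    (hq : p%:Z - n%:Z <= (n * q)%N%:Z) :
  microflexible (Phi lam q) /\
  (forall (a : nat) (ha : (2 * q <= a)%N),
     (maxn (3 * q + 1) (2 * q + 2) <= a)%N ->
     local_weak_homotopy_equivalence (jet_map lam q a ha)).
Proof.
split; first exact: Phi_microflexible lam_smooth lam_indep q.
by move=> a ha _ x; exact: stalk_equivalence.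
Qed.
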